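(* Let $M$ be a compact manifold of dimension $n\ge3$. There exist on $M$ a one-parameter family of Riemannian metrics $g_\varepsilon$, $\varepsilon>0$, of volume $1$, and a constant $C$ which does not depend on $\varepsilon$ or $k$, such that for all $k$ and all $\varepsilon>0$, $$\mu_k^*(M,g_\varepsilon)\le C\,k\,\varepsilon^{\frac{n-2}n}.$$
   Context: $M$ may have nonempty boundary; $k$ ranges over nonnegative integers. $v_g$ is the Riemannian volume element and $|M|_g$ the volume of $M$ with respect to $g$. For positive functions $\rho,\sigma$ on $M$ and $k\ge0$, $$\mu_k^g(\rho,\sigma)=\inf_{E\in S_{k+1}}\sup_{u\in E\setminus\{0\}}\frac{\int_M|\nabla u|^2\sigma\,v_g}{\int_Mu^2\rho\,v_g},$$ where $S_k$ is the set of $k$-dimensional vector subspaces of $H^1(M)$. The extremal eigenvalue is $\mu_k^*(M,g)=\sup\{\mu_k^g(\rho,1):\rho>0 \text{ a density with } \frac1{|M|_g}\int_M\rho\,v_g=1\}$, densities being positive continuous functions on $M$. *)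

(* Defs.v *)
From HB Require Import structures.
From mathcomp Require Import all_boot all_order all_algebra.
From mathcomp Require Import all_classical all_reals all_analysis.

Set Implicit Arguments.
Unset Strict Implicit.
Unset Printing Implicit Defensive.

Import Order.TTheory GRing.Theory Num.Theory numFieldNormedType.Exports.

Local Open Scope classical_set_scope.
Local Open Scope ring_scope.

Section Calculus.
Variables (R : realType) (n : nat).
Implicit Types (W A : set 'rV[R]_n) (f : 'rV[R]_n -> R).

Fixpoint C_k (k : nat) W f : Prop :=
  (forall x, W x -> {for x, continuous f}) /\
  (if k is j.+1 then
     forall i : 'I_n,
       (forall x, W x -> derivable f x (delta_mx 0 i)) /\
       C_k j W (fun x => 'D_(delta_mx 0 i) f x)
   else True).

Definition C_infty W f : Prop := forall k, C_k k W f.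

(* Smoothness on a set A that need not be open (a relatively open subset of
   the half-space): local existence of smooth extensions. *)
Definition smooth_on A f : Prop :=
  forall x, A x -> exists W F,
    [/\ open W, W x, C_infty W F & forall y, W y -> A y -> F y = f y].

(* {x in R^n | x_0 >= 0}; the quantifier avoids asking for n > 0. *)
Definition half_space : set 'rV[R]_n :=
  [set x | forall i : 'I_n, val i = 0%N -> 0 <= x 0 i].

End Calculus.

(* Lebesgue integral over R^n as an iterated one-dimensional integral.  By
   Tonelli-Fubini this is the integral against n-dimensional Lebesgue measure
   for Borel functions that are nonnegative or integrable, which are the only
   ones it is applied to below. *)
Fixpoint lebesgue_integral_n (R : realType) (n : nat) :
    ('rV[R]_n -> \bar R) -> \bar R :=
  match n with
  | 0 => fun f => f 0
  | m.+1 => fun f =>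
      (\int[lebesgue_measure]_t
         lebesgue_integral_n
           (fun x : 'rV[R]_m => f (row_mx (const_mx t : 'rV[R]_1) x)))%E
  end.

(* Coordinate charts with values in the half-space; [chart_inv] is only
   meaningful on the image of the chart.  A chart whose image does not meet the
   hyperplane x_0 = 0 is an interior chart. *)
Record chart (R : realType) (n : nat) (M : topologicalType) := Chart {
  chart_dom : set M ;
  chart_map : M -> 'rV[R]_n ;
  chart_inv : 'rV[R]_n -> M ;
  chart_dom_open : open chart_dom ;
  chart_mapK : forall p, chart_dom p -> chart_inv (chart_map p) = p ;
  chart_img_open : exists2 W, open W &
    chart_map @` chart_dom = W `&` @half_space R n ;
  chart_map_continuous : {within chart_dom, continuous chart_map} ;
  chart_inv_continuous :
    {within chart_map @` chart_dom, continuous chart_inv} }.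

Definition chart_img R n M (c : chart R n M) : set 'rV[R]_n :=
  chart_map c @` chart_dom c.

Definition transition R n M (a b : chart R n M) : 'rV[R]_n -> 'rV[R]_n :=
  chart_map b \o chart_inv a.

Definition overlap R n M (a b : chart R n M) : set 'rV[R]_n :=
  chart_map a @` (chart_dom a `&` chart_dom b).

(* Smooth manifolds of dimension n, possibly with boundary.  The carrier is
   pointed, i.e. nonempty, because the library's measurable types are. *)
Record manifold (R : realType) (n : nat) := Manifold {
  carrier :> ptopologicalType ;
  atlas : set (chart R n carrier) ;
  manifold_hausdorff : hausdorff_space carrier ;
  manifold_second_countable : @second_countable carrier ;
  atlas_cover : forall p, exists2 c, atlas c & chart_dom c p ;
  atlas_smooth : forall a b, atlas a -> atlas b -> forall j : 'I_n,
    smooth_on (overlap a b) (fun x => transition a b x 0 j) }.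

(* A Riemannian metric, given by its matrices (g(d_i, d_j))_ij in the charts of
   the atlas.  At boundary points the Jacobian of a transition map is that of
   any smooth extension [F] of it. *)
Record metric (R : realType) (n : nat) (M : manifold R n) := Metric {
  gram : chart R n M -> M -> 'M[R]_n ;
  gram_sym : forall c, atlas c -> forall p, chart_dom c p ->
    (gram c p)^T = gram c p ;
  gram_posdef : forall c, atlas c -> forall p, chart_dom c p ->
    forall v : 'rV[R]_n, v != 0 -> 0 < (v *m gram c p *m v^T) 0 0 ;
  gram_smooth : forall c, atlas c -> forall i j : 'I_n,
    smooth_on (chart_img c) (fun x => gram c (chart_inv c x) i j) ;
  gram_transition : forall a b, atlas a -> atlas b ->
    forall p, chart_dom a p -> chart_dom b p ->
    forall (W : set 'rV[R]_n) (F : 'rV[R]_n -> 'rV[R]_n),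
      open W -> W (chart_map a p) ->
      (forall j : 'I_n, C_infty W (fun x => F x 0 j)) ->
      (forall x, W x -> overlap a b x -> F x = transition a b x) ->
      let J := \matrix_(i < n, j < n)
        'D_(delta_mx 0 i) (fun x => F x 0 j) (chart_map a p) in
      gram a p = J *m gram b p *m J^T }.

Notation borel M := (g_sigma_algebraType (@open M)).

Section Riemannian.
Variables (R : realType) (n : nat) (M : manifold R n) (g : metric M).

Definition is_volume (v : {measure set (borel M) -> \bar R}) : Prop :=
  forall c, atlas c -> forall B : set (borel M),
    measurable B -> B `<=` chart_dom c ->
    v B = lebesgue_integral_n (fun x =>
      (\1_(chart_map c @` B) x *
       Num.sqrt (\det (gram g c (chart_inv c x))))%:E).

(* v_g: the unique Borel measure satisfying [is_volume]. *)
Definition volume : {measure set (borel M) -> \bar R} :=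
  xget (mzero : {classic {measure set (borel M) -> \bar R}})
    [set v | is_volume v].

Definition test_function (c : chart R n M) (psi : 'rV[R]_n -> R) : Prop :=
  C_infty setT psi /\
  exists K, [/\ compact K, K `<=` interior (chart_img c) &
                forall x, ~ K x -> psi x = 0].

(* [w c p] is the row of the weak partial derivatives of u at p in the
   coordinates of the chart c. *)
Definition weak_differential (u : M -> R)
    (w : chart R n M -> M -> 'rV[R]_n) : Prop :=
  forall c, atlas c -> forall i : 'I_n,
    measurable_fun (chart_dom c : set (borel M)) (fun p => w c p 0 i) /\
    forall psi, test_function c psi ->
      lebesgue_integral_n (fun x =>
        (u (chart_inv c x) * 'D_(delta_mx 0 i) psi x)%:E) =
      (- lebesgue_integral_n (fun x =>
        (w c (chart_inv c x) 0 i * psi x)%:E))%E.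

(* e = |grad u|^2 almost everywhere, i.e. e = g^{ij} d_i u d_j u in charts. *)
Definition is_grad_sq (u e : M -> R) : Prop :=
  measurable_fun [set: borel M] e /\
  exists w, weak_differential u w /\
    forall c, atlas c ->
      {ae volume, forall p, chart_dom c p ->
         e p = (w c p *m invmx (gram g c p) *m (w c p)^T) 0 0}.

(* H^1(M), through representatives of the almost everywhere classes. *)
Definition H1 (u : M -> R) : Prop :=
  [/\ measurable_fun [set: borel M] u,
      (\int[volume]_p (u p ^+ 2)%:E < +oo)%E &
      exists e, is_grad_sq u e /\
        volume.-integrable [set: borel M] (fun p => (e p)%:E)].

(* |grad u|^2, well defined up to almost everywhere equality for u in H^1. *)
Definition grad_sq (u : M -> R) : M -> R :=
  xget ((fun=> 0) : {classic (M -> R)}) [set e | is_grad_sq u e].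

Definition ae0 : set (M -> R) := [set u | {ae volume, forall p, u p = 0}].

(* S_k: the k-dimensional subspaces of H^1(M), each given as the set of linear
   combinations of k functions that are linearly independent modulo almost
   everywhere equality. *)
Definition subspaces (k : nat) : set (set (M -> R)) :=
  [set E | exists b : 'I_k -> M -> R,
    [/\ forall i, H1 (b i),
        forall a : 'I_k -> R,
          ae0 (fun p => \sum_(i < k) a i * b i p) -> forall i, a i = 0 &
        E = [set u | exists a : 'I_k -> R,
               u = (fun p => \sum_(i < k) a i * b i p)]]].

Definition rayleigh (rho sigma u : M -> R) : \bar R :=
  ((\int[volume]_p (grad_sq u p * sigma p)%:E) /
   (\int[volume]_p (u p ^+ 2 * rho p)%:E))%E.

Definition mu (k : nat) (rho sigma : M -> R) : \bar R :=
  ereal_inf [set ereal_sup [set rayleigh rho sigma u | u in E `\` ae0]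
            | E in subspaces k.+1].

Definition density (rho : M -> R) : Prop :=
  continuous rho /\ (forall p, 0 < rho p).

Definition mu_star (k : nat) : \bar R :=
  ereal_sup [set mu k rho (fun=> 1) | rho in
    [set rho | density rho /\
       ((volume [set: borel M])^-1 * \int[volume]_p (rho p)%:E = 1)%E]].

End Riemannian.

(* Main.v *)
(* Embed M in a Euclidean space by finitely many charts cut off by bump
   functions, and add one more coordinate lam * tau, where tau is a bump
   function supported in a single chart.  The induced volume element is
   sqrt(1 + lam^2 |grad tau|^2) times the one for lam = 0.  Hence the total
   volume V grows at least linearly in lam; but, since tau is unimodal along
   coordinate lines, a Euclidean ball of radius s has a preimage of volume at
   most E s^2 with E independent of lam.  Rescaling the embedding by
   sig = V^(-1/n) gives volume 1 and replaces E by E sig^(n-2), which tends to 0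
   as lam grows because n >= 3.

   For a fixed density one argues as Grigor'yan, Netrusov and Yau: the ambient
   Euclidean space has the doubling property, so a greedy choice of balls yields
   2(k+1) disjoint annuli whose masses are bounded below by a constant over k.
   Cut-off functions of the ambient distance supported in these annuli are
   disjointly supported, and the quadratic volume growth bounds their Dirichlet
   energies by a constant times E sig^(n-2) for at least k+1 of them.  Hence
   mu_k <= C E sig^(n-2) k, with C depending only on the ambient dimension. *)

From HB Require Import structures.
Require Import Defs.
From mathcomp Require Import all_boot all_order all_algebra.
From mathcomp Require Import all_classical all_reals all_analysis.
From mathcomp Require Import perm measurable_realfun ring lra.

Set Implicit Arguments.
Unset Strict Implicit.
Unset Printing Implicit Defensive.

Import Order.TTheory GRing.Theory Num.Theory numFieldNormedType.Exports.

Local Open Scope classical_set_scope.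
Local Open Scope ring_scope.

(** * Functions of class C^k on R^n *)

(** Quadratic growth is the right condition because a cut-off at scale s has energy of order s^-2
    times the volume of a ball of radius 4 s, hence at most a multiple of E whatever s is. It
    survives the stretching since two directions contribute a factor s each: along axis j the added
    volume is at most the variation of lam tau while its value stays in an interval of length 2 s,
    which unimodality makes O(s) with no trace of lam; along another axis a coordinate is itself
    confined to an interval of length 2 s. The resulting factor can be made smaller than any del >
    0, so the power of epsilon is simply taken as del, and C = 1 suffices. Much of the remaining
    work comes from the definitions. The volume and |grad u|^2 are picked by [xget], so existence
    and uniqueness have to be proved: the volume needs a change of variables between charts, and
    weak gradients, defined by iterated integrals with no integrability assumed, need a uniqueness
    argument that cannot start with Fubini. At boundary points, one-sided derivatives and local
    extensions take the place of derivatives. *)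

Section Lines.
Variables (R : realType) (V : normedModType R).
Implicit Types (f : V -> R) (x v : V).

Lemma derive_line f x v : 'D_v f x = 'D_1 (fun t : R => f (t *: v + x)) 0.
Proof.
rewrite /derive; set g1 := fun h => h^-1 *: _; set g2 := fun h => h^-1 *: _.
suff -> : g1 = g2 by [].
by rewrite funeqE /g1 /g2 => h /=; rewrite addr0 scale0r add0r [_%:A]mulr1.
Qed.

Lemma is_derive_along f x v (t : R) d : is_derive (x + t *: v) v f d ->
  is_derive t (1 : R) (fun s => f (x + s *: v)) d.
Proof.
move=> [H1 H2].
pose g1 (h : R) := h^-1 *: ((f \o shift (x + t *: v)) (h *: v) - f (x + t *: v)).
pose g2 (h : R) :=
  h^-1 *: (((fun s => f (x + s *: v)) \o shift t) (h *: (1 : R)) - f (x + t *: v)).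
have E : g1 = g2.
  apply/funext => h; rewrite /g1 /g2 /=; congr (_ *: (f _ - _)).
  by rewrite scalerDl [_%:A]mulr1 addrCA addrA.
by apply: DeriveDef; [move: H1|move: H2]; rewrite /derivable /derive -/g1 -/g2 E.
Qed.

Lemma is_derive_comp1 (h : R -> R) dh f x v df :
  is_derive x v f df -> is_derive (f x) 1 h dh ->
  is_derive x v (fun y => h (f y)) (df * dh).
Proof.
move=> [/derivable1P df1 dfE] [dh1 dhE].
pose l t := f (t *: v + x).
have l0 : l 0 = f x by rewrite /l scale0r add0r.
have l'0 : 'D_1 l 0 = df by rewrite -dfE derive_line.
have dhl : derivable h (l 0) 1 by rewrite l0.
have dl : derivable l 0 1 := df1.
apply: DeriveDef.
  apply/derivable1P; apply/derivable1_diffP.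
  have /derivable1_diffP dl' := dl.
  have /derivable1_diffP dhl' := dhl.
  exact: (differentiable_comp dl' dhl').
rewrite derive_line -[fun t => _]/(h \o l).
by rewrite -derive1E (derive1_comp dl dhl) !derive1E l'0 l0 dhE mulrC.
Qed.

End Lines.

Section CkClosure.
Variables (R : realType) (n : nat).
Implicit Types (W : set 'rV[R]_n) (f g : 'rV[R]_n -> R).
Local Notation ee i := (delta_mx 0 i : 'rV[R]_n).

Lemma C_k_continuous k W f : C_k k W f ->
  forall x, W x -> {for x, continuous f}.
Proof. by case: k => [|k] []. Qed.

Lemma C_k_cvg k W f : C_k k W f ->
  forall x, W x -> f y @[y --> x] --> f x.
Proof. exact: C_k_continuous. Qed.

Lemma C_k_derivable k W f : C_k k.+1 W f ->
  forall i x, W x -> derivable f x (ee i).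
Proof. by move=> [_ H] i x Wx; case: (H i) => + _; apply. Qed.

Lemma C_k_derive k W f : C_k k.+1 W f ->
  forall i, C_k k W (fun x => 'D_(ee i) f x).
Proof. by move=> [_ H] i; case: (H i). Qed.

Lemma C_kS k W f : C_k k.+1 W f -> C_k k W f.
Proof.
elim: k f => [|k IH] f [cf H]; split => // i.
by case: (H i) => df Hk; split => //; exact: IH.
Qed.

Lemma C_k_le k l W f : (k <= l)%N -> C_k l W f -> C_k k W f.
Proof.
move=> /subnK <-; elim: (l - k)%N => //= m IH /C_kS; exact: IH.
Qed.

Lemma C_k_sub k W W' f : W' `<=` W -> C_k k W f -> C_k k W' f.
Proof.
move=> sW; elim: k f => [|k IH] f [cf H]; split => //; do ?by move=> x /sW; exact: cf.
move=> i; case: (H i) => df Hk; split; last exact: IH.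
by move=> x /sW; exact: df.
Qed.

Lemma open_near_eq W f g x : open W -> W x -> {in W, f =1 g} ->
  \forall y \near x, f y = g y.
Proof.
move=> oW Wx fg; near=> y; apply: fg; rewrite inE; near: y.
exact: open_nbhs_nbhs.
Unshelve. all: by end_near. Qed.

Lemma C_k_ext k W f g : open W -> {in W, f =1 g} -> C_k k W f -> C_k k W g.
Proof.
move=> oW; elim: k f g => [|k IH] f g fg [cf H]; split => //.
- move=> x Wx; have nfg := open_near_eq oW Wx fg.
  rewrite /prop_for /continuous_at -(fg x) ?inE//.
  have cfx : f y @[y --> x] --> f x := cf _ Wx.
  exact: cvg_trans (near_eq_cvg nfg) cfx.
- move=> x Wx; have nfg := open_near_eq oW Wx fg.
  rewrite /prop_for /continuous_at -(fg x) ?inE//.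
  have cfx : f y @[y --> x] --> f x := cf _ Wx.
  exact: cvg_trans (near_eq_cvg nfg) cfx.
- move=> i; case: (H i) => df Hk; split.
    move=> x Wx; have nfg := open_near_eq oW Wx fg.
    exact: near_eq_derivable nfg (df _ Wx).
  apply: IH Hk => x; rewrite inE => Wx.
  exact/near_eq_derive/(open_near_eq oW Wx fg).
Qed.

Lemma C_k_step k W f (df : 'I_n -> 'rV[R]_n -> R) : open W ->
  (forall x, W x -> {for x, continuous f}) ->
  (forall i x, W x -> is_derive x (ee i) f (df i x)) ->
  (forall i, C_k k W (df i)) -> C_k k.+1 W f.
Proof.
move=> oW cf dfE Hk; split => // i; split.
  by move=> x /(dfE i)[].
apply: C_k_ext (Hk i) => // x; rewrite inE => /(dfE i) H.
by rewrite derive_val.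
Qed.

Lemma C_k_is_derive k W f : C_k k.+1 W f ->
  forall i x, W x -> is_derive x (ee i) f ('D_(ee i) f x).
Proof. by move=> Hf i x Wx; apply/derivableP/(C_k_derivable Hf). Qed.

Lemma C_k_cst k W (a : R) : C_k k W (fun=> a).
Proof.
elim: k a => [|k IH] a; split => //; try by move=> x _; exact: cst_continuous.
move=> i; split; first by move=> x _; exact: derivable_cst.
suff -> : (fun x => 'D_(ee i) (fun=> a) x) = (fun=> 0) by exact: IH.
by apply/funext => x; exact: derive_cst.
Qed.

Lemma is_derive_coord (i j : 'I_n) x :
  is_derive x (ee i) (fun y : 'rV[R]_n => y 0 j) ((j == i)%:R).
Proof.
have H : is_derive x (ee i) (fun y : 'rV[R]_n => y) (ee i) by exact: is_derive_id.
have [H1 H2] := H.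
apply: DeriveDef; first exact: (derivable_mxP _ _ _).1 H1 0 j.
by have := derive_mx H1; rewrite H2 => /matrixP/(_ 0 j); rewrite !mxE eqxx /= => ->.
Qed.

Lemma C_k_coord k W j : open W -> C_k k W (fun x => x 0 j).
Proof.
move=> oW; case: k => [|k]; first by split => // x _; exact: coord_continuous.
apply: (C_k_step (df := fun i _ => (j == i)%:R)) => //.
- by move=> x _; exact: coord_continuous.
- by move=> i x _; exact: is_derive_coord.
- by move=> i; exact: C_k_cst.
Qed.

Lemma C_kD k W f g : open W -> C_k k W f -> C_k k W g ->
  C_k k W (fun x => f x + g x).
Proof.
move=> oW; elim: k f g => [|k IH] f g Hf Hg.
  by split => // x Wx; exact: (cvgD (C_k_cvg Hf Wx) (C_k_cvg Hg Wx)).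
apply: (C_k_step (df := fun i x => 'D_(ee i) f x + 'D_(ee i) g x)) => //.
- by move=> x Wx; exact: (cvgD (C_k_cvg Hf Wx) (C_k_cvg Hg Wx)).
- move=> i x Wx; have := C_k_is_derive Hf i Wx; have := C_k_is_derive Hg i Wx.
  by move=> dg df; exact: is_deriveD.
- by move=> i; apply: IH; exact: C_k_derive.
Qed.

Lemma C_kM k W f g : open W -> C_k k W f -> C_k k W g ->
  C_k k W (fun x => f x * g x).
Proof.
move=> oW; elim: k f g => [|k IH] f g Hf Hg.
  by split => // x Wx; exact: (cvgM (C_k_cvg Hf Wx) (C_k_cvg Hg Wx)).
apply: (C_k_step (df := fun i x => f x * 'D_(ee i) g x + g x * 'D_(ee i) f x)) => //.
- by move=> x Wx; exact: (cvgM (C_k_cvg Hf Wx) (C_k_cvg Hg Wx)).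
- move=> i x Wx; have := C_k_is_derive Hf i Wx; have := C_k_is_derive Hg i Wx.
  by move=> dg df; exact: is_deriveM.
- move=> i; apply: C_kD => //; apply: IH; do ?exact: C_k_derive.
    exact: C_kS.
  exact: C_kS.
Qed.

Lemma C_k_sum k W (I : Type) (r : seq I) (F : I -> 'rV[R]_n -> R) : open W ->
  (forall i, C_k k W (F i)) -> C_k k W (fun x => \sum_(i <- r) F i x).
Proof.
move=> oW HF; elim: r => [|i r IH].
  by under [X in C_k _ _ X]eq_fun do rewrite big_nil; exact: C_k_cst.
by under [X in C_k _ _ X]eq_fun do rewrite big_cons; exact: C_kD.
Qed.

Lemma C_k_prod k W (I : Type) (r : seq I) (F : I -> 'rV[R]_n -> R) : open W ->
  (forall i, C_k k W (F i)) -> C_k k W (fun x => \prod_(i <- r) F i x).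
Proof.
move=> oW HF; elim: r => [|i r IH].
  by under [X in C_k _ _ X]eq_fun do rewrite big_nil; exact: C_k_cst.
by under [X in C_k _ _ X]eq_fun do rewrite big_cons; exact: C_kM.
Qed.

Lemma C_kN k W f : open W -> C_k k W f -> C_k k W (fun x => - f x).
Proof.
move=> oW Hf; under [X in C_k _ _ X]eq_fun do rewrite -mulN1r.
by apply: C_kM => //; exact: C_k_cst.
Qed.

(** The sequence [h] lists the successive derivatives of the outer function, which allows an
    induction on k that shifts the sequence. *)
Lemma C_k_comp1 k W f (h : nat -> R -> R) : open W ->
  (forall j, (j <= k)%N -> continuous (h j)) ->
  (forall j, (j < k)%N -> forall t : R, is_derive t 1 (h j) (h j.+1 t)) ->
  C_k k W f -> C_k k W (fun x => h 0%N (f x)).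
Proof.
move=> oW; elim: k h => [|k IH] h hc hd Hf.
  split=> // x Wx; apply: (continuous_comp (f := f)); first exact: (C_k_cvg Hf).
  exact: hc.
apply: (C_k_step (df := fun i x => 'D_(ee i) f x * h 1%N (f x))) => //.
- move=> x Wx; apply: (continuous_comp (f := f)); first exact: (C_k_cvg Hf).
  exact: hc.
- move=> i x Wx; apply: is_derive_comp1; first exact: (C_k_is_derive Hf).
  exact: hd.
- move=> i; apply: C_kM => //; first exact: C_k_derive.
  apply: (IH (fun j => h j.+1)) => //; last exact: C_kS.
    by move=> j jk; exact: hc.
  by move=> j jk; exact: hd.
Qed.

Lemma C_kV k W f : open W -> (forall x, W x -> f x != 0) -> C_k k W f ->
  C_k k W (fun x => (f x)^-1).
Proof.
move=> oW f0; elim: k => [|k IH] Hf.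
  by split=> // x Wx; exact: (cvgV (f0 _ Wx) (C_k_cvg Hf Wx)).
apply: (C_k_step (df := fun i x => - ((f x)^-1 * (f x)^-1) * 'D_(ee i) f x)) => //.
- by move=> x Wx; exact: (cvgV (f0 _ Wx) (C_k_cvg Hf Wx)).
- move=> i x Wx; have [d1 d2] := C_k_is_derive Hf i Wx.
  apply: DeriveDef; first by apply: derivableV => //; exact: f0.
  by rewrite deriveV ?f0// d2 -expr2 -exprVn.
- move=> i; apply: C_kM => //; last exact: C_k_derive.
  by apply/C_kN/C_kM => //; apply: IH; exact: C_kS.
Qed.

End CkClosure.

(** * Differentiability and the chain rule on R^n *)

Section Differentiability.
Variables (R : realType) (n : nat).
Implicit Types (W : set 'rV[R]_n) (f : 'rV[R]_n -> R).
Local Notation ee i := (delta_mx 0 i : 'rV[R]_n).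

Lemma rV_normE (x : 'rV[R]_n) i : `|x 0 i| <= `|x|.
Proof.
rewrite [leRHS]/Num.norm /= mx_normrE.
exact: (le_bigmax _ (fun ij : 'I_1 * 'I_n => `|x ij.1 ij.2|) (0, i)).
Qed.

Lemma rV_norm_le (x : 'rV[R]_n) e : 0 <= e -> (forall i, `|x 0 i| <= e) -> `|x| <= e.
Proof.
move=> e0 H; rewrite [leLHS]/Num.norm /= mx_normrE.
by apply: bigmax_le => // -[j i] _ /=; rewrite (ord1 j).
Qed.

Lemma rV_norm_lt (x : 'rV[R]_n) e : 0 < e -> (forall i, `|x 0 i| < e) -> `|x| < e.
Proof.
move=> e0 H; rewrite [ltLHS]/Num.norm /= mx_normrE.
by apply: bigmax_lt => // -[j i] _ /=; rewrite (ord1 j).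
Qed.

Lemma rV_continuous (T : topologicalType) (G : T -> 'rV[R]_n) x :
  (forall j, {for x, continuous (fun y => G y 0 j)}) -> {for x, continuous G}.
Proof.
move=> HG; apply/cvgrPdist_le => e e0.
have : \forall y \near x, forall j, `|G x 0 j - G y 0 j| <= e.
  apply: (filter_forall (f := fun j y => `|G x 0 j - G y 0 j| <= e)) => j.
  have cj : (fun y => G y 0 j) y @[y --> x] --> G x 0 j := HG j.
  by have /cvgrPdist_le := cj; apply.
apply: filterS => y H; apply: rV_norm_le; first exact: ltW.
by move=> j; rewrite !mxE; exact: H.
Qed.

(** The increment is telescoped along the axes. On each piece the mean value theorem produces a
    partial derivative at a point near x, which continuity compares with the one at x. *)
Lemma C1_expansion W f x : open W -> C_k 1 W f -> W x ->
  forall e : R, 0 < e -> \forall h \near (0 : 'rV[R]_n),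
    `|f (x + h) - f x - \sum_i h 0 i * 'D_(ee i) f x| <= e * `|h|.
Proof.
move=> oW Hf Wx e e0.
(* n + 1 rather than n: the share e / n1 allotted to each axis is then well defined for n = 0
   too. *)
pose n1 : R := n.+1%:R; have n10 : 0 < n1 by rewrite ltr0n.
have H i : \forall y \near x, W y /\ `|'D_(ee i) f y - 'D_(ee i) f x| <= e / n1.
  apply: filterI; first exact: open_nbhs_nbhs.
  have /cvgrPdist_le := C_k_cvg (C_k_derive Hf i) Wx.
  by move=> /(_ (e / n1) (divr_gt0 e0 n10)); apply: filterS => y; rewrite distrC.
have {}H : \forall y \near x, forall i,
    W y /\ `|'D_(ee i) f y - 'D_(ee i) f x| <= e / n1.
  exact: (@filter_forall _ _ (fun (i : 'I_n) y =>
    W y /\ `|'D_(ee i) f y - 'D_(ee i) f x| <= e / n1) (nbhs x) _ H).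
have [d /= d0 Hd] := (nbhs_ballP _ _).1 H.
have Bd y : `|y - x| < d -> forall i, W y /\ `|'D_(ee i) f y - 'D_(ee i) f x| <= e / n1.
  by move=> yx; apply: Hd; rewrite -ball_normE /ball_ /= distrC.
have H0d : \forall h \near (0 : 'rV[R]_n), `|h| < d.
  by apply/nbhs_ballP; exists d => // h; rewrite -ball_normE /ball_ /= sub0r normrN.
near=> h; have hd : `|h| < d by near: h.
(* [hm m] keeps the first m coordinates of h, so that x + hm i and x + hm i.+1 differ along axis i
   only. *)
pose hm m := \row_i (if (i < m)%N then h 0 i else 0) : 'rV[R]_n.
have hmle m (t : R) (i : 'I_n) : (m = i)%N -> 0 <= t <= 1 ->
    `|hm m + (t * h 0 i) *: ee i| <= `|h|.
  move=> mi /andP[t0 t1]; apply: rV_norm_le => // j; rewrite !mxE eqxx /=.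
  case: ifP => jm; case: (j =P i) => [ji|ji]; rewrite ?mulr1 ?mulr0 ?addr0 ?add0r ?normr0 //.
  - by move: jm; rewrite mi ji ltnn.
  - exact: rV_normE.
  - rewrite normrM ger0_norm//; apply: le_trans (rV_normE h i).
    by rewrite ler_piMl.
have E : f (x + h) - f x = \sum_(i < n) (f (x + hm i.+1) - f (x + hm i)).
  rewrite (_ : \sum_(i < n) _ = \sum_(0 <= i < n) (f (x + hm i.+1) - f (x + hm i))); last by rewrite big_mkord.
  rewrite telescope_sumr// (_ : hm n = h); last by apply/rowP => i; rewrite mxE ltn_ord.
  by rewrite (_ : hm 0%N = 0) ?addr0//; apply/rowP => i; rewrite !mxE.
rewrite E -sumrB; apply: (le_trans (ler_norm_sum _ _ _)).
have T (i : 'I_n) : `|f (x + hm i.+1) - f (x + hm i) - h 0 i * 'D_(ee i) f x|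
    <= (e / n1) * `|h|.
  pose g t := f (x + hm i + (t * h 0 i) *: ee i).
  pose dg t := h 0 i * 'D_(ee i) f (x + hm i + (t * h 0 i) *: ee i).
  have inB (t : R) : 0 <= t <= 1 -> `|x + hm i + (t * h 0 i) *: ee i - x| < d.
    move=> t01; rewrite addrC -addrA addrA addNr add0r.
    by apply: le_lt_trans hd; exact: hmle.
  have gd (t : R) : 0 <= t <= 1 -> is_derive t (1 : R) g (dg t).
    move=> t01; have [Wy _] := Bd _ (inB _ t01) i.
    have := is_derive_along (C_k_is_derive Hf i Wy).
    have H2 : is_derive t (1 : R) (fun s : R => s * h 0 i) (h 0 i).
      have : is_derive t (1 : R) ( *%R (h 0 i) ) (h 0 i *: 1).
        have := @is_deriveZ R R R id (h 0 i) t 1 1 (is_derive_id _ _).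
        by [].
      rewrite [_ *: _]mulr1; apply: near_eq_is_derive.
      by near=> s; rewrite mulrC.
    move=> H1; have := is_derive_comp1 H2 H1.
    by [].
  have [||c cab] := @MVT R g dg 0 1 ltr01.
  - by move=> t; rewrite in_itv /= => /andP[/ltW t0 /ltW t1]; apply: gd; rewrite t0.
  - apply: derivable_within_continuous => t; rewrite in_itv /= => t01.
    by have [] := gd t t01.
  rewrite /g mul1r mul0r scale0r addr0 subr0 mulr1.
  have -> : x + hm i + h 0 i *: ee i = x + hm i.+1.
    rewrite -addrA; congr (_ + _); apply/rowP => j; rewrite !mxE eqxx /=.
    rewrite ltnS (_ : (j == i) = (val j == val i))//.
    case: (ltngtP (val j) (val i)) => [ji|ji|/val_inj ->] /=; rewrite ?mulr0 ?mulr1 ?addr0 ?add0r//.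
  move=> ->; rewrite /dg -mulrBr normrM mulrC.
  have c01 : 0 <= c <= 1 by move: cab; rewrite in_itv /= => /andP[/ltW -> /ltW ->].
  apply: ler_pM => //; last exact: rV_normE.
  by have [_] := Bd _ (inB _ c01) i.
apply: (le_trans (ler_sum _ (fun i _ => T i))).
rewrite sumr_const card_ord -mulr_natl mulrA ler_wpM2r//.
rewrite mulrCA ler_piMr ?(ltW e0)// ler_pdivrMr// mul1r ler_nat //.
Unshelve. all: by end_near. Qed.

Lemma C1_differentiable W f x : open W -> C_k 1 W f -> W x -> differentiable f x.
Proof.
move=> oW Hf Wx.
pose L (h : 'rV[R]_n) : R := \sum_i h 0 i * 'D_(ee i) f x.
have L_lin : linear L.
  move=> k u v; rewrite /L scaler_sumr -big_split; apply: eq_bigr => i _ /=.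
  by rewrite !mxE mulrDl -mulrA.
pose LM := GRing.isLinear.Build _ _ _ _ L L_lin.
pose LL : {linear 'rV[R]_n -> R} := HB.pack L LM.
have cL : continuous LL.
  move=> h; apply: (C_k_continuous (k := 0) (W := setT)) => //.
  apply: C_k_sum => [|i]; first exact: openT.
  apply: C_kM; [exact: openT| |exact: C_k_cst].
  by apply: C_k_coord; exact: openT.
have E : f \o shift x = cst (f x) + LL +o_ (0 : 'rV[R]_n) id.
  apply/eqaddoP => e e0; have := C1_expansion oW Hf Wx e0.
  by apply: filterS => h; rewrite [x + h]addrC -addrA -opprD.
apply/diff_locallyP; rewrite (diff_unique cL E); split => //.
Qed.

Lemma derive_sum_coord f x (v : 'rV[R]_n) : differentiable f x ->
  'D_v f x = \sum_i v 0 i * 'D_(ee i) f x.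
Proof.
move=> df; rewrite deriveE// {1}(row_sum_delta v) linear_sum; apply: eq_bigr => i _.
by rewrite linearZ /= deriveE.
Qed.

End Differentiability.

Section Composition.
Variables (R : realType) (n m : nat).
Implicit Types (W : set 'rV[R]_n) (U : set 'rV[R]_m).

Lemma is_derive_comp_rV (f : 'rV[R]_m -> R) (G : 'rV[R]_n -> 'rV[R]_m) x v dG :
  differentiable f (G x) ->
  (forall j, is_derive x v (fun y => G y 0 j) (dG j)) ->
  is_derive x v (fun y => f (G y)) (\sum_j dG j * 'D_(delta_mx 0 j) f (G x)).
Proof.
move=> df HG.
have dGx : derivable G x v.
  by apply/derivable_mxP => i j; rewrite ord1; case: (HG j).
pose l (t : R) := G (t *: v + x).
have dl : derivable l 0 1 := (derivable1P G x v).1 dGx.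
have /derivable1_diffP dl' := dl.
have l0 : l 0 = G x by rewrite /l scale0r add0r.
have df0 : differentiable f (l 0) by rewrite l0.
have dfl : differentiable (f \o l) 0 := differentiable_comp dl' df0.
apply: DeriveDef.
  by apply/derivable1P; apply/derivable1_diffP.
rewrite derive_line -[fun t => _]/(f \o l) deriveE// (diff_comp dl' df0) /=.
rewrite -(deriveE _ df0) derive_sum_coord// l0; apply: eq_bigr => j _; congr (_ * _).
rewrite -deriveE// derive_mx// mxE -(@derive_val _ _ _ _ _ _ _ (HG j)).
by rewrite [RHS]derive_line.
Qed.

Lemma C_k_comp k W U (f : 'rV[R]_m -> R) (G : 'rV[R]_n -> 'rV[R]_m) :
  open W -> open U -> (forall x, W x -> U (G x)) ->
  C_k k U f -> (forall j, C_k k W (fun x => G x 0 j)) ->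
  C_k k W (fun x => f (G x)).
Proof.
move=> oW oU WU; elim: k f => [|k IH] f Hf HG.
  split => // x Wx.
  apply: (continuous_comp (f := G)); last exact: (C_k_continuous Hf (WU _ Wx)).
  by apply: rV_continuous => j; exact: (C_k_continuous (HG j)).
have cG x : W x -> {for x, continuous G}.
  by move=> Wx; apply: rV_continuous => j; exact: (C_k_continuous (HG j)).
apply: (C_k_step (df := fun i x => \sum_j
    'D_(delta_mx 0 i) (fun y => G y 0 j) x * 'D_(delta_mx 0 j) f (G x))) => //.
- move=> x Wx; apply: (continuous_comp (f := G)); first exact: cG.
  exact: (C_k_continuous Hf (WU _ Wx)).
- move=> i x Wx; apply: is_derive_comp_rV.
    by apply: (C1_differentiable oU) (WU _ Wx); apply: C_k_le Hf.
  by move=> j; exact: (C_k_is_derive (HG j)).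
- move=> i; apply: C_k_sum => // j; apply: C_kM => //; first exact: C_k_derive.
  apply: (IH (fun y => 'D_(delta_mx 0 j) f y)); first exact: C_k_derive.
  by move=> j'; exact: C_kS.
Unshelve. all: by end_near. Qed.

End Composition.

(** * Smooth cut-offs *)

Section Flat.
Variable R : realType.
Implicit Types (P : {poly R}) (x y t : R).

(** The usual flat function exp(-1/x), with a polynomial in 1/x as a factor: this family is closed
    under derivation, the derivative of [flat P] being [flat (flatD P)], so smoothness needs a
    single computation. *)
Definition flat P x : R := if 0 < x then P.[x^-1] * expR (- x^-1) else 0.
Definition flatD P : {poly R} := 'X^2 * (P - P^`()).

(** For a positive exponent i, exp y = exp(y / i)^i is at least (y / i)^i, whence the bound i^i. *)
Lemma expR_pow_bound i : exists C : R, forall y, 0 <= y -> y ^+ i * expR (- y) <= C.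
Proof.
case: i => [|i].
  by exists 1 => y y0; rewrite expr0 mul1r -expR0 ler_expR oppr_le0.
exists (i.+1%:R ^+ i.+1) => y y0.
have i0 : (0 : R) < i.+1%:R by rewrite ltr0n.
rewrite expRN ler_pdivrMr ?expR_gt0//.
have -> : y = i.+1%:R * (y / i.+1%:R) by rewrite mulrC divfK ?gt_eqF.
rewrite expRM_natl exprMn ler_wpM2l ?exprn_ge0 ?ler0n// lerXn2r ?nnegrE ?divr_ge0 ?expR_ge0 ?ler0n//.
by apply: le_trans (expR_ge1Dx _); rewrite lerDr.
Qed.

Lemma poly_expR_bound P : exists C : R, forall y, 0 <= y -> `|P.[y]| * expR (- y) <= C.
Proof.
pose B i := projT1 (cid (expR_pow_bound i)).
exists (\sum_(i < size P) `|P`_i| * B i) => y y0.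
rewrite horner_coef -[leLHS]mulr1 -mulrA mulr1.
apply: le_trans (_ : (\sum_(i < size P) `|P`_i * y ^+ i|) * expR (- y) <= _).
  by rewrite ler_wpM2r ?expR_ge0// ler_norm_sum.
rewrite mulr_suml; apply: ler_sum => i _.
rewrite normrM normrX (ger0_norm y0) -mulrA ler_wpM2l//.
by rewrite /B; case: cid => C /= ->.
Qed.

Lemma flat0 P x : x <= 0 -> flat P x = 0.
Proof. by rewrite /flat leNgt => /negbTE ->. Qed.

Lemma is_derive_flat P x : is_derive x (1 : R) (flat P) (flat (flatD P) x).
Proof.
have [x0|x0|->] := ltgtP x 0.
- rewrite (flat0 _ (ltW x0)).
  have : is_derive x (1 : R) (cst (0 : R)) 0 by exact: is_derive_cst.
  apply: near_eq_is_derive.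
  near=> y; rewrite flat0//; apply/ltW; near: y; exact: lt_nbhsl.
- apply: (near_eq_is_derive (f := fun y => P.[y^-1] * expR (- y^-1))).
    near=> y; rewrite /flat ifT//; near: y; exact: lt_nbhsr.
  have dV : is_derive x (1 : R) (fun y : R => y^-1) (- x ^- 2).
    have [H1 H2] : is_derive x (1 : R) id 1 by exact: is_derive_id.
    apply: DeriveDef; first by apply: derivableV => //; rewrite gt_eqF.
    by rewrite deriveV ?gt_eqF// H2 /= [_ *: _]mulr1.
  have dP : is_derive x (1 : R) (fun y : R => P.[y^-1]) (- x ^- 2 * (P^`()).[x^-1]).
    exact: (is_derive_comp1 (h := horner P) dV (is_derive_poly P x^-1)).
  have dE : is_derive x (1 : R) (fun y : R => expR (- y^-1)) (x ^- 2 * expR (- x^-1)).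
    apply: (is_derive_comp1 (h := expR) (f := fun y : R => - y^-1)).
    by have := is_deriveN dV; rewrite opprK.
  apply: (is_derive_eq (is_deriveM dP dE)).
  rewrite /flat x0 /flatD hornerM hornerXn hornerD hornerN -exprVn /GRing.scale /=.
  by ring.
- rewrite flat0//.
  (* The bound is taken for X^2 P instead of P: the two extra powers of 1/h bring the difference
     quotient at 0, which is P(1/h) exp(-1/h) / h, below C |h|. *)
  have [C HC] := poly_expR_bound ('X^2 * P).
  have C0 : 0 <= C by apply: le_trans (HC 0 (lexx _)); rewrite mulr_ge0 ?expR_ge0.
  have H : (fun h : R => h^-1 *: ((flat P \o shift 0) (h *: (1 : R)) - flat P 0)) @ 0^' --> (0 : R).
    apply: (cvg_to_0_linear (K := C) (k := 1)) => // h /andP[h0 _].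
    rewrite /= addr0 [_%:A]mulr1 (flat0 _ (lexx _)) subr0.
    have [hn|hp] := leP h 0; first by rewrite flat0// scaler0 normr0 mulr_ge0.
    rewrite /flat hp.
    have := HC h^-1; rewrite invr_ge0 ltW// => /(_ isT).
    rewrite hornerM hornerXn normrM => HH.
    rewrite /GRing.scale /= normrM normrM (ger0_norm (expR_ge0 _)).
    have -> : `|h^-1| * (`|P.[h^-1]| * expR (- h^-1)) =
        `|h^-1 ^+ 2| * `|P.[h^-1]| * expR (- h^-1) * `|h|.
      rewrite normrX (ger0_norm (x := h^-1)) ?invr_ge0 ?ltW// (gtr0_norm hp).
      by field; rewrite gt_eqF.
    by rewrite ler_wpM2r.
  apply: DeriveDef; first by apply/cvg_ex; exists 0.
  exact: cvg_lim H.
Unshelve. all: by end_near. Qed.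

Lemma flat_continuous P : continuous (flat P).
Proof.
by move=> x; apply/differentiable_continuous/derivable1_diffP; have [] := is_derive_flat P x.
Qed.

Lemma C_k_flat (n : nat) k (W : set 'rV[R]_n) (f : 'rV[R]_n -> R) P : open W -> C_k k W f ->
  C_k k W (fun z => flat P (f z)).
Proof.
move=> oW; apply: (C_k_comp1 (h := fun j => flat (iter j flatD P))) => //.
  by move=> j _; exact: flat_continuous.
by move=> j _ t; exact: is_derive_flat.
Qed.

Lemma flat1_gt0 t : 0 < t -> 0 < flat 1 t.
Proof. by move=> t0; rewrite /flat t0 hornerC mul1r expR_gt0. Qed.

Lemma flat1_ge0 t : 0 <= flat 1 t.
Proof. by have [/flat0->//|/flat1_gt0/ltW] := leP t 0. Qed.

Lemma flat1_nondecr x y : x <= y -> flat 1 x <= flat 1 y.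
Proof.
move=> xy; have [x0|x0] := leP x 0; first by rewrite flat0 ?flat1_ge0.
have y0 := lt_le_trans x0 xy.
by rewrite /flat x0 y0 !hornerC !mul1r ler_expR lerN2 lef_pV2.
Qed.

Definition step t : R := flat 1 t / (flat 1 t + flat 1 (1 - t)).

Lemma step_den t : 0 < flat 1 t + flat 1 (1 - t).
Proof.
have [t0|t0] := leP t 0.
  by rewrite ltr_wpDl ?flat1_ge0// flat1_gt0// subr_gt0 (le_lt_trans t0)// ltr01.
by rewrite ltr_wpDr ?flat1_ge0// flat1_gt0.
Qed.

Lemma step0 t : t <= 0 -> step t = 0.
Proof. by move=> t0; rewrite /step flat0// mul0r. Qed.

Lemma step1 t : 1 <= t -> step t = 1.
Proof.
move=> t1; rewrite /step (@flat0 _ (1 - t)) ?subr_le0// addr0 divff// gt_eqF//.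
by rewrite flat1_gt0// (lt_le_trans ltr01).
Qed.

Lemma step_ge0 t : 0 <= step t.
Proof. by rewrite divr_ge0 ?flat1_ge0// ltW// step_den. Qed.

Lemma step_le1 t : step t <= 1.
Proof. by rewrite ler_pdivrMr ?step_den// mul1r lerDl flat1_ge0. Qed.

Lemma step_nondecr x y : x <= y -> step x <= step y.
Proof.
move=> xy; rewrite ler_pdivrMr ?step_den// mulrAC ler_pdivlMr ?step_den//.
rewrite !mulrDr mulrC lerD2l [leRHS]mulrC.
have H1 := flat1_nondecr xy.
have H2 : flat 1 (1 - y) <= flat 1 (1 - x) by apply: flat1_nondecr; rewrite lerD2l lerN2.
by rewrite mulrC; apply: ler_pM; rewrite ?flat1_ge0.
Qed.

Lemma C_k_step_comp (n : nat) k (W : set 'rV[R]_n) (f : 'rV[R]_n -> R) : open W -> C_k k W f ->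
  C_k k W (fun z => step (f z)).
Proof.
move=> oW Hf; have H1 : C_k k W (fun z => 1 - f z).
  by apply: C_kD => //; [exact: C_k_cst|exact: C_kN].
apply: C_kM => //; first exact: C_k_flat.
apply: C_kV => //; first by move=> x _; rewrite gt_eqF// step_den.
by apply: C_kD => //; exact: C_k_flat.
Qed.

Lemma step_derive : exists2 ds : R -> R, continuous ds &
  forall t, is_derive t (1 : R) step (ds t).
Proof.
pose den t := flat 1 t + flat 1 (1 - t).
pose dden t := flat (flatD 1) t - flat (flatD 1) (1 - t).
exists (fun t => flat 1 t * (- (den t) ^- 2 * dden t) + (den t)^-1 * flat (flatD 1) t).
  have c1 P : continuous (fun t => flat P (1 - t)).
    move=> t; apply: (continuous_comp (f := fun t => 1 - t)); last exact: flat_continuous.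
    by apply: cvgB; [exact: cvg_cst|exact: cvg_id].
  have cden : continuous (fun t => (den t)^-1).
    move=> t; apply: cvgV; first by rewrite gt_eqF// step_den.
    apply: cvgD; [exact: flat_continuous|exact: c1].
  move=> t; apply: cvgD; apply: cvgM; do ?[exact: flat_continuous|exact: cden].
  apply: cvgM; last by apply: cvgB; [exact: flat_continuous|exact: c1].
  apply: cvgN; under eq_fun do rewrite expr2 invfM.
  by rewrite expr2 invfM; apply: cvgM; exact: cden.
move=> t.
have d1 : is_derive t (1 : R) (fun s => flat 1 (1 - s)) (-1 * flat (flatD 1) (1 - t)).
  apply: (is_derive_comp1 (h := flat 1) (f := fun s : R => 1 - s)); last exact: is_derive_flat.
  have := is_deriveB (is_derive_cst (1 : R) t (1 : R)) (is_derive_id t (1 : R)).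
  by rewrite sub0r.
have dd : is_derive t (1 : R) den (dden t).
  have := is_deriveD (is_derive_flat 1 t) d1.
  by rewrite mulN1r.
have dV : is_derive t (1 : R) (fun s => (den s)^-1) (- (den t) ^- 2 * dden t).
  have [H1 H2] := dd.
  have n0 : den t != 0 by rewrite gt_eqF// step_den.
  by apply: DeriveDef; [exact: derivableV|rewrite deriveV// H2].
exact: is_deriveM (is_derive_flat 1 t) dV.
Qed.

Definition bump t : R := step (t + 2) * step (2 - t).

Lemma bump1 t : `|t| <= 1 -> bump t = 1.
Proof. by rewrite ler_norml => /andP[t1 t2]; rewrite /bump !step1 ?mulr1//; lra. Qed.

Lemma bump0 t : 2 <= `|t| -> bump t = 0.
Proof.
rewrite /bump; have [t0|t0] := leP 0 t.
  rewrite (ger0_norm t0) => t2; by rewrite [X in _ * X]step0 ?mulr0//; lra.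
by rewrite ltr0_norm// => t2; rewrite step0 ?mul0r//; lra.
Qed.

Lemma bump_ge0 t : 0 <= bump t. Proof. by rewrite mulr_ge0 ?step_ge0. Qed.

(** Monotonicity on each side of 0 is the unimodality on which the slicing estimates rest. *)
Lemma bump_nondecr s t : s <= t -> t <= 0 -> bump s <= bump t.
Proof.
move=> st t0; rewrite /bump (@step1 (2 - s)) 1?(@step1 (2 - t)) ?mulr1; try lra.
by apply: step_nondecr; lra.
Qed.

Lemma bump_nonincr s t : s <= t -> 0 <= s -> bump t <= bump s.
Proof.
move=> st t0; rewrite /bump (@step1 (s + 2)) 1?(@step1 (t + 2)) ?mul1r; try lra.
by apply: step_nondecr; lra.
Qed.

Lemma bump_derive : exists2 db : R -> R, continuous db &
  forall t, is_derive t (1 : R) bump (db t).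
Proof.
have [ds cds dsE] := step_derive.
have ca : continuous (fun t : R => t + 2).
  by move=> t; apply: cvgD; [exact: cvg_id|exact: cvg_cst].
have cb : continuous (fun t : R => 2 - t).
  by move=> t; apply: cvgB; [exact: cvg_cst|exact: cvg_id].
have cs : continuous step.
  by move=> x; apply/differentiable_continuous/derivable1_diffP; have [] := dsE x.
exists (fun t => step (t + 2) * (-1 * ds (2 - t)) + step (2 - t) * (1 * ds (t + 2))).
  move=> t; apply: cvgD; apply: cvgM.
  - by apply: (continuous_comp (f := fun t => t + 2)); [exact: ca|exact: cs].
  - apply: cvgM; first exact: cvg_cst.
    by apply: (continuous_comp (f := fun t => 2 - t)); [exact: cb|exact: cds].
  - by apply: (continuous_comp (f := fun t => 2 - t)); [exact: cb|exact: cs].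
  - apply: cvgM; first exact: cvg_cst.
    by apply: (continuous_comp (f := fun t => t + 2)); [exact: ca|exact: cds].
move=> t.
have d1 : is_derive t (1 : R) (fun s => step (s + 2)) (1 * ds (t + 2)).
  have Ha : is_derive t (1 : R) (fun s : R => s + 2) 1.
    by have := is_deriveD (is_derive_id t (1 : R)) (is_derive_cst (2 : R) t (1 : R)); rewrite addr0.
  exact: (is_derive_comp1 Ha (dsE _)).
have d2 : is_derive t (1 : R) (fun s => step (2 - s)) (-1 * ds (2 - t)).
  have Ha : is_derive t (1 : R) (fun s : R => 2 - s) (-1).
    by have := is_deriveB (is_derive_cst (2 : R) t (1 : R)) (is_derive_id t (1 : R)); rewrite sub0r.
  exact: (is_derive_comp1 Ha (dsE _)).
exact: is_deriveM d1 d2.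
Qed.

Lemma C_k_bump (n : nat) k (W : set 'rV[R]_n) (f : 'rV[R]_n -> R) : open W -> C_k k W f ->
  C_k k W (fun z => bump (f z)).
Proof.
move=> oW Hf; apply: C_kM => //; apply: C_k_step_comp => //; apply: C_kD => //.
- exact: C_k_cst.
- exact: C_k_cst.
- exact: C_kN.
Qed.

End Flat.

Section CubeBump.
Variables (R : realType) (n : nat).
Implicit Types (x y : 'rV[R]_n) (r : R).

(** A product over the coordinates, not a function of the norm: its restriction to a line parallel
    to an axis is a nonnegative multiple of a rescaled [bump], hence unimodal. *)
Definition cube_bump x r y : R := \prod_(i < n) bump ((y 0 i - x 0 i) / r).

Lemma C_k_cube_bump k W x r : open W -> C_k k W (cube_bump x r).
Proof.
move=> oW; apply: C_k_prod => // i; apply: C_k_bump => //.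
apply: C_kM => //; last exact: C_k_cst.
by apply: C_kD => //; [exact: C_k_coord|exact: C_k_cst].
Qed.

Lemma cube_bump1 x r y : 0 < r -> `|y - x| <= r -> cube_bump x r y = 1.
Proof.
move=> r0 yx; apply: big1 => i _; apply: bump1.
rewrite normrM normfV (gtr0_norm r0) ler_pdivrMr// mul1r.
by apply: le_trans yx; have := rV_normE (y - x) i; rewrite !mxE.
Qed.

Lemma cube_bump0 x r y : 0 < r -> 2 * r <= `|y - x| -> cube_bump x r y = 0.
Proof.
move=> r0 yx; apply/eqP; apply: contraTT yx => /prodf_neq0 H; rewrite -ltNge.
apply: rV_norm_lt; first by rewrite mulr_gt0.
move=> i; rewrite !mxE ltNge; apply/negP => h; move: (H i isT).
rewrite bump0 ?eqxx// normrM normfV (gtr0_norm r0) ler_pdivlMr//.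
Qed.

End CubeBump.

(** * Borel sets and Lebesgue measure on R^n *)

Section Borel.

Lemma borel_open (T : ptopologicalType) (U : set T) :
  open U -> measurable (U : set (borel T)).
Proof. by move=> oU; apply: sub_sigma_algebra. Qed.

Lemma borel_closed (T : ptopologicalType) (U : set T) :
  closed U -> measurable (U : set (borel T)).
Proof.
by move=> cU; rewrite -[U]setCK; apply: measurableC; apply: borel_open; exact: closed_openC.
Qed.

Lemma measurable_fun_borel d (X : measurableType d) (T : ptopologicalType) (D : set X)
    (f : X -> T) : (forall U, open U -> measurable (D `&` f @^-1` U)) ->
  measurable_fun D (f : X -> borel T).
Proof. move=> H; apply: (@measurability _ _ X (borel T) D f (@open T) erefl).
by move=> _ [U oU <-]; exact: H. Qed.

Lemma measurable_fun_R d (X : measurableType d) (R : realType) (D : set X)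
    (f : X -> R) : (forall U : set R, open U -> measurable (D `&` f @^-1` U)) ->
  measurable_fun D f.
Proof.
move=> H; apply: (measurability _ (measurable_realfun.RGenOpens.measurableE R)).
by move=> _ [_ [a [b ->] <-]]; apply/H/interval_open.
Qed.

Lemma within_continuous_preimage (S T : topologicalType) (D : set S) (f : S -> T) U :
  {within D, continuous f} -> open U ->
  exists2 V, open V & D `&` f @^-1` U = D `&` V.
Proof.
move=> /continuousP /(_ U) cf /cf /open_subspaceP[V oV VD].
by exists V => //; rewrite setIC -VD setIC.
Qed.

Lemma within_continuous_borel (S T : ptopologicalType) (D : set (borel S)) (f : S -> T) :
  measurable D -> {within (D : set S), continuous f} ->
  measurable_fun D (f : borel S -> borel T).
Proof.
move=> mD cf; apply: measurable_fun_borel => U oU.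
have [V oV ->] := within_continuous_preimage cf oU.
by apply: measurableI => //; exact: borel_open.
Qed.

Lemma within_continuous_measurable (S : ptopologicalType) (R : realType)
    (D : set (borel S)) (f : S -> R) :
  measurable D -> {within (D : set S), continuous f} ->
  measurable_fun D (f : borel S -> R).
Proof.
move=> mD cf; apply: measurable_fun_R => U oU.
have [V oV ->] := within_continuous_preimage cf oU.
by apply: measurableI => //; exact: borel_open.
Qed.

Lemma continuous_borel (S T : ptopologicalType) (f : S -> T) :
  continuous f -> measurable_fun [set: borel S] (f : borel S -> borel T).
Proof.
by move=> cf; apply: within_continuous_borel => //; exact: continuous_subspaceT.
Qed.

Lemma continuous_measurable (S : ptopologicalType) (R : realType) (f : S -> R) :
  continuous f -> measurable_fun [set: borel S] (f : borel S -> R).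
Proof.
by move=> cf; apply: within_continuous_measurable => //; exact: continuous_subspaceT.
Qed.

End Borel.

(** * Lebesgue measure on R^n as an iterated product *)

Section BorelRn.
Variable R : realType.
Local Notation Rn n := (borel 'rV[R]_n).
Local Notation MR := (measurableTypeR R).

Lemma rV_ballE n (x y : 'rV[R]_n) (e : R) : 0 < e ->
  ball x e y <-> forall i, `|x 0 i - y 0 i| < e.
Proof.
move=> e0; rewrite -ball_normE /ball_ /=; split.
  by move=> H i; have := rV_normE (x - y) i; rewrite !mxE => /le_lt_trans; apply.
by move=> H; apply: rV_norm_lt => // i; rewrite !mxE.
Qed.

(** An open set is the countable union of the cubes with rational centre and inverse integer radius
    that it contains, and the preimage of such a cube is a finite intersection of conditions on
    coordinates. *)
Lemma measurable_rV d (X : measurableType d) n (D : set X) (f : X -> 'rV[R]_n) :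
  (forall i, measurable_fun D (fun x => f x 0 i)) ->
  measurable_fun D (f : X -> Rn n).
Proof.
move=> mf mD; move: mD (mD) => mD; apply: measurable_fun_borel => U oU.
pose cube (p : 'rV[rat]_n * nat) : set 'rV[R]_n :=
  [set x | forall i, `|ratr (p.1 0 i) - x 0 i| < p.2.+1%:R^-1].
have UE : U = \bigcup_(p in [set p | cube p `<=` U]) cube p.
  apply/seteqP; split => [x Ux|x [p /= pU px]]; last exact: pU.
  have [e /= e0 xe] : exists2 e : R, 0 < e & ball x e `<=` U.
    by have /nbhs_ballP : nbhs x U by exact: open_nbhs_nbhs.
  have [k ke] : exists k : nat, k.+1%:R^-1 < e / 2 :> R.
    have := near_infty_natSinv_lt (PosNum (divr_gt0 e0 (ltr0n R 2))).
    by case=> k _ /(_ k (leqnn _)) /=; exists k.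
  have k0 : (0 : R) < k.+1%:R^-1 by rewrite invr_gt0.
  have q_ i : exists q : rat, `|ratr q - x 0 i| < k.+1%:R^-1.
    move: k0; set r : R := k.+1%:R^-1 => k0.
    have : x 0 i - r < x 0 i + r by lra.
    move=> /rat_in_itvoo[q]; rewrite in_itv /= => /andP[q1 q2]; exists q.
    by rewrite ltr_distl; apply/andP; split; lra.
  pose q : 'rV[rat]_n := \row_i projT1 (cid (q_ i)).
  have Hq i : `|ratr (q 0 i) - x 0 i| < k.+1%:R^-1 by rewrite mxE; case: cid.
  exists (q, k) => //= y Hy; apply: xe; apply/rV_ballE => // i.
  have -> : x 0 i - y 0 i = (ratr (q 0 i) - y 0 i) - (ratr (q 0 i) - x 0 i) by ring.
  apply: (le_lt_trans (ler_normB _ _)); have := Hy i; have := Hq i => /=.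
  by move: ke; set r : R := k.+1%:R^-1 => ke h1 h2; lra.
rewrite UE preimage_bigcup setI_bigcupr bigcup_mkcond.
apply: countable_bigcupT_measurable; first exact: countableP.
move=> p; case: ifP => // _.
rewrite (_ : _ `&` _ = D `&` \bigcap_(i in [set: 'I_n])
    (D `&` (fun x => f x 0 i) @^-1` [set t | `|ratr (p.1 0 i) - t| < p.2.+1%:R^-1])).
  apply: measurableI => //; apply: fin_bigcap_measurable => // i _.
  apply: mf => //; apply: open_measurable.
  have -> : [set t : R | `|ratr (p.1 0 i) - t| < p.2.+1%:R^-1] = ball (ratr (p.1 0 i) : R) p.2.+1%:R^-1.
    by rewrite -ball_normE.
  exact: ball_open.
apply/seteqP; split => x [Dx] H; split => // i.
  by move=> _; split => //; exact: H.
by have [] := H i I.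
Qed.

Lemma measurable_coord n i : measurable_fun setT (fun x : Rn n => x 0 i).
Proof. by apply: continuous_measurable => x; exact: coord_continuous. Qed.

(** The very row built in the recursive clause of [lebesgue_integral_n], so that sections of
    integrands match it by conversion. *)
Definition rcons0 n (t : R) (x : 'rV[R]_n) : 'rV[R]_n.+1 :=
  row_mx (const_mx t : 'rV[R]_1) x.
Definition rtail n (y : 'rV[R]_n.+1) : 'rV[R]_n := \row_j y 0 (lift ord0 j).

Lemma rcons0E0 n t (x : 'rV[R]_n) : rcons0 t x 0 ord0 = t.
Proof.
have := row_mxEl (const_mx t : 'rV[R]_1) x 0 ord0; rewrite [RHS]mxE => {2}<-.
by rewrite /rcons0; congr (row_mx _ _ _ _); exact: val_inj.
Qed.

Lemma rcons0ES n t (x : 'rV[R]_n) j : rcons0 t x 0 (lift ord0 j) = x 0 j.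
Proof.
have := row_mxEr (const_mx t : 'rV[R]_1) x 0 j => <-.
by rewrite /rcons0; congr (row_mx _ _ _ _); exact: val_inj.
Qed.

Lemma rtailK n t (x : 'rV[R]_n) : rtail (rcons0 t x) = x.
Proof. by apply/rowP => i; rewrite mxE rcons0ES. Qed.

Lemma measurable_rcons0 d (X : measurableType d) n (f : X -> R) (g : X -> Rn n) :
  measurable_fun setT f -> measurable_fun setT g ->
  measurable_fun setT (fun x => rcons0 (f x) (g x) : Rn n.+1).
Proof.
move=> mf mg; apply: measurable_rV => i; case: (unliftP ord0 i) => [j ->|->].
  under eq_fun do rewrite rcons0ES.
  exact: (measurableT_comp (measurable_coord j) mg).
by under eq_fun do rewrite rcons0E0.
Qed.

Lemma measurable_rcons0_pair n :
  measurable_fun setT (fun p : MR * Rn n => rcons0 p.1 p.2 : Rn n.+1).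
Proof.
by apply: measurable_rcons0; [exact: (@measurable_fst _ _ MR (Rn n))|exact: measurable_snd].
Qed.

Lemma measurable_rtail n : measurable_fun setT (@rtail n : Rn n.+1 -> Rn n).
Proof.
by apply: measurable_rV => i; under eq_fun do rewrite mxE; exact: measurable_coord.
Qed.

Section Step.
Variables (m1 : {sigma_finite_measure set MR -> \bar R}).
Variables (n : nat) (mu : {sigma_finite_measure set (Rn n) -> \bar R}).
Local Notation prodm := (product_measure1 m1 mu).

(** Transport of the product measure from R x R^n to R^(n+1). Iterating it gives an actual measure
    [lebn], to which convergence theorems apply, with Tonelli available at each step in both
    orders. *)
Definition lebesgue_step (A : set (Rn n.+1)) : \bar R :=
  prodm ((fun p : MR * Rn n => rcons0 p.1 p.2 : Rn n.+1) @^-1` A).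

Let m0 : lebesgue_step set0 = 0%E.
Proof. by rewrite /lebesgue_step preimage_set0 measure0. Qed.

Let mge0 A : (0 <= lebesgue_step A)%E.
Proof. exact: measure_ge0. Qed.

Let madd : semi_sigma_additive lebesgue_step.
Proof.
move=> F mF tF mUF; rewrite /lebesgue_step preimage_bigcup.
apply: measure_semi_sigma_additive.
- by move=> k; rewrite -[X in measurable X]setTI; exact: measurable_rcons0_pair.
- apply/trivIsetP => /= i j _ _ ij; rewrite -preimage_setI.
  by move/trivIsetP : tF => /(_ _ _ _ _ ij) ->//; rewrite preimage_set0.
- by rewrite -preimage_bigcup -[X in measurable X]setTI; exact: measurable_rcons0_pair.
Qed.

HB.instance Definition _ := isMeasure.Build _ _ _ lebesgue_step m0 mge0 madd.

Let msf : sigma_finite setT lebesgue_step.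
Proof.
have /sigma_finiteP [F [FT ndF HF]] := sigma_finiteT m1.
have /sigma_finiteP [G [GT ndG HG]] := sigma_finiteT mu.
exists (fun k => [set y : Rn n.+1 | F k (y 0 ord0) /\ G k (rtail y)]).
  apply/seteqP; split => // y _.
  have [i _ Fi] : (\bigcup_i F i) (y 0 ord0) by rewrite -FT.
  have [j _ Gj] : (\bigcup_i G i) (rtail y) by rewrite -GT.
  exists (maxn i j) => //; split.
    by have /subsetPset := ndF _ _ (leq_maxl i j); apply.
  by have /subsetPset := ndG _ _ (leq_maxr i j); apply.
move=> k; have [mFk Fk] := HF k; have [mGk Gk] := HG k; split.
  apply: measurableI; rewrite -[X in measurable X]setTI.
    exact: (measurable_coord ord0).
  exact: measurable_rtail.
rewrite /lebesgue_step (_ : _ @^-1` _ = F k `*` G k).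
  by rewrite product_measure1E// lte_mul_pinfty// ge0_fin_numE.
by apply/seteqP; split => -[t x] /=; rewrite rcons0E0 rtailK.
Qed.

HB.instance Definition _ := Measure_isSigmaFinite.Build _ _ _ lebesgue_step msf.

Lemma lebesgue_stepE (f : Rn n.+1 -> \bar R) :
  measurable_fun setT f -> (forall x, 0 <= f x)%E ->
  (\int[lebesgue_step]_x f x = \int[prodm]_p f (rcons0 p.1 p.2))%E.
Proof.
move=> mf f0.
have := @ge0_integral_pushforward _ _ _ _ R _ (@measurable_rcons0_pair n) prodm setT f.
by rewrite preimage_setT => ->.
Qed.

End Step.

Fixpoint lebn n : {sigma_finite_measure set (Rn n) -> \bar R} :=
  match n with
  | 0 => \d_(0 : Rn 0)
  | m.+1 => lebesgue_step (@lebesgue_measure R) (lebn m)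
  end.

Lemma measurable_section n (f : Rn n.+1 -> \bar R) t :
  measurable_fun setT f -> measurable_fun setT (fun x : Rn n => f (rcons0 t x)).
Proof.
move=> mf; apply: (measurableT_comp mf).
by apply: measurable_rcons0.
Qed.

Lemma measurable_section_l n (f : Rn n.+1 -> \bar R) (x : Rn n) :
  measurable_fun setT f -> measurable_fun setT (fun t : MR => f (rcons0 t x)).
Proof.
move=> mf; apply: (measurableT_comp mf).
by apply: measurable_rcons0.
Qed.

Lemma lebnS1 n (f : Rn n.+1 -> \bar R) :
  measurable_fun setT f -> (forall x, 0 <= f x)%E ->
  (\int[lebn n.+1]_x f x =
   \int[lebesgue_measure]_t \int[lebn n]_x f (rcons0 t x))%E.
Proof.
move=> mf f0; rewrite lebesgue_stepE//.
rewrite (fubini_tonelli1 (fun p : MR * Rn n => f (rcons0 p.1 p.2)))//.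
apply: (measurableT_comp mf); exact: measurable_rcons0_pair.
Qed.

Lemma lebnS2 n (f : Rn n.+1 -> \bar R) :
  measurable_fun setT f -> (forall x, 0 <= f x)%E ->
  (\int[lebn n.+1]_x f x =
   \int[lebn n]_x \int[lebesgue_measure]_t f (rcons0 t x))%E.
Proof.
move=> mf f0; rewrite lebesgue_stepE//.
rewrite (fubini_tonelli2 (fun p : MR * Rn n => f (rcons0 p.1 p.2)))//.
apply: (measurableT_comp mf); exact: measurable_rcons0_pair.
Qed.

Lemma measurable_lebnS1 n (f : Rn n.+1 -> \bar R) :
  measurable_fun setT f -> (forall x, 0 <= f x)%E ->
  measurable_fun setT (fun t : MR => \int[lebn n]_x f (rcons0 t x))%E.
Proof.
move=> mf f0.
apply: (measurable_fun_fubini_tonelli_F (fun p : MR * Rn n => f (rcons0 p.1 p.2))) => //.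
apply: (measurableT_comp mf); exact: measurable_rcons0_pair.
Qed.

Lemma measurable_lebnS2 n (f : Rn n.+1 -> \bar R) :
  measurable_fun setT f -> (forall x, 0 <= f x)%E ->
  measurable_fun setT (fun x : Rn n => \int[lebesgue_measure]_t f (rcons0 t x))%E.
Proof.
move=> mf f0.
apply: (measurable_fun_fubini_tonelli_G (fun p : MR * Rn n => f (rcons0 p.1 p.2))) => //.
apply: (measurableT_comp mf); exact: measurable_rcons0_pair.
Qed.

Lemma lebesgue_integral_nE n (f : Rn n -> \bar R) :
  measurable_fun setT f -> (forall x, 0 <= f x)%E ->
  lebesgue_integral_n f = (\int[lebn n]_x f x)%E.
Proof.
elim: n f => [|n IH] f mf f0 /=.
  by rewrite integral_dirac// diracT mul1e.
rewrite lebnS1//; apply: eq_integral => t _; rewrite -IH//.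
exact: measurable_section.
Qed.

End BorelRn.

(** * Affine changes of variables and boxes *)

Section Affine.
Variable R : realType.
Local Notation Rn n := (borel 'rV[R]_n).
Local Notation MR := (measurableTypeR R).
Local Notation leb := (@lebesgue_measure R).

Lemma measurable_affine (a b : R) : measurable_fun setT (fun t : MR => (a * t + b)%R : MR).
Proof.
apply: (@measurable_funD _ MR R); last exact: measurable_cst.
by apply: (@measurable_funM _ MR R); [exact: measurable_cst|exact: measurable_id].
Qed.

(** Both sides are measures in [A], and Lebesgue measure is determined by half-open intervals. For a
    < 0 the preimage is open at the other end, which does not change its length. *)
Lemma lebesgue_affine (a b : R) (A : set MR) : a != 0 -> measurable A ->
  leb A = (`|a|%:E * leb ((fun t : MR => (a * t + b)%R : MR) @^-1` A))%E.
Proof.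
move=> a0 mA.
have an : 0 < `|a| by rewrite normr_gt0.
pose p : {nonneg R} := NngNum (ltW an).
pose push : {measure set MR -> \bar R} :=
  measure_function_pushforward__canonical__measure_function_Measure leb (measurable_affine a b).
pose numeas : {measure set MR -> \bar R} := mscale p push.
have nuE X : numeas X = (`|a|%:E * leb ((fun t : MR => (a * t + b)%R : MR) @^-1` X))%E by [].
have H : forall X, ocitv X -> leb X = numeas X.
  move=> _ [[x y] _ <-] /=; rewrite -[RHS]/(numeas _) nuE.
  have [ap|an'] := ltP 0 a.
    have -> : (fun t : MR => (a * t + b)%R : MR) @^-1` `]x, y] = `](x - b) / a, (y - b) / a]%classic.
      apply/seteqP; split => t /=; rewrite !in_itv /= ltr_pdivrMr// ler_pdivlMr// (mulrC t);
        move=> /andP[h1 h2]; apply/andP; split; lra.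
    rewrite !lebesgue_measure_itv /= !lte_fin ltr_pM2r ?invr_gt0// ltrD2r.
    case: ifP => _; last by rewrite mule0.
    by rewrite -!EFinB -EFinM (gtr0_norm ap) -mulrBl mulrC divfK// opprB addrA subrK.
  have {}an' : a < 0 by rewrite lt_neqAle a0.
  have -> : (fun t : MR => (a * t + b)%R : MR) @^-1` `]x, y] = `[(y - b) / a, (x - b) / a[%classic.
    apply/seteqP; split => t /=; rewrite !in_itv /= ltr_ndivlMr// ler_ndivrMr// (mulrC t);
      move=> /andP[h1 h2]; apply/andP; split; lra.
  rewrite !lebesgue_measure_itv /= !lte_fin ltr_nM2r ?invr_lt0// ltrD2r.
  case: ifP => _; last by rewrite mule0.
  by rewrite -!EFinB -EFinM; congr EFin; rewrite (ltr0_norm an'); field.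
by rewrite (lebesgue_measure_unique H mA) nuE.
Qed.

Lemma integral_affine (a b : R) (f : MR -> \bar R) : a != 0 ->
  measurable_fun setT f -> (forall t, 0 <= f t)%E ->
  (\int[leb]_t f t = `|a|%:E * \int[leb]_t f (a * t + b)%R)%E.
Proof.
move=> a0 mf f0.
have an : 0 < `|a| by rewrite normr_gt0.
pose p : {nonneg R} := NngNum (ltW an).
pose push := measure_function_pushforward__canonical__measure_function_Measure leb (measurable_affine a b).
have := @ge0_integral_pushforward _ _ _ _ R _ (measurable_affine a b) leb setT f measurableT mf.
rewrite preimage_setT => H; rewrite -[X in (_ * X)%E]H; last by [].
have := @ge0_integral_mscale _ MR R push setT measurableT p f mf (fun t _ => f0 t).
move=> <-; apply: eq_measure_integral => A mA _.
exact: lebesgue_affine.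
Qed.

Lemma addr_continuous n (w : 'rV[R]_n) : continuous (fun x : 'rV[R]_n => x + w).
Proof.
move=> x; apply: rV_continuous => j.
rewrite (_ : (fun y => (y + w) 0 j) = fun y => y 0 j + w 0 j); last first.
  by apply/funext => y; rewrite mxE.
apply: (C_k_continuous (k := 0) (W := setT)) => //.
by apply: C_kD; [exact: openT|apply: C_k_coord; exact: openT|exact: C_k_cst].
Qed.

Lemma integral_shift n (v : 'rV[R]_n) (f : Rn n -> \bar R) :
  measurable_fun setT f -> (forall x, 0 <= f x)%E ->
  (\int[lebn R n]_x f (x + v)%R = \int[lebn R n]_x f x)%E.
Proof.
have ms m (w : 'rV[R]_m) : measurable_fun setT (fun x : Rn m => x + w : Rn m).
  exact: (@continuous_borel 'rV[R]_m 'rV[R]_m (fun x => x + w) (@addr_continuous _ w)).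
elim: n v f => [|n IH] v f mf f0.
  by apply: eq_integral => x _; congr f; apply/rowP; case.
have mfs : measurable_fun setT (fun x : Rn n.+1 => f (x + v)) by exact: (measurableT_comp mf (ms _ v)).
rewrite (lebnS1 mfs (fun x => f0 (x + v))) (lebnS1 mf f0).
have E t x : rcons0 t x + v = rcons0 (t + v 0 ord0) (x + rtail v).
  apply/rowP => i; case: (unliftP ord0 i) => [j ->|->].
    by rewrite mxE !rcons0ES [RHS]mxE; congr (_ + _); rewrite mxE.
  by rewrite mxE !rcons0E0.
under eq_integral do under eq_integral do rewrite E.
under eq_integral => t _.
  rewrite (IH (rtail v) (fun x => f (rcons0 (t + v 0 ord0) x))) //; last exact: measurable_section.
  over.
have := @integral_affine 1 (v 0 ord0) (fun t => \int[lebn R n]_x f (rcons0 t x))%E (oner_neq0 _).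
rewrite normr1 mul1e => ->.
- by under [RHS]eq_integral do rewrite mul1r.
- exact: measurable_lebnS1.
- by move=> t; apply: integral_ge0.
Qed.

Lemma mulmx_continuous n m (A : 'M[R]_(n, m)) : continuous (fun x : 'rV[R]_n => x *m A).
Proof.
move=> x; apply: rV_continuous => j.
have : C_k 0 setT (fun y : 'rV[R]_n => \sum_k y 0 k * A k j).
  apply: C_k_sum => [|k]; first exact: openT.
  by apply: C_kM; [exact: openT|apply: C_k_coord; exact: openT|exact: C_k_cst].
move=> /C_k_continuous /(_ x I).
by rewrite (_ : (fun y => (y *m A) 0 j) = fun y => \sum_k y 0 k * A k j)//; apply/funext => y; rewrite mxE.
Qed.

Lemma measurable_mulmx n m (A : 'M[R]_(n, m)) :
  measurable_fun setT (fun x : Rn n => x *m A : Rn m).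
Proof. exact: (@continuous_borel 'rV[R]_n 'rV[R]_m (fun x => x *m A) (@mulmx_continuous _ _ A)). Qed.

(** The linear change of variables for one matrix, named because it is stable under products: an
    invertible matrix can then be treated factor by factor. *)
Definition scales n (A : 'M[R]_n) := forall f : Rn n -> \bar R,
  measurable_fun setT f -> (forall x, 0 <= f x)%E ->
  (\int[lebn R n]_x f x = `|\det A|%:E * \int[lebn R n]_x f (x *m A)%R)%E.

Lemma scalesM n (A B : 'M[R]_n) : scales A -> scales B -> scales (A *m B).
Proof.
move=> HA HB f mf f0; rewrite HB// HA//; last first.
  exact: (measurableT_comp mf (measurable_mulmx B)).
rewrite det_mulmx normrM muleA -EFinM mulrC.
by under [in RHS]eq_integral do rewrite mulmxA.
Qed.

Lemma rcons0_block n (t : R) (x : 'rV[R]_n) (a : R) (b : 'rV[R]_n) (c : 'cV[R]_n)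
    (D : 'M[R]_n) :
  rcons0 t x *m (block_mx a%:M b c D : 'M[R]_(n.+1)) =
  rcons0 (a * t + (x *m c) 0 0) (x *m D + t *: b).
Proof.
rewrite /rcons0 (mul_row_block (const_mx t : 'rV[R]_1) x a%:M b c D).
have -> : const_mx t *m a%:M + x *m c = const_mx (a * t + (x *m c) 0 0) :> 'rV[R]_1.
  by apply/rowP => i; rewrite (ord1 i) mxE [in RHS]mxE; congr (_ + _); rewrite mxE big_ord1 !mxE eqxx mulr1n mulrC.
have -> // : const_mx t *m b + x *m D = x *m D + t *: b.
by rewrite addrC; congr (_ + _); apply/rowP => i; rewrite mxE big_ord1 !mxE.
Qed.

(** With the first coordinate t fixed, the inner integral sees D and a translation by t b, which is
    harmless; what remains is the dilation of t by a. *)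
Lemma scales_upper n (a : R) (b : 'rV[R]_n) (D : 'M[R]_n) : a != 0 -> scales D ->
  scales (block_mx a%:M b 0 D : 'M[R]_(n.+1)).
Proof.
move=> a0 HD f mf f0.
have mfA : measurable_fun setT (fun x : Rn n.+1 => f (x *m (block_mx a%:M b 0 D : 'M[R]_(n.+1)))).
  exact: (measurableT_comp mf (measurable_mulmx _)).
rewrite (lebnS1 mf f0) lebnS1//.
under [in RHS]eq_integral do under eq_integral do rewrite rcons0_block mulmx0 mxE addr0.
have ms t : measurable_fun setT (fun x : Rn n => f (rcons0 t x)) by exact: measurable_section.
have mt t : measurable_fun setT (fun x : Rn n => f (rcons0 (a * t) (x + t *: b))).
  apply: (measurableT_comp (ms (a * t))).
  exact: (@continuous_borel 'rV[R]_n 'rV[R]_n (fun x => x + t *: b) (@addr_continuous _ _)).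
rewrite (det_ublock a%:M b D) det_scalar1 normrM EFinM -muleA.
rewrite (@integral_affine a 0 (fun t => \int[lebn R n]_x f (rcons0 t x))%E a0); last 2 first.
- exact: measurable_lebnS1.
- by move=> t; apply: integral_ge0.
congr (_ * _)%E.
rewrite -ge0_integralZl//; last 2 first.
- have := measurable_lebnS1 mfA (fun x => f0 _).
  under eq_fun do under eq_integral do rewrite rcons0_block mulmx0 mxE addr0.
  by [].
- by move=> t _; apply: integral_ge0.
apply: eq_integral => t _; rewrite addr0.
rewrite -(HD (fun x => f (rcons0 (a * t) (x + t *: b))))//.
by rewrite (integral_shift (t *: b) (f := fun x => f (rcons0 (a * t) x))).
Qed.

(** Integrating over the first coordinate first, the shear is a translation of that coordinate. *)
Lemma scales_lower n (c : 'cV[R]_n) : scales (block_mx 1%:M 0 c 1%:M : 'M[R]_(n.+1)).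
Proof.
move=> f mf f0.
have mfA : measurable_fun setT (fun x : Rn n.+1 => f (x *m (block_mx 1%:M 0 c 1%:M : 'M[R]_(n.+1)))).
  exact: (measurableT_comp mf (measurable_mulmx _)).
rewrite (lebnS2 mf f0) lebnS2//.
rewrite (det_lblock 1%:M c 1%:M) !det1 mulr1 normr1 mul1e.
apply: eq_integral => x _.
under [in RHS]eq_integral do rewrite rcons0_block mulmx1 scaler0 addr0.
rewrite (@integral_affine 1 ((x *m c) 0 0) (fun t => f (rcons0 t x)) (oner_neq0 _)) ?normr1 ?mul1e//.
exact: measurable_section_l.
Qed.

(** One step of Gaussian elimination: the matrix is a lower shear times an upper block matrix whose
    corner is the Schur complement [D']. *)
Lemma scales_pivot n (a : R) (b : 'rV[R]_n) (c : 'cV[R]_n) (D : 'M[R]_n) : a != 0 ->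
  (forall D' : 'M[R]_n, D' \in unitmx -> scales D') ->
  (block_mx a%:M b c D : 'M[R]_(n.+1)) \in unitmx ->
  scales (block_mx a%:M b c D : 'M[R]_(n.+1)).
Proof.
move=> a0 IH uA.
pose D' := D - a^-1 *: (c *m b).
have AE : block_mx a%:M b c D =
    (block_mx 1%:M 0 (a^-1 *: c) 1%:M : 'M[R]_(1 + n)) *m block_mx a%:M b 0 D'.
  rewrite mulmx_block !mul1mx !mul0mx !addr0.
  congr block_mx; last by rewrite -scalemxAl /D' addrC subrK.
  by rewrite mul_mx_scalar scalerA divff// scale1r.
have uD' : D' \in unitmx.
  move: uA; rewrite AE unitmxE det_mulmx (det_lblock (1%:M : 'M[R]_1) (a^-1 *: c) 1%:M) !det1 mulr1 mul1r.
  by rewrite (det_ublock (a%:M : 'M[R]_1) b D') unitrM -unitmxE => /andP[].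
rewrite AE; apply: scalesM; first exact: scales_lower.
by apply: scales_upper => //; exact: IH.
Qed.

Lemma unitmx_scales n (A : 'M[R]_n) : A \in unitmx -> scales A.
Proof.
elim: n A => [|n IH] A uA.
  move=> f mf f0; rewrite det_mx00 normr1 mul1e.
  by apply: eq_integral => x _; congr f; apply/rowP; case.
rewrite -[A](@submxK _ 1 n 1 n) in uA *.
move: (ulsubmx _) (ursubmx _) (dlsubmx _) (drsubmx _) uA => a0 b c D.
rewrite [a0]mx11_scalar; move: (a0 0 0) => {a0} a uA.
have [a0|a0] := eqVneq a 0; last exact: scales_pivot.
have [j bj] : exists j, b 0 j != 0.
  apply: contrapT => H; move: uA.
  have -> : b = 0.
    apply/rowP => j; rewrite mxE; apply/eqP; apply: contrapT => /negP bj.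
    by apply: H; exists j.
  by rewrite a0 unitmxE (det_lblock _ c D) det_scalar1 mul0r unitr0.
(* Right multiplication by [E] adds the column of the nonzero entry b_j to the first column, so that
   b_j becomes the pivot; [E'] undoes this. *)
pose E : 'M[R]_(n.+1) := (block_mx 1%:M 0 (delta_mx j 0) 1%:M : 'M[R]_(1 + n)).
pose E' : 'M[R]_(n.+1) := (block_mx 1%:M 0 (- delta_mx j 0) 1%:M : 'M[R]_(1 + n)).
have EE : E *m E' = 1%:M.
  rewrite /E /E' (@mulmx_block _ 1 n 1 n 1 n) !mul1mx !mul0mx !mulmx0 !mulmx1 !addr0 add0r subrr.
  by rewrite -(@scalar_mx_block _ 1 n).
rewrite -[block_mx _ _ _ _]mulmx1 -EE mulmxA; apply: scalesM; last exact: scales_lower.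
have uAE : (block_mx a%:M b c D : 'M[R]_(n.+1)) *m E \in unitmx.
  by rewrite unitmx_mul uA unitmxE (det_lblock (1%:M : 'M[R]_1) (delta_mx j 0) 1%:M) !det1 mulr1 unitr1.
rewrite (@mulmx_block _ 1 n 1 n 1 n) !mulmx1 !mulmx0 !add0r in uAE *.
have Eb : a%:M + b *m delta_mx j 0 = (b 0 j)%:M :> 'M[R]_1.
  rewrite a0; apply/rowP => i; rewrite !mxE ord1 mul0rn add0r.
  rewrite (bigD1 j)//= big1 ?addr0 ?mxE ?eqxx ?mulr1 ?mulr1n// => k kj.
  by rewrite mxE (negbTE kj) mulr0.
by rewrite Eb in uAE *; exact: scales_pivot.
Qed.

Lemma integral_linear n (A : 'M[R]_n) (f : Rn n -> \bar R) : A \in unitmx ->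
  measurable_fun setT f -> (forall x, 0 <= f x)%E ->
  (\int[lebn R n]_x f x = `|\det A|%:E * \int[lebn R n]_x f (x *m A)%R)%E.
Proof. by move=> uA; exact: unitmx_scales. Qed.

Lemma lebn_box n (S : 'I_n -> set R) (r : 'I_n -> R) :
  (forall i, measurable (S i)) -> (forall i, leb (S i) = (r i)%:E) ->
  measurable [set x : Rn n | forall i, S i (x 0 i)] /\
  lebn R n [set x : Rn n | forall i, S i (x 0 i)] = (\prod_i r i)%:E.
Proof.
elim: n S r => [|n IH] S r mS Sr.
  have -> : [set x : Rn 0 | forall i, S i (x 0 i)] = setT.
    by apply/seteqP; split => // x _ [].
  by split => //; rewrite big_ord0 /= diracT.
have [m1 l1] := IH (fun i => S (lift ord0 i)) (fun i => r (lift ord0 i))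
  (fun i => mS _) (fun i => Sr _).
set B := [set x : Rn n | _] in m1 l1.
set B' := [set x : Rn n.+1 | _].
have BE (x : Rn n.+1) : B' x <-> S ord0 (x 0 ord0) /\ B (rtail x).
  split=> [H|[H1 H2] i]; first by split => // i; rewrite mxE.
  by case: (unliftP ord0 i) => [j ->|->]//; have := H2 j; rewrite mxE.
have mB' : measurable B'.
  rewrite (_ : B' = [set x : Rn n.+1 | S ord0 (x 0 ord0)] `&` [set x : Rn n.+1 | B (rtail x)]); last first.
    by apply/seteqP; split => x /BE.
  apply: measurableI; rewrite -[X in measurable X]setTI.
    exact: (measurable_coord ord0).
  exact: measurable_rtail.
split => //.
have := integral_indic (lebn R n.+1) measurableT mB'; rewrite setIT => <-.
have mI (T : measurableType _) (U : set T) : measurable U ->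
  measurable_fun setT (fun x => (\1_U x)%:E : \bar R).
  by move=> mU; apply/measurable_EFinP.
rewrite lebnS1//; last by apply/measurable_EFinP.
have IB : (\int[lebn R n]_x (\1_B x)%:E = (\prod_i r (lift ord0 i))%:E)%E.
  by have := integral_indic (lebn R n) measurableT m1; rewrite setIT => ->; exact: l1.
have E t x : (\1_B' (rcons0 t x) : R) = \1_(S ord0) t * \1_B x.
  have := BE (rcons0 t x); rewrite rcons0E0 rtailK !indicE => H.
  rewrite -natrM mulnb; congr (nat_of_bool _)%:R.
  apply/idP/andP; rewrite !inE; [by move/H|by move=> ?; apply/H].
under eq_integral do under eq_integral do rewrite E EFinM.
under eq_integral => t _.
  rewrite ge0_integralZl//; last by first [apply/measurable_EFinP|rewrite lee_fin].
  rewrite IB.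
  over.
rewrite ge0_integralZr//; do ?by apply/measurable_EFinP.
  have := integral_indic leb measurableT (mS ord0); rewrite setIT => ->.
  by rewrite big_ord_recl EFinM; congr (_ * _)%E; exact: Sr.
  exact: (mI _ MR (S ord0) (mS ord0)).
rewrite lee_fin; apply: prodr_ge0 => i _; rewrite -lee_fin -Sr; exact: measure_ge0.
Qed.

(** The boundary of the half-space is null, so identities proved in the interior of a chart image
    hold almost everywhere on it. *)
Lemma lebn_hyperplane n (i : 'I_n) : val i = 0%N -> lebn R n [set x : Rn n | x 0 i = 0] = 0%E.
Proof.
case: n i => [[]//|n] i i0; have {i i0}-> : i = ord0 by exact: val_inj.
set H := [set x | _].
have mH : measurable (H : set (Rn n.+1)).
  rewrite (_ : H = (fun x : Rn n.+1 => x 0 ord0) @^-1` [set 0])//.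
  by rewrite -[X in measurable X]setTI; exact: (measurable_coord ord0).
have := integral_indic (lebn R n.+1) measurableT mH; rewrite setIT => <-.
rewrite lebnS2//; last by apply/measurable_EFinP.
rewrite integral0_eq// => x _.
transitivity (\int[leb]_t (\1_([set 0] : set MR) t)%:E)%E.
  apply: eq_integral => t _; congr EFin; rewrite !indicE; congr (nat_of_bool _)%:R.
  by apply/idP/idP; rewrite !inE /H /= rcons0E0.
rewrite integral_indic// setIT; exact: lebesgue_measure_set1.
Qed.

End Affine.

(** * Iterated integrals of bounded functions with bounded support *)

Section BoundedSupport.
Variable R : realType.
Local Notation Rn n := (borel 'rV[R]_n).
Local Notation MR := (measurableTypeR R).
Local Notation leb := (@lebesgue_measure R).

(** A class of signed functions stable under sections and contained in the integrable ones. For them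
    the iterated integral of the definitions is an integral against [lebn]. *)
Definition bounded_support n (f : Rn n -> R) := measurable_fun setT f /\
  exists r M : R, (forall x, `|f x| <= M) /\
    (forall (x : Rn n) i, r < `|x 0 i| -> f x = 0).

Lemma lebn_cube n (r : R) : 0 <= r ->
  measurable [set x : Rn n | forall i, `|x 0 i| <= r] /\
  (lebn R n [set x : Rn n | (forall i, `|x 0 i| <= r)%R] < +oo)%E.
Proof.
move=> r0.
have E : [set x : Rn n | forall i, `|x 0 i| <= r] =
    [set x : Rn n | forall i, `[- r, r]%classic (x 0 i)].
  by apply/seteqP; split => x H i; have := H i; rewrite /= in_itv /= -ler_norml.
rewrite E; have [|i|m l] := @lebn_box R n (fun=> `[- r, r]%classic) (fun=> r - (- r)) => //.
  rewrite lebesgue_measure_itv /= lte_fin; case: ltP => // rr.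
  have -> : r = 0 by lra.
  by rewrite oppr0 subr0.
by split => //; rewrite [X in (X < _)%E]l ltry.
Qed.

Lemma bounded_support_integrable n (f : Rn n -> R) : bounded_support f ->
  (lebn R n).-integrable setT (EFin \o f).
Proof.
move=> [mf [r [M [fM fr]]]].
pose r' := Num.max r 0; have r'0 : 0 <= r' by rewrite le_max lexx orbT.
have [mC Coo] := lebn_cube n r'0; set C := [set x | _] in mC Coo.
have M0 : 0 <= M by apply: le_trans (fM 0); exact: normr_ge0.
apply/integrableP; split; first exact/measurable_EFinP.
apply: (@le_lt_trans _ _ (\int[lebn R n]_x (M%:E * (\1_C x)%:E))%E).
  apply: ge0_le_integral => //.
  - by apply: measurableT_comp => //; exact/measurable_EFinP.
  - by apply: emeasurable_funM; [exact: measurable_cst|apply/measurable_EFinP].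
  - move=> x _; rewrite -EFinM lee_fin indicE.
    case: (boolP (x \in C)) => [_|]; first by rewrite mulr1; exact: fM.
    rewrite notin_setE => xC; have [i xi] : exists i, r' < `|x 0 i|.
      by apply: contrapT => H; apply: xC => i; rewrite leNgt; apply/negP => h; apply: H; exists i.
    by rewrite (fr x i) ?normr0 ?mulr0//; apply: le_lt_trans xi; rewrite le_max lexx.
rewrite ge0_integralZl//; last by apply/measurable_EFinP.
have := integral_indic (lebn R n) measurableT mC; rewrite setIT => ->.
by rewrite lte_mul_pinfty.
Qed.

Lemma bounded_support_section n (f : Rn n.+1 -> R) (t : R) : bounded_support f ->
  bounded_support (fun x => f (rcons0 t x)).
Proof.
move=> [mf [r [M [fM fr]]]]; split.
  by apply: (measurableT_comp mf); exact: measurable_rcons0.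
exists r, M; split => [x|x i xi]; first exact: fM.
by apply: (fr _ (lift ord0 i)); rewrite rcons0ES.
Qed.

(** Tonelli is applied to the positive and the negative part; integrability of both allows the
    subtraction under the outer integral. *)
Lemma bounded_support_lebnS n (f : Rn n.+1 -> R) : bounded_support f ->
  (\int[lebn R n.+1]_x (f x)%:E =
   \int[leb]_t \int[lebn R n]_x (f (rcons0 t x))%:E)%E.
Proof.
move=> Hf; have [mf _] := Hf.
have /integrableP[_ foo] := bounded_support_integrable Hf.
have mE : measurable_fun setT (EFin \o f) by exact/measurable_EFinP.
have mp := measurable_funepos mE; have mn := measurable_funeneg mE.
have p0 x : (0 <= (EFin \o f)^\+ x)%E by exact: funepos_ge0.
have n0 x : (0 <= (EFin \o f)^\- x)%E by exact: funeneg_ge0.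
have /integrableP[_ poo] := integrable_funepos measurableT (bounded_support_integrable Hf).
have /integrableP[_ noo] := integrable_funeneg measurableT (bounded_support_integrable Hf).
rewrite integralE.
have E g : measurable_fun setT g -> (forall x, 0 <= g x)%E ->
    (\int[lebn R n.+1]_x `|g x| < +oo)%E ->
    leb.-integrable setT (fun t => \int[lebn R n]_x g (rcons0 t x))%E.
  move=> mg g0 goo; apply/integrableP; split; first exact: measurable_lebnS1.
  under eq_integral => t _ do rewrite gee0_abs ?integral_ge0//.
  rewrite -lebnS1//; apply: le_lt_trans goo.
  rewrite le_eqVlt; apply/orP; left; apply/eqP.
  by apply: eq_integral => x _; rewrite gee0_abs.
rewrite (lebnS1 mp p0) (lebnS1 mn n0) -(integralB measurableT (E _ mp p0 poo) (E _ mn n0 noo)).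
apply: eq_integral => t _; rewrite [RHS]integralE.
by congr (_ - _)%E; apply: eq_integral => x _; rewrite ?funeposE ?funenegE.
Qed.

Lemma bounded_support_lebesgue_integral n (f : Rn n -> R) : bounded_support f ->
  lebesgue_integral_n (fun x => (f x)%:E) = (\int[lebn R n]_x (f x)%:E)%E.
Proof.
elim: n f => [|n IH] f Hf /=.
  have [mf _] := Hf; rewrite integral_dirac//; last exact/measurable_EFinP.
  by rewrite diracT mul1e.
rewrite (bounded_support_lebnS Hf); apply: eq_integral => t _.
by rewrite IH//; exact: bounded_support_section.
Qed.

Lemma bounded_support_fin_num n (f : Rn n -> R) : bounded_support f ->
  (\int[lebn R n]_x (f x)%:E)%E \is a fin_num.
Proof. by move=> /bounded_support_integrable/integrable_fin_num; apply. Qed.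

End BoundedSupport.

(** * Calculus on a manifold *)

Section ManifoldCalculus.
Variables (R : realType) (n : nat) (M : manifold R n).
Local Notation ee i := (delta_mx 0 i : 'rV[R]_n).
Local Notation H := (@half_space R n).
Implicit Types (c a b : chart R n M) (p q : M) (f g : M -> R).

Lemma chart_img_rel_open c : exists2 W, open W & chart_img c = W `&` H.
Proof. exact: chart_img_open. Qed.

Lemma chart_imgP c p : chart_dom c p -> chart_img c (chart_map c p).
Proof. by move=> cp; exists p. Qed.

Lemma chart_invP c x : chart_img c x -> chart_dom c (chart_inv c x).
Proof. by move=> [p cp <-]; rewrite chart_mapK. Qed.

Lemma chart_invK c x : chart_img c x -> chart_map c (chart_inv c x) = x.
Proof. by move=> [p cp <-]; rewrite chart_mapK. Qed.

Lemma chart_img_half c x : chart_img c x -> H x.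
Proof. by have [W _ ->] := chart_img_rel_open c; case. Qed.

Lemma chart_img_near c x : chart_img c x -> \forall y \near x, H y -> chart_img c y.
Proof.
have [W oW ->] := chart_img_rel_open c; move=> [Wx _].
have : nbhs x W by exact: open_nbhs_nbhs.
by apply: filterS => y Wy Hy.
Qed.

Lemma overlap_rel_open a b : exists2 V, open V & overlap a b = V `&` H.
Proof.
have [W oW E] := chart_img_rel_open a.
have [V oV VE] := within_continuous_preimage (@chart_inv_continuous _ _ _ a) (@chart_dom_open _ _ _ b).
exists (W `&` V); first exact: openI.
rewrite setIAC -E -[chart_img a `&` V]/(_ `&` V) -VE; apply/seteqP; split => x.
  by move=> [p [ap bp] <-]; split; [exact: chart_imgP|rewrite /= chart_mapK].
move=> [[p ap <-]]; rewrite /= chart_mapK// => bp.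
by exists p.
Qed.

Lemma overlap_near a b p : chart_dom a p -> chart_dom b p ->
  \forall y \near chart_map a p, chart_img a y -> overlap a b y.
Proof.
move=> ap bp; have [V oV E] := overlap_rel_open a b.
have : nbhs (chart_map a p) V.
  apply: open_nbhs_nbhs; split => //.
  have : overlap a b (chart_map a p) by exists p.
  by rewrite E => -[].
by apply: filterS => y Vy /chart_img_half Hy; rewrite E.
Qed.

Lemma chart_map_cvg c p : chart_dom c p -> {for p, continuous (chart_map c)}.
Proof.
move=> cp; have := @chart_map_continuous _ _ _ c.
by rewrite (continuous_open_subspace _ (@chart_dom_open _ _ _ c)); apply; rewrite inE.
Qed.

(* Only increments pointing into the half-space are used, so that no extension
   beyond the boundary has to be chosen. *)
Definition pd c f p : 'rV[R]_n := \row_i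
  lim ((fun h : R => h^-1 *: (f (chart_inv c (h *: ee i + chart_map c p)) - f p)) @ 0^'+).

Definition local_ext c f p (F : 'rV[R]_n -> R) := chart_dom c p /\
  \forall y \near chart_map c p, chart_img c y -> F y = f (chart_inv c y).

(** For h > 0 the point h e_i + x stays in the half-space, hence in the image of the chart for small
    h, where [F] agrees with [f] read in the chart. The two-sided limit defining the derivative of
    [F] thus restricts to the one-sided limit in [pd]. *)
Lemma pdE c f p F i d : local_ext c f p F ->
  is_derive (chart_map c p) (ee i) F d -> pd c f p 0 i = d.
Proof.
move=> [cp ext] [dF dFE]; rewrite mxE.
set x := chart_map c p in ext dF dFE *.
apply/cvg_lim => //.
have Hd : (fun h : R => h^-1 *: (F (h *: ee i + x) - F x)) @ 0^' --> d.
  by rewrite -dFE; exact: dF.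
have Hr := cvg_dnbhs_at_right Hd.
apply: cvg_trans Hr; apply: near_eq_cvg; rewrite near_withinE.
have ch : (fun h : R => h *: ee i + x) @ (0 : R) --> x.
  have : (fun h : R => h *: ee i + x) @ (0 : R) --> (0 : R) *: ee i + x.
    by apply: cvgD; [exact: scalel_continuous|exact: cvg_cst].
  by rewrite scale0r add0r.
have near1 : \forall h \near (0 : R), H (h *: ee i + x) -> chart_img c (h *: ee i + x).
  exact: ch (chart_img_near (chart_imgP cp)).
have near2 : \forall h \near (0 : R), chart_img c (h *: ee i + x) ->
    F (h *: ee i + x) = f (chart_inv c (h *: ee i + x)) := ch _ ext.
near=> h => h0.
have imgh : chart_img c (h *: ee i + x).
  apply: (near near1 h) => // j j0; rewrite !mxE eqxx /=.
  apply: addr_ge0; first by rewrite mulr_ge0// ltW.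
  exact: (chart_img_half (chart_imgP cp)).
rewrite -(near near2 h)//; congr (_ *: (_ - _)).
by rewrite (nbhs_singleton ext) ?chart_mapK//; exact: chart_imgP.
Unshelve. all: by end_near. Qed.

Definition C1_at c f p := exists W F, [/\ open W, W (chart_map c p), C_k 1 W F &
  forall y, W y -> chart_img c y -> F y = f (chart_inv c y)].

Lemma pd_ext c f p W F : chart_dom c p -> open W -> C_k 1 W F -> W (chart_map c p) ->
  (forall y, W y -> chart_img c y -> F y = f (chart_inv c y)) ->
  pd c f p = \row_i 'D_(ee i) F (chart_map c p).
Proof.
move=> cp oW HF Wp ext; apply/rowP => i; rewrite [RHS]mxE.
apply: (@pdE c f p F); last exact: (C_k_is_derive HF).
split => //; have : nbhs (chart_map c p) W by exact: open_nbhs_nbhs.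
by apply: filterS => y Wy; exact: ext.
Qed.

Lemma C1_at_val c f p W (F : 'rV[R]_n -> R) : chart_dom c p -> W (chart_map c p) ->
  (forall y, W y -> chart_img c y -> F y = f (chart_inv c y)) -> F (chart_map c p) = f p.
Proof. by move=> cp Wp /(_ _ Wp (chart_imgP cp)); rewrite chart_mapK. Qed.

Lemma C1_at_cst c p (k : R) : C1_at c (fun=> k) p.
Proof. by exists setT, (fun=> k); split => //; [exact: openT|exact: C_k_cst]. Qed.

Lemma pd_cst c p (k : R) : chart_dom c p -> pd c (fun=> k) p = 0.
Proof.
move=> cp; rewrite (@pd_ext c _ p setT (fun=> k))//; last 2 first.
- exact: openT.
- exact: C_k_cst.
by apply/rowP => i; rewrite !mxE; exact: derive_cst.
Qed.

Lemma C1_atD c f g p : C1_at c f p -> C1_at c g p -> C1_at c (fun q => f q + g q) p.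
Proof.
move=> [W [F [oW Wp HF ext]]] [V [G [oV Vp HG extG]]].
exists (W `&` V), (fun y => F y + G y); split => //; first exact: openI.
  apply: C_kD; first exact: openI.
    by apply: C_k_sub HF => y [].
  by apply: C_k_sub HG => y [].
by move=> y [Wy Vy] cy; rewrite ext// extG.
Qed.

Lemma pdD c f g p : chart_dom c p -> C1_at c f p -> C1_at c g p ->
  pd c (fun q => f q + g q) p = pd c f p + pd c g p.
Proof.
move=> cp [W [F [oW Wp HF ext]]] [V [G [oV Vp HG extG]]].
rewrite (pd_ext cp oW HF Wp ext) (pd_ext cp oV HG Vp extG).
apply/rowP => i; rewrite [RHS]mxE [X in X + _]mxE [X in _ + X]mxE.
apply: (@pdE c _ p (fun y => F y + G y)).
  split => //; have : nbhs (chart_map c p) (W `&` V) by apply: open_nbhs_nbhs; split => //; exact: openI.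
  by apply: filterS => y [Wy Vy] cy; rewrite ext// extG.
by apply: is_deriveD; [exact: (C_k_is_derive HF)|exact: (C_k_is_derive HG)].
Qed.

Lemma C1_atM c f g p : C1_at c f p -> C1_at c g p -> C1_at c (fun q => f q * g q) p.
Proof.
move=> [W [F [oW Wp HF ext]]] [V [G [oV Vp HG extG]]].
exists (W `&` V), (fun y => F y * G y); split => //; first exact: openI.
  apply: C_kM; first exact: openI.
    by apply: C_k_sub HF => y [].
  by apply: C_k_sub HG => y [].
by move=> y [Wy Vy] cy; rewrite ext// extG.
Qed.

Lemma pdM c f g p : chart_dom c p -> C1_at c f p -> C1_at c g p ->
  pd c (fun q => f q * g q) p = f p *: pd c g p + g p *: pd c f p.
Proof.
move=> cp [W [F [oW Wp HF ext]]] [V [G [oV Vp HG extG]]].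
rewrite (pd_ext cp oW HF Wp ext) (pd_ext cp oV HG Vp extG).
rewrite -(C1_at_val cp Wp ext) -(C1_at_val cp Vp extG).
apply/rowP => i; rewrite [RHS]mxE [X in X + _]mxE [X in _ * X + _]mxE [X in _ + X]mxE [X in _ + _ * X]mxE.
apply: (@pdE c _ p (fun y => F y * G y)).
  split => //; have : nbhs (chart_map c p) (W `&` V) by apply: open_nbhs_nbhs; split => //; exact: openI.
  by apply: filterS => y [Wy Vy] cy; rewrite ext// extG.
by apply: is_deriveM; [exact: (C_k_is_derive HF)|exact: (C_k_is_derive HG)].
Qed.

Lemma C1_at_sum c p (I : Type) (r : seq I) (f : I -> M -> R) :
  (forall i, C1_at c (f i) p) -> C1_at c (fun q => \sum_(i <- r) f i q) p.
Proof.
move=> H1; elim: r => [|i r IH].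
  by under [X in C1_at _ X]eq_fun do rewrite big_nil; exact: C1_at_cst.
by under [X in C1_at _ X]eq_fun do rewrite big_cons; exact: C1_atD.
Qed.

Lemma pd_sum c p (I : Type) (r : seq I) (f : I -> M -> R) : chart_dom c p ->
  (forall i, C1_at c (f i) p) ->
  pd c (fun q => \sum_(i <- r) f i q) p = \sum_(i <- r) pd c (f i) p.
Proof.
move=> cp H1; elim: r => [|i r IH].
  by under [X in pd _ X]eq_fun do rewrite big_nil; rewrite big_nil pd_cst.
under [X in pd _ X]eq_fun do rewrite big_cons.
by rewrite pdD// ?big_cons ?IH//; exact: C1_at_sum.
Qed.

Lemma pdZ c f p (k : R) : chart_dom c p -> C1_at c f p ->
  pd c (fun q => k * f q) p = k *: pd c f p.
Proof.
by move=> cp Cf; rewrite (pdM cp (C1_at_cst c p k) Cf) pd_cst// scaler0 addr0.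
Qed.

Lemma C1_at_comp1 c f p (h h' : R -> R) : continuous h' ->
  (forall t, is_derive t (1 : R) h (h' t)) -> C1_at c f p -> C1_at c (fun q => h (f q)) p.
Proof.
move=> ch' hh' [W [F [oW Wp HF ext]]].
exists W, (fun y => h (F y)); split => //; last by move=> y Wy cy; rewrite ext.
apply: (@C_k_comp1 _ _ 1 W F (fun j => if j is 0 then h else h')) => //.
  case=> [_ x|[_|//]]; last exact: ch'.
  by apply/differentiable_continuous/derivable1_diffP; have [] := hh' x.
by case=> // _ t; exact: hh'.
Qed.

Lemma pd_comp1 c f p (h h' : R -> R) : chart_dom c p -> continuous h' ->
  (forall t, is_derive t (1 : R) h (h' t)) -> C1_at c f p ->
  pd c (fun q => h (f q)) p = h' (f p) *: pd c f p.
Proof.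
move=> cp ch' hh' [W [F [oW Wp HF ext]]].
rewrite (pd_ext cp oW HF Wp ext) -(C1_at_val cp Wp ext).
apply/rowP => i; rewrite [RHS]mxE [X in _ * X]mxE.
apply: (@pdE c _ p (fun y => h (F y))).
  split => //; have : nbhs (chart_map c p) W by exact: open_nbhs_nbhs.
  by apply: filterS => y Wy cy; rewrite ext.
rewrite mulrC; exact: (is_derive_comp1 (C_k_is_derive HF i Wp) (hh' _)).
Qed.

(** [atlas_smooth] extends each component separately; finitely many neighbourhoods are intersected,
    and also with one on which points of the image of [a] lie in the overlap. *)
Lemma transition_ext a b p : atlas a -> atlas b -> chart_dom a p -> chart_dom b p ->
  exists W (G : 'rV[R]_n -> 'rV[R]_n), [/\ open W, W (chart_map a p),
    forall j, C_infty W (fun x => G x 0 j),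
    forall y, W y -> chart_img a y -> overlap a b y /\ G y = transition a b y &
    G (chart_map a p) = chart_map b p].
Proof.
move=> Aa Ab ap bp.
have ov : overlap a b (chart_map a p) by exists p.
pose WF j := cid (atlas_smooth Aa Ab j ov).
pose W_ j := projT1 (WF j); pose F_ j := projT1 (cid (projT2 (WF j))).
have HWF j : [/\ open (W_ j), W_ j (chart_map a p), C_infty (W_ j) (F_ j) &
    forall y, W_ j y -> overlap a b y -> F_ j y = transition a b y 0 j].
  by rewrite /F_ /W_; case: (WF j) => W' /= h; case: cid.
have [V oV VE] := overlap_rel_open a b.
have Vp : V (chart_map a p).
  by have : overlap a b (chart_map a p) := ov; rewrite VE => -[].
pose W := V `&` \bigcap_(j in [set: 'I_n]) W_ j.
have oW : open W.
  rewrite openE => y [Vy Wy]; apply: filterI; first exact: open_nbhs_nbhs.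
  have : \forall z \near y, forall j, W_ j z.
    have nW j : nbhs y (W_ j).
      have [oWj _ _ _] := HWF j.
      by apply: open_nbhs_nbhs; split => //; exact: Wy.
    exact: (@filter_forall _ _ (fun (j : 'I_n) z => W_ j z) (nbhs y) _ nW).
  by apply: filterS => z Wz j _.
have WW j : W `<=` W_ j by move=> y [_]; apply.
have ext y : W y -> chart_img a y ->
    overlap a b y /\ (\row_j F_ j y) = transition a b y.
  move=> Wy ay; have oy : overlap a b y.
    by rewrite VE; split; [case: Wy|exact: chart_img_half ay].
  split => //; apply/rowP => j; rewrite mxE.
  by have [_ _ _] := HWF j; apply => //; exact: WW.
have Wp : W (chart_map a p) by split => // j _; have [] := HWF j.
exists W, (fun y => \row_j F_ j y); split => //.
- move=> j k; under [X in C_k _ _ X]eq_fun do rewrite mxE.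
  by have [_ _ HF _] := HWF j; exact: C_k_sub (WW j) (HF k).
- by have [_ ->] := ext _ Wp (chart_imgP ap); rewrite /transition /= chart_mapK.
Qed.

Lemma pd_transition a b p f (G : 'rV[R]_n -> 'rV[R]_n) W :
  chart_dom a p -> chart_dom b p -> open W -> W (chart_map a p) ->
  (forall j, C_k 1 W (fun x => G x 0 j)) ->
  (forall y, W y -> overlap a b y -> G y = transition a b y) ->
  C1_at b f p ->
  pd a f p = pd b f p *m
    (\matrix_(i < n, j < n) 'D_(ee i) (fun x => G x 0 j) (chart_map a p))^T.
Proof.
move=> ap bp oW Wp HG extG [U [F [oU Up HF ext]]].
have Gp : G (chart_map a p) = chart_map b p.
  by rewrite extG ?/transition /= ?chart_mapK//; exists p.
rewrite (pd_ext bp oU HF Up ext); apply/rowP => i; rewrite [RHS]mxE.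
under eq_bigr do rewrite !mxE mulrC.
rewrite -Gp; apply: (@pdE a f p (fun y => F (G y))); last first.
  apply: is_derive_comp_rV; last by move=> j; exact: (C_k_is_derive (HG j)).
  by apply: C1_differentiable oU HF _; rewrite Gp.
split => //.
have cG : {for chart_map a p, continuous G}.
  by apply: rV_continuous => j; exact: (C_k_continuous (HG j)).
have nU : \forall y \near chart_map a p, U (G y).
  apply: (cG U); apply: open_nbhs_nbhs; split => //.
  by rewrite Gp.
have nW : \forall y \near chart_map a p, W y by exact: open_nbhs_nbhs.
near=> y => ay.
have oy : overlap a b y by apply: (near (overlap_near ap bp) y).
have Wy : W y by near: y.
have UGy : U (G y) by near: y.
have [q [aq bq] qy] := oy.
rewrite ext//; first by rewrite extG// /transition /= -qy !chart_mapK.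
by rewrite extG// /transition /= -qy chart_mapK//; exact: chart_imgP.
Unshelve. all: by end_near. Qed.

(* The coordinates of b, differentiated in a, form the rows of the Jacobian of
   the transition from a to b. *)
Lemma C1_at_coord a b p j : atlas a -> atlas b -> chart_dom a p -> chart_dom b p ->
  C1_at a (fun q => chart_map b q 0 j) p.
Proof.
move=> Aa Ab ap bp; have [W [G [oW Wp HG extG Gp]]] := transition_ext Aa Ab ap bp.
exists W, (fun y => G y 0 j); split => //; first exact: HG.
by move=> y Wy ay; have [_ ->] := extG _ Wy ay.
Qed.

Lemma pd_coord_self c p j : chart_dom c p ->
  pd c (fun q => chart_map c q 0 j) p = ee j.
Proof.
move=> cp; apply/rowP => i; rewrite [RHS]mxE eqxx /=.
apply: (@pdE c _ p (fun y => y 0 j)).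
  split => //; have : nbhs (chart_map c p) setT by exact: filterT.
  by apply: filterS => y _ cy; rewrite chart_invK.
by rewrite eq_sym; exact: is_derive_coord.
Qed.

(** Differentiating the coordinates of [a] in the chart [b] inverts the Jacobian J: by
    [pd_transition], e_j = d J^T with d the differential in [b] of the j-th coordinate of [a], and
    so v_j = v J d^T = 0. *)
Lemma jacobian_inj a b p (G : 'rV[R]_n -> 'rV[R]_n) W (v : 'rV[R]_n) :
  atlas a -> atlas b ->
  chart_dom a p -> chart_dom b p -> open W -> W (chart_map a p) ->
  (forall j, C_k 1 W (fun x => G x 0 j)) ->
  (forall y, W y -> overlap a b y -> G y = transition a b y) ->
  v *m (\matrix_(i < n, j < n) 'D_(ee i) (fun x => G x 0 j) (chart_map a p)) = 0 ->
  v = 0.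
Proof.
move=> Aa Ab ap bp oW Wp HG extG vJ; apply/rowP => j; rewrite [RHS]mxE.
have := pd_transition ap bp oW Wp HG extG (C1_at_coord j Ab Aa bp ap).
rewrite pd_coord_self// => E.
have : (v *m (ee j)^T) 0 0 = 0.
  by rewrite E trmx_mul trmxK mulmxA vJ mul0mx mxE.
rewrite mxE (bigD1 j)//= big1 ?addr0 ?mxE ?eqxx ?mulr1// => i ij.
by rewrite !mxE eqxx /= (negbTE ij) mulr0.
Qed.

End ManifoldCalculus.

(** * Smooth functions on a manifold and extension by zero *)

Section SmoothFunctions.
Variables (R : realType) (n : nat) (M : manifold R n).
Local Notation ee i := (delta_mx 0 i : 'rV[R]_n).
Local Notation H := (@half_space R n).
Implicit Types (c a b : chart R n M) (p q : M) (f g : M -> R).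

Lemma smooth_onD A (f g : 'rV[R]_n -> R) : smooth_on A f -> smooth_on A g ->
  smooth_on A (fun x => f x + g x).
Proof.
move=> Hf Hg x Ax; have [W [F [oW Wx HF ext]]] := Hf x Ax.
have [V [G [oV Vx HG extG]]] := Hg x Ax.
exists (W `&` V), (fun y => F y + G y); split => //; first exact: openI.
  move=> k; apply: C_kD; first exact: openI.
    by apply: C_k_sub (HF k) => y [].
  by apply: C_k_sub (HG k) => y [].
by move=> y [Wy Vy] Ay; rewrite ext// extG.
Qed.

Lemma smooth_onM A (f g : 'rV[R]_n -> R) : smooth_on A f -> smooth_on A g ->
  smooth_on A (fun x => f x * g x).
Proof.
move=> Hf Hg x Ax; have [W [F [oW Wx HF ext]]] := Hf x Ax.
have [V [G [oV Vx HG extG]]] := Hg x Ax.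
exists (W `&` V), (fun y => F y * G y); split => //; first exact: openI.
  move=> k; apply: C_kM; first exact: openI.
    by apply: C_k_sub (HF k) => y [].
  by apply: C_k_sub (HG k) => y [].
by move=> y [Wy Vy] Ay; rewrite ext// extG.
Qed.

Lemma smooth_on_cst A (k : R) : smooth_on A (fun _ : 'rV[R]_n => k).
Proof.
move=> x _; exists setT, (fun=> k); split => //; first exact: openT.
by move=> j; exact: C_k_cst.
Qed.

Lemma smooth_on_sum A (I : Type) (r : seq I) (f : I -> 'rV[R]_n -> R) :
  (forall i, smooth_on A (f i)) -> smooth_on A (fun x => \sum_(i <- r) f i x).
Proof.
move=> Hf; elim: r => [|i r IH].
  by under [X in smooth_on _ X]eq_fun do rewrite big_nil; exact: smooth_on_cst.
by under [X in smooth_on _ X]eq_fun do rewrite big_cons; exact: smooth_onD.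
Qed.

Lemma smooth_on_continuous A (f : 'rV[R]_n -> R) : smooth_on A f ->
  {within A, continuous f}.
Proof.
move=> Hf; apply/subspace_continuousP => x Ax.
have [W [F [oW Wx HF ext]]] := Hf x Ax.
have cF : F y @[y --> x] --> F x := C_k_continuous (HF 0%N) Wx.
have cF' : F y @[y --> within A (nbhs x)] --> F x.
  by apply: cvg_trans cF; apply: cvg_app; exact: cvg_within.
suff h : f y @[y --> within A (nbhs x)] --> f x by exact: h.
rewrite -ext//; apply: cvg_trans cF'; apply: near_eq_cvg.
rewrite near_withinE; have : nbhs x W by exact: open_nbhs_nbhs.
by apply: filterS => y Wy Ay; exact: ext.
Qed.

Definition smoothM f := forall c, atlas c ->
  smooth_on (chart_img c) (fun x => f (chart_inv c x)).

Definition C1M f := forall c, atlas c -> forall p, chart_dom c p -> C1_at c f p.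

Lemma smoothM_C1M f : smoothM f -> C1M f.
Proof.
move=> Hf c Ac p cp; have [W [F [oW Wp HF ext]]] := Hf c Ac _ (chart_imgP cp).
by exists W, F; split => //; exact: HF.
Qed.

Lemma smoothM_pd c f i : atlas c -> smoothM f ->
  smooth_on (chart_img c) (fun x => pd c f (chart_inv c x) 0 i).
Proof.
move=> Ac Hf x cx; have [W [F [oW Wx HF ext]]] := Hf c Ac x cx.
exists W, (fun y => 'D_(ee i) F y); split => //.
  by move=> k; apply: C_k_derive; exact: HF.
move=> y Wy cy; have cp := chart_invP cy.
rewrite (pd_ext cp oW (HF 1%N))//; first by rewrite mxE chart_invK.
by rewrite chart_invK.
Qed.

Lemma chart_inv_near c p U : chart_dom c p -> nbhs p U ->
  \forall y \near chart_map c p, chart_img c y -> U (chart_inv c y).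
Proof.
move=> cp; rewrite nbhsE => -[U' [oU' U'p] UU].
have [V oV VE] := within_continuous_preimage (@chart_inv_continuous _ _ _ c) oU'.
have Vp : V (chart_map c p).
  have : ([set chart_map c x | x in chart_dom c] `&` chart_inv c @^-1` U') (chart_map c p).
    by split; [exact: chart_imgP|rewrite /= chart_mapK].
  by rewrite VE => -[].
have : nbhs (chart_map c p) V by exact: open_nbhs_nbhs.
apply: filterS => y Vy cy; apply: UU.
have : ([set chart_map c x | x in chart_dom c] `&` V) y by [].
by rewrite -VE => -[].
Qed.

Lemma pd_near c f g p : chart_dom c p -> C1_at c g p ->
  (\forall q \near p, f q = g q) -> pd c f p = pd c g p.
Proof.
move=> cp [W [F [oW Wp HF ext]]] fg.
rewrite (pd_ext cp oW HF Wp ext); apply/rowP => i; rewrite [RHS]mxE.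
apply: (@pdE _ _ _ c f p F); last exact: (C_k_is_derive HF).
split => //; have nW : nbhs (chart_map c p) W by exact: open_nbhs_nbhs.
have := chart_inv_near cp fg; apply: filterS2 nW => y Wy fgy cy.
by rewrite ext// fgy.
Qed.

Lemma C1M_continuous f : C1M f -> continuous f.
Proof.
move=> Hf p; have [c Ac cp] := atlas_cover p.
have [W [F [oW Wp HF ext]]] := Hf c Ac p cp.
have cF : {for p, continuous (fun q => F (chart_map c q))}.
  apply: (@continuous_comp _ _ _ (chart_map c) F); first exact: chart_map_cvg.
  exact: (C_k_continuous HF).
rewrite /continuous_at -(C1_at_val cp Wp ext).
apply: cvg_trans cF; apply: near_eq_cvg.
have nc : nbhs p (chart_dom c) by apply: open_nbhs_nbhs; split => //; exact: chart_dom_open.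
have nW : \forall q \near p, W (chart_map c q).
  have h : chart_map c q @[q --> p] --> chart_map c p := chart_map_cvg cp.
  by apply: (h W); exact: open_nbhs_nbhs.
by apply: filterS2 nc nW => q cq Wq; rewrite ext ?chart_mapK//; exact: chart_imgP.
Qed.

Lemma half_space_closed : closed H.
Proof.
rewrite -[H]setCK; apply: open_closedC; rewrite openE => x Hx.
have [i [i0 xi]] : exists i : 'I_n, val i = 0%N /\ x 0 i < 0.
  apply: contrapT => N; apply: Hx => i i0; rewrite leNgt; apply/negP => xi.
  by apply: N; exists i.
have : \forall y \near x, (y : 'rV[R]_n) 0 i < 0.
  by apply: (@coord_continuous R 1 n 0 i x [set t | t < 0]); exact: lt_nbhsl.
by apply: filterS => y yi /(_ i i0); rewrite leNgt yi.
Qed.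

Definition extM c (F : 'rV[R]_n -> R) p : R :=
  if `[< chart_dom c p >] then F (chart_map c p) else 0.

Lemma extME c F p : chart_dom c p -> extM c F p = F (chart_map c p).
Proof. by rewrite /extM => /asboolP ->. Qed.

(** The image is compact, and M is Hausdorff. *)
Lemma compact_chart_closed c (K : set 'rV[R]_n) : compact K -> K `&` H `<=` chart_img c ->
  closed (chart_inv c @` (K `&` H)).
Proof.
move=> cK sK; apply: compact_closed; first exact: manifold_hausdorff.
apply: continuous_compact; last first.
  by apply: compact_closedI => //; exact: half_space_closed.
by apply: continuous_subspaceW (@chart_inv_continuous _ _ _ c).
Qed.

(** Inside the domain of [c] this is composition with a transition map. A point outside it has a
    neighbourhood that misses the closed image of K, and the extension is zero there. *)
Lemma smoothM_extM c (F : 'rV[R]_n -> R) (K : set 'rV[R]_n) : atlas c ->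
  C_infty setT F -> compact K -> K `&` H `<=` chart_img c ->
  (forall y, ~ K y -> F y = 0) -> smoothM (extM c F).
Proof.
move=> Ac HF cK sK F0 b Ab x [p bp <-].
have [cp|ncp] := pselect (chart_dom c p).
  have [W [G [oW Wp HG extG Gp]]] := transition_ext Ab Ac bp cp.
  exists W, (fun y => F (G y)); split => //.
    by move=> k; apply: (C_k_comp oW (@openT _)) (HF k) _ => // j; exact: HG.
  move=> y Wy by'; have [[q [bq cq] <-] ->] := extG y Wy by'.
  by rewrite /transition /= chart_mapK// extME.
have clS := compact_chart_closed cK sK.
have nS : nbhs p (~` (chart_inv c @` (K `&` H))).
  apply: open_nbhs_nbhs; split; first exact: closed_openC.
  by move=> [y Ky yp]; apply: ncp; rewrite -yp; apply: chart_invP; exact: sK.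
have : nbhs (chart_map b p) (fun y => chart_img b y -> (~` (chart_inv c @` (K `&` H))) (chart_inv b y)) := chart_inv_near bp nS.
rewrite nbhsE => -[W [oW Wp] WS].
exists W, (fun=> 0); split => //; first by move=> k; exact: C_k_cst.
move=> y Wy by'; rewrite /extM; case: asboolP => // cq; apply/esym/F0 => Kq.
apply: (WS y Wy by'); exists (chart_map c (chart_inv b y)); last by rewrite chart_mapK.
by split => //; exact: chart_img_half (chart_imgP cq).
Qed.

End SmoothFunctions.

(** * The metric induced by a map into Euclidean space *)

Section PullbackMetric.
Variables (R : realType) (n : nat) (M : manifold R n) (I : finType).
Variable phi : I -> M -> R.
Local Notation ee i := (delta_mx 0 i : 'rV[R]_n).
Local Notation pd c l p := (@pd R n M c (phi l) p).

Definition immersion := forall c : chart R n M, atlas c -> forall p, chart_dom c p ->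
  forall v : 'rV[R]_n, v != 0 -> exists l, (v *m (pd c l p)^T) 0 0 != 0.

(** The first fundamental form of the map with components [phi l]. Its quadratic form is a sum of
    squares, so positivity is exactly injectivity of the differential, which is [immersion]. *)
Definition pull_gram (c : chart R n M) (p : M) : 'M[R]_n :=
  \sum_l (pd c l p)^T *m pd c l p.

Lemma pull_gramE c p i j : pull_gram c p i j = \sum_l pd c l p 0 i * pd c l p 0 j.
Proof.
rewrite /pull_gram summxE; apply: eq_bigr => l _.
by rewrite mxE big_ord1 [X in X * _]mxE.
Qed.

Lemma pull_gram_form c p (v : 'rV[R]_n) :
  (v *m pull_gram c p *m v^T) 0 0 = \sum_l ((v *m (pd c l p)^T) 0 0) ^+ 2.
Proof.
rewrite /pull_gram mulmx_sumr mulmx_suml summxE; apply: eq_bigr => l _.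
rewrite mulmxA -mulmxA -[X in _ *m X]trmxK trmx_mul trmxK.
by rewrite mxE big_ord1 [X in _ * X]mxE expr2.
Qed.

Lemma pull_gram_sym c p : (pull_gram c p)^T = pull_gram c p.
Proof. by apply/matrixP => i j; rewrite mxE !pull_gramE; apply: eq_bigr => l _; rewrite mulrC. Qed.

Hypothesis (phi_smooth : forall l, smoothM (phi l)) (phi_imm : immersion).

Lemma pull_gram_posdef c : atlas c -> forall p, chart_dom c p ->
  forall v : 'rV[R]_n, v != 0 -> 0 < (v *m pull_gram c p *m v^T) 0 0.
Proof.
move=> Ac p cp v v0; rewrite pull_gram_form.
have [l vl] := phi_imm Ac cp v0.
by rewrite (bigD1 l)//= ltr_wpDr ?sumr_ge0// => [k _|]; rewrite ?sqr_ge0// exprn_even_gt0.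
Qed.

Lemma pull_gram_smooth c : atlas c -> forall i j : 'I_n,
  smooth_on (chart_img c) (fun x => pull_gram c (chart_inv c x) i j).
Proof.
move=> Ac i j; under [X in smooth_on _ X]eq_fun do rewrite pull_gramE.
by apply: smooth_on_sum => l; apply: smooth_onM; exact: smoothM_pd.
Qed.

Lemma pull_gram_transition a b : atlas a -> atlas b ->
  forall p, chart_dom a p -> chart_dom b p ->
  forall (W : set 'rV[R]_n) (F : 'rV[R]_n -> 'rV[R]_n),
    open W -> W (chart_map a p) ->
    (forall j : 'I_n, C_infty W (fun x => F x 0 j)) ->
    (forall x, W x -> overlap a b x -> F x = transition a b x) ->
    let J := \matrix_(i < n, j < n)
      'D_(ee i) (fun x => F x 0 j) (chart_map a p) in
    pull_gram a p = J *m pull_gram b p *m J^T.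
Proof.
move=> Aa Ab p ap bp W F oW Wp HF ext J.
rewrite /pull_gram mulmx_sumr mulmx_suml; apply: eq_bigr => l _.
rewrite (pd_transition ap bp oW Wp (fun j => HF j 1%N) ext (smoothM_C1M (phi_smooth l) Ab bp)).
by rewrite -/J trmx_mul trmxK !mulmxA.
Qed.

Definition pullback_metric : metric M :=
  @Defs.Metric R n M pull_gram (fun c _ p _ => pull_gram_sym c p) pull_gram_posdef pull_gram_smooth
    pull_gram_transition.

(** A vector killed by the differentials of all components is killed by the Jacobian of the
    transition to [b], because the coordinates of [b] are among the components near p. *)
Lemma coordinates_immersion :
  (forall p, exists b (idx : 'I_n -> I), [/\ atlas b, chart_dom b p &
     forall j, \forall q \near p, phi (idx j) q = chart_map b q 0 j]) -> immersion.
Proof.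
move=> Hc c Ac p cp v v0; have [b [idx [Ab bp Hidx]]] := Hc p.
apply: contrapT => N.
have [W [G [oW Wp HG extG Gp]]] := transition_ext Ac Ab cp bp.
have extG' y : W y -> overlap c b y -> G y = transition c b y.
  by move=> Wy oy; have [q [cq bq] qy] := oy; have [] := extG y Wy; first by rewrite -qy; exact: chart_imgP.
suff : v = 0 by move/eqP; rewrite (negbTE v0).
apply: (jacobian_inj Ac Ab cp bp oW Wp (fun j => HG j 1%N) extG').
apply/rowP => j; rewrite [RHS]mxE.
have E : pd c (idx j) p = (ee j) *m (\matrix_(i < n, j < n) 'D_(ee i) (fun x => G x 0 j) (chart_map c p))^T.
  rewrite (pd_near cp (C1_at_coord j Ac Ab cp bp) (Hidx j)).
  rewrite (pd_transition cp bp oW Wp (fun j => HG j 1%N) extG' (C1_at_coord j Ab Ab bp bp)).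
  by rewrite pd_coord_self.
have : (v *m (pd c (idx j) p)^T) 0 0 = 0.
  by apply/eqP/negPn/negP => h; apply: N; exists (idx j).
rewrite E trmx_mul trmxK mulmxA; set u := v *m _.
rewrite mxE (bigD1 j)//= big1 ?addr0 ?mxE ?eqxx ?mulr1// => i ij.
by rewrite !mxE eqxx /= (negbTE ij) mulr0.
Qed.

End PullbackMetric.

(** * Measures with a density *)

Section DensityPushforward.
Context d1 d2 (X : measurableType d1) (Y : measurableType d2) (R : realType).
Variables (m : {measure set X -> \bar R}) (w : X -> R) (h : X -> Y).
Hypotheses (mw : measurable_fun setT w) (w0 : forall x, 0 <= w x).
Hypothesis mh : measurable_fun setT h.

Import HBNNSimple.
Local Open Scope ereal_scope.

(** The integral formula holds for simple functions by the definition of the measure and passes to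
    increasing limits by monotone convergence. *)
Lemma density_measure : exists v : {measure set X -> \bar R},
  (forall A, v A = \int[m]_(x in A) (w x)%:E) /\
  forall f : X -> \bar R, measurable_fun setT f -> (forall x, 0 <= f x) ->
    \int[v]_x f x = \int[m]_x ((w x)%:E * f x).
Proof.
pose nu (A : set X) := \int[m]_(x in A) (w x)%:E.
have w0' x : 0 <= (w x)%:E by rewrite lee_fin.
have mwE : measurable_fun setT (fun x => (w x)%:E) by exact/measurable_EFinP.
have nu0 : nu set0 = 0 by rewrite /nu integral_set0.
have nuge A : 0 <= nu A by apply: integral_ge0 => x _.
have nuadd : semi_sigma_additive nu := semi_sigma_additive_nng_induced mwE w0'.
pose mix := isMeasure.Build _ X R nu nu0 nuge nuadd.
pose v : {measure set X -> \bar R} := HB.pack nu mix.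
exists v; split => // f mf f0.
pose f_ := nnsfun_approx measurableT mf.
have cf x : (f_ k x)%:E @[k --> \oo] --> f x by exact: cvg_nnsfun_approx.
transitivity (limn (fun k => \int[v]_x (f_ k x)%:E)).
  rewrite -monotone_convergence//.
  - by apply: eq_integral => y _; apply/esym/cvg_lim.
  - by move=> k; exact/measurable_EFinP/measurable_funP.
  - by move=> k y _; rewrite lee_fin.
  - by move=> y _ i j ij; rewrite lee_fin; exact/lefP/nd_nnsfun_approx.
rewrite [X in limn X](_ : _ = (fun k => \int[m]_x ((w x)%:E * (f_ k x)%:E))).
  rewrite -monotone_convergence//.
  - apply: eq_integral => x _; apply/cvg_lim => //.
    by apply: cvgeZl => //; exact: cf.
  - by move=> k; apply: emeasurable_funM => //; exact/measurable_EFinP/measurable_funP.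
  - by move=> k x _; rewrite mule_ge0// lee_fin.
  - move=> x _ i j ij; rewrite lee_wpmul2l// lee_fin.
    exact/lefP/nd_nnsfun_approx.
apply/funext => k; set g := f_ k.
rewrite integralT_nnsfun sintegralE.
transitivity (\sum_(r \in range g) \int[m]_x (r%:E * ((w x)%:E * (\1_(g @^-1` [set r]) x)%:E))).
  apply: eq_fsbigr => r /[!inE] -[t _ <-].
  have mA : measurable (g @^-1` [set g t]) by exact: measurable_funPTI.
  rewrite ge0_integralZl//; last first.
  - by rewrite lee_fin.
  - by move=> x _; rewrite mule_ge0// lee_fin.
  - apply: emeasurable_funM => //; apply/measurable_EFinP; exact: measurable_indic.
  congr (_ * _); rewrite /v /= /nu integral_mkcond; apply: eq_integral => x _.
  by rewrite epatch_indic.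
rewrite -ge0_integral_fsum//.
- apply: eq_integral => x _; rewrite [in RHS](fimfunE g) -fsumEFin// ge0_mule_fsumr//.
    by apply: eq_fsbigr => r _; rewrite muleCA EFinM.
  by move=> r; exact: nnfun_muleindic_ge0.
- move=> r; apply: emeasurable_funM => //; apply: emeasurable_funM => //.
  by apply/measurable_EFinP; exact: measurable_indic.
- by move=> r x _; rewrite muleCA mule_ge0// nnfun_muleindic_ge0.
Qed.

Lemma density_pushforward : exists v : {measure set Y -> \bar R},
  (forall B, measurable B -> v B = \int[m]_x (w x * \1_B (h x))%:E) /\
  forall f : Y -> \bar R, measurable_fun setT f -> (forall y, 0 <= f y) ->
    \int[v]_y f y = \int[m]_x ((w x)%:E * f (h x)).
Proof.
have [v [vE vI]] := density_measure.
exists (measure_function_pushforward__canonical__measure_function_Measure v mh); split => /=.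
  move=> B mB; rewrite /pushforward vE integral_mkcond; apply: eq_integral => x _.
  by rewrite epatch_indic EFinM.
move=> f mf f0; rewrite ge0_integral_pushforward// preimage_setT vI//; [exact: (measurableT_comp mf)|move=> x; exact: f0].
Qed.

End DensityPushforward.

(** * Comparing measures through small cubes *)

Section Cubes.
Variables (R : realType) (n : nat).
Local Notation Rn n := (borel 'rV[R]_n).
Implicit Types (u x : 'rV[R]_n) (s : R).

(** Half-open cubes are used for tilings. The closed ones, [ccube], retain the limit point of a
    nested sequence and are compact. *)
Definition cube u s : set (Rn n) := [set x | forall i, u 0 i <= x 0 i < u 0 i + s].
Definition ccube u s : set 'rV[R]_n := [set x | forall i, u 0 i <= x 0 i <= u 0 i + s].

Lemma cube_ccube u s : cube u s `<=` ccube u s.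
Proof. by move=> x ux i; have /andP[-> /ltW ->] := ux i. Qed.

Lemma lebn_cubeE u s : 0 <= s ->
  measurable (cube u s) /\ lebn R n (cube u s) = (s ^+ n)%:E.
Proof.
move=> s0; have [] := @lebn_box R n (fun i => [set` `[u 0 i, u 0 i + s[ ]) (fun=> s).
- by move=> i; exact: measurable_itv.
- by move=> i; rewrite lebesgue_measure_itv /= lte_fin ltrDl; case: ltP => h; [rewrite -EFinB addrC addKr|congr (_%:E); apply/le_anti/andP].
rewrite prodr_const card_ord (_ : [set x | _] = cube u s)//.
Qed.

Lemma measurable_cube u s : measurable (cube u s).
Proof.
have [s0|s0] := leP 0 s; first by have [] := lebn_cubeE u s0.
case: (posnP n) => [n0|n0].
  have -> : cube u s = setT; last exact: measurableT.
  by apply/seteqP; split => // x _ i; move: (ltn_ord i); rewrite [X in (_ < X)%N]n0.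
have -> : cube u s = set0; last exact: measurable0.
by apply/seteqP; split => // x /(_ (Ordinal n0)) /andP[h1 h2]; lra.
Qed.

Lemma le_measure_bigcup d (T : measurableType d) (I : countType) (a b : {measure set T -> \bar R})
    (P : set I) (F : I -> set T) : (forall i, measurable (F i)) -> trivIset P F ->
  (forall i, P i -> (b (F i) <= a (F i))%E) ->
  (b (\bigcup_(i in P) F i) <= a (\bigcup_(i in P) F i))%E.
Proof.
move=> mF tF ba.
pose G k := if @pickle_inv I k is Some i then (if `[< P i >] then F i else set0) else set0.
have mG k : measurable (G k).
  by rewrite /G; case: pickle_inv => // i; case: ifP => // _; exact: measurable0.
have E : \bigcup_(i in P) F i = \bigcup_k G k.
  apply/seteqP; split => [x [i Pi Fx]|x [k _]].
    by exists (pickle i) => //; rewrite /G pickleK_inv asboolT.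
  by rewrite /G; case: pickle_inv => // i; case: asboolP => // Pi Fx; exists i.
have tG : trivIset setT G.
  apply/trivIsetP => i j _ _ ij; rewrite /G.
  have := @pickle_invK I i; have := @pickle_invK I j.
  case: pickle_inv => [k|]; last by rewrite setI0.
  case: pickle_inv => [l|]; last by rewrite set0I.
  move=> /= kj li; case: asboolP => Pl; last by rewrite set0I.
  case: asboolP => Pk; last by rewrite setI0.
  move/trivIsetP : tF; apply => //; apply: contra ij => /eqP lk.
  by rewrite -kj -li lk.
rewrite E !measure_bigcup//; apply: lee_nneseries => k _; first by move=> _; exact: measure_ge0.
by rewrite /G; case: pickle_inv => [i|]; rewrite ?measure0//; case: asboolP; rewrite ?measure0// => /ba.
Qed.

Definition child u s (e : {ffun 'I_n -> bool}) : 'rV[R]_n := \row_i (u 0 i + (if e i then s / 2 else 0)).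

Lemma cube_child u s : cube u s = \bigcup_e cube (child u s e) (s / 2).
Proof.
apply/seteqP; split => [x ux|x [e _ ex] i].
  exists [ffun i => u 0 i + s / 2 <= x 0 i] => // i; rewrite !mxE ffunE.
  have /andP[h1 h2] := ux i; case: (leP (u 0 i + s / 2) (x 0 i)) => h3; apply/andP; split; lra.
have := ex i; rewrite !mxE => /andP[]; case: (e i) => h1 h2; apply/andP; split; lra.
Qed.

Lemma ccube_child u s e : 0 <= s -> ccube (child u s e) (s / 2) `<=` ccube u s.
Proof.
move=> s0 x ex i; have := ex i; rewrite !mxE => /andP[].
by case: (e i) => h1 h2; apply/andP; split; lra.
Qed.

Lemma child_disjoint u s : trivIset setT (fun e => cube (child u s e) (s / 2)).
Proof.
apply/trivIsetP => e f _ _ ef; apply/seteqP; split => // x [ex fx].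
move/eqP : ef; apply; apply/ffunP => i; have := ex i; have := fx i; rewrite !mxE.
by case: (e i); case: (f i) => // /andP[h1 h2] /andP[h3 h4]; lra.
Qed.

Section Compare.
Variables (O : set (Rn n)) (a b : {measure set (Rn n) -> \bar R}).
Hypothesis a_fin : forall u s, 0 < s -> ccube u s `<=` O -> (a (cube u s) < +oo)%E.
Hypothesis local : forall x e, O x -> 0 < e -> exists2 r, 0 < r &
  forall u s, 0 < s < r -> ccube u s x -> ccube u s `<=` O ->
    (b (cube u s) <= (1 + e)%:E * a (cube u s))%E.

Lemma compare_child u s (e : R) : 0 <= e ->
  (forall f, b (cube (child u s f) (s / 2)) <= (1 + e)%:E * a (cube (child u s f) (s / 2)))%E ->
  (b (cube u s) <= (1 + e)%:E * a (cube u s))%E.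
Proof.
move=> e0 H; have e1 : 0 <= 1 + e by rewrite addr_ge0.
rewrite cube_child.
apply: (@le_measure_bigcup _ _ {ffun 'I_n -> bool} (mscale (NngNum e1) a) b) => //.
- by move=> f; exact: measurable_cube.
- exact: child_disjoint.
Qed.

(** If b exceeds (1 + e) a on a cube, it does so on one of its children, by additivity. Repeated
    halving gives nested cubes that shrink to a point of O, where [local] is contradicted. *)
Lemma compare_cube u s : 0 < s -> ccube u s `<=` O -> (b (cube u s) <= a (cube u s))%E.
Proof.
move=> s0 sO; rewrite leNgt; apply/negP => ab.
have [e e0 bad0] : exists2 e : R, 0 < e & ((1 + e)%:E * a (cube u s) < b (cube u s))%E.
  have := a_fin s0 sO; have : (0 <= a (cube u s))%E := measure_ge0 a _.
  move: ab; case: (a (cube u s)) => [r| |] // ab a0 afin.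
  move: ab a0; case: (b (cube u s)) => [t| |]//; last first.
    by move=> _ _; exists 1; rewrite // -EFinM ltry.
  (* Here r < t are the values of a and b. With this e the excess e r is at most half of t - r; the
     denominator 1 + r covers r = 0. *)
  rewrite lte_fin lee_fin => rt r0; exists ((t - r) / (2 * (1 + r))).
    by rewrite divr_gt0 ?subr_gt0// mulr_gt0// ltr_pwDl.
  rewrite -EFinM lte_fin.
  have -> : (1 + (t - r) / (2 * (1 + r))) * r = r + (t - r) / 2 * (r / (1 + r)).
    by field; lra.
  have : r / (1 + r) <= 1 by rewrite ler_pdivrMr; lra.
  have : 0 <= r / (1 + r) by rewrite divr_ge0; lra.
  by move: (r / (1 + r)) => k; nra.
pose bad (us : 'rV[R]_n * R) := ((1 + e)%:E * a (cube us.1 us.2) < b (cube us.1 us.2))%E.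
have nextP us : exists f, bad us -> bad (child us.1 us.2 f, us.2 / 2).
  have [bus|] := pselect (bad us); last by exists [ffun=> true].
  apply: contrapT => N.
  have : (b (cube us.1 us.2) <= (1 + e)%:E * a (cube us.1 us.2))%E.
    apply: compare_child; first exact: ltW.
    move=> f; rewrite leNgt; apply/negP => Hf; apply: N; exists f => _; exact: Hf.
  by rewrite leNgt => /negP; apply.
pose F us := projT1 (cid (nextP us)).
have FP us : bad us -> bad (child us.1 us.2 (F us), us.2 / 2) := projT2 (cid (nextP us)).
pose next us := (child us.1 us.2 (F us), us.2 / 2).
pose q k := iter k next (u, s).
have qbad k : bad (q k) by elim: k => // k IH; exact: FP.
have qs k : (q k).2 = s / 2 ^+ k.
  by elim: k => [|k IH]; rewrite ?expr0 ?divr1// /q iterS /= -/(q k) IH exprS; field.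
have qs0 k : 0 < (q k).2 by rewrite qs divr_gt0// exprn_gt0.
have ndq i : nondecreasing_seq (fun k => (q k).1 0 i).
  apply/nondecreasing_seqP => k; rewrite [in leRHS]/q iterS /= -/(q k) mxE lerDl.
  by case: ifP => // _; rewrite divr_ge0// ltW.
have ccS k : ccube (q k.+1).1 (q k.+1).2 `<=` ccube (q k).1 (q k).2.
  by apply: ccube_child; exact: ltW.
have ccM k l : (k <= l)%N -> ccube (q l).1 (q l).2 `<=` ccube (q k).1 (q k).2.
  move=> /subnK <-; elim: (l - k)%N => // j IH; rewrite addSn.
  exact: subset_trans (ccS _) IH.
have qin k l : (k <= l)%N -> ccube (q k).1 (q k).2 (q l).1.
  by move=> kl; apply: (ccM _ _ kl) => i; rewrite lexx lerDl ltW.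
have ubq i k l : (q l).1 0 i <= (q k).1 0 i + (q k).2.
  have [kl|/ltnW lk] := leqP k l; first by have /andP[] := qin _ _ kl i.
  by apply: le_trans (ndq i _ _ lk) _; rewrite lerDl ltW.
(* The common point of the nested closed cubes: the lower corners increase and are bounded by every
   upper corner. *)
pose x : 'rV[R]_n := \row_i sup (range (fun k => (q k).1 0 i)).
have hs i : has_sup (range (fun k => (q k).1 0 i)).
  split; first by exists ((q 0%N).1 0 i), 0%N.
  by exists ((q 0%N).1 0 i + (q 0%N).2) => _ [l _ <-]; exact: ubq.
have xin k : ccube (q k).1 (q k).2 x.
  move=> i; rewrite mxE; apply/andP; split.
    by apply: ub_le_sup; [case: (hs i)|exists k].
  by apply: ge_sup; [case: (hs i)|move=> _ [l _ <-]; exact: ubq].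
have qO k : ccube (q k).1 (q k).2 `<=` O by exact: subset_trans (ccM 0%N k (leq0n _)) sO.
have [r r0 Hr] := local (qO 0%N _ (xin 0%N)) e0.
have [k kr] : exists k, (q k).2 < r.
  have rs0 : 0 < r / s by rewrite divr_gt0.
  have [k _ /(_ k (leqnn k)) /= Hk] := near_infty_natSinv_expn_lt (PosNum rs0).
  by exists k; rewrite qs; move: Hk; rewrite ltr_pdivlMr// mul1r mulrC.
have := Hr (q k).1 (q k).2; rewrite kr qs0 => /(_ isT (xin k) (qO k)).
by rewrite leNgt => /negP; apply; exact: qbad.
Qed.

End Compare.

(** * Dyadic cubes and comparison of measures on Borel sets *)

Definition dcorner (l : nat) (x : 'rV[R]_n) : 'rV[int]_n := \row_i Num.floor (2 ^+ l * x 0 i).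
Definition dcube l (k : 'rV[int]_n) : set (Rn n) := cube (\row_i ((k 0 i)%:~R / 2 ^+ l)) (2 ^+ l)^-1.

Lemma dcubeP l k x : dcube l k x <-> dcorner l x = k.
Proof.
have H i : ((k 0 i)%:~R / 2 ^+ l <= x 0 i < (k 0 i)%:~R / 2 ^+ l + (2 ^+ l)^-1) =
    (Num.floor (2 ^+ l * x 0 i) == k 0 i).
  rewrite floor_eq ler_pdivrMr// [2 ^+ l * _]mulrC; congr (_ && _).
  by rewrite (_ : _ + _ = (k 0 i + 1)%:~R / 2 ^+ l) ?ltr_pdivlMr// intrD mulrDl mul1r.
split => [xk|xk i].
  by apply/rowP => i; rewrite mxE; apply/eqP; rewrite -H; have := xk i; rewrite !mxE.
by have := H i; rewrite !mxE => ->; rewrite -xk mxE.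
Qed.

Lemma dcorner_le l m x y : (l <= m)%N -> dcorner m x = dcorner m y -> dcorner l x = dcorner l y.
Proof.
move=> /subnK <-; elim: (m - l)%N => //= j IH; rewrite addSn => E; apply: IH.
apply/rowP => i; have := congr1 (fun v : 'rV[int]_n => v 0 i) E; rewrite !mxE exprS -!mulrA.
set t := _ * x 0 i; set t' := _ * y 0 i => F; symmetry; apply/eqP; rewrite floor_eq.
have /andP[h1 h2] := floor_itv t; have /andP[h3 h4] := floor_itv (2 * t).
have /andP[h5 h6] := floor_itv (2 * t'); move: h3 h4; rewrite F => h3 h4.
set a := Num.floor t in h1 h2 *; set k := Num.floor (2 * t') in h3 h4 h5 h6.
have k1 : (2 * a <= k)%R.
  rewrite -ltzD1 -(ltr_int R); apply: le_lt_trans h4.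
  by rewrite intrM /= ler_pM2l.
have k2 : (k + 1 <= 2 * (a + 1))%R.
  rewrite lezD1 -(ltr_int R); apply: le_lt_trans h3 _.
  by rewrite intrM /= ltr_pM2l.
have k1' : (2 * a)%:~R <= k%:~R :> R by rewrite ler_int.
have k2' : (k + 1)%:~R <= (2 * (a + 1))%:~R :> R by rewrite ler_int.
move: k1' k2'; rewrite !intrM /= => k1' k2'.
by apply/andP; split; lra.
Qed.

(** Unions of dyadic cubes of one level. They form a ring of sets whose sigma-ring contains all
    Borel sets, as every open set is a countable union of dyadic cubes. *)
Definition dyadic_set (A : set (Rn n)) :=
  exists l, forall x y, dcorner l x = dcorner l y -> A x -> A y.

Lemma dyadic_setring : setring dyadic_set.
Proof.
have common A B : dyadic_set A -> dyadic_set B -> exists l, forall x y, dcorner l x = dcorner l y ->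
    (A x <-> A y) /\ (B x <-> B y).
  move=> [l Hl] [m Hm]; exists (maxn l m) => x y xy.
  have xl := dcorner_le (leq_maxl l m) xy; have xm := dcorner_le (leq_maxr l m) xy.
  by split; split; [exact: Hl xl|exact: Hl (esym xl)|exact: Hm xm|exact: Hm (esym xm)].
split; first by exists 0%N.
- move=> A B /common h /h [l Hl]; exists l => x y /Hl[[h1 _] [h2 _]] [/h1|/h2]; [by left|by right].
- by move=> A B /common h /h [l Hl]; exists l => x y /Hl[[h1 _] [_ h2]] [/h1 Ay NB]; split => // /h2.
Qed.

Lemma dyadic_setE A l : (forall x y, dcorner l x = dcorner l y -> A x -> A y) ->
  A = \bigcup_(k in [set k | exists2 x, A x & dcorner l x = k]) dcube l k.
Proof.
move=> HA; apply/seteqP; split => [x Ax|x [k [y Ay yk] /dcubeP xk]].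
  by exists (dcorner l x); [exists x|apply/dcubeP].
by apply: HA Ay; rewrite yk xk.
Qed.

Lemma dcube_disjoint l (P : set 'rV[int]_n) : trivIset P (dcube l).
Proof.
apply/trivIsetP => k k' _ _ /eqP kk; apply/seteqP; split => // x [/dcubeP h1 /dcubeP h2].
by apply: kk; rewrite -h1 -h2.
Qed.

Lemma dcube_small (x : 'rV[R]_n) (r : R) : 0 < r -> exists l, (2 ^+ l)^-1 < r.
Proof.
move=> r0; have [l _ /(_ l (leqnn l)) /= Hl] := near_infty_natSinv_expn_lt (PosNum r0).
by exists l; rewrite -div1r.
Qed.

Lemma dcube_near l (x y : 'rV[R]_n) :
  ccube (\row_i ((dcorner l x 0 i)%:~R / 2 ^+ l)) (2 ^+ l)^-1 y ->
  forall i, `|x 0 i - y 0 i| <= (2 ^+ l)^-1.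
Proof.
move=> xy i; have := xy i; rewrite mxE => /andP[h1 h2].
have /dcubeP/(_ i) : dcorner l x = dcorner l x by [].
rewrite mxE => /andP[h3 h4]; rewrite ler_norml; apply/andP; split; lra.
Qed.

Lemma open_dcube (U : set 'rV[R]_n) x : open U -> U x ->
  exists l, dcube l (dcorner l x) `<=` U.
Proof.
move=> oU Ux; have [r /= r0 xr] : exists2 r : R, 0 < r & ball x r `<=` U.
  by have /nbhs_ballP : nbhs x U by exact: open_nbhs_nbhs.
have [l lr] := dcube_small x r0.
exists l => y /cube_ccube xy; apply: xr; apply/rV_ballE => // i.
exact: le_lt_trans (dcube_near xy i) lr.
Qed.

Lemma borel_sub_dyadic : (@measurable _ (Rn n) : set (set (Rn n))) `<=` <<sr dyadic_set>>.
Proof.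
have [sr0 srD srU] := smallest_sigma_ring dyadic_set.
have srT : <<sr dyadic_set>> setT by apply: sub_g_sigma_ring; exists 0%N.
apply: smallest_sub => [|U oU]; first by split => // A; exact: srD.
pose F j := if @pickle_inv (nat * 'rV[int]_n)%type j is Some p then
    (if `[< dcube p.1 p.2 `<=` U >] then dcube p.1 p.2 else set0) else set0.
suff -> : U = \bigcup_j F j.
  apply: srU => j; rewrite /F; case: pickle_inv => // -[l k] /=; case: asboolP => // _.
  by apply: sub_g_sigma_ring; exists l => x y xy /dcubeP xk; apply/dcubeP; rewrite -xy.
apply/seteqP; split => [x Ux|x [j _]].
  have [l lU] := open_dcube oU Ux.
  by exists (pickle (l, dcorner l x)) => //; rewrite /F pickleK_inv /= asboolT//; exact/dcubeP.
by rewrite /F; case: pickle_inv => // -[l k] /=; case: asboolP => // kU /kU.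
Qed.

(** Monotone class argument: for finite measures the inequality is preserved by monotone limits of
    sets, and it holds on the ring of dyadic sets by additivity over cubes of a fine level. *)
Lemma dyadic_le_measure (a b : {measure set (Rn n) -> \bar R}) l0 :
  (a setT < +oo)%E -> (b setT < +oo)%E ->
  (forall l k, (l0 <= l)%N -> (b (dcube l k) <= a (dcube l k))%E) ->
  forall A, measurable A -> (b A <= a A)%E.
Proof.
move=> aT bT ba A mA; pose G := [set A : set (Rn n) | measurable A /\ (b A <= a A)%E].
suff : G A by case.
have fin (c : {measure set (Rn n) -> \bar R}) B : (c setT < +oo)%E -> measurable B -> (c B < +oo)%E.
  by move=> cT mB; apply: le_lt_trans cT; apply: le_measure; rewrite ?inE.
apply: (@monotone_setring_sub_g_sigma_ring _ G dyadic_set) => //; last exact: borel_sub_dyadic.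
- split=> F mF HF.
    have mU : measurable (\bigcup_i F i) by apply: bigcupT_measurable => i; case: (HF i).
    split => //; have mFi i : measurable (F i) by case: (HF i).
    have ca := nondecreasing_cvg_mu (mu := a) mFi mU mF.
    have cb := nondecreasing_cvg_mu (mu := b) mFi mU mF.
    rewrite -(cvg_lim _ ca)// -(cvg_lim _ cb)//; apply: lee_lim.
    + by apply/cvg_ex; eexists; exact: cb.
    + by apply/cvg_ex; eexists; exact: ca.
    + by near=> i; case: (HF i).
  have mU : measurable (\bigcap_i F i) by apply: bigcapT_measurable => i; case: (HF i).
  split => //; have mFi i : measurable (F i) by case: (HF i).
  have ca := nonincreasing_cvg_mu (mu := a) (fin a _ aT (mFi 0%N)) mFi mU mF.
  have cb := nonincreasing_cvg_mu (mu := b) (fin b _ bT (mFi 0%N)) mFi mU mF.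
  rewrite -(cvg_lim _ ca)// -(cvg_lim _ cb)//; apply: lee_lim.
  + by apply/cvg_ex; eexists; exact: cb.
  + by apply/cvg_ex; eexists; exact: ca.
  + by near=> i; case: (HF i).
- exact: dyadic_setring.
- move=> B [l Bl]; have Bl' : forall x y, dcorner (maxn l0 l) x = dcorner (maxn l0 l) y -> B x -> B y.
    by move=> x y xy; apply: Bl; apply: dcorner_le xy; exact: leq_maxr.
  have E := dyadic_setE Bl'.
  split.
    rewrite E bigcup_mkcond; apply: countable_bigcupT_measurable; first exact: countableP.
    by move=> k; case: ifP => // _; exact: measurable_cube.
  rewrite E; apply: le_measure_bigcup; first by move=> k; exact: measurable_cube.
    exact: dcube_disjoint.
  by move=> k _; apply: ba; exact: leq_maxl.
Unshelve. all: by end_near. Qed.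

Section Compare2.
Variables (O : set (Rn n)) (a b : {measure set (Rn n) -> \bar R}).
Hypothesis mO : measurable O.
Hypothesis Onear : forall x, O x -> \forall y \near x, @half_space R n y -> O y.
Hypothesis Ohalf : O `<=` @half_space R n.
Hypothesis a_fin : forall u s, 0 < s -> ccube u s `<=` O -> (a (cube u s) < +oo)%E.
Hypothesis local : forall x e, O x -> 0 < e -> exists2 r, 0 < r &
  forall u s, 0 < s < r -> ccube u s x -> ccube u s `<=` O ->
    (b (cube u s) <= (1 + e)%:E * a (cube u s))%E.

Let good l (k : 'rV[int]_n) := ccube (\row_i ((k 0 i)%:~R / 2 ^+ l)) (2 ^+ l)^-1 `<=` O.

Lemma ccube_sub u s u' s' : 0 < s -> cube u s `<=` cube u' s' -> ccube u s `<=` ccube u' s'.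
Proof.
move=> s0 sub x ux i.
have [h1 _] : u' 0 i <= u 0 i /\ True.
  by split => //; have /(_ i) /andP[] : cube u' s' u by apply: sub => j; rewrite lexx ltrDl.
have h2 : u 0 i + s <= u' 0 i + s'.
  apply/ler_addgt0Pr => e e0; pose d := Num.min (e / 2) (s / 2).
  have d0 : 0 < d by rewrite lt_min !divr_gt0.
  have [d1 d2] : d <= e / 2 /\ d <= s / 2 by rewrite !ge_min !lexx orbT.
  have /(_ i) : cube u' s' (\row_j (u 0 j + (s - d))).
    by apply: sub => j; rewrite mxE; apply/andP; split; lra.
  by rewrite mxE => /andP[]; lra.
have /andP[h3 h4] := ux i; apply/andP; split; lra.
Qed.

(** Restricting both measures to the cube makes them finite. A finer dyadic cube is either disjoint
    from it or contained in it, and then [compare_cube] applies. *)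
Lemma compare_good l k A : good l k -> measurable A -> (b (A `&` dcube l k) <= a (A `&` dcube l k))%E.
Proof.
move=> gk mA; set q := dcube l k; have mq : measurable q := @measurable_cube _ _.
have i0 : 0 < (2 ^+ l)^-1 :> R by rewrite invr_gt0.
have aq : (a q < +oo)%E by exact: a_fin.
have bq : (b q < +oo)%E by apply: le_lt_trans aq; apply: (compare_cube a_fin local).
pose a' := mrestr a mq; pose b' := mrestr b mq.
apply: (@dyadic_le_measure a' b' l) => //.
- by change (a (setT `&` q) < +oo)%E; rewrite setTI.
- by change (b (setT `&` q) < +oo)%E; rewrite setTI.
move=> m k' lm; change (b (dcube m k' `&` q) <= a (dcube m k' `&` q))%E; have [[x [xk' xq]]|N] := pselect (exists x, (dcube m k' `&` q) x); last first.
  by rewrite (_ : _ `&` _ = set0) ?measure0//; apply/seteqP; split => // x xx; apply: N; exists x.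
have sub : dcube m k' `<=` q.
  move=> y /dcubeP yk'; apply/dcubeP; move/dcubeP : xq => <-.
  by apply: (dcorner_le lm); rewrite yk'; apply/esym/dcubeP.
rewrite (setIidl sub); apply: (compare_cube a_fin local); first by rewrite invr_gt0.
by apply: subset_trans gk; apply: ccube_sub => //; rewrite invr_gt0.
Qed.

(** The dyadic grid is aligned with the hyperplane x_0 = 0: the lower corner of the cube of a point
    of the half-space is again in the half-space, so a small dyadic cube does not leave it. *)
Lemma good_exists x : O x -> exists l, good l (dcorner l x).
Proof.
move=> Ox; have /nbhs_ballP[r /= r0 xr] := Onear Ox.
have [l lr] := dcube_small x r0.
exists l => y xy; apply: xr.
  by apply/rV_ballE => // i; apply: le_lt_trans (dcube_near xy i) lr.
move=> i i0; have := xy i; rewrite !mxE => /andP[+ _]; apply: le_trans.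
apply: divr_ge0; last exact: ltW.
rewrite ler0z floor_ge0; apply: mulr_ge0; first exact: ltW.
exact: (Ohalf Ox i0).
Qed.

(** The good dyadic cubes are countably many and cover O; made disjoint, they cut A into pieces to
    which [compare_good] applies. *)
Lemma compare_measure A : measurable A -> A `<=` O -> (b A <= a A)%E.
Proof.
move=> mA AO.
pose F j := if @pickle_inv (nat * 'rV[int]_n)%type j is Some p then
    (if `[< good p.1 p.2 >] then dcube p.1 p.2 else set0) else set0.
have mF j : measurable (F j).
  by rewrite /F; case: pickle_inv => // p; case: ifP => // _; exact: measurable_cube.
have AE : A = \bigcup_j (A `&` seqDU F j).
  rewrite -setI_bigcupr -seqDU_bigcup_eq; apply/esym/setIidl => x /AO Ox.
  have [l gl] := good_exists Ox.
  by exists (pickle (l, dcorner l x)) => //; rewrite /F pickleK_inv /= asboolT//; exact/dcubeP.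
rewrite AE; apply: (@le_measure_bigcup _ _ nat) => [j||j _].
- by apply: measurableI => //; exact: seqDU_measurable.
- by apply: trivIset_setIl; exact: trivIset_seqDU.
have sub : seqDU F j `<=` F j by exact: subset_seqDU.
have : forall x, seqDU F j x -> F j x := sub.
rewrite {2}/F; case E : pickle_inv => [[l k]|]; last first.
  by move=> N; rewrite (_ : A `&` _ = set0) ?measure0//; apply/seteqP; split => // x [_ /N].
case: asboolP => /= g; last first.
  by move=> N; rewrite (_ : A `&` _ = set0) ?measure0//; apply/seteqP; split => // x [_ /N].
move=> sub'; rewrite (_ : A `&` _ = (A `&` seqDU F j) `&` dcube l k).
  by apply: compare_good => //; apply: measurableI => //; exact: seqDU_measurable.
by apply/esym/setIidl => x [_ /sub'].
Qed.

End Compare2.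
End Cubes.

(** * The volume measure *)

Section PosDef.
Variable R : realType.

Definition posdef n (A : 'M[R]_n) := forall v : 'rV[R]_n, v != 0 -> 0 < (v *m A *m v^T) 0 0.

Lemma dot_gt0 n (v : 'rV[R]_n) : v != 0 -> 0 < (v *m v^T) 0 0.
Proof.
move=> v0; rewrite mxE.
have H i : v 0 i * v^T i 0 = v 0 i ^+ 2 by rewrite mxE expr2.
under eq_bigr do rewrite H.
rewrite lt_def sumr_ge0 => [|i _]; last by rewrite sqr_ge0.
rewrite andbT; apply: contra v0 => /eqP E; apply/eqP/rowP => i; rewrite [RHS]mxE.
have := E => /eqP; rewrite psumr_eq0 => [|j _]; last by rewrite sqr_ge0.
by move=> /allP/(_ i (mem_index_enum i)) /=; rewrite sqrf_eq0 => /eqP.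
Qed.

(** The matrices on the segment from 1 to A are positive definite, hence invertible. Their
    determinant is a polynomial in the parameter with value 1 at the start, so the intermediate
    value theorem excludes a value at most 0 at the end. *)
Lemma det_posdef n (A : 'M[R]_n) : posdef A -> 0 < \det A.
Proof.
move=> pA.
pose B : 'M[{poly R}]_n := map_mx polyC (1%:M : 'M[R]_n) + 'X *: map_mx polyC (A - 1%:M).
have BE t : (\det B).[t] = \det (1%:M + t *: (A - 1%:M)).
  rewrite -[LHS]/(horner_eval t (\det B)) -det_map_mx; congr (\det _); apply/matrixP => i j.
  by rewrite mxE /B !mxE /= /horner_eval !hornerE.
have pos (t : R) : 0 <= t <= 1 -> \det (1%:M + t *: (A - 1%:M)) != 0.
  move=> /andP[t0 t1]; apply/det0P => -[v v0 vB].
  have : (v *m (1%:M + t *: (A - 1%:M)) *m v^T) 0 0 = 0 by rewrite vB mul0mx mxE.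
  rewrite mulmxDr mulmx1 mulmxDl -scalemxAr -scalemxAl mulmxBr mulmx1 mulmxBl.
  have := dot_gt0 v0; have := pA _ v0.
  by move: (v *m v^T) (v *m A *m v^T) => c d d0 c0; rewrite !mxE; nra.
rewrite ltNge; apply/negP => dA.
have [||t tI] := @poly_ivt R (- \det B) 0 1 => //.
  rewrite !hornerN !BE scale0r addr0 scale1r addrC subrK det1 oppr_ge0.
  by rewrite lerN10.
move=> /rootP; rewrite hornerN BE => /eqP; rewrite oppr_eq0.
by apply/negP/pos.
Qed.

End PosDef.

Lemma lebn_indic (R : realType) n (A : set (borel 'rV[R]_n)) : measurable A ->
  (\int[lebn R n]_x (\1_A x)%:E = lebn R n A)%E.
Proof. by move=> mA; rewrite (integral_indic (lebn R n) measurableT mA) setIT. Qed.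

Section ChartVolume.
Variables (R : realType) (n : nat) (M : manifold R n) (g : metric M).
Local Notation Rn := (borel 'rV[R]_n).
Local Notation H := (@half_space R n).
Implicit Types (c a b : chart R n M).

Definition cdens c (x : 'rV[R]_n) : R := Num.sqrt (\det (gram g c (chart_inv c x))).

Lemma cdens_gt0 c x : atlas c -> chart_img c x -> 0 < cdens c x.
Proof.
move=> Ac cx; rewrite /cdens sqrtr_gt0; apply: det_posdef.
exact: gram_posdef Ac _ (chart_invP cx).
Qed.

Lemma within_continuousD (T : topologicalType) (A : set T) (f h : T -> R) :
  {within A, continuous f} -> {within A, continuous h} ->
  {within A, continuous (fun x => f x + h x)}.
Proof. by move=> cf ch x; exact: (cvgD (cf x) (ch x)). Qed.

Lemma within_continuousM (T : topologicalType) (A : set T) (f h : T -> R) :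
  {within A, continuous f} -> {within A, continuous h} ->
  {within A, continuous (fun x => f x * h x)}.
Proof. by move=> cf ch x; exact: (cvgM (cf x) (ch x)). Qed.

Lemma within_continuous_cst (T : topologicalType) (A : set T) (k : R) :
  {within A, continuous (fun=> k)}.
Proof. by apply: continuous_subspaceT => x; exact: cvg_cst. Qed.

Lemma within_continuous_sum (T : topologicalType) (A : set T) (I : Type) (r : seq I)
    (f : I -> T -> R) : (forall i, {within A, continuous (f i)}) ->
  {within A, continuous (fun x => \sum_(i <- r) f i x)}.
Proof.
move=> cf; elim: r => [|i r IH].
  by under [X in continuous X]eq_fun do rewrite big_nil; exact: within_continuous_cst.
by under [X in continuous X]eq_fun do rewrite big_cons; exact: within_continuousD.
Qed.

Lemma within_continuous_prod (T : topologicalType) (A : set T) (I : Type) (r : seq I)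
    (f : I -> T -> R) : (forall i, {within A, continuous (f i)}) ->
  {within A, continuous (fun x => \prod_(i <- r) f i x)}.
Proof.
move=> cf; elim: r => [|i r IH].
  by under [X in continuous X]eq_fun do rewrite big_nil; exact: within_continuous_cst.
by under [X in continuous X]eq_fun do rewrite big_cons; exact: within_continuousM.
Qed.

Lemma within_continuous_det (T : topologicalType) (A : set T) m (f : T -> 'M[R]_m) :
  (forall i j, {within A, continuous (fun x => f x i j)}) ->
  {within A, continuous (fun x => \det (f x))}.
Proof.
move=> cf; apply: within_continuous_sum => s.
by apply: within_continuousM; [exact: within_continuous_cst|exact: within_continuous_prod].
Qed.

Lemma cdens_continuous c : atlas c -> {within chart_img c, continuous (cdens c)}.
Proof.
move=> Ac; have cd : {within chart_img c, continuous (fun x => \det (gram g c (chart_inv c x)))}.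
  apply: within_continuous_det => i j; apply: smooth_on_continuous.
  exact: gram_smooth Ac i j.
by move=> x; exact: (continuous_comp (cd x) (@sqrt_continuous _ _)).
Qed.

Lemma chart_img_measurable c : measurable (chart_img c : set Rn).
Proof.
have [W oW ->] := chart_img_rel_open c.
by apply: measurableI; [exact: borel_open|apply: borel_closed; exact: half_space_closed].
Qed.

Lemma chart_dom_measurable c : measurable (chart_dom c : set (borel M)).
Proof. by apply: borel_open; exact: chart_dom_open. Qed.

(** Total versions of the density and of the chart maps, with value 0 or the base point outside the
    natural domain: they are Borel measurable on the whole space. *)
Definition cdens0 c : Rn -> R := cdens c \_ (chart_img c).
Definition cinv c : Rn -> borel M := (chart_inv c : Rn -> borel M) \_ (chart_img c).
Definition cmap c : borel M -> Rn := (chart_map c : borel M -> Rn) \_ (chart_dom c).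

Lemma cdens0E c x : chart_img c x -> cdens0 c x = cdens c x.
Proof. by move=> cx; rewrite /cdens0 patchE mem_set. Qed.
Lemma cdens0N c x : ~ chart_img c x -> cdens0 c x = 0.
Proof. by move=> cx; rewrite /cdens0 patchE memNset. Qed.
Lemma cinvE c x : chart_img c x -> cinv c x = chart_inv c x.
Proof. by move=> cx; rewrite /cinv patchE mem_set. Qed.
Lemma cmapE c p : chart_dom c p -> cmap c p = chart_map c p.
Proof. by move=> cx; rewrite /cmap patchE mem_set. Qed.

Lemma cdens0_ge0 c x : 0 <= cdens0 c x.
Proof. by rewrite /cdens0 patchE; case: ifP => // _; exact: sqrtr_ge0. Qed.

Lemma measurable_cdens0 c : atlas c -> measurable_fun setT (cdens0 c).
Proof.
move=> Ac; apply/(measurable_restrictT _ (chart_img_measurable c)).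
by apply: within_continuous_measurable; [exact: chart_img_measurable|exact: cdens_continuous].
Qed.

Lemma measurable_cinv c : measurable_fun setT (cinv c).
Proof.
apply/(measurable_restrictT _ (chart_img_measurable c)).
by apply: within_continuous_borel; [exact: chart_img_measurable|exact: chart_inv_continuous].
Qed.

Lemma measurable_cmap c : measurable_fun setT (cmap c).
Proof.
apply/(measurable_restrictT _ (chart_dom_measurable c)).
by apply: within_continuous_borel; [exact: chart_dom_measurable|exact: chart_map_continuous].
Qed.

(** The volume seen by one chart: a measure on all of M that vanishes off the domain of the chart,
    because [cdens0] vanishes off its image. *)
Definition chart_volume c (V : {measure set (borel M) -> \bar R}) :=
  (forall B, measurable B -> V B = (\int[lebn R n]_x (cdens0 c x * \1_B (cinv c x))%:E)%E) /\
  forall f : borel M -> \bar R, measurable_fun setT f -> (forall p, 0 <= f p)%E ->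
    (\int[V]_p f p = \int[lebn R n]_x ((cdens0 c x)%:E * f (cinv c x)))%E.

Lemma chart_volume_exists c : atlas c -> exists V, chart_volume c V.
Proof.
move=> Ac; exact: density_pushforward (measurable_cdens0 Ac) (cdens0_ge0 c) (measurable_cinv c).
Qed.

Lemma chart_volumeE c (B : set (borel M)) : atlas c -> measurable B -> B `<=` chart_dom c ->
  lebesgue_integral_n (fun x => (\1_(chart_map c @` B) x * cdens c x)%:E) =
  (\int[lebn R n]_x (cdens0 c x * \1_B (cinv c x))%:E)%E.
Proof.
move=> Ac mB Bc; rewrite -lebesgue_integral_nE; last 2 first.
- apply/measurable_EFinP; apply: measurable_funM; first exact: measurable_cdens0.
  by apply: measurableT_comp (measurable_cinv c); exact: measurable_indic.
- by move=> x; rewrite lee_fin mulr_ge0// cdens0_ge0.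
congr (lebesgue_integral_n _); apply/funext => x; congr (_%:E).
rewrite !indicE; have [cx|cx] := pselect (chart_img c x); last first.
  rewrite cdens0N// mul0r memNset ?mul0r// => -[p Bp px]; apply: cx; exists p => //; exact: Bc.
rewrite cdens0E// cinvE// mulrC; congr (_ * _); congr ((_ : bool)%:R).
apply/idP/idP => /set_mem; rewrite ?inE => h.
  by case: h => p Bp <-; rewrite chart_mapK//; exact: Bc.
by exists (chart_inv c x) => //; rewrite chart_invK.
Qed.

End ChartVolume.

(** * Change of variables: the volume does not depend on the chart *)

Section ChartCompare.
Variables (R : realType) (n : nat) (M : manifold R n) (g : metric M).
Local Notation Rn := (borel 'rV[R]_n).
Local Notation H := (@half_space R n).
Variables (a b : chart R n M) (Va Vb : {measure set (borel M) -> \bar R}).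
Hypotheses (Aa : atlas a) (Ab : atlas b).
Hypotheses (HVa : chart_volume g a Va) (HVb : chart_volume g b Vb).
Let O : set Rn := overlap a b.
Let D : set (borel M) := chart_dom a `&` chart_dom b.

Let mD : measurable D.
Proof. by apply: measurableI; exact: chart_dom_measurable. Qed.

Let mO : measurable O.
Proof.
rewrite /O; have [V oV ->] := overlap_rel_open a b.
by apply: measurableI; [exact: borel_open|apply: borel_closed; exact: half_space_closed].
Qed.

(** A measure on M, restricted to the common domain and read on R^n through the chart [a]. Both
    chart volumes are compared there. *)
Let read (V : {measure set (borel M) -> \bar R}) : {measure set Rn -> \bar R} :=
  measure_function_pushforward__canonical__measure_function_Measure
    (measure_function_mrestr__canonical__measure_function_Measure V mD) (measurable_cmap a).

Let readE V A : read V A = V (cmap a @^-1` A `&` D).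
Proof. by []. Qed.

Let O_img : O `<=` chart_img a.
Proof. by move=> x [p [ap _] <-]; exact: chart_imgP. Qed.

Let O_inv x : O x -> D (chart_inv a x).
Proof. by move=> [p [ap bp] <-]; rewrite chart_mapK. Qed.

Let readVa A : measurable A -> A `<=` O ->
  read Va A = (\int[lebn R n]_x (\1_A x * cdens g a x)%:E)%E.
Proof.
move=> mA AO; rewrite readE HVa.1; last first.
  by apply: measurableI => //; rewrite -[X in measurable X]setTI; exact: measurable_cmap.
apply: eq_integral => x _; congr (_%:E); rewrite !indicE.
have [ax|ax] := pselect (chart_img a x); last first.
  by rewrite cdens0N// mul0r memNset ?mul0r// => /AO/O_img.
rewrite cdens0E// cinvE// mulrC; congr ((_ : bool)%:R * _); apply/idP/idP => /set_mem; rewrite ?inE.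
  by move=> [/=]; rewrite cmapE ?chart_invK//; exact: chart_invP.
move=> Ax; split; first by rewrite /= cmapE ?chart_invK//; exact: chart_invP.
by apply: O_inv; exact: AO.
Qed.

Let ccube_bounded (u : 'rV[R]_n) s : ccube u s `<=` O ->
  exists K : R, forall x, ccube u s x -> cdens g a x <= K.
Proof.
move=> uO; have cK : compact (ccube u s).
  have -> : ccube u s = [set v : 'rV[R]_n | forall i, `[u 0 i, u 0 i + s]%classic (v ord0 i)].
    by apply/seteqP; split => x ux i; have := ux i; rewrite /= in_itv.
  by apply: (@rV_compact R n (fun i => `[u 0 i, u 0 i + s]%classic)) => i; exact: segment_compact.
have cim : compact (cdens g a @` ccube u s).
  apply: continuous_compact cK; apply: continuous_subspaceW (cdens_continuous Aa).
  by move=> x /uO/O_img.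
have [K [_ HK]] := compact_bounded cim.
exists (K + 1) => x ux; have := HK (K + 1); rewrite ltrDl => /(_ ltr01 (cdens g a x)) h.
by apply: le_trans (ler_norm _) (h _); exists x.
Qed.

Let read_fin (u : 'rV[R]_n) s : 0 < s -> ccube u s `<=` O -> (read Va (cube u s) < +oo)%E.
Proof.
move=> s0 uO; have [K HK] := ccube_bounded uO.
have [mq lq] := lebn_cubeE u (ltW s0).
rewrite readVa//; last exact: subset_trans (@cube_ccube _ _ _ _) uO.
have K0 : 0 <= K.
  have [x ux] : ccube u s !=set0 by exists u => i; rewrite lexx lerDl ltW.
  by apply: le_trans (HK x ux); exact: sqrtr_ge0.
apply: (@le_lt_trans _ _ (\int[lebn R n]_x (K%:E * (\1_(cube u s) x)%:E))%E).
  apply: ge0_le_integral => //.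
  - by move=> x _; rewrite lee_fin mulr_ge0// sqrtr_ge0.
  - rewrite (_ : (fun x => _) = (fun x => (\1_(cube u s) x * cdens0 g a x)%:E)).
      apply/measurable_EFinP; apply: measurable_funM; first exact: measurable_indic.
      exact: measurable_cdens0.
    apply/funext => x; rewrite indicE; case: (boolP (x \in _)); rewrite ?mul0r// => /set_mem/cube_ccube/uO/O_img ax.
    by rewrite cdens0E.
  - by apply: emeasurable_funM => //; apply/measurable_EFinP; exact: measurable_indic.
  - move=> x _; rewrite -EFinM lee_fin indicE; case: (boolP (x \in _)); rewrite ?mul0r ?mulr0//.
    by move=> /set_mem/cube_ccube/HK; rewrite mul1r mulr1.
rewrite ge0_integralZl//; last by apply/measurable_EFinP; exact: measurable_indic.
by rewrite lebn_indic// lq -EFinM ltry.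
Qed.

Let cdens_near c x0 e : atlas c -> chart_img c x0 -> 0 < e ->
  \forall x \near x0, chart_img c x -> `|cdens g c x - cdens g c x0| <= e.
Proof.
move=> Ac cx0 e0; have /subspace_continuousP/(_ _ cx0) h  := @cdens_continuous _ _ _ g c Ac.
have h' : cdens g c x @[x --> within (chart_img c) (nbhs x0)] --> cdens g c x0 := h.
have /cvgrPdist_le/(_ e e0) := h'; rewrite near_withinE; apply: filterS => x + cx => /(_ cx).
by rewrite distrC.
Qed.

Let poly_small (F : {poly R}) : 0 < F.[0] -> exists2 eta, 0 < eta & 0 < F.[eta].
Proof.
move=> F0; have cF : F.[t] @[t --> (0 : R)] --> F.[0] := @continuous_horner R F 0.
have : \forall t \near (0 : R), 0 < F.[t] by apply: (cF [set t | 0 < t]); exact: lt_nbhsr.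
move=> /nbhs_ballP[r /= r0 Hr]; exists (r / 2); first by rewrite divr_gt0.
apply: Hr; rewrite /ball /= sub0r normrN ger0_norm ?ltr_pdivrMr//; lra.
Qed.

(** Near x the transition is close to its linear part J, so the image of a small cube lies in the
    image under J of a slightly larger box. Its measure is |det J| times that of the box, and the
    law of transformation of the Gram matrices says that the densities differ by the same factor
    |det J|. *)
Let local x e : O x -> 0 < e -> exists2 r, 0 < r &
  forall u s, 0 < s < r -> ccube u s x -> ccube u s `<=` O ->
    (read Vb (cube u s) <= (1 + e)%:E * read Va (cube u s))%E.
Proof.
move=> [p [ap bp] px] e0.
have [W [G [oW Wp HG extG Gp]]] := transition_ext Aa Ab ap bp.
pose J := \matrix_(i < n, j < n) 'D_(delta_mx 0 i) (fun z => G z 0 j) (chart_map a p).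
have extG' y : W y -> overlap a b y -> G y = transition a b y.
  by move=> Wy oy; have [q [aq bq] qy] := oy; have [] := extG y Wy; first by rewrite -qy; exact: chart_imgP.
have uJ : J \in unitmx.
  rewrite unitmxE unitfE; apply/det0P => -[v v0 vJ].
  have : v = 0 by apply: (jacobian_inj Aa Ab ap bp oW Wp (fun j => HG j 1%N) extG' vJ).
  by move/eqP; rewrite (negbTE v0).
rewrite px in Wp Gp J uJ.
have ax : chart_img a x by rewrite -px; exact: chart_imgP.
set y0 := chart_map b p in Gp; have by0 : chart_img b y0 by exact: chart_imgP.
pose da := cdens g a x; pose db := cdens g b y0; pose jd := `|\det J|.
have dab : da = jd * db.
  rewrite /da /db /cdens -px !chart_mapK//.
  have := gram_transition g Aa Ab ap bp oW _ HG extG'; rewrite px => /(_ Wp) /= ->.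
  rewrite -/J !det_mulmx det_tr mulrAC -expr2 sqrtrM ?sqr_ge0// sqrtr_sqr//.
have da0 : 0 < da by exact: cdens_gt0.
have db0 : 0 < db by exact: cdens_gt0.
have jd0 : 0 < jd by rewrite normr_gt0 -unitfE -unitmxE.
(* K bounds J^-1 for the maximum norm; summing all entries is crude but sufficient. *)
pose T := invmx J; pose K : R := \sum_i \sum_j `|T j i|.
have K0 : 0 <= K by apply: sumr_ge0 => i _; apply: sumr_ge0.
(* Positivity of F at eta is the final inequality divided by s^n, when the densities are known up to
   eta and the transition up to eta s. At 0 it reduces to e da > 0 since da = jd db, so a small eta
   > 0 works by continuity. *)
pose F : {poly R} := (1 + e)%:P * (da%:P - 'X) -
  (db%:P + 'X) * jd%:P * (1 + (2 * K)%:P * 'X) ^+ n.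
have FE t : F.[t] = (1 + e) * (da - t) - (db + t) * jd * (1 + 2 * K * t) ^+ n.
  by rewrite /F !(hornerE, horner_exp).
have [eta eta0] : exists2 eta, 0 < eta & 0 < F.[eta].
  apply: poly_small; rewrite FE subr0 addr0 mulr0 addr0 expr1n mulr1 dab.
  by rewrite [db * jd]mulrC mulrDl mul1r addrC addKr mulr_gt0// mulr_gt0.
rewrite FE subr_gt0 => small.
have da_eta : 0 < da - eta.
  have : 0 < (1 + e) * (da - eta).
    apply: le_lt_trans small; rewrite mulr_ge0// ?exprn_ge0//; last first.
      by rewrite ?(addr_ge0, mulr_ge0)// ltW.
    by rewrite ?(addr_ge0, mulr_ge0)// ltW.
  by rewrite pmulr_rgt0// addr_gt0.
have cG : {for x, continuous G}.
  by apply: rV_continuous => j; exact: (C_k_continuous (HG j 0%N)).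
have cG' : G z @[z --> x] --> y0 by rewrite -Gp; exact: cG.
have nA := cdens_near Aa ax eta0.
have nB : \forall z \near x, chart_img b (G z) -> `|cdens g b (G z) - db| <= eta.
  exact: (cG' _ (cdens_near Ab by0 eta0)).
have nW : \forall z \near x, W z by exact: open_nbhs_nbhs.
have nE : \forall z \near x, forall j,
    `|G z 0 j - G x 0 j - \sum_i (z - x) 0 i * J i j| <= eta * `|z - x|.
  have H1 j : \forall z \near x, `|G z 0 j - G x 0 j - \sum_i (z - x) 0 i * J i j| <= eta * `|z - x|.
    have := C1_expansion oW (HG j 1%N) Wp eta0.
    have sh : (z - x) @[z --> x] --> x - x := @addr_continuous _ _ (- x) x.
    rewrite subrr in sh.
    move=> /sh; rewrite /= => h; have : \forall z \near x, `|G (x + (z - x)) 0 j - G x 0 j -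
      \sum_i (z - x) 0 i * 'D_(delta_mx 0 i) (fun w => G w 0 j) x| <= eta * `|z - x| := h.
    apply: filterS => z; rewrite [x + _]addrC subrK.
    by rewrite (eq_bigr (fun i => (z - x) 0 i * J i j)) // => i _; congr (_ * _); rewrite mxE ?px.
  exact: (@filter_forall _ _ (fun (j : 'I_n) z => `|G z 0 j - G x 0 j - \sum_i (z - x) 0 i * J i j| <= eta * `|z - x|) (nbhs x) _ H1).
have nAll : \forall z \near x,
    ((chart_img a z -> `|cdens g a z - da| <= eta) /\ (chart_img b (G z) -> `|cdens g b (G z) - db| <= eta)) /\
    (W z /\ forall j, `|G z 0 j - G x 0 j - \sum_i (z - x) 0 i * J i j| <= eta * `|z - x|).
  by apply: filterI; apply: filterI.
move/nbhs_ballP : nAll => [r /= r0 Hr].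
exists r => // u s /andP[s0 sr] ux uO.
have inball z : cube u s z -> [/\ `|z - x| <= s, chart_img a z -> `|cdens g a z - da| <= eta,
    chart_img b (G z) -> `|cdens g b (G z) - db| <= eta, W z &
    forall j, `|G z 0 j - G x 0 j - \sum_i (z - x) 0 i * J i j| <= eta * `|z - x|].
  move=> uz; have zx i : `|z 0 i - x 0 i| <= s.
    have /andP[h1 /ltW h2] := uz i; have /andP[h3 h4] := ux i.
    by rewrite ler_norml; apply/andP; split; lra.
  have bz : ball x r z by apply/rV_ballE => // i; rewrite distrC; exact: le_lt_trans (zx i) sr.
  have [[h1 h2] [h3 h4]] := Hr z bz; split => //.
  by apply: rV_norm_le; [exact: ltW|move=> i; rewrite !mxE].
have [mq lq] := lebn_cubeE u (ltW s0).
(* After applying J^-1, the image of the cube is the cube itself, translated, up to an error K eta s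
   in each coordinate: [lo] and [hi] delimit the box that allows for it. *)
pose w := y0 *m T; pose lo i := w 0 i + u 0 i - x 0 i - K * eta * s.
pose hi i := w 0 i + u 0 i - x 0 i + s + K * eta * s.
have lohi i : hi i - lo i = s * (1 + 2 * K * eta) by rewrite /hi /lo; ring.
have kes : 0 <= K * eta * s by rewrite !mulr_ge0// ltW.
have [mB lB] : measurable [set z : Rn | forall i, `[lo i, hi i]%classic (z 0 i)] /\
    lebn R n [set z : Rn | forall i, `[lo i, hi i]%classic (z 0 i)] = ((s * (1 + 2 * K * eta)) ^+ n)%:E.
  have [||h1 h2] := @lebn_box R n (fun i => `[lo i, hi i]%classic) (fun=> s * (1 + 2 * K * eta)).
  - by move=> i; exact: measurable_itv.
  - move=> i; rewrite lebesgue_measure_itv /= lte_fin -(lohi i) -subr_gt0 lohi.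
    rewrite mulr_gt0//; first by rewrite -EFinB lohi.
    by rewrite ltr_pwDl// !mulr_ge0// ltW.
  by split => //; rewrite h2 prodr_const card_ord.
set B := [set z : Rn | _] in mB lB.
pose E : set Rn := (fun y => y *m T) @^-1` B.
have mE : measurable E by rewrite /E -[X in measurable X]setTI; exact: measurable_mulmx.
have lE : lebn R n E = (jd * (s * (1 + 2 * K * eta)) ^+ n)%:E.
  rewrite -lebn_indic// (integral_linear uJ)//; last first.
    by apply/measurable_EFinP; exact: measurable_indic.
  rewrite EFinM -lB -lebn_indic//; congr (_ * _)%E.
  apply: eq_integral => z _; rewrite !indicE; congr ((_ : bool)%:R)%:E.
  by apply/idP/idP => /set_mem; rewrite inE /E /= -mulmxA mulmxV// mulmx1.
have lowA : ((da - eta)%:E * (s ^+ n)%:E <= read Va (cube u s))%E.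
  rewrite readVa//; last exact: subset_trans (@cube_ccube _ _ _ _) uO.
  rewrite -lq -lebn_indic// -ge0_integralZl//; last 2 first.
  - by apply/measurable_EFinP; exact: measurable_indic.
  - by rewrite lee_fin ltW.
  apply: ge0_le_integral => //.
  - by move=> z _; rewrite mule_ge0// lee_fin// ltW.
  - by apply: emeasurable_funM => //; apply/measurable_EFinP; exact: measurable_indic.
  - rewrite (_ : (fun x => _) = (fun x => (\1_(cube u s) x * cdens0 g a x)%:E)).
      apply/measurable_EFinP; apply: measurable_funM; first exact: measurable_indic.
      exact: measurable_cdens0.
    apply/funext => z; rewrite indicE; case: (boolP (z \in _)); rewrite ?mul0r// => /set_mem/cube_ccube/uO/O_img az.
    by rewrite cdens0E.
  - move=> z _; rewrite -EFinM lee_fin indicE; case: (boolP (z \in _)); rewrite ?mulr0 ?mul0r// => /set_mem uz.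
    rewrite mul1r mulr1; have [_ h _ _ _] := inball z uz.
    have := h (O_img (uO _ (cube_ccube uz))); rewrite ler_norml => /andP[]; rewrite /da; lra.
have upB : (read Vb (cube u s) <= (db + eta)%:E * (jd * (s * (1 + 2 * K * eta)) ^+ n)%:E)%E.
  have mS : measurable (cmap a @^-1` (cube u s) `&` D).
    by apply: measurableI => //; rewrite -[X in measurable X]setTI; exact: measurable_cmap.
  rewrite readE HVb.1// -lE -lebn_indic// -ge0_integralZl//; last 2 first.
  - by apply/measurable_EFinP; exact: measurable_indic.
  - by rewrite lee_fin addr_ge0 ?ltW.
  apply: ge0_le_integral => //.
  - by move=> z _; rewrite lee_fin mulr_ge0// cdens0_ge0.
  - apply/measurable_EFinP; apply: measurable_funM; first exact: measurable_cdens0.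
    by apply: measurableT_comp (measurable_cinv b); exact: measurable_indic.
  - by apply: emeasurable_funM => //; apply/measurable_EFinP; exact: measurable_indic.
  move=> y _; have rhs0 : (0 <= (db + eta)%:E * (\1_E y)%:E)%E.
    by rewrite mule_ge0// lee_fin addr_ge0 ?ltW.
  have [by'|nby] := pselect (chart_img b y); last by rewrite cdens0N// mul0r.
  rewrite cdens0E// cinvE// [in X in (X <= _)%E]indicE.
  case: (boolP (_ \in _)); rewrite ?mulr0// mulr1 => /set_mem[/= Qz [aq bq]].
  rewrite cmapE// in Qz; set z := chart_map a _ in Qz.
  have [zx _ hB Wz hE] := inball z Qz.
  have Gz : G z = y.
    by rewrite extG' ?/transition /= ?/z ?chart_mapK ?chart_invK//; exists (chart_inv b y).
  have Ey : E y.
    move=> i; rewrite /= in_itv /=.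
    pose rho := (y - y0) - (z - x) *m J.
    have rhoj j : `|rho 0 j| <= eta * s.
      have := hE j; rewrite Gz Gp => h; apply: le_trans (le_trans h _); last first.
        by rewrite ler_pM2l.
      by rewrite /rho; move: (z - x) => d; rewrite !mxE.
    have -> : (y *m T) 0 i = w 0 i + (z 0 i - x 0 i) + (rho *m T) 0 i.
      rewrite /rho mulmxBl -mulmxA mulmxV// mulmx1 mulmxBl -/w !mxE; ring.
    have rT : `|(rho *m T) 0 i| <= K * eta * s.
      rewrite mxE; apply: le_trans (ler_norm_sum _ _ _) _.
      apply: (@le_trans _ _ (\sum_j eta * s * `|T j i|)).
        by apply: ler_sum => j _; rewrite normrM ler_wpM2r.
      rewrite -mulr_sumr mulrC -mulrA; apply: ler_wpM2r; first by rewrite mulr_ge0// ltW.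
      by rewrite /K [leRHS](bigD1 i)//= lerDl sumr_ge0// => k _; exact: sumr_ge0.
    have /andP[h1 h2] := Qz i; move: rT; rewrite ler_norml => /andP[h3 h4].
    rewrite /lo /hi; apply/andP; split; lra.
  rewrite indicE mem_set// mule1 lee_fin -Gz.
  have := hB; rewrite Gz => /(_ by'); rewrite ler_norml => /andP[]; lra.
apply: (le_trans upB); apply: (@le_trans _ _ ((1 + e)%:E * ((da - eta)%:E * (s ^+ n)%:E))%E); last first.
  by apply: lee_wpmul2l => //; rewrite lee_fin addr_ge0// ltW.
rewrite -!EFinM lee_fin exprMn.
have -> : (db + eta) * (jd * (s ^+ n * (1 + 2 * K * eta) ^+ n)) =
  ((db + eta) * jd * (1 + 2 * K * eta) ^+ n) * s ^+ n by ring.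
by rewrite [leRHS]mulrA ler_pM2r ?exprn_gt0// ltW.
Qed.

Lemma chart_volume_le (S : set (borel M)) : measurable S ->
  S `<=` chart_dom a `&` chart_dom b -> (Vb S <= Va S)%E.
Proof.
move=> mS SD; pose A : set Rn := O `&` cinv a @^-1` S.
have mA : measurable A.
  by apply: measurableI => //; rewrite -[X in measurable X]setTI; exact: measurable_cinv.
have SE : cmap a @^-1` A `&` D = S.
  apply/seteqP; split => [q [[_ +] [aq bq]]|q Sq].
    by rewrite /= cmapE// cinvE ?chart_mapK//; exact: chart_imgP.
  have [aq bq] := SD q Sq; split => //; rewrite /A /= cmapE// cinvE ?chart_mapK//.
    by split => //; exists q.
  exact: chart_imgP.
have := @compare_measure _ _ O (read Va) (read Vb) _ _ read_fin local A mA.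
rewrite !readE SE; apply.
- move=> x Ox; have [V oV VE] := overlap_rel_open a b.
  have : nbhs x V.
    by apply: open_nbhs_nbhs; split => //; have : overlap a b x := Ox; rewrite VE => -[].
  by apply: filterS => y Vy Hy; change (overlap a b y); rewrite VE.
- by move=> x /O_img/chart_img_half.
- by move=> x [].
Qed.

End ChartCompare.

(** * Existence, uniqueness and chart formula of the volume *)

Section Volume.
Variables (R : realType) (n : nat) (M : manifold R n).
Hypothesis M_compact : compact [set: M].
Local Notation Rn := (borel 'rV[R]_n).
Implicit Types (c a b : chart R n M).

Lemma finite_cover (P : chart R n M -> set M -> Prop) :
  (forall p, exists c, exists U, [/\ P c U, open U & U p]) ->
  exists (N : nat) (f : 'I_N -> chart R n M) (U : 'I_N -> set M),
    (forall i, P (f i) (U i)) /\ forall p, exists i, U i p.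
Proof.
move=> H; pose c_ p := projT1 (cid (H p)); pose U_ p := projT1 (cid (projT2 (cid (H p)))).
have HU p : [/\ P (c_ p) (U_ p), open (U_ p) & U_ p p].
  by rewrite /U_ /c_; case: (cid (H p)) => c' /= h; case: cid.
have := M_compact; rewrite compact_cover => /(_ M setT U_)[|p _|D _ DU].
- by move=> p _; case: (HU p).
- by exists p => //; case: (HU p).
pose l := finmap.enum_fset D.
exists (size l), (fun i => c_ (nth point l i)), (fun i => U_ (nth point l i)); split.
  by move=> i; case: (HU (nth point l i)).
move=> p; have [//|q /= qD pq] := DU p.
have ql : (index q l < size l)%N by rewrite index_mem.
by exists (Ordinal ql); rewrite /= nth_index.
Qed.

Variable g : metric M.

Let cover : exists (N : nat) (f : 'I_N -> chart R n M),
  (forall i, atlas (f i)) /\ forall p, exists i, chart_dom (f i) p.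
Proof.
have [p|N [f [U [fU cU]]]] := @finite_cover (fun c U => atlas c /\ U = chart_dom c).
  have [c Ac cp] := atlas_cover p; exists c, (chart_dom c); split => //.
  exact: chart_dom_open.
exists N, f; split=> [i|p]; first by case: (fU i).
by have [i] := cU p; case: (fU i) => _ ->; exists i.
Qed.

Lemma chart_volume_eq a b Va Vb (S : set (borel M)) : atlas a -> atlas b ->
  chart_volume g a Va -> chart_volume g b Vb ->
  measurable S -> S `<=` chart_dom a `&` chart_dom b -> Va S = Vb S.
Proof.
move=> Aa Ab Ha Hb mS sS; apply/le_anti/andP; split.
  by apply: (chart_volume_le Ab Aa Hb Ha) => // p /sS[].
exact: (chart_volume_le Aa Ab Ha Hb).
Qed.

(** Successive differences of a finite cover by charts. Cutting along them reduces statements on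
    volumes to a single chart. *)
Let pieces : exists (N : nat) (f : nat -> chart R n M) (B : nat -> set (borel M)),
  [/\ forall i, (i < N)%N -> atlas (f i),
      forall i, measurable (B i),
      forall i, (i < N)%N -> B i `<=` chart_dom (f i),
      trivIset setT B & forall (S : set (borel M)), S = \bigcup_(i < N) (S `&` B i)].
Proof.
have [N [f [Af cf]]] := cover.
have [c0 Ac0 _] := atlas_cover (point : M).
pose f' i := if insub i is Some j then f j else c0.
have Af' i : atlas (f' i) by rewrite /f'; case: insub.
pose D i : set (borel M) := if (i < N)%N then chart_dom (f' i) else set0.
have mD i : measurable (D i).
  by rewrite /D; case: ifP => _; [exact: chart_dom_measurable|exact: measurable0].
exists N, f', (seqDU D); split => //.
- by move=> i; exact: seqDU_measurable.
- by move=> i iN p /(@subset_seqDU _ D); rewrite /D iN.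
- move=> S; apply/seteqP; split=> [p Sp|p [i _ []]//].
  have [i fip] := cf p.
  have : (\bigcup_k D k) p.
    by exists (val i) => //; rewrite /D ltn_ord /f' insubT//= => ?; rewrite (_ : Sub _ _ = i)//; exact: val_inj.
  rewrite seqDU_bigcup_eq => -[k _ Dk]; exists k => //.
  have /= := @subset_seqDU _ D _ _ Dk.
  by rewrite /D; case: ifP.
Qed.

Let sum_pieces (v : {measure set (borel M) -> \bar R}) N (B : nat -> set (borel M)) (S : set (borel M)) :
  (forall i, measurable (B i)) -> trivIset setT B -> measurable S ->
  (forall (S : set (borel M)), S = \bigcup_(i < N) (S `&` B i)) ->
  v S = (\sum_(i < N) v (S `&` B i))%E.
Proof.
move=> mB tB mS BE; rewrite {1}(BE S) bigcup_mkord.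
apply: (@measure_bigsetU _ _ _ v (fun i => S `&` B i)) => [i|].
  exact: measurableI.
exact: trivIset_setIl.
Qed.

(** Each piece is measured in its own chart and the results are added; [chart_volume_eq] makes the
    sum agree with any other chart. *)
Lemma is_volume_exists : exists v, is_volume g v.
Proof.
have [N [f [B [Af mB Bf tB BE]]]] := pieces.
pose V i := if pselect (atlas (f i)) is left Ai then projT1 (cid (chart_volume_exists g Ai)) else mzero.
have HV i : (i < N)%N -> chart_volume g (f i) (V i).
  by move=> /Af Ai; rewrite /V; case: pselect => // Ai'; case: cid.
pose m i := measure_function_mrestr__canonical__measure_function_Measure (V i) (mB i).
exists (measure_function_msum__canonical__measure_function_Measure m N) => c Ac S mS Sc.
rewrite chart_volumeE//; have [Vc HVc] := chart_volume_exists g Ac.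
rewrite -HVc.1// /= /msum (sum_pieces Vc mB tB mS BE).
apply: eq_bigr => i _; rewrite /m /= /mrestr.
apply: (chart_volume_eq (Af i (ltn_ord i)) Ac (HV i (ltn_ord i)) HVc).
  exact: measurableI.
by move=> p [Sp Bp]; split; [exact: Bf Bp|exact: Sc].
Qed.

Lemma volumeP : is_volume g (volume g).
Proof.
exact: (@xgetPex {classic {measure set (borel M) -> \bar R}} _ [set v | is_volume g v] is_volume_exists).
Qed.

(** The property [is_volume] fixes the measure of a set inside one chart, hence of every set, piece
    by piece. This identifies the volume of a stretched metric with a weighted volume. *)
Lemma volume_unique v (S : set (borel M)) : is_volume g v -> measurable S -> v S = volume g S.
Proof.
move=> Hv mS; have [N [f [B [Af mB Bf tB BE]]]] := pieces.
rewrite (sum_pieces v mB tB mS BE) (sum_pieces (volume g) mB tB mS BE).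
apply: eq_bigr => i _; have mSB : measurable (S `&` B i) by exact: measurableI.
have SBf : S `&` B i `<=` chart_dom (f i) by move=> p [_]; exact: Bf.
by rewrite (Hv _ (Af _ (ltn_ord i)) _ mSB SBf) (volumeP (Af _ (ltn_ord i)) mSB SBf).
Qed.

Lemma volume_chart_integral c (f : borel M -> \bar R) : atlas c ->
  measurable_fun setT f -> (forall p, 0 <= f p)%E ->
  (\int[volume g]_(p in chart_dom c) f p =
   \int[lebn R n]_x ((cdens0 g c x)%:E * f (cinv c x)))%E.
Proof.
move=> Ac mf f0; have [Vc HVc] := chart_volume_exists g Ac.
have mc := chart_dom_measurable c.
have -> : (\int[volume g]_(p in chart_dom c) f p = \int[Vc]_(p in chart_dom c) f p)%E.
  apply: eq_measure_integral => S mS Sc.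
  by rewrite (volumeP Ac mS Sc) (chart_volumeE _ Ac mS Sc) -HVc.1.
rewrite integral_mkcond HVc.2//.
- apply: eq_integral => x _; have [cx|cx] := pselect (chart_img c x); last first.
    by rewrite cdens0N// !mul0e.
  by rewrite patchE cinvE// mem_set//; exact: chart_invP.
- by apply/(measurable_restrictT _ mc); exact: measurable_funTS.
- by move=> p; rewrite patchE; case: ifP.
Qed.

Lemma volume_chart c (S : set (borel M)) : atlas c -> measurable S -> S `<=` chart_dom c ->
  volume g S = (\int[lebn R n]_x (cdens0 g c x * \1_S (cinv c x))%:E)%E.
Proof. by move=> Ac mS Sc; rewrite (volumeP Ac mS Sc) chart_volumeE. Qed.

End Volume.

(** * Integration by parts and uniqueness in the class of iterated integrals *)

Section DeriveZero.
Variables (R : realType) (n : nat).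
Local Notation Rn := (borel 'rV[R]_n).
Local Notation ee i := (delta_mx 0 i : 'rV[R]_n).

Lemma integral_shift_signed (v : 'rV[R]_n) (f : Rn -> \bar R) : measurable_fun setT f ->
  (\int[lebn R n]_x f (x + v)%R = \int[lebn R n]_x f x)%E.
Proof.
move=> mf; rewrite [LHS]integralE [RHS]integralE; congr (_ - _)%E.
  rewrite -(integral_shift v (measurable_funepos mf) (@funepos_ge0 _ _ _)).
  by apply: eq_integral => x _; rewrite !funeposE.
rewrite -(integral_shift v (measurable_funeneg mf) (@funeneg_ge0 _ _ _)).
by apply: eq_integral => x _; rewrite !funenegE.
Qed.

Lemma continuous_bounded_support (f : 'rV[R]_n -> R) (r : R) : continuous f ->
  (forall (x : 'rV[R]_n) j, r < `|x 0 j| -> f x = 0) -> bounded_support (f : Rn -> R).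
Proof.
move=> cf fr; split; first exact: continuous_measurable.
have cC : compact [set x : 'rV[R]_n | forall j, `[- r, r]%classic (x ord0 j)].
  by apply: (@rV_compact R n (fun=> `[- r, r]%classic)) => j; exact: segment_compact.
have cim : compact (f @` [set x : 'rV[R]_n | forall j, `[- r, r]%classic (x ord0 j)]).
  by apply: continuous_compact cC; exact: continuous_subspaceT.
have [K [_ HK]] := compact_bounded cim.
exists r, (Num.max 0 (K + 1)); split => // x; rewrite le_max; apply/orP.
have [[j xj]|N] := pselect (exists j, r < `|x 0 j|).
  by left; rewrite (fr _ _ xj) normr0.
right; have := HK (K + 1); rewrite ltrDl => /(_ ltr01 (f x)); apply.
exists x => // j; rewrite /= in_itv /= -ler_norml leNgt; apply/negP => xj; apply: N.
by exists j.
Qed.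

Section Zero.
Variables (h : 'rV[R]_n -> R) (r : R) (i : 'I_n).
Hypotheses (h1 : C_k 1 setT h) (r0 : 0 < r).
Hypothesis hr : forall (x : 'rV[R]_n) j, r < `|x 0 j| -> h x = 0.

Let dh x := 'D_(ee i) h x.

Let dh0 (x : 'rV[R]_n) j : r < `|x 0 j| -> dh x = 0.
Proof.
move=> xj; rewrite /dh (@near_eq_derive _ _ _ h (fun=> 0) x (ee i)) ?derive_cst//.
have cj : `|(y : 'rV[R]_n) 0 j| @[y --> x] --> `|x 0 j|.
  have cx : (y : 'rV[R]_n) 0 j @[y --> x] --> x 0 j := @coord_continuous R 1 n 0 j x.
  exact: (cvg_norm cx).
have : \forall y \near x, r < `|(y : 'rV[R]_n) 0 j| by apply: (cj [set t | r < t]); exact: lt_nbhsr.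
by apply: filterS => y; exact: hr.
Qed.

Let cdh : continuous dh.
Proof. by move=> x; exact: (C_k_continuous (C_k_derive h1 i)). Qed.

Let dhK : exists2 K, 0 <= K & forall x, `|dh x| <= K.
Proof.
have [_ [r' [K [HK _]]]] := continuous_bounded_support cdh dh0.
by exists K => //; apply: le_trans (HK 0); exact: normr_ge0.
Qed.

Let supp : bounded_support (h : Rn -> R).
Proof. by apply: (continuous_bounded_support _ hr) => x; exact: (C_k_continuous h1). Qed.

(** Difference quotients have integral zero by translation invariance, and they converge to the
    derivative with a bound from the mean value theorem and a common support, so dominated
    convergence applies. *)
Lemma integral_derive_zero : (\int[lebn R n]_x ('D_(ee i) h x)%:E = 0)%E.
Proof.
have [K K0 HK] := dhK.
pose t_ k : R := k.+1%:R^-1.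
have t0 k : 0 < t_ k by rewrite invr_gt0.
have t1 k : t_ k <= 1 by rewrite invf_le1// ler1n.
pose q k (x : Rn) : R := (t_ k)^-1 * (h (t_ k *: ee i + x) - h x).
have mh : measurable_fun setT (h : Rn -> R) by case: supp.
have mhs k : measurable_fun setT (fun x : Rn => h (t_ k *: ee i + x)).
  rewrite (_ : (fun x => _) = (fun x => h (x + t_ k *: ee i))); last first.
    by apply/funext => x; rewrite addrC.
  by apply: (measurableT_comp mh); apply: continuous_borel; exact: addr_continuous.
have mq k : measurable_fun setT (q k).
  by apply: measurable_funM => //; exact: measurable_funB.
(* The steps [t_ k] are at most 1, so enlarging the support by 1 contains all translates. *)
pose C : set Rn := [set x | forall j, `|x 0 j| <= r + 1].
have [mC Coo] : measurable C /\ (lebn R n C < +oo)%E by apply: lebn_cube; rewrite addr_ge0// ltW.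
have int0 k : (\int[lebn R n]_x (q k x)%:E = 0)%E.
  have is1 := bounded_support_integrable supp.
  have int1 : (lebn R n).-integrable setT (fun x => (h (t_ k *: ee i + x))%:E).
    apply: (@bounded_support_integrable R n (fun x => h (t_ k *: ee i + x))).
    have [_ [r' [B [HB Hr']]]] := supp; split => //.
    exists (r + 1), B; split => // x j xj; apply: (hr (j := j)).
    rewrite !mxE eqxx /=; have : `|x 0 j| <= `|t_ k * (j == i)%:R + x 0 j| + `|t_ k * (j == i)%:R|.
      by rewrite -[X in `|X| <= _](addKr (t_ k * (j == i)%:R)) addrC; exact: ler_normB.
    have : `|t_ k * (j == i)%:R| <= 1.
      by case: (j == i); rewrite ?mulr1 ?mulr0 ?normr0// ger0_norm ?t1// ltW.
    by lra.
  rewrite /q; under eq_integral do rewrite EFinM.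
  rewrite integralZl//; last exact: (integrableB measurableT int1 is1).
  rewrite (integralB measurableT int1 is1).
  rewrite (_ : (\int[lebn R n]_x (h (t_ k *: ee i + x))%:E = \int[lebn R n]_x (h x)%:E)%E).
    by rewrite subee ?mule0//; exact: bounded_support_fin_num.
  rewrite -(@integral_shift_signed (t_ k *: ee i) (EFin \o h)); last exact/measurable_EFinP.
  by apply: eq_integral => x _ /=; rewrite addrC.
have [|||||_ _ L] := @dominated_convergence _ _ _ (lebn R n) setT measurableT
  (fun k x => (q k x)%:E) (fun x => (dh x)%:E) (fun x => (K * \1_C x)%:E).
- by move=> k; exact/measurable_EFinP.
- by apply/measurable_EFinP; exact: continuous_measurable.
- apply: aeW => /= x _; apply: cvg_EFin; first exact: nearW.
  have d1 : derivable h x (ee i) by exact: (C_k_derivable h1).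
  have d2 : (fun t : R => t^-1 *: (h (t *: ee i + x) - h x)) @ 0^'+ --> dh x.
    exact: (cvg_dnbhs_at_right d1).
  have /cvg_at_rightP/(_ t_) := d2; apply; split => //.
  exact: cvg_harmonic.
- apply: (@bounded_support_integrable R n (fun x => K * \1_C x)); split.
    by apply: measurable_funM => //; exact: measurable_indic.
  exists (r + 1), K; split => [x|x j xj].
    by rewrite indicE; case: (x \in C); rewrite ?mulr1 ?mulr0 ?normr0 ?ger0_norm.
  by rewrite indicE memNset ?mulr0// => /(_ j); rewrite leNgt xj.
- apply: aeW => /= x k _; rewrite lee_fin indicE.
  have bound : `|q k x| <= K.
    pose f s := h (x + s *: ee i).
    have fd s : is_derive s (1 : R) f (dh (x + s *: ee i)).
      by apply: is_derive_along; exact: (C_k_is_derive h1).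
    have fc : {within `[0, t_ k], continuous f}.
      by apply: derivable_within_continuous => s _; have [] := fd s.
    have [c _] := MVT_segment (ltW (t0 k)) (fun s _ => fd s) fc.
    rewrite /f scale0r addr0 subr0 => E'.
    rewrite /q [_ *: _ + x]addrC E' mulrC -mulrA divff ?mulr1 ?gt_eqF//.
  case: (boolP (x \in C)) => xC; first by rewrite mulr1.
  have [j xj] : exists j, r + 1 < `|x 0 j|.
    move: xC; rewrite notin_setE => xC; apply: contrapT => N; apply: xC => j.
    by rewrite leNgt; apply/negP => xj; apply: N; exists j.
  rewrite mulr0 /q (hr (x := x) (j := j)); last by lra.
  rewrite (hr (j := j)) ?subr0 ?mulr0 ?normr0//.
  rewrite !mxE eqxx /=; have : `|x 0 j| <= `|t_ k * (j == i)%:R + x 0 j| + `|t_ k * (j == i)%:R|.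
    by rewrite -[X in `|X| <= _](addKr (t_ k * (j == i)%:R)) addrC; exact: ler_normB.
  have : `|t_ k * (j == i)%:R| <= 1.
    by case: (j == i); rewrite ?mulr1 ?mulr0 ?normr0// ger0_norm ?t1// ltW.
  by lra.
rewrite (_ : [sequence _]_k = fun=> 0%E) in L; last first.
  by apply/funext => k /=; exact: int0.
by rewrite -(cvg_lim _ L)// lim_cst.
Qed.

End Zero.
End DeriveZero.

(** * Uniqueness for iterated integrals against test functions *)

Section IteratedUnique.
Variable R : realType.
Local Notation Rn n := (borel 'rV[R]_n).
Local Notation MR := (measurableTypeR R).
Local Notation leb := (@lebesgue_measure R).

Lemma measurable_iterated n d (X : measurableType d) (f : X * Rn n -> \bar R) :
  measurable_fun setT f ->
  measurable_fun setT (fun x : X => lebesgue_integral_n (fun y => f (x, y))).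
Proof.
elim: n d X f => [|n IH] d X f mf /=.
  by apply: (measurableT_comp mf); exact: measurable_pair2.
pose G (p : X * MR) := lebesgue_integral_n (fun y : 'rV[R]_n => f (p.1, rcons0 p.2 y)).
have mG : measurable_fun setT G.
  apply: (IH _ (X * MR)%type (fun q => f (q.1.1, rcons0 q.1.2 q.2))).
  apply: (measurableT_comp mf); apply/measurable_fun_pairP; split => /=.
    exact: (measurableT_comp measurable_fst measurable_fst).
  apply: measurable_rcons0; last exact: measurable_snd.
  exact: (measurableT_comp measurable_snd measurable_fst).
rewrite (_ : (fun x => _) = (fun x => \int[leb]_t G (x, t))%E) //.
rewrite (_ : (fun x => _) = (fun x => \int[leb]_t G^\+ (x, t) - \int[leb]_t G^\- (x, t))%E).
  apply: emeasurable_funB.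
    by apply: (measurable_fun_fubini_tonelli_F (m2 := leb) (G^\+)%E) => //; exact: measurable_funepos.
  by apply: (measurable_fun_fubini_tonelli_F (m2 := leb) (G^\-)%E) => //; exact: measurable_funeneg.
apply/funext => x; rewrite [LHS]integralE.
by congr (_ - _)%E; apply: eq_integral => t _; rewrite ?funeposE ?funenegE.
Qed.

Lemma ge0_integralZl_signed d (X : measurableType d) (mu : {measure set X -> \bar R}) (c : R)
    (f : X -> \bar R) : measurable_fun setT f -> 0 <= c ->
  (\int[mu]_x (c%:E * f x) = c%:E * \int[mu]_x f x)%E.
Proof.
move=> mf; rewrite le_eqVlt => /orP[/eqP <-|c0].
  by under eq_integral do rewrite mul0e; rewrite integral0 mul0e.
rewrite [LHS]integralE [in RHS]integralE.
rewrite ge0_funeposM ?ge0_funenegM ?ltW//.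
rewrite !ge0_integralZl//; [|exact: measurable_funeneg|by rewrite lee_fin ltW|exact: measurable_funepos|by rewrite lee_fin ltW].
set a := (\int[mu]_x f^\+ x)%E; set b := (\int[mu]_x f^\- x)%E.
have a0 : (0 <= a)%E by exact: integral_ge0.
have b0 : (0 <= b)%E by exact: integral_ge0.
case: a b a0 b0 => [a| |] [b| |] // a0 b0.
- by rewrite muleBr.
- by rewrite /= gt0_muley ?lte_fin// addeNy gt0_muleNy ?lte_fin.
- by rewrite /= gt0_muley ?lte_fin// gt0_muley ?lte_fin.
- by rewrite /= gt0_muley ?lte_fin// addeNy gt0_muleNy ?lte_fin.
Qed.

Lemma lebesgue_integral_nZ n (c : R) (f : Rn n -> \bar R) : measurable_fun setT f -> 0 <= c ->
  (lebesgue_integral_n (fun x => c%:E * f x) = c%:E * lebesgue_integral_n f)%E.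
Proof.
elim: n f => [//|n IH] f mf c0 /=.
rewrite -ge0_integralZl_signed//.
  apply: eq_integral => t _; rewrite -IH//; exact: (measurable_section t mf).
apply: (measurable_iterated (X := MR) (f := fun p => f (rcons0 p.1 p.2))).
by apply: (measurableT_comp mf); exact: measurable_rcons0_pair.
Qed.

(** The integral is the difference of two nonnegative extended reals, and a finite difference forces
    both to be finite. *)
Lemma fin_num_integrable d (X : measurableType d) (mu : {measure set X -> \bar R}) (D : set X)
    (f : X -> \bar R) : measurable D -> measurable_fun D f ->
  (\int[mu]_(x in D) f x)%E \is a fin_num -> mu.-integrable D f.
Proof.
move=> mD mf; rewrite integralE fin_numB => /andP[fp fn].
apply/integrableP; split => //.
rewrite -[X in (\int[mu]_(x in D) X x)%E]/(abse \o f) fune_abse ge0_integralD//; last 2 first.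
- exact: measurable_funepos.
- exact: measurable_funeneg.
by rewrite lte_add_pinfty// ltey_eq ?fp ?fn.
Qed.

(** A smooth approximation of the indicator of ]a, b[, supported in this interval, with transition
    layers of width 1 / m when m > 0. *)
Definition wd (a b : R) (m : nat) (t : R) : R := step (m%:R * (t - a)) * step (m%:R * (b - t)).

Lemma wd_ge0 a b m t : 0 <= wd a b m t.
Proof. by rewrite mulr_ge0// step_ge0. Qed.

Lemma wd_le1 a b m t : wd a b m t <= 1.
Proof. by rewrite mulr_ile1// ?step_ge0 ?step_le1. Qed.

Lemma wd0 a b m t : ~ (a < t < b) -> wd a b m t = 0.
Proof.
move=> N; rewrite /wd; have [ta|at'] := leP t a.
  by rewrite step0 ?mul0r// mulr_ge0_le0// subr_le0.
have [tb|bt] := ltP t b; first by exfalso; apply: N; rewrite at' tb.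
by rewrite [X in _ * X]step0 ?mulr0// mulr_ge0_le0// subr_le0.
Qed.

Lemma wd1 a b m t : 1 <= m%:R * (t - a) -> 1 <= m%:R * (b - t) -> wd a b m t = 1.
Proof. by move=> h1 h2; rewrite /wd !step1 ?mulr1. Qed.

Lemma measurable_wd a b m : measurable_fun setT (wd a b m : MR -> R).
Proof.
have cs : continuous (@step R) .
  have [ds _ H] := @step_derive R; move=> t.
  by apply/differentiable_continuous/derivable1_diffP; have [] := H t.
have ms (f : R -> R) : continuous f -> measurable_fun setT (fun t : MR => step (f t)).
  by move=> cf; apply: continuous_measurable_fun => t; exact: (continuous_comp (cf t) (cs _)).
have c1 : continuous (fun t : R => m%:R * (t - a)).
  by move=> t; exact: (cvgM (cvg_cst (m%:R : R)) (cvgB cvg_id (cvg_cst a))).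
have c2 : continuous (fun t : R => m%:R * (b - t)).
  by move=> t; exact: (cvgM (cvg_cst (m%:R : R)) (cvgB (cvg_cst b) cvg_id)).
exact: (measurable_funM (ms _ c1) (ms _ c2)).
Qed.

Lemma induced_measure d (X : measurableType d) (mu : {measure set X -> \bar R}) (f : X -> \bar R) :
  measurable_fun setT f -> (forall x, 0 <= f x)%E ->
  exists v : {measure set X -> \bar R}, forall A, v A = (\int[mu]_(x in A) f x)%E.
Proof.
move=> mf f0; pose nu (A : set X) := (\int[mu]_(x in A) f x)%E.
have nu0 : nu set0 = 0%E by rewrite /nu integral_set0.
have nuge A : (0 <= nu A)%E by apply: integral_ge0 => x _.
have nuadd : semi_sigma_additive nu := semi_sigma_additive_nng_induced mf f0.
pose mix := isMeasure.Build _ X R nu nu0 nuge nuadd.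
pose v : {measure set X -> \bar R} := HB.pack nu mix.
by exists v.
Qed.

(** The positive and the negative part of h induce finite measures that agree on the rays ]a, +oo[.
    These are stable under intersection and generate the Borel sets, so the measures coincide and
    both parts agree almost everywhere. *)
Lemma interval_integral_ae0 (p q : R) (h : MR -> \bar R) : measurable_fun setT h ->
  leb.-integrable `]p, q[%classic h ->
  (forall a : R, (p <= a)%R -> \int[leb]_(t in `]a, q[) h t = 0)%E ->
  ae_eq leb (`]p, q[%classic : set MR) h (cst 0%E).
Proof.
move=> mh ih h0; set D : set MR := `]p, q[%classic.
have mD : measurable D by exact: measurable_itv.
pose hp : MR -> \bar R := (h^\+)%E \_ D; pose hn : MR -> \bar R := (h^\-)%E \_ D.
have mhp : measurable_fun setT hp.
  by apply/(measurable_restrictT _ mD)/measurable_funTS; exact: measurable_funepos.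
have mhn : measurable_fun setT hn.
  by apply/(measurable_restrictT _ mD)/measurable_funTS; exact: measurable_funeneg.
have hp0 x : (0 <= hp x)%E by apply: erestrict_ge0 => y _; exact: funepos_ge0.
have hn0 x : (0 <= hn x)%E by apply: erestrict_ge0 => y _; exact: funeneg_ge0.
have [vp vpE] := induced_measure leb mhp hp0; have [vn vnE] := induced_measure leb mhn hn0.
have ipp := integrable_funepos mD ih; have inn := integrable_funeneg mD ih.
have intp A : measurable A -> vp A = (\int[leb]_(t in A `&` D) h^\+ t)%E.
  by move=> mA; rewrite vpE /hp integral_mkcondr.
have intn A : measurable A -> vn A = (\int[leb]_(t in A `&` D) h^\- t)%E.
  by move=> mA; rewrite vnE /hn integral_mkcondr.
have key (a : R) : vp (`]a, +oo[%classic : set MR) = vn (`]a, +oo[%classic : set MR).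
  have mI : measurable (`]a, +oo[%classic : set MR) by exact: measurable_itv.
  rewrite intp// intn//.
  have -> : `]a, +oo[%classic `&` D = `]Num.max a p, q[%classic.
    apply/seteqP; split => t; rewrite /D /= !in_itv /= andbT gt_max.
      by move=> [-> /andP[-> ->]].
    by move=> /andP[/andP[-> ->] ->].
  have sub : `]Num.max a p, q[%classic `<=` D.
    by move=> t; rewrite /D /= !in_itv /= gt_max => /andP[/andP[_ ->] ->].
  have mJ : measurable (`]Num.max a p, q[%classic : set MR) by exact: measurable_itv.
  have := h0 (Num.max a p); rewrite le_max lexx orbT => /(_ isT).
  rewrite integralE => /eqP; rewrite sube_eq; last 2 first.
  - apply: integrable_fin_num => //; exact: integrableS ipp.
  - by rewrite fin_num_adde_defr.
  by rewrite add0e => /eqP.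
have vv A : measurable A -> vp A = vn A.
  apply: (@measure_unique _ R MR (measurable_realfun.RGenOInfty.G (R:=R)) (fun k => `]- k%:R, +oo[%classic)).
  - exact: measurable_realfun.RGenOInfty.measurableE.
  - move=> A' B' [a ->] [b ->]; exists (Num.max a b); apply/seteqP; split => t; rewrite /= !in_itv /= !andbT gt_max.
      by move=> [-> ->].
    by move=> /andP[].
  - by move=> k; exists (- k%:R).
  - apply/seteqP; split => // t _.
    exists (Num.truncn `|t|).+1 => //; rewrite /= in_itv /= andbT.
    have := truncnS_gt `|t|; rewrite ltr_norml => /andP[]; by rewrite ltrNl.
  - by move=> A' [a ->]; exact: key.
  - move=> k; rewrite intp; last exact: measurable_itv.
    apply: le_lt_trans (_ : \int[leb]_(t in D) h^\+ t < +oo)%E.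
      by apply: ge0_subset_integral => //; [apply: measurableI => //; exact: measurable_itv|exact: measurable_int ipp].
    by have /integrable_fin_num := ipp => /(_ mD); rewrite ge0_fin_numE// integral_ge0.
have [||N [mN N0 HN]] := @integral_ae_eq _ _ R leb D mD (h^\-)%E (h^\+)%E ipp.
- exact: measurable_int inn.
- by move=> E ED mE; have := vv E mE; rewrite intp// intn// setIidl.
exists N; split => // t /= Nt; apply: HN => /= E; apply: Nt => Dt.
have := E Dt; rewrite funeposE funenegE; move: (h t) => [x| |] /=.
- rewrite -!EFin_max => -[]; rewrite !maxEle; case: (leP x 0) => h1; case: (leP (- x) 0) => h2 e; congr (_%:E); lra.
- by rewrite maxye ?maxNye.
- by rewrite maxNye maxye.
Qed.

(** On the plateau of a fixed cut-off both functions are integrable. There, cut-offs whose rational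
    ends tend to those of an interval ]a, q[ and whose layers shrink recover the integrals over ]a,
    q[, and [interval_integral_ae0] concludes. *)
Lemma unique_1D (A B K : R) (F G : MR -> \bar R) :
  measurable_fun setT F -> measurable_fun setT G -> (forall t, `|G t| <= K%:E)%E ->
  (forall (a b : rat) m, (A <= ratr a)%R -> (ratr b <= B)%R ->
    \int[leb]_t ((wd (ratr a) (ratr b) m t)%:E * F t) =
    \int[leb]_t ((wd (ratr a) (ratr b) m t)%:E * G t))%E ->
  {ae leb, forall t, A < t < B -> F t = G t}.
Proof.
move=> mF mG GK HFG.
have mw a b m : measurable_fun setT (fun t : MR => (wd a b m t)%:E : \bar R).
  by apply/measurable_EFinP; exact: measurable_wd.
have K0 : 0 <= K by have := GK 0; rewrite -lee_fin; apply: le_trans; exact: abse_ge0.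
have Gint a b m : leb.-integrable setT (fun t => (wd a b m t)%:E * G t)%E.
  apply/integrableP; split; first exact: emeasurable_funM.
  apply: (@le_lt_trans _ _ (\int[leb]_t (K%:E * (\1_(`[a, b]%classic : set MR) t)%:E))%E).
    apply: ge0_le_integral => //.
    - by apply: measurableT_comp => //; exact: emeasurable_funM.
    - by apply: emeasurable_funM => //; apply/measurable_EFinP; exact: measurable_indic.
    - move=> t _; rewrite abseM /= ger0_norm ?wd_ge0// indicE.
      have [/andP[ta tb]|N] := pselect (a < t < b); last first.
        by rewrite wd0// mul0e mule_ge0// lee_fin.
      rewrite mem_set; last by rewrite /= in_itv /= !ltW.
      rewrite mule1; apply: le_trans (GK t); rewrite -[leRHS]mul1e.
      by apply: lee_wpmul2r; rewrite ?abse_ge0// lee_fin wd_le1.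
  rewrite ge0_integralZl//; last by apply/measurable_EFinP; exact: measurable_indic.
  apply: lte_mul_pinfty; rewrite ?lee_fin//.
  have lI : (leb `[a, b] < +oo)%E.
    by rewrite lebesgue_measure_itv /=; case: ifP => _; rewrite -?EFinB ltry.
  by rewrite (integral_indic leb measurableT (measurable_itv _)) setIT.
(* Integrability of F comes for free: its integral against the cut-off equals that of the bounded
   function G, hence is finite. *)
have Fint (a b : rat) m : A <= ratr a -> ratr b <= B ->
    leb.-integrable setT (fun t => (wd (ratr a) (ratr b) m t)%:E * F t)%E.
  move=> Aa bB; apply: fin_num_integrable => //; first exact: emeasurable_funM.
  by rewrite HFG//; exact: integrable_fin_num.
have main (a0 b0 : rat) m0 : A <= ratr a0 -> ratr b0 <= B ->
    {ae leb, forall t, ratr a0 + m0.+1%:R^-1 < t < ratr b0 - m0.+1%:R^-1 -> F t = G t}.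
  move=> Aa bB; set p := ratr a0 + _; set q := ratr b0 - _.
  have m00 : 0 < m0.+1%:R^-1 :> R by rewrite invr_gt0.
  have mD (x y : R) : measurable (`]x, y[%classic : set MR) by exact: measurable_itv.
  have one t : t \in `]p, q[ -> wd (ratr a0) (ratr b0) m0.+1 t = 1.
    rewrite in_itv /= /p /q => /andP[h1 h2]; apply: wd1; rewrite -ler_pdivrMl// mulr1.
      by rewrite lerBrDl ltW.
    by rewrite lerBrDr -lerBrDl ltW.
  have restr (Phi : MR -> \bar R) : leb.-integrable setT (fun t => (wd (ratr a0) (ratr b0) m0.+1 t)%:E * Phi t)%E ->
      leb.-integrable `]p, q[%classic Phi.
    move=> H; apply: (@eq_integrable _ _ _ _ _ (mD p q) (fun t => (wd (ratr a0) (ratr b0) m0.+1 t)%:E * Phi t)%E).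
      by move=> t /set_mem tD; rewrite one// mul1e.
    exact: integrableS H.
  have iF := restr _ (Fint _ _ _ Aa bB); have iG := restr _ (Gint _ _ _).
  have sub (a : R) : p <= a -> (`]a, q[%classic : set R) `<=` `]p, q[%classic.
    by move=> pa t; rewrite /= !in_itv /= => /andP[at' ->]; rewrite (le_lt_trans pa).
  have h0 (a : R) : p <= a -> (\int[leb]_(t in `]a, q[) (F t - G t) = 0)%E.
    move=> pa; have iFa := integrableS (mD p q) (mD a q) (sub a pa) iF.
    have iGa := integrableS (mD p q) (mD a q) (sub a pa) iG.
    rewrite integralB//.
    suff -> : (\int[leb]_(t in `]a, q[) F t = \int[leb]_(t in `]a, q[) G t)%E.
      by rewrite subee// integrable_fin_num.
    pose e k : R := k.+1%:R^-1; have e0 k : 0 < e k by rewrite invr_gt0.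
    have al_ k : exists x : rat, a < ratr x < a + e k.
      have /rat_in_itvoo[x] : a < a + e k by rewrite ltrDl.
      by rewrite in_itv /=; exists x.
    have be_ k : exists x : rat, q - e k < ratr x < q.
      have /rat_in_itvoo[x] : q - e k < q by rewrite gtrDl oppr_lt0.
      by rewrite in_itv /=; exists x.
    pose al k := projT1 (cid (al_ k)); pose be k := projT1 (cid (be_ k)).
    have alP k : a < ratr (al k) < a + e k := projT2 (cid (al_ k)).
    have beP k : q - e k < ratr (be k) < q := projT2 (cid (be_ k)).
    pose w k t := wd (ratr (al k)) (ratr (be k)) k t.
    have lim (Phi : MR -> \bar R) : measurable_fun setT Phi -> leb.-integrable `]p, q[%classic Phi ->
        (\int[leb]_t ((w k t)%:E * Phi t))%E @[k --> \oo] --> (\int[leb]_(t in `]a, q[) Phi t)%E.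
      move=> mPhi iPhi; rewrite integral_mkcond.
      have iD : leb.-integrable setT (Phi \_ `]p, q[) by apply/(integrable_mkcond _ (mD p q)).
      have w0 k t : ~ (a < t < q) -> w k t = 0.
        move=> N; apply: wd0 => /andP[h1 h2]; apply: N.
        have /andP[h3 h4] := alP k; have /andP[h5 h6] := beP k.
        by rewrite (lt_trans h3 h1) (lt_trans h2 h6).
      have [||||| _ _ L] := @dominated_convergence _ _ _ leb setT measurableT
        (fun k t => (w k t)%:E * Phi t)%E (Phi \_ `]a, q[) (abse \o (Phi \_ `]p, q[)).
      - by move=> k; apply: emeasurable_funM => //; exact: mw.
      - by apply/(measurable_restrictT _ (mD a q)); exact: measurable_funTS.
      - apply: aeW => /= t _; rewrite patchE.
        case: (boolP (t \in _)) => [/set_mem|]; last first.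
          rewrite notin_setE /= in_itv /= => N.
          under eq_fun do rewrite w0// mul0e; exact: cvg_cst.
        rewrite /= in_itv /= => /andP[h1 h2].
        pose d := Num.min (t - a) (q - t) / 2.
        have [d0 [d1 d2]] : 0 < d /\ 2 * d <= t - a /\ 2 * d <= q - t.
          rewrite /d; split; first by rewrite divr_gt0// lt_min !subr_gt0 h1.
          by rewrite mulrCA divff// mulr1 !ge_min !lexx orbT.
        apply: cvg_near_cst; have := nbhs_infty_ger d^-1.
        apply: filterS => k kd.
        have kd1 : 1 <= k%:R * d by rewrite -ler_pdivrMr// mul1r.
        have ed : e k <= d.
          rewrite -[e k]mul1r /e ler_pdivrMr//; apply: (le_trans kd1); by rewrite mulrC ler_pM2l// ler_nat.
        have /andP[h3 h4] := alP k; have /andP[h5 h6] := beP k.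
        rewrite /w wd1 ?mul1e//; apply: (le_trans kd1); apply: ler_wpM2l => //; lra.
      - exact: integrable_abse.
      - apply: aeW => /= t k _; rewrite abseM /= ger0_norm ?wd_ge0// patchE.
        case: (boolP (t \in _)) => [_|].
          by rewrite -[leRHS]mul1e lee_wpmul2r ?abse_ge0// lee_fin wd_le1.
        rewrite notin_setE /= in_itv /= => N; rewrite w0 ?mul0e ?abse_ge0// => /andP[h1 h2].
        by apply: N; rewrite h2 (le_lt_trans pa).
      exact: L.
    have LF := lim F mF iF; have LG := lim G mG iG.
    rewrite -(cvg_lim _ LF)// -(cvg_lim _ LG)//; congr (limn _); apply/funext => k.
    apply: HFG.
      have /andP[h1 _] := alP k; apply: le_trans (ltW h1); apply: le_trans pa.
      by apply: (le_trans Aa); rewrite /p lerDl ltW.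
    have /andP[_ h2] := beP k; apply: (le_trans (ltW h2)); apply: le_trans bB.
    by rewrite /q gerDl oppr_le0 ltW.
  have := @interval_integral_ae0 p q (fun t => F t - G t)%E _ _ h0.
  have mFG : measurable_fun setT (fun t => F t - G t)%E by exact: emeasurable_funB.
  move=> /(_ mFG (integrableB (mD p q) iF iG)).
  apply: filterS => t H tpq; have := H; rewrite /= in_itv /= => /(_ tpq).
  have : G t \is a fin_num by rewrite fin_num_abs; apply: le_lt_trans (GK t) (ltry _).
  by case: (G t) => // b1 _; case: (F t) => [a1| |] //= [] e; congr (_%:E); lra.
(* Countably many rational intervals with integer margins exhaust ]A, B[, so a single null set
   suffices. *)
pose P k t := if @pickle_inv (rat * rat * nat)%type k is Some x then
   (A <= ratr x.1.1 -> ratr x.1.2 <= B ->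
    ratr x.1.1 + x.2.+1%:R^-1 < t < ratr x.1.2 - x.2.+1%:R^-1 -> F t = G t) else True.
have : \forall t \ae leb, forall k, P k t.
  apply: ae_foralln => k; rewrite /P; case: pickle_inv => [[[a b] m]|] /=; last exact: aeW.
  have [Aa|Aa] := pselect (is_true (A <= ratr a)); last by apply: aeW => t /Aa.
  have [bB|bB] := pselect (is_true (ratr b <= B)); last by apply: aeW => t _ /bB.
  have [N [mN N0 HN]] := main a b m Aa bB; exists N; split => // t Nt; apply: HN => H.
  by apply: Nt => _ _; exact: H.
move=> [N [mN N0 HN]]; exists N; split => // t Nt; apply: HN => H; apply: Nt => /andP[At tB].
have [a] := rat_in_itvoo At; have [b] := rat_in_itvoo tB.
rewrite !in_itv /= => /andP[tb bB] /andP[Aa at'].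
have d0 : 0 < Num.min (t - ratr a) (ratr b - t) by rewrite lt_min !subr_gt0 at'.
have [m _ /(_ m (leqnn m)) /= Hm] := near_infty_natSinv_lt (PosNum d0).
have := H (pickle (a, b, m)); rewrite /P pickleK_inv /=; apply; [exact: ltW|exact: ltW|].
move: Hm; rewrite lt_min => /andP[h1 h2]; apply/andP; split; first by rewrite -ltrBrDl.
by rewrite ltrBrDr -ltrBrDl.
Qed.

(** Product test functions with rational ends and integer slopes: a countable family, so that
    exceptional null sets in the first variable can be united, and one that factors along the
    recursion on the dimension. *)
Definition pbump n (a b : {ffun 'I_n -> rat}) (m : {ffun 'I_n -> nat}) (x : 'rV[R]_n) : R :=
  \prod_i wd (ratr (a i)) (ratr (b i)) (m i) (x 0 i).

Definition fcons (T : Type) n (t : T) (f : 'I_n -> T) : {ffun 'I_n.+1 -> T} :=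
  [ffun i => if unlift ord0 i is Some j then f j else t].

Lemma fcons0 T n (t : T) (f : 'I_n -> T) : fcons t f ord0 = t.
Proof. by rewrite ffunE unlift_none. Qed.

Lemma fconsS T n (t : T) (f : 'I_n -> T) j : fcons t f (lift ord0 j) = f j.
Proof. by rewrite ffunE liftK. Qed.

Lemma pbump_cons n a0 b0 m0 (a b : {ffun 'I_n -> rat})
    (m : {ffun 'I_n -> nat}) t (x : 'rV[R]_n) :
  pbump (fcons a0 a) (fcons b0 b) (fcons m0 m) (rcons0 t x) =
  wd (ratr a0) (ratr b0) m0 t * pbump a b m x.
Proof.
rewrite /pbump big_ord_recl !fcons0 rcons0E0; congr (_ * _).
by apply: eq_bigr => i _; rewrite !fconsS rcons0ES.
Qed.

Lemma pbump_ge0 n a b m (x : 'rV[R]_n) : 0 <= pbump a b m x.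
Proof. by apply: prodr_ge0 => i _; exact: wd_ge0. Qed.

Lemma pbump_le1 n a b m (x : 'rV[R]_n) : pbump a b m x <= 1.
Proof. by apply: prodr_ile1 => i _; rewrite wd_ge0 wd_le1. Qed.

Lemma measurable_pbump n a b m : measurable_fun setT (pbump a b m : Rn n -> R).
Proof.
rewrite /pbump; elim: (index_enum _) => [|i r IH].
  by under eq_fun do rewrite big_nil; exact: measurable_cst.
under eq_fun do rewrite big_cons; apply: measurable_funM => //.
by apply: (measurableT_comp (@measurable_wd _ _ _)); exact: measurable_coord.
Qed.

Lemma pbump0 n (a b : {ffun 'I_n -> rat}) (m : {ffun 'I_n -> nat}) (x : 'rV[R]_n) i :
  ~ (ratr (a i) < x 0 i < ratr (b i)) -> pbump a b m x = 0.
Proof. by move=> N; rewrite /pbump (bigD1 i)//= wd0 ?mul0r. Qed.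

Lemma pbump_bounded_support n (a b : {ffun 'I_n -> rat}) m (g : Rn n -> R) (K : R) :
  measurable_fun setT g -> (forall x, `|g x| <= K) ->
  bounded_support (fun x => g x * pbump a b m x).
Proof.
move=> mg gK; split; first by apply: measurable_funM => //; exact: measurable_pbump.
exists (\sum_i (`|ratr (a i)| + `|ratr (b i)|)), K; split => [x|x i xi].
  rewrite normrM (ger0_norm (pbump_ge0 _ _ _ _)); apply: le_trans (gK x).
  by rewrite ler_piMr// pbump_le1.
rewrite (@pbump0 _ _ _ _ _ i) ?mulr0// => /andP[ax xb].
move: xi; rewrite (bigD1 i)//= ltNge => /negP; apply.
apply: (@le_trans _ _ (`|ratr (a i)| + `|ratr (b i)|)).
  rewrite ler_norml; have := ler_norm (- ratr (a i) : R); have := ler_norm (ratr (b i) : R).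
  rewrite normrN; have := normr_ge0 (ratr (a i) : R); have := normr_ge0 (ratr (b i) : R).
  by move=> *; apply/andP; split; lra.
by rewrite lerDl sumr_ge0// => j _; rewrite addr_ge0.
Qed.

(** Induction on the dimension. For a fixed test function in the last n variables, [unique_1D] gives
    equality of the inner iterated integrals for almost every t; by countability one null set of t
    serves all of them. Off that set the sections satisfy the induction hypothesis, and Tonelli on
    the measurable set S finishes. Fubini is never applied to f itself. *)
Lemma iterated_unique n (f g : Rn n -> R) (K : R) (A B : 'I_n -> R) :
  measurable_fun setT f -> measurable_fun setT g -> (forall x, `|g x| <= K) ->
  (forall (a b : {ffun 'I_n -> rat}) (m : {ffun 'I_n -> nat}),
    (forall i, A i <= ratr (a i)) -> (forall i, ratr (b i) <= B i) ->
    lebesgue_integral_n (fun x => (f x * pbump a b m x)%:E) =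
    lebesgue_integral_n (fun x => (g x * pbump a b m x)%:E)) ->
  measurable [set x : Rn n | (forall i, A i < x 0 i < B i) /\ f x != g x] /\
  lebn R n [set x : Rn n | (forall i, A i < x 0 i < B i)%R /\ f x != g x] = 0%E.
Proof.
elim: n f g K A B => [|n IH] f g K A B mf mg gK Hfg; set S := [set x | _].
  suff -> : S = set0 by split; [exact: measurable0|exact: measure0].
  apply/seteqP; split => // x [_ /negP]; apply.
  have := Hfg [ffun=> 0] [ffun=> 0] [ffun=> 0%N].
  rewrite /= /pbump !big_ord0 !mulr1 => E; rewrite (_ : x = 0) ?flatmx0 ?thinmx0//.
  by apply/eqP; apply: EFin_inj; apply: E => -[].
have mS : measurable S.
  have -> : S = [set x : Rn n.+1 | forall i, `]A i, B i[%classic (x 0 i)] `&`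
      (fun x => f x - g x) @^-1` [set~ 0].
    apply/seteqP; split => x [h1 h2]; split => //.
    - by move=> /= /eqP; rewrite subr_eq0 (negbTE h2).
    - by apply/eqP => e; apply: h2; rewrite /= e subrr.
  apply: measurableI.
    have -> : [set x : Rn n.+1 | forall i, `]A i, B i[%classic (x 0 i)] =
       \bigcap_(i in [set: 'I_n.+1]) ((fun x : Rn n.+1 => x 0 i) @^-1` `]A i, B i[%classic).
      by apply/seteqP; split => x h i; [move=> _; exact: h|exact: (h i I)].
    apply: fin_bigcap_measurable => // i _; rewrite -[X in measurable X]setTI.
    exact: measurable_coord.
  rewrite -[X in measurable X]setTI; apply: (measurable_funB mf mg) => //.
  by apply: measurableC; exact: measurable_set1.
split => //.
pose F a b m (t : MR) := lebesgue_integral_n (fun x : Rn n => (f (rcons0 t x) * pbump a b m x)%:E).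
pose G a b m (t : MR) := lebesgue_integral_n (fun x : Rn n => (g (rcons0 t x) * pbump a b m x)%:E).
have mh (h : Rn n.+1 -> R) a b m : measurable_fun setT h ->
    measurable_fun setT (fun p : MR * Rn n => (h (rcons0 p.1 p.2) * pbump a b m p.2)%:E).
  move=> mh; apply/measurable_EFinP; apply: measurable_funM.
    by apply: (measurableT_comp mh); exact: measurable_rcons0_pair.
  by apply: (measurableT_comp (@measurable_pbump n a b m)); exact: measurable_snd.
have mF a b m : measurable_fun setT (F a b m) by apply: (measurable_iterated (mh f a b m mf)).
have mG a b m : measurable_fun setT (G a b m) by apply: (measurable_iterated (mh g a b m mg)).
have sec (h : Rn n.+1 -> R) t : measurable_fun setT h -> measurable_fun setT (fun x : Rn n => h (rcons0 t x)).
  by move=> mh'; apply: (measurableT_comp mh'); exact: measurable_rcons0.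
have Gbd a b m : exists K', forall t, (`|G a b m t| <= K'%:E)%E.
  have bs1 : bounded_support (fun x : Rn n => 1 * pbump a b m x).
    by apply: (@pbump_bounded_support _ _ _ _ _ 1) => // x; rewrite normr1.
  have fin1 := bounded_support_fin_num bs1.
  exists (K * fine (\int[lebn R n]_x (1 * pbump a b m x)%:E)) => t.
  have bst : bounded_support (fun x : Rn n => g (rcons0 t x) * pbump a b m x).
    by apply: (@pbump_bounded_support _ _ _ _ _ K) => //; exact: sec.
  rewrite /G bounded_support_lebesgue_integral//; apply: le_trans (le_abse_integral _ _ _) _ => //.
    by have [mm _] := bst; exact/measurable_EFinP.
  rewrite EFinM fineK//; have K0 : 0 <= K by apply: le_trans (gK 0); exact: normr_ge0.
  rewrite -ge0_integralZl//; last 2 first.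
  - by have [mm _] := bs1; exact/measurable_EFinP.
  - by move=> x _; rewrite lee_fin mul1r pbump_ge0.
  apply: ge0_le_integral => //.
  - by have [mm _] := bst; apply: measurableT_comp => //; exact/measurable_EFinP.
  - by apply: emeasurable_funM => //; have [mm _] := bs1; exact/measurable_EFinP.
  - move=> x _; rewrite -EFinM /= lee_fin mul1r normrM (ger0_norm (pbump_ge0 _ _ _ _)).
    by apply: ler_wpM2r => //; exact: pbump_ge0.
pose A' j := A (lift ord0 j); pose B' j := B (lift ord0 j).
have main (a b : {ffun 'I_n -> rat}) (m : {ffun 'I_n -> nat}) : (forall i, A' i <= ratr (a i)) -> (forall i, ratr (b i) <= B' i) ->
    {ae leb, forall t, A ord0 < t < B ord0 -> F a b m t = G a b m t}.
  move=> Aa bB; have [K' HK'] := Gbd a b m.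
  apply: (@unique_1D (A ord0) (B ord0) K') => // a0 b0 m0 Aa0 bB0.
  have E (h : Rn n.+1 -> R) : measurable_fun setT h ->
     lebesgue_integral_n (fun x => (h x * pbump (fcons a0 a) (fcons b0 b) (fcons m0 m) x)%:E) =
     (\int[leb]_t ((wd (ratr a0) (ratr b0) m0 t)%:E *
       lebesgue_integral_n (fun x : Rn n => (h (rcons0 t x) * pbump a b m x)%:E)))%E.
    move=> mh'; apply: eq_integral => t _; rewrite -lebesgue_integral_nZ ?wd_ge0//; last first.
      apply/measurable_EFinP; apply: measurable_funM; [exact: sec|exact: measurable_pbump].
    congr (lebesgue_integral_n _); apply/funext => x.
    by rewrite -[row_mx _ _]/(rcons0 t x) pbump_cons -EFinM mulrCA.
  have := Hfg (fcons a0 a) (fcons b0 b) (fcons m0 m); rewrite !E//; apply.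
    by move=> i; case: (unliftP ord0 i) => [j ->|->]; rewrite ?fconsS ?fcons0//; exact: Aa.
  by move=> i; case: (unliftP ord0 i) => [j ->|->]; rewrite ?fconsS ?fcons0//; exact: bB.
pose P k t := if @pickle_inv ({ffun 'I_n -> rat} * {ffun 'I_n -> rat} * {ffun 'I_n -> nat})%type k is Some x then
   ((forall i, A' i <= ratr (x.1.1 i)) -> (forall i, ratr (x.1.2 i) <= B' i) ->
    A ord0 < t < B ord0 -> F x.1.1 x.1.2 x.2 t = G x.1.1 x.1.2 x.2 t) else True.
have [N [mN N0 HN]] : {ae leb, forall t, forall k, P k t}.
  apply: ae_foralln => k; rewrite /P; case: pickle_inv => [[[a b] m]|] /=; last exact: aeW.
  have [Aa|Aa] := pselect (forall i, A' i <= ratr (a i)); last by apply: aeW => t /Aa.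
  have [bB|bB] := pselect (forall i, ratr (b i) <= B' i); last by apply: aeW => t _ /bB.
  have [N [mN N0 HN]] := main a b m Aa bB; exists N; split => // t Nt; apply: HN => H.
  by apply: Nt => _ _; exact: H.
have key t : ~ N t -> A ord0 < t < B ord0 ->
    (\int[lebn R n]_x (\1_S (rcons0 t x))%:E = 0)%E.
  move=> Nt tAB; have Pt : forall k, P k t.
    by apply: contrapT => H; apply: Nt; apply: HN.
  have [|||mT T0] := IH (fun x => f (rcons0 t x)) (fun x => g (rcons0 t x)) K A' B' _ _ (fun x => gK _).
  - exact: sec.
  - exact: sec.
  - move=> a b m Aa bB; have := Pt (pickle (a, b, m)); rewrite /P pickleK_inv /=.
    by move=> /(_ Aa bB tAB).
  rewrite -[RHS]T0 -[RHS]lebn_indic//; apply: eq_integral => x _; rewrite !indicE.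
  congr ((_ : bool)%:R)%:E; apply/idP/idP => /set_mem; rewrite ?inE => -[h1 h2].
    by split => //= i; have := h1 (lift ord0 i); rewrite rcons0ES.
  split => // i; case: (unliftP ord0 i) => [j ->|->]; last by rewrite rcons0E0.
  by rewrite rcons0ES; exact: h1.
have mI : measurable_fun setT (fun x : Rn n.+1 => (\1_S x)%:E : \bar R).
  by apply/measurable_EFinP; exact: measurable_indic.
rewrite -lebn_indic// lebnS1//.
rewrite (@ae_eq_integral _ _ _ _ _ (cst 0%E))// ?integral0//.
  by apply: (measurable_lebnS1 (f := fun x => (\1_S x)%:E)) => // x; rewrite lee_fin.
exists N; split => // t /= Nt; apply: contrapT => nN; apply: Nt => _.
have [tAB|tAB] := pselect (A ord0 < t < B ord0); first exact: key.
apply: integral0_eq => x _; rewrite indicE memNset// => -[/(_ ord0)].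
by rewrite rcons0E0.
Qed.

End IteratedUnique.

(** * Weak gradients of functions of class C^1 *)

Section AlmostEverywhere.
Context d (T : measurableType d) (R : realType) (mu : {measure set T -> \bar R}).
Implicit Types P Q : T -> Prop.

Lemma ae_mono P Q : {ae mu, forall x, P x} -> (forall x, P x -> Q x) -> {ae mu, forall x, Q x}.
Proof.
move=> [N [mN N0 HN]] PQ; exists N; split => // x Nx; apply: HN => Px; apply: Nx.
exact: PQ.
Qed.

Lemma ae_forall_ord n (P : 'I_n -> T -> Prop) : (forall i, {ae mu, forall x, P i x}) ->
  {ae mu, forall x, forall i, P i x}.
Proof.
move=> HP; pose Q k x := if insub k is Some i then P i x else True.
have : {ae mu, forall x, forall k, Q k x}.
  by apply: ae_foralln => k; rewrite /Q; case: insub => [i|]; [exact: HP|exact: aeW].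
move/ae_mono; apply => x Qx i; have := Qx (val i); rewrite /Q insubT//= => ?.
by rewrite (_ : Sub _ _ = i)//; exact: val_inj.
Qed.

Lemma ae_and P Q : {ae mu, forall x, P x} -> {ae mu, forall x, Q x} -> {ae mu, forall x, P x /\ Q x}.
Proof.
move=> HP HQ; have := @ae_forall_ord 2 (fun i => if i == ord0 then P else Q).
move=> /(_ (fun i => _))/ae_mono; apply; first by move=> i; case: ifP.
by move=> x H; split; [exact: (H ord0)|exact: (H ord_max)].
Qed.

End AlmostEverywhere.

Section Gradient.
Variables (R : realType) (n : nat) (M : manifold R n) (g : metric M).
Hypothesis M_compact : compact [set: M].
Local Notation Rn := (borel 'rV[R]_n).
Local Notation H := (@half_space R n).
Local Notation ee i := (delta_mx 0 i : 'rV[R]_n).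
Implicit Types (c a b : chart R n M) (p q : M) (f h u : M -> R).

Lemma transition_jacobian a b p : atlas a -> atlas b -> chart_dom a p -> chart_dom b p ->
  exists J : 'M[R]_n, [/\ J \in unitmx, gram g a p = J *m gram g b p *m J^T &
    forall f, C1_at b f p -> pd a f p = pd b f p *m J^T].
Proof.
move=> Aa Ab ap bp; have [W [G [oW Wp HG extG Gp]]] := transition_ext Aa Ab ap bp.
have extG' y : W y -> overlap a b y -> G y = transition a b y.
  by move=> Wy oy; have [q [aq bq] qy] := oy; have [] := extG y Wy; first by rewrite -qy; exact: chart_imgP.
exists (\matrix_(i < n, j < n) 'D_(ee i) (fun z => G z 0 j) (chart_map a p)); split.
- rewrite unitmxE unitfE; apply/det0P => -[v v0 vJ].
  have : v = 0 by apply: (jacobian_inj Aa Ab ap bp oW Wp (fun j => HG j 1%N) extG' vJ).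
  by move/eqP; rewrite (negbTE v0).
- exact: (gram_transition g Aa Ab ap bp oW Wp HG extG').
- by move=> f Cf; exact: (pd_transition ap bp oW Wp (fun j => HG j 1%N) extG' Cf).
Qed.

Definition gform c f h p : R := (pd c f p *m invmx (gram g c p) *m (pd c h p)^T) 0 0.

Lemma gram_unit c p : atlas c -> chart_dom c p -> gram g c p \in unitmx.
Proof.
move=> Ac cp; rewrite unitmxE unitfE gt_eqF//; apply: det_posdef.
exact: gram_posdef Ac _ cp.
Qed.

(** Differentials pick up J^T and the inverse Gram matrix becomes J^-T G^-1 J^-1, so the Jacobians
    cancel. *)
Lemma gform_chart a b f h p : atlas a -> atlas b -> chart_dom a p -> chart_dom b p ->
  C1_at b f p -> C1_at b h p -> gform a f h p = gform b f h p.
Proof.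
move=> Aa Ab ap bp Cf Ch; have [J [uJ gJ pJ]] := transition_jacobian Aa Ab ap bp.
rewrite /gform (pJ _ Cf) (pJ _ Ch) gJ trmx_mul trmxK.
have uJT : J^T \in unitmx by rewrite unitmx_tr.
have ug := gram_unit Ab bp.
have -> : invmx (J *m gram g b p *m J^T) = invmx J^T *m invmx (gram g b p) *m invmx J.
  apply: (can_inj (mulKmx (_ : J *m gram g b p *m J^T \in unitmx))).
    by rewrite !unitmx_mul uJ ug uJT.
  rewrite mulmxV; last by rewrite !unitmx_mul uJ ug uJT.
  by rewrite -!mulmxA mulKVmx// (mulmxA (gram g b p)) mulmxV// mul1mx mulmxV.
congr (_ 0 0); rewrite -!mulmxA; congr (_ *m _).
by rewrite (mulmxA J^T) mulmxV// mul1mx (mulmxA (invmx J)) mulVmx// mul1mx.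
Qed.

Definition some_chart p : chart R n M := projT1 (cid2 (atlas_cover p)).

Lemma some_chartP p : atlas (some_chart p) /\ chart_dom (some_chart p) p.
Proof. by rewrite /some_chart; case: cid2. Qed.

Definition gip f h p : R := gform (some_chart p) f h p.

Lemma gipE c f h p : atlas c -> chart_dom c p -> C1M f -> C1M h -> gip f h p = gform c f h p.
Proof.
move=> Ac cp Cf Ch; have [As sp] := some_chartP p.
by apply: gform_chart => //; [exact: Cf|exact: Ch].
Qed.

Lemma pd_continuous c f i : atlas c -> C1M f ->
  {within chart_img c, continuous (fun x => pd c f (chart_inv c x) 0 i)}.
Proof.
move=> Ac Cf; apply/subspace_continuousP => x cx.
have [W [F [oW Wx HF ext]]] := Cf c Ac _ (chart_invP cx).
rewrite chart_invK// in Wx.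
have E y : W y -> chart_img c y -> 'D_(ee i) F y = pd c f (chart_inv c y) 0 i.
  move=> Wy cy; rewrite (pd_ext (chart_invP cy) oW HF)//; last by rewrite chart_invK.
  by rewrite mxE chart_invK.
have cF : 'D_(ee i) F y @[y --> x] --> 'D_(ee i) F x := C_k_cvg (C_k_derive HF i) Wx.
have cF' : 'D_(ee i) F y @[y --> within (chart_img c) (nbhs x)] --> 'D_(ee i) F x.
  by apply: cvg_trans cF; apply: cvg_app; exact: cvg_within.
suff h : pd c f (chart_inv c y) 0 i @[y --> within (chart_img c) (nbhs x)] --> pd c f (chart_inv c x) 0 i.
  exact: h.
rewrite -E//; apply: cvg_trans cF'; apply: near_eq_cvg.
rewrite near_withinE; have : nbhs x W by exact: open_nbhs_nbhs.
by apply: filterS => y Wy cy; exact: E.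
Qed.

(** The inverse of the Gram matrix is continuous as its adjugate divided by its determinant. *)
Lemma gform_continuous c f h : atlas c -> C1M f -> C1M h ->
  {within chart_img c, continuous (fun x => gform c f h (chart_inv c x))}.
Proof.
move=> Ac Cf Ch.
pose D x := \det (gram g c (chart_inv c x)).
have cgram i j : {within chart_img c, continuous (fun x => gram g c (chart_inv c x) i j)}.
  by apply: smooth_on_continuous; exact: gram_smooth Ac i j.
have cD : {within chart_img c, continuous D} by apply: within_continuous_det.
have cDV : {within chart_img c, continuous (fun x => (D x)^-1)}.
  apply/subspace_continuousP => x cx; have /subspace_continuousP/(_ _ cx) := cD.
  move=> cDx; have cDx' : D y @[y --> within (chart_img c) (nbhs x)] --> D x := cDx.
  suff hV : (D y)^-1 @[y --> within (chart_img c) (nbhs x)] --> (D x)^-1 by exact: hV.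
  apply: (cvgV _ cDx'); rewrite gt_eqF//; apply: det_posdef.
  exact: gram_posdef Ac _ (chart_invP cx).
have cadj i j : {within chart_img c, continuous (fun x => (\adj (gram g c (chart_inv c x))) i j)}.
  rewrite (_ : (fun x => _) = (fun x => (-1) ^+ (j + i) * \det (row' j (col' i (gram g c (chart_inv c x)))))).
    apply: within_continuousM; first exact: within_continuous_cst.
    apply: within_continuous_det => k l.
    by under [X in continuous X]eq_fun do rewrite !mxE; exact: cgram.
  by apply/funext => x; rewrite mxE.
pose Phi x := \sum_j (\sum_i pd c f (chart_inv c x) 0 i * ((D x)^-1 * (\adj (gram g c (chart_inv c x))) i j)) *
  pd c h (chart_inv c x) 0 j.
have cPhi : {within chart_img c, continuous Phi}.
  apply: within_continuous_sum => j; apply: within_continuousM; last exact: pd_continuous.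
  apply: within_continuous_sum => i; apply: within_continuousM; first exact: pd_continuous.
  exact: within_continuousM.
apply/subspace_continuousP => x cx; have /subspace_continuousP/(_ _ cx) cP := cPhi.
have E y : chart_img c y -> Phi y = gform c f h (chart_inv c y).
  move=> cy; rewrite /gform [RHS]mxE; apply: eq_bigr => j _.
  congr (_ * _); last by rewrite [RHS]mxE.
  rewrite [RHS]mxE; apply: eq_bigr => i _; congr (_ * _).
  by rewrite /invmx gram_unit ?[RHS]mxE//; exact: chart_invP.
have cP' : Phi y @[y --> within (chart_img c) (nbhs x)] --> Phi x := cP.
suff h' : gform c f h (chart_inv c y) @[y --> within (chart_img c) (nbhs x)] --> gform c f h (chart_inv c x).
  exact: h'.
rewrite -E//; apply: cvg_trans cP'; apply: near_eq_cvg.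
by rewrite near_withinE; apply: nearW => y cy; exact: E.
Qed.

Lemma within_chart_cvg c (Phi : 'rV[R]_n -> R) p : chart_dom c p ->
  {within chart_img c, continuous Phi} ->
  Phi (chart_map c q) @[q --> p] --> Phi (chart_map c p).
Proof.
move=> cp /subspace_continuousP/(_ _ (chart_imgP cp)) cP.
have cP' : Phi y @[y --> within (chart_img c) (nbhs (chart_map c p))] --> Phi (chart_map c p) := cP.
apply: (@cvg_comp _ _ _ (chart_map c) Phi _ (within (chart_img c) (nbhs (chart_map c p)))) cP'.
move=> A /= nA; have h : chart_map c q @[q --> p] --> chart_map c p := chart_map_cvg cp.
have h1 : \forall q \near p, chart_img c (chart_map c q) -> A (chart_map c q) := h _ nA.
have nd : nbhs p (chart_dom c).
  by apply: open_nbhs_nbhs; split => //; exact: chart_dom_open.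
by apply: filterS2 nd h1 => q cq; apply; exact: chart_imgP.
Qed.

Lemma gip_continuous f h : C1M f -> C1M h -> continuous (gip f h).
Proof.
move=> Cf Ch p; have [c Ac cp] := atlas_cover p.
have cP := within_chart_cvg cp (gform_continuous Ac Cf Ch).
suff h' : gip f h q @[q --> p] --> gip f h p by exact: h'.
rewrite (gipE Ac cp Cf Ch) -{2}(chart_mapK cp); apply: cvg_trans cP; apply: near_eq_cvg.
have : nbhs p (chart_dom c) by apply: open_nbhs_nbhs; split => //; exact: chart_dom_open.
by apply: filterS => q cq; rewrite chart_mapK// (gipE Ac cq Cf Ch).
Qed.

Lemma pd_measurable c f i : atlas c -> C1M f ->
  measurable_fun (chart_dom c : set (borel M)) (fun p => pd c f p 0 i).
Proof.
move=> Ac Cf; apply: within_continuous_measurable; first exact: chart_dom_measurable.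
rewrite (continuous_open_subspace _ (@chart_dom_open _ _ _ c)) => p /set_mem cp.
have cP := within_chart_cvg cp (@pd_continuous c f i Ac Cf).
suff h' : pd c f q 0 i @[q --> p] --> pd c f p 0 i by exact: h'.
rewrite -{2}(chart_mapK cp); apply: cvg_trans cP; apply: near_eq_cvg.
have : nbhs p (chart_dom c) by apply: open_nbhs_nbhs; split => //; exact: chart_dom_open.
by apply: filterS => q cq; rewrite chart_mapK.
Qed.

Lemma gip_ge0 f p : C1M f -> 0 <= gip f f p.
Proof.
move=> Cf; have [Ac cp] := some_chartP p; rewrite /gip /gform.
set c := some_chart p in Ac cp *; set w := pd c f p; set G := gram g c p.
have uG := gram_unit Ac cp; have symG : G^T = G := gram_sym g Ac cp.
have -> : w *m invmx G *m w^T = (w *m invmx G) *m G *m (w *m invmx G)^T.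
  by rewrite mulmxKV// trmx_mul trmx_inv symG mulmxA.
have [->|v0] := eqVneq (w *m invmx G) 0; first by rewrite !mul0mx mxE.
by apply: ltW; exact: gram_posdef Ac _ cp _ v0.
Qed.

Lemma C_k_local k (U : set 'rV[R]_n) (f : 'rV[R]_n -> R) :
  (forall x, U x -> exists2 W, W x & C_k k W f) -> C_k k U f.
Proof.
elim: k f => [|k IH] f Hf; split => //.
- by move=> x /Hf[W Wx HW]; exact: (C_k_continuous HW).
- by move=> x /Hf[W Wx HW]; exact: (C_k_continuous HW).
- move=> i; split; first by move=> x /Hf[W Wx HW]; exact: (C_k_derivable HW).
  by apply: IH => x /Hf[W Wx HW]; exists W => //; exact: C_k_derive.
Qed.

Lemma C1M_interior c f : atlas c -> C1M f ->
  C_k 1 (interior (chart_img c)) (fun x => f (chart_inv c x)) /\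
  forall x i, interior (chart_img c) x ->
    'D_(ee i) (fun x => f (chart_inv c x)) x = pd c f (chart_inv c x) 0 i.
Proof.
move=> Ac Cf; set U := interior _; have oU : open U := @open_interior _ _.
have UI : U `<=` chart_img c := @interior_subset _ _.
have loc x : U x -> exists W, [/\ open W, W x & C_k 1 W (fun x => f (chart_inv c x))].
  move=> Ux; have [W [F [oW Wx HF ext]]] := Cf c Ac _ (chart_invP (UI _ Ux)).
  rewrite chart_invK in Wx; last exact: UI.
  exists (W `&` U); split => //; first exact: openI.
  apply: (C_k_ext (f := F)) (openI oW oU) _ _ => [y /set_mem[Wy Uy]|]; first by rewrite ext//; exact: UI.
  by apply: C_k_sub HF => y [].
split.
  by apply: C_k_local => x /loc[W [_ Wx HW]]; exists W.
move=> x i Ux; have [W [oW Wx HW]] := loc x Ux.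
have cx := UI _ Ux; have W' : W (chart_map c (chart_inv c x)) by rewrite chart_invK.
by rewrite (pd_ext (chart_invP cx) oW HW W')// mxE chart_invK.
Qed.

Section Test.
Variables (c : chart R n M) (f : M -> R) (psi : 'rV[R]_n -> R) (K : set 'rV[R]_n).
Hypotheses (Ac : atlas c) (Cf : C1M f) (Cpsi : C_infty setT psi) (cK : compact K).
Hypotheses (KU : K `<=` interior (chart_img c)) (psiK : forall x, ~ K x -> psi x = 0).

Let U := interior (chart_img c).
Let fb x := f (chart_inv c x).
Let oU : open U. Proof. exact: open_interior. Qed.
Let oK : open (~` K).
Proof. by apply: closed_openC; apply: compact_closed => //; exact: norm_hausdorff. Qed.

Let dpsiK i x : ~ K x -> 'D_(ee i) psi x = 0.
Proof.
move=> Kx; rewrite (@near_eq_derive _ _ _ psi (fun=> 0) x (ee i)) ?derive_cst//.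
have : nbhs x (~` K) by exact: open_nbhs_nbhs.
by apply: filterS => y; exact: psiK.
Qed.

Let C_k_mul k (a b : 'rV[R]_n -> R) : C_k k U a -> C_k k setT b -> (forall x, ~ K x -> b x = 0) ->
  C_k k setT (fun x => a x * b x).
Proof.
move=> Ca Cb bK; apply: C_k_local => x _.
have [Kx|Kx] := pselect (K x).
  exists U; first exact: KU.
  by apply: C_kM => //; exact: C_k_sub Cb.
exists (~` K) => //; apply: (C_k_ext (f := fun=> 0)) => //; last exact: C_k_cst.
by move=> y /set_mem Ky; rewrite bK// mulr0.
Qed.

Let box : exists r : R, 0 < r /\ forall (x : 'rV[R]_n) j, r < `|x 0 j| -> ~ K x.
Proof.
have [r [_ Hr]] := compact_bounded cK; exists (Num.max 1 (r + 1)); split.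
  by rewrite lt_max ltr01.
move=> x j + Kx; rewrite gt_max => /andP[_ xj].
have := Hr (r + 1); rewrite ltrDl => /(_ ltr01 x Kx) /= xr.
by have := lt_le_trans xj (le_trans (rV_normE x j) xr); rewrite ltxx.
Qed.

(** Since psi has compact support inside the image, f psi extends by zero to a C^1 function on R^n.
    The integral of its derivative vanishes and the product rule splits it into two bounded
    functions of bounded support. *)
Lemma weak_pd i :
  lebesgue_integral_n (fun x => (f (chart_inv c x) * 'D_(ee i) psi x)%:E) =
  (- lebesgue_integral_n (fun x => (pd c f (chart_inv c x) 0 i * psi x)%:E))%E.
Proof.
have [Cfb dfb] := C1M_interior Ac Cf.
pose h x := fb x * psi x.
have Ch : C_k 1 setT h by apply: C_k_mul => //; exact: Cpsi.
have [r [r0 Hr]] := box.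
have hr (x : 'rV[R]_n) j : r < `|x 0 j| -> h x = 0 by move=> /Hr/psiK; rewrite /h => ->; rewrite mulr0.
pose f1 x := fb x * 'D_(ee i) psi x; pose f2 x := pd c f (chart_inv c x) 0 i * psi x.
have C1 : C_k 0 setT f1.
  apply: C_k_mul; [exact: C_kS Cfb|exact: C_k_derive (Cpsi 1%N) i|exact: dpsiK].
have dh x : 'D_(ee i) h x = f1 x + f2 x.
  have [Kx|Kx] := pselect (K x).
    have Ux := KU Kx.
    have [_ e1] := C_k_is_derive Cfb i Ux.
    have D := is_deriveM (C_k_is_derive Cfb i Ux) (C_k_is_derive (Cpsi 1%N) i (I : setT x)).
    have [_ ->] := D; rewrite /f1 /f2 -dfb//= /GRing.scale /=.
    by rewrite [psi x * _]mulrC.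
  rewrite /f1 /f2 psiK// dpsiK// !mulr0 addr0.
  rewrite (@near_eq_derive _ _ _ h (fun=> 0) x (ee i)) ?derive_cst//.
  have : nbhs x (~` K) by exact: open_nbhs_nbhs.
  by apply: filterS => y Ky; rewrite /h psiK// mulr0.
have bs1 : bounded_support (f1 : Rn -> R).
  apply: (@continuous_bounded_support _ _ _ r) => [x|x j /Hr Kx].
    exact: (C_k_continuous C1).
  by rewrite /f1 dpsiK// mulr0.
have bs2 : bounded_support (f2 : Rn -> R).
  have -> : f2 = (fun x => 'D_(ee i) h x - f1 x) by apply/funext => x; rewrite dh addrC addKr.
  apply: (@continuous_bounded_support _ _ _ r) => [x|x j /Hr Kx].
    exact: (cvgB (C_k_cvg (C_k_derive Ch i) I) (C_k_cvg C1 I)).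
  by rewrite dh addrC addKr /f2 psiK// mulr0.
have := integral_derive_zero i Ch r0 hr.
under eq_integral do rewrite dh EFinD.
rewrite (integralD measurableT (bounded_support_integrable bs1) (bounded_support_integrable bs2)).
rewrite (bounded_support_lebesgue_integral bs1) (bounded_support_lebesgue_integral bs2).
have := bounded_support_fin_num bs1; have := bounded_support_fin_num bs2.
by case: integral => // a1 _; case: integral => // a2 _ [] e; congr (_%:E); lra.
Qed.

End Test.

Lemma pd_weak_differential f : C1M f -> weak_differential f (fun c p => pd c f p).
Proof.
move=> Cf c Ac i; split; first exact: pd_measurable.
by move=> psi [Cpsi [K [cK KU psiK]]]; exact: (weak_pd Ac Cf Cpsi cK KU psiK).
Qed.

Lemma gip_is_grad_sq f : C1M f -> is_grad_sq g f (gip f f).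
Proof.
move=> Cf; split; first by apply: continuous_measurable; exact: gip_continuous.
exists (fun c p => pd c f p); split; first exact: pd_weak_differential.
by move=> c Ac; apply: aeW => p cp; exact: gipE.
Qed.

Lemma C_infty_pbump (a b : {ffun 'I_n -> rat}) (m : {ffun 'I_n -> nat}) :
  C_infty setT (pbump a b m : 'rV[R]_n -> R).
Proof.
move=> k; apply: C_k_prod; first exact: openT.
move=> i; apply: C_kM; [exact: openT| |].
  apply: C_k_step_comp; first exact: openT.
  apply: C_kM; [exact: openT|exact: C_k_cst|].
  by apply: C_kD; [exact: openT|apply: C_k_coord; exact: openT|exact: C_k_cst].
apply: C_k_step_comp; first exact: openT.
apply: C_kM; [exact: openT|exact: C_k_cst|].
apply: C_kD; [exact: openT|exact: C_k_cst|].
by apply: C_kN; [exact: openT|apply: C_k_coord; exact: openT].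
Qed.

Lemma rat_box (U : set 'rV[R]_n) x : open U -> U x ->
  exists a b : {ffun 'I_n -> rat}, (forall i, ratr (a i) < x 0 i < ratr (b i)) /\
    forall y : 'rV[R]_n, (forall i, ratr (a i) <= y 0 i <= ratr (b i)) -> U y.
Proof.
move=> oU Ux; have /nbhs_ballP[r /= r0 xr] : nbhs x U by exact: open_nbhs_nbhs.
have Ha i : exists q : rat, x 0 i - r < ratr q < x 0 i.
  have /rat_in_itvoo[q] : x 0 i - r < x 0 i by rewrite gtrDl oppr_lt0.
  by rewrite in_itv /=; exists q.
have Hb i : exists q : rat, x 0 i < ratr q < x 0 i + r.
  have /rat_in_itvoo[q] : x 0 i < x 0 i + r by rewrite ltrDl.
  by rewrite in_itv /=; exists q.
exists [ffun i => projT1 (cid (Ha i))], [ffun i => projT1 (cid (Hb i))]; split.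
  by move=> i; rewrite !ffunE; case: (cid (Ha i)) => /= a /andP[_ ->]; case: (cid (Hb i)) => /= b /andP[->].
move=> y Hy; apply: xr; apply/rV_ballE => // i; have := Hy i; rewrite !ffunE.
case: (cid (Ha i)) => /= a /andP[h1 _]; case: (cid (Hb i)) => /= b /andP[_ h2] /andP[h3 h4].
by rewrite ltr_norml; apply/andP; split; lra.
Qed.

Hypothesis n_gt0 : (0 < n)%N.

Lemma interior_chart_img c (x : 'rV[R]_n) : chart_img c x -> x 0 (Ordinal n_gt0) != 0 ->
  interior (chart_img c) x.
Proof.
move=> cx x0; have x0' : 0 < x 0 (Ordinal n_gt0).
  by rewrite lt_def x0 (chart_img_half cx).
have nH : \forall y \near x, 0 < (y : 'rV[R]_n) 0 (Ordinal n_gt0).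
  by apply: (@coord_continuous R 1 n 0 (Ordinal n_gt0) x [set t | 0 < t]); exact: lt_nbhsr.
have := chart_img_near cx; apply: filterS2 nH => y y0; apply => i i0.
by rewrite (_ : i = Ordinal n_gt0) ?ltW//; exact: val_inj.
Qed.

(** [iterated_unique] is applied on each of the countably many rational boxes inside the interior of
    the chart image. They cover that interior, and the rest of the image lies in the null hyperplane
    x_0 = 0. *)
Lemma weak_unique c f w i : atlas c -> C1M f -> weak_differential f w ->
  {ae volume g, forall p, chart_dom c p -> w c p 0 i = pd c f p 0 i}.
Proof.
move=> Ac Cf Hw; have [mw ww] := Hw c Ac i.
have [_ wp] := pd_weak_differential Cf Ac i.
set U := interior (chart_img c); have oU : open U by exact: open_interior.
have UI : U `<=` chart_img c by exact: interior_subset.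
have mU : measurable (U : set Rn) by exact: borel_open.
pose F : Rn -> R := (fun x => w c (cinv c x) 0 i) \_ U.
have mF : measurable_fun setT F.
  apply/(measurable_restrictT _ mU).
  apply: (@measurable_comp _ _ _ _ _ _ (chart_dom c : set (borel M))) mw _.
  - exact: chart_dom_measurable.
  - by move=> _ [x /UI cx <-]; rewrite cinvE//; exact: chart_invP.
  - exact: measurable_funTS (@measurable_cinv _ _ _ c).
pose valid (ab : {ffun 'I_n -> rat} * {ffun 'I_n -> rat}) :=
  forall x : 'rV[R]_n, (forall i, ratr (ab.1 i) <= x 0 i <= ratr (ab.2 i)) -> U x.
pose box (ab : {ffun 'I_n -> rat} * {ffun 'I_n -> rat}) : set Rn :=
  [set x | forall i, ratr (ab.1 i) <= x 0 i <= ratr (ab.2 i)].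
have boxE ab : box ab = [set x : 'rV[R]_n | forall j, `[ratr (ab.1 j), ratr (ab.2 j)]%classic (x ord0 j)].
  by apply/seteqP; split => x h j; have := h j; rewrite /= in_itv.
have cbox ab : compact (box ab : set 'rV[R]_n).
  rewrite boxE; apply: (@rV_compact R n (fun j => `[ratr (ab.1 j), ratr (ab.2 j)]%classic)) => j.
  exact: segment_compact.
have mbox ab : measurable (box ab).
  by apply: borel_closed; apply: compact_closed => //; exact: norm_hausdorff.
(* Cutting the classical derivative to the compact box supplies the bound that [iterated_unique]
   asks of one of the two functions. *)
pose Gr ab : Rn -> R := (fun x => pd c f (chart_inv c x) 0 i) \_ (box ab).
have cpd := @pd_continuous c f i Ac Cf.
have S0 ab : valid ab ->
   let S := [set x : Rn | (forall i, ratr (ab.1 i) < x 0 i < ratr (ab.2 i)) /\ F x != Gr ab x] in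
   measurable S /\ lebn R n S = 0%E.
  move=> vab.
  have sub : box ab `<=` chart_img c by move=> x /vab/UI.
  have mG : measurable_fun setT (Gr ab).
    apply/(measurable_restrictT _ (mbox ab)); apply: within_continuous_measurable => //.
    exact: continuous_subspaceW sub cpd.
  have [K HK] : exists K, forall x, `|Gr ab x| <= K.
    have cim : compact ((fun x => pd c f (chart_inv c x) 0 i) @` (box ab : set 'rV[R]_n)).
      by apply: continuous_compact (cbox ab); exact: continuous_subspaceW sub cpd.
    have [K [_ HK]] := compact_bounded cim.
    exists (Num.max 0 (K + 1)) => x; rewrite /Gr patchE le_max; apply/orP.
    case: (boolP (x \in box ab)) => [/set_mem xb|_]; last by left; rewrite normr0.
    by right; apply: HK; [rewrite ltrDl|exists x].
  apply: (iterated_unique mF mG HK) => a b m Aa bB.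
  have psi0 x : ~ box ab x -> pbump a b m x = 0.
    move=> N; have [j Hj] : exists j, ~ (ratr (a j) < x 0 j < ratr (b j)).
      apply: contrapT => N2; apply: N => j; apply: contrapT => N3; apply: N2; exists j => /andP[h1 h2].
      by apply: N3; rewrite (le_trans (Aa j) (ltW h1)) (le_trans (ltW h2) (bB j)).
    exact: pbump0 Hj.
  have tf : test_function c (pbump a b m : 'rV[R]_n -> R).
    split; first exact: C_infty_pbump.
    by exists (box ab); split => //; exact: vab.
  have := ww _ tf; rewrite (wp _ tf) => /oppe_inj E.
  transitivity (lebesgue_integral_n (fun x => (w c (chart_inv c x) 0 i * pbump a b m x)%:E)).
    congr (lebesgue_integral_n _); apply/funext => x; congr (_%:E).
    have [xb|xb] := pselect (box ab x); last by rewrite psi0// !mulr0.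
    by rewrite /F patchE mem_set ?cinvE//; [exact/UI/vab|exact: vab].
  rewrite -E; congr (lebesgue_integral_n _); apply/funext => x; congr (_%:E).
  have [xb|xb] := pselect (box ab x); last by rewrite psi0// !mulr0.
  by rewrite /Gr patchE mem_set.
pose S k : set Rn := if @pickle_inv ({ffun 'I_n -> rat} * {ffun 'I_n -> rat})%type k is Some ab then
  (if pselect (valid ab) then [set x : Rn | (forall i, ratr (ab.1 i) < x 0 i < ratr (ab.2 i)) /\ F x != Gr ab x]
   else set0) else set0.
have HS k : measurable (S k) /\ lebn R n (S k) = 0%E.
  rewrite /S; case: pickle_inv => [ab|]; last by split; [exact: measurable0|exact: measure0].
  by case: pselect => vab; [exact: S0|split; [exact: measurable0|exact: measure0]].
pose Hy : set Rn := [set x | x 0 (Ordinal n_gt0) = 0].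
have mHy : measurable Hy.
  have -> : Hy = (fun x : Rn => x 0 (Ordinal n_gt0)) @^-1` [set 0] by [].
  by rewrite -[X in measurable X]setTI; apply: measurable_coord => //; exact: measurable_set1.
pose Z : set (borel M) := [set p | chart_dom c p /\ w c p 0 i != pd c f p 0 i].
have mZ : measurable Z.
  have -> : Z = chart_dom c `&` (fun p => w c p 0 i - pd c f p 0 i) @^-1` [set~ 0].
    apply/seteqP; split => p [h1 h2]; split => //.
      by move=> /= /eqP; rewrite subr_eq0 (negbTE h2).
    by apply/eqP => e; apply: h2; rewrite /= e subrr.
  apply: (measurable_funB mw (pd_measurable i Ac Cf)); first exact: chart_dom_measurable.
  by apply: measurableC; exact: measurable_set1.
exists Z; split => //; last first.
  by move=> p /= Np; apply: contrapT => NZ; apply: Np => cp; apply/eqP/negPn/negP => h; apply: NZ.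
rewrite (volume_chart M_compact g Ac mZ); last by move=> p [].
rewrite (@ae_eq_integral _ _ _ _ _ (cst 0%E))// ?integral0//.
  apply/measurable_EFinP; apply: measurable_funM; first exact: measurable_cdens0.
  by apply: measurableT_comp (@measurable_cinv _ _ _ c); exact: measurable_indic.
exists (Hy `|` \bigcup_k S k); split.
- by apply: measurableU => //; apply: bigcupT_measurable => k; case: (HS k).
- apply/le_anti/andP; split; last exact: measure_ge0.
  apply: le_trans (measureU2 _ _ _) _ => //; first by apply: bigcupT_measurable => k; case: (HS k).
  rewrite [X in (X + _)%E](@lebn_hyperplane R n (Ordinal n_gt0))// add0e.
  apply: le_trans (measure_sigma_subadditive _ _ _ (@subset_refl _ _)) _ => //.
  + by move=> k; case: (HS k).
  + by apply: bigcupT_measurable => k; case: (HS k).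
  + by rewrite eseries0// => k _ _; case: (HS k).
- move=> x /= Nx; apply: contrapT => Nu; apply: Nx => _.
  have [cx|cx] := pselect (chart_img c x); last by rewrite cdens0N// mul0r.
  have Ux : U x by apply: interior_chart_img => //; apply/eqP => e; apply: Nu; left.
  have [a [b [xab vab]]] := rat_box oU Ux.
  rewrite indicE memNset ?mulr0// => -[_]; rewrite cinvE//; apply/negP/negPn/eqP.
  apply: contrapT => Nw; apply: Nu; right; exists (pickle (a, b)) => //.
  have -> : S (pickle (a, b)) = [set y : Rn | (forall i, ratr (a i) < y 0 i < ratr (b i)) /\ F y != Gr (a, b) y].
    by rewrite /S pickleK_inv; case: pselect.
  split => //.
  rewrite /F /Gr !patchE !mem_set//; last by move=> j; have /andP[/ltW -> /ltW ->] := xab j.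
  by rewrite cinvE//; apply/eqP.
Qed.

(** Each point has a chart neighbourhood with bounded density and image inside a cube; compactness
    leaves finitely many. *)
Lemma volume_fin_num : volume g [set: borel M] \is a fin_num.
Proof.
pose P c (U : set M) := atlas c /\ (volume g (U : set (borel M)) < +oo)%E /\ open U.
have [p|N [f [U [HU cU]]]] := @finite_cover _ _ _ M_compact P.
  have [c Ac cp] := atlas_cover p; set x0 := chart_map c p.
  have cx0 : chart_img c x0 by exact: chart_imgP.
  have /subspace_continuousP/(_ _ cx0) cd := @cdens_continuous _ _ _ g c Ac.
  have cd' : cdens g c x @[x --> within (chart_img c) (nbhs x0)] --> cdens g c x0 := cd.
  have h1 : cdens g c x0 < cdens g c x0 + 1 by rewrite ltrDl.
  move/cvgr_lt : cd' => /(_ _ h1).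
  rewrite near_withinE => /nbhs_ballP[r /= r0 Hr].
  have oB : open (ball x0 r) by exact: ball_open.
  have [V oV VE] := within_continuous_preimage (@chart_map_continuous _ _ _ c) oB.
  have oU : open (chart_dom c `&` chart_map c @^-1` ball x0 r).
    by rewrite VE; apply: openI => //; exact: chart_dom_open.
  exists c, (chart_dom c `&` chart_map c @^-1` ball x0 r); split => //; last first.
    by split => //=; exact: ballxx.
  split => //; split => //.
  have mU : measurable (chart_dom c `&` chart_map c @^-1` ball x0 r : set (borel M)) by exact: borel_open.
  rewrite (volume_chart M_compact g Ac mU); last by move=> q [].
  pose u : 'rV[R]_n := x0 - const_mx r.
  have r20 : 0 <= 2 * r by rewrite mulr_ge0// ltW.
  have [mq lq] := lebn_cubeE u r20.
  set D := cdens g c x0 + 1 in Hr.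
  have D0 : 0 <= D by rewrite addr_ge0// sqrtr_ge0.
  apply: (@le_lt_trans _ _ (\int[lebn R n]_x (D%:E * (\1_(cube u (2 * r)) x)%:E))%E).
    apply: ge0_le_integral => //.
    - by move=> x _; rewrite lee_fin mulr_ge0// cdens0_ge0.
    - apply/measurable_EFinP; apply: measurable_funM; first exact: measurable_cdens0.
      by apply: measurableT_comp (@measurable_cinv _ _ _ c); exact: measurable_indic.
    - by apply: emeasurable_funM => //; apply/measurable_EFinP; exact: measurable_indic.
    - move=> x _; rewrite -EFinM lee_fin.
      have [cx|cx] := pselect (chart_img c x); last by rewrite cdens0N// mul0r mulr_ge0.
      rewrite cinvE// cdens0E// [in X in X <= _]indicE.
      case: (boolP (_ \in _)); rewrite ?mulr0 ?mulr_ge0// => /set_mem[_ /=]; rewrite chart_invK// => bx.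
      rewrite mulr1 indicE mem_set ?mulr1; last first.
        move=> i; rewrite !mxE; have /(rV_ballE _ _ r0)/(_ i) := bx.
        rewrite ltr_distl => /andP[h2 h3]; apply/andP; split; lra.
      exact: ltW (Hr x bx cx).
  rewrite ge0_integralZl//; last by apply/measurable_EFinP; exact: measurable_indic.
  by rewrite lebn_indic// lq -EFinM ltry.
rewrite ge0_fin_numE//; pose U' k : set (borel M) := if insub k is Some i then U i else set0.
have mU' k : measurable (U' k).
  rewrite /U'; case: insub => [i|]; last exact: measurable0.
  by apply: borel_open; case: (HU i) => _ [].
apply: (@le_lt_trans _ _ (\sum_(k < N) volume g (U' k))%E).
  apply: (@content_subadditive _ _ _ (volume g)) => //.
  move=> p _; have [i Ui] := cU p; rewrite -bigcup_mkord; exists (val i) => /=; first exact: ltn_ord.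
  by rewrite /U' insubT//= => ?; rewrite (_ : Sub _ _ = i)//; exact: val_inj.
apply: lte_sum_pinfty => k _; rewrite /U'; case: insub => [i|]; last by rewrite measure0.
by case: (HU i) => _ [].
Qed.

Lemma continuous_bounded (f : M -> R) : continuous f -> exists2 K, 0 <= K & forall p, `|f p| <= K.
Proof.
move=> cf; have cim : compact (f @` [set: M]).
  by apply: continuous_compact M_compact; exact: continuous_subspaceT.
have [K [_ HK]] := compact_bounded cim.
exists (Num.max 0 (K + 1)); first by rewrite le_max lexx.
by move=> p; rewrite le_max; apply/orP; right; apply: HK; [rewrite ltrDl|exists p].
Qed.

Lemma continuous_integrable (f : M -> R) : continuous f ->
  (volume g).-integrable [set: borel M] (fun p => (f p)%:E).
Proof.
move=> cf; have [K K0 HK] := continuous_bounded cf.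
have mf := continuous_measurable cf.
apply/integrableP; split; first exact/measurable_EFinP.
apply: (@le_lt_trans _ _ (\int[volume g]_(p in [set: borel M]) K%:E)%E).
  apply: ge0_le_integral => //.
  - by apply: measurableT_comp => //; exact/measurable_EFinP.
  - by move=> p _; rewrite /= lee_fin.
rewrite integral_cst// lte_mul_pinfty//; have := volume_fin_num.
by rewrite ge0_fin_numE.
Qed.

Lemma C1M_H1 f : C1M f -> H1 g f.
Proof.
move=> Cf; have cf := C1M_continuous Cf; split.
- exact: continuous_measurable.
- have cf2 : continuous (fun p => f p ^+ 2).
    by move=> p; under [X in continuous_at _ X]eq_fun do rewrite expr2; exact: (cvgM (cf p) (cf p)).
  have := integrable_fin_num measurableT (continuous_integrable cf2).
  by rewrite ge0_fin_numE// integral_ge0// => p _; rewrite lee_fin sqr_ge0.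
- exists (gip f f); split; first exact: gip_is_grad_sq.
  by apply: continuous_integrable; exact: gip_continuous.
Qed.

Lemma grad_sq_ae f e : C1M f -> is_grad_sq g f e -> {ae volume g, forall p, e p = gip f f p}.
Proof.
move=> Cf [me [w [Hw He]]].
have [p|N [ch [U [HU cU]]]] := @finite_cover _ _ _ M_compact (fun c U => atlas c /\ U = chart_dom c).
  have [c Ac cp] := atlas_cover p; exists c, (chart_dom c); split => //.
  exact: chart_dom_open.
have Q c : atlas c -> {ae volume g, forall p, chart_dom c p -> e p = gip f f p}.
  move=> Ac; have Hw' := ae_forall_ord (fun i => weak_unique i Ac Cf Hw).
  apply: (ae_mono (ae_and Hw' (He c Ac))) => p [h1 h2] cp.
  have E : w c p = pd c f p by apply/rowP => i; exact: h1.
  by rewrite (h2 cp) E (gipE Ac cp Cf Cf).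
apply: (ae_mono (ae_forall_ord (fun i => Q (ch i) (proj1 (HU i))))) => p Hp.
have [i Ui] := cU p; apply: (Hp i); have [_ <-] := HU i; exact: Ui.
Qed.

(** [gip f f] is an admissible choice, so [xget] returns an admissible one, and all of these agree
    almost everywhere. *)
Lemma grad_sq_spec f : C1M f -> measurable_fun [set: borel M] (grad_sq g f) /\
  {ae volume g, forall p, grad_sq g f p = gip f f p}.
Proof.
move=> Cf; have ex : exists e, is_grad_sq g f e by exists (gip f f); exact: gip_is_grad_sq.
have Hg : is_grad_sq g f (grad_sq g f).
  exact: (@xgetPex {classic (M -> R)} _ [set e | is_grad_sq g f e] ex).
by split; [case: Hg|exact: grad_sq_ae].
Qed.

Lemma integral_grad_sq f : C1M f ->
  (\int[volume g]_p (grad_sq g f p * 1)%:E = \int[volume g]_p (gip f f p)%:E)%E.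
Proof.
move=> Cf; have [mg [N [mN N0 HN]]] := grad_sq_spec Cf.
have mi : measurable_fun [set: borel M] (gip f f).
  by apply: continuous_measurable; exact: gip_continuous.
under eq_integral do rewrite mulr1.
apply: ae_eq_integral => //; [exact/measurable_EFinP|exact/measurable_EFinP|].
by exists N; split => // p Np; apply: HN => /= E; apply: Np => _; rewrite E.
Qed.

End Gradient.

(** * Selection of disjoint annuli *)

Section Greedy.
Context d (T : measurableType d) (R : realType) (m : {measure set T -> \bar R}).
Variables (Y : Type) (ball big : Y -> nat -> set T) (N K : nat).
Hypotheses (m1 : m setT = 1%E) (N0 : (0 < N)%N) (K0 : (0 < K)%N).
(** With N beta = 1 / (2 K), and each choice removing mass at most N beta, at least half of the mass
    remains before each of the K choices. *)
Let beta : R := (2 * N%:R * K%:R)^-1.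
Hypotheses (mball : forall y l, measurable (ball y l)) (mbig : forall y l, measurable (big y l)).
Hypothesis cover0 : exists y, ball y 0%N = setT.
Hypothesis cover : forall y l, exists c : 'I_N -> Y, big y l `<=` \bigcup_i ball (c i) l.+1.
Hypothesis small : exists L, forall y l, (L <= l)%N -> (m (ball y l) < beta%:E)%E.

Let NK0 : 0 < 2 * N%:R * K%:R :> R. Proof. by rewrite !mulr_gt0// ltr0n. Qed.
Let beta0 : 0 < beta. Proof. by rewrite invr_gt0. Qed.

(** Level 0 contains a ball of mass beta in A and fine levels do not, so some level l has one while
    level l + 1 has none. Then the big ball of level l, covered by N balls of level l + 1, has mass
    at most N beta in A. *)
Let step_exists A : measurable A -> ((2^-1)%:E <= m A)%E ->
  exists yl : Y * nat, (beta%:E <= m (ball yl.1 yl.2 `&` A))%E /\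
    (m (A `&` big yl.1 yl.2) <= (N%:R * beta)%:E)%E.
Proof.
move=> mA A2; pose P l := exists y, (beta%:E <= m (ball y l `&` A))%E.
have P0 : P 0%N.
  have [y y0] := cover0; exists y; rewrite y0 setTI; apply: le_trans A2.
  rewrite lee_fin lef_pV2 ?posrE// -mulrA ler_peMr// -natrM ler1n muln_gt0 N0 K0//.
have [L HL] := small.
have [l [Pl NPl]] : exists l, P l /\ ~ P l.+1.
  apply: contrapT => H; have PP l : P l.
    by elim: l => // l IH; apply: contrapT => N'; apply: H; exists l.
  have [y] := PP L; rewrite leNgt => /negP; apply.
  apply: le_lt_trans (HL y L (leqnn L)); apply: le_measure; rewrite ?inE//.
  exact: measurableI.
have [y Hy] := Pl; exists (y, l); split => //=.
have [c Hc] := cover y l.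
have small' i : (m (ball (c i) l.+1 `&` A) <= beta%:E)%E.
  by rewrite leNgt; apply/negP => h; apply: NPl; exists (c i); exact: ltW.
pose D k : set T := if insub k is Some i then ball (c i) l.+1 `&` A else set0.
have mD k : measurable (D k).
  by rewrite /D; case: insub => [i|]; [exact: measurableI|exact: measurable0].
apply: (@le_trans _ _ (\sum_(k < N) m (D k))%E).
  apply: (@content_subadditive _ _ _ m) => //; first exact: measurableI.
  move=> p [Ap /Hc[i _ Bi]]; rewrite -bigcup_mkord; exists (val i) => /=; first exact: ltn_ord.
  by rewrite /D insubT//= => ?; rewrite (_ : Sub _ _ = i)//; exact: val_inj.
apply: (@le_trans _ _ (\sum_(k < N) beta%:E)%E).
  apply: lee_sum => k _; rewrite /D; case: insub => [i|]; first exact: small'.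
  by rewrite measure0 lee_fin ltW.
by rewrite sumEFin sumr_const card_ord mulr_natl lexx.
Qed.

Lemma greedy : exists yl : nat -> Y * nat, forall i, (i < K)%N ->
  (beta%:E <= m (ball (yl i).1 (yl i).2 `\` \bigcup_(j < i) big (yl j).1 (yl j).2))%E.
Proof.
have [y00 _] := cover0.
have sel A : exists yl : Y * nat, measurable A -> ((2^-1)%:E <= m A)%E ->
    (beta%:E <= m (ball yl.1 yl.2 `&` A))%E /\ (m (A `&` big yl.1 yl.2) <= (N%:R * beta)%:E)%E.
  have [[mA A2]|H] := pselect (measurable A /\ ((2^-1)%:E <= m A)%E).
    by have [yl Hyl] := step_exists mA A2; exists yl.
  by exists (y00, 0%N) => mA A2; exfalso; apply: H.
pose F A := projT1 (cid (sel A)).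
have FP A : measurable A -> ((2^-1)%:E <= m A)%E ->
    (beta%:E <= m (ball (F A).1 (F A).2 `&` A))%E /\ (m (A `&` big (F A).1 (F A).2) <= (N%:R * beta)%:E)%E.
  exact: (projT2 (cid (sel A))).
pose A_ := fix A_ i := if i is j.+1 then A_ j `\` big (F (A_ j)).1 (F (A_ j)).2 else setT.
have mA i : measurable (A_ i) by elim: i => [|i IH] /=; [exact: measurableT|exact: measurableD].
have AE i : A_ i = ~` \bigcup_(j < i) big (F (A_ j)).1 (F (A_ j)).2.
  elim: i => [|i IH]; first by rewrite bigcup_mkord big_ord0 setC0.
  change (A_ i.+1) with (A_ i `\` big (F (A_ i)).1 (F (A_ i)).2).
  by rewrite {1}IH !bigcup_mkord big_ord_recr /= setCU setDE.
have Nb : N%:R * beta = (2 * K%:R)^-1.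
  rewrite /beta -mulrA mulrCA invfM mulrA divff ?mul1r//.
  by rewrite pnatr_eq0 -lt0n.
have mass i : (i <= K)%N -> ((1 - i%:R * (2 * K%:R)^-1)%:E <= m (A_ i))%E.
  elim: i => [|i IH] iK; first by rewrite mul0r subr0 /= m1.
  have half : ((2^-1)%:E <= m (A_ i))%E.
    apply: le_trans (IH (ltnW iK)); rewrite lee_fin.
    have KR : 0 < K%:R :> R by rewrite ltr0n.
    have : i%:R * (2 * K%:R)^-1 <= 2^-1 :> R.
      rewrite invfM mulrCA ler_piMr ?invr_ge0// ler_pdivrMr// mul1r ler_nat; exact: ltnW.
    lra.
  have [_ H2] := FP _ (mA i) half.
  have := IH (ltnW iK); rewrite (measureDI m (mA i) (mbig (F (A_ i)).1 (F (A_ i)).2)) => H1.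
  have H3 : ((1 - i%:R * (2 * K%:R)^-1)%:E <= m (A_ i.+1) + (2 * K%:R)^-1%:E)%E.
    by apply: (le_trans H1); rewrite -Nb; apply: leeD.
  rewrite -(@leeD2rE _ (2 * K%:R)^-1%:E)//; apply: le_trans H3.
  by rewrite -EFinD lee_fin -natr1 mulrDl mul1r opprD addrA subrK.
exists (fun i => F (A_ i)) => i iK; rewrite setDE -AE.
apply: (FP _ (mA i) _).1; apply: le_trans (mass i (ltnW iK)); rewrite lee_fin.
have KR : 0 < K%:R :> R by rewrite ltr0n.
have : i%:R * (2 * K%:R)^-1 <= 2^-1 :> R.
  rewrite invfM mulrCA ler_piMr ?invr_ge0// ler_pdivrMr// mul1r ler_nat; exact: ltnW.
lra.
Qed.

End Greedy.

(** * Test functions supported in annuli *)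

Section PosSquare.
Variable R : realType.
Implicit Types t : R.

Definition pos t : R := Num.max t 0.
(** The square makes the truncation of class C^1, so that the cut-offs have classical gradients. *)
Definition pos2 t : R := pos t ^+ 2.

Lemma pos_ge0 t : 0 <= pos t. Proof. by rewrite le_max lexx orbT. Qed.
Lemma pos_id t : 0 <= t -> pos t = t. Proof. by move=> t0; rewrite /pos max_l. Qed.
Lemma pos_le0 t : t <= 0 -> pos t = 0. Proof. by move=> t0; rewrite /pos max_r. Qed.
Lemma pos2_ge0 t : 0 <= pos2 t. Proof. exact: sqr_ge0. Qed.

Lemma pos2_lt1 t : pos2 t < 1 -> t < 1.
Proof.
move=> h; rewrite ltNge; apply/negP => t1; move: h; rewrite ltNge => /negP; apply.
by rewrite /pos2 pos_id ?expr_ge1//; apply: le_trans t1.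
Qed.

Lemma pos_continuous : continuous pos.
Proof. by move=> t; apply: continuous_max; [exact: cvg_id|exact: cvg_cst]. Qed.

Lemma is_derive_pos2 t : is_derive t (1 : R) pos2 (2 * pos t).
Proof.
have [t0|t0|->] := ltgtP t 0.
- rewrite pos_le0 ?ltW// mulr0.
  have fg : \forall s \near t, cst (0 : R) s = pos2 s.
    have : \forall s \near t, s < 0 by exact: lt_nbhsl.
    by apply: filterS => s s0; rewrite /pos2 pos_le0 ?ltW// expr0n.
  exact: near_eq_is_derive fg (is_derive_cst _ _ _).
- rewrite pos_id ?ltW//.
  have fg : \forall s \near t, s * s = pos2 s.
    have : \forall s \near t, 0 < s by exact: lt_nbhsr.
    by apply: filterS => s s0; rewrite /pos2 pos_id ?ltW// expr2.
  have h : is_derive t (1 : R) (fun s : R => s) 1 by exact: is_derive_id.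
  have h2 : is_derive t (1 : R) (fun s : R => s * s) (2 * t).
    apply: (is_derive_eq (is_deriveM h h)).
    by rewrite -[_ *: _]/(_ * _) mulr1 mulr2n mulrDl mul1r.
  exact: near_eq_is_derive fg h2.
- rewrite pos_le0// mulr0.
  have L : (fun h : R => h^-1 *: (pos2 (h *: 1 + 0) - pos2 0)) @ 0^' --> (0 : R).
    apply/cvgrPdist_le => e e0; near=> h.
    have h0 : h != 0 by near: h; exact: nbhs_dnbhs_neq.
    have he : `|h| <= e.
      by near: h; apply: dnbhs0_le.
    rewrite sub0r normrN /pos2 [pos 0]pos_le0// expr0n subr0 addr0 -[h *: 1]/(h * 1) mulr1.
    apply: le_trans he; rewrite -[_ *: _]/(_ * _) normrM normfV ler_pdivrMl ?normr_gt0//.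
    rewrite normrX -expr2 lerXn2r ?nnegrE//.
    by rewrite ger0_norm ?pos_ge0// /pos; case: (leP h 0) => // h1; rewrite gtr0_norm.
  by apply: DeriveDef; [apply/cvg_ex; exists 0; exact: L|exact: (cvg_lim _ L)].
Unshelve. all: by end_near. Qed.

Lemma cauchy_schwarz1 (J : finType) (a b : J -> R) : \sum_j a j ^+ 2 <= 1 ->
  (\sum_j a j * b j) ^+ 2 <= \sum_j b j ^+ 2.
Proof.
move=> a1; set t := \sum_j a j * b j.
have : 2 * (t * t) <= \sum_j (t ^+ 2 * a j ^+ 2 + b j ^+ 2).
  rewrite {2}/t mulr_sumr mulr_sumr; apply: ler_sum => j _.
  have := sqr_ge0 (t * a j - b j); rewrite sqrrB exprMn; lra.
rewrite big_split -mulr_sumr /= => h.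
have : t ^+ 2 * \sum_j a j ^+ 2 <= t ^+ 2 by rewrite ler_piMr// sqr_ge0.
by move: h; rewrite expr2; lra.
Qed.

End PosSquare.

Section TestFunctions.
Variables (R : realType) (n : nat) (M : manifold R n) (I : finType) (phi : I -> M -> R).
Hypothesis phi_C1 : forall l, C1M (phi l).
Variables (y : nat -> I -> R) (s : nat -> R).
Hypothesis s_gt0 : forall j, 0 < s j.

Definition zfun j (p : M) : R := (\sum_l (phi l p - y j l) ^+ 2) / s j ^+ 2.

(** The argument t is a squared distance in units of s_j. For j = i the positive part starts at
    distance s and reaches 1 at distance sqrt 2 s; for the earlier balls it is nonzero within
    distance 4 s and is at least 1 within 2 s. [cutoffD] is the slope times the factor 2 from the
    derivative of [pos2]. *)
Definition cutoff (i j : nat) (t : R) : R := if j == i then t - 1 else (16 - t) / 12.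
Definition cutoffD (i j : nat) : R := if j == i then 2 else - (1 / 6).

Definition annulus i (p : M) : R := \sum_(j < i.+1) pos2 (cutoff i j (zfun j p)).
Definition test_fun i (p : M) : R := pos2 (1 - annulus i p).

Lemma zfun_ge0 j p : 0 <= zfun j p.
Proof. by rewrite divr_ge0 ?sqr_ge0// sumr_ge0// => l _; exact: sqr_ge0. Qed.

Lemma C1M_sum (J : Type) (r : seq J) (f : J -> M -> R) : (forall i, C1M (f i)) ->
  C1M (fun p => \sum_(i <- r) f i p).
Proof. by move=> Cf c Ac p cp; apply: C1_at_sum => i; exact: Cf. Qed.

Lemma C1M_comp (f : M -> R) (h h' : R -> R) : continuous h' ->
  (forall t, is_derive t (1 : R) h (h' t)) -> C1M f -> C1M (fun p => h (f p)).
Proof. by move=> ch hh Cf c Ac p cp; apply: C1_at_comp1 (Cf c Ac p cp). Qed.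

Let sqd (a t : R) : is_derive t (1 : R) (fun t => (t - a) ^+ 2) (2 * (t - a)).
Proof.
have h : is_derive t (1 : R) (fun t => t - a) 1.
  have := @is_deriveB _ _ _ (fun t : R => t) (cst a) t 1 1 0 (is_derive_id _ _) (is_derive_cst _ _ _).
  by rewrite subr0.
have -> : (fun t => (t - a) ^+ 2) = (fun t => (t - a) * (t - a)) by apply/funext => u; rewrite expr2.
apply: (is_derive_eq (is_deriveM h h)).
by rewrite -![_ *: _]/(_ * _) !mulr1 mulr2n mulrDl mul1r.
Qed.

Let sq_cont (a : R) : continuous (fun t : R => 2 * (t - a)).
Proof. by move=> t; exact: (cvgM (cvg_cst (2 : R)) (cvgB cvg_id (cvg_cst a))). Qed.

Lemma zfun_C1 j : C1M (zfun j).
Proof.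
move=> c Ac p cp; apply: C1_atM; last exact: C1_at_cst.
apply: C1_at_sum => l.
by apply: (C1_at_comp1 (h := fun t => (t - y j l) ^+ 2) (@sq_cont _) (@sqd _)); exact: phi_C1.
Qed.

Lemma pd_zfun c p j : atlas c -> chart_dom c p ->
  pd c (zfun j) p = \sum_l (2 * (phi l p - y j l) / s j ^+ 2) *: pd c (phi l) p.
Proof.
move=> Ac cp; have Cl l : C1_at c (fun q => (phi l q - y j l) ^+ 2) p.
  by apply: (C1_at_comp1 (h := fun t => (t - y j l) ^+ 2) (@sq_cont _) (@sqd _)); exact: phi_C1.
rewrite (pdM cp (C1_at_sum _ Cl) (C1_at_cst c p _)) pd_cst// scaler0 add0r pd_sum//.
rewrite scaler_sumr; apply: eq_bigr => l _.
rewrite (pd_comp1 (h := fun t => (t - y j l) ^+ 2) cp (@sq_cont _) (@sqd _)) ?scalerA; last exact: phi_C1.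
by rewrite mulrC.
Qed.

Let cutoff_derive i j t : is_derive t (1 : R) (fun t => pos2 (cutoff i j t)) (pos (cutoff i j t) * cutoffD i j).
Proof.
have h : is_derive t (1 : R) (cutoff i j) (cutoffD i j / 2).
  rewrite /cutoffD; have [ji|ji] := eqVneq j i.
    have -> : cutoff i j = (fun t => t - 1) by apply/funext => u; rewrite /cutoff ji eqxx.
    have := @is_deriveB _ _ _ (fun t : R => t) (cst 1) t 1 1 0 (is_derive_id _ _) (is_derive_cst _ _ _).
    by rewrite subr0 divff.
  have -> : cutoff i j = (fun t => 16 / 12 - 12^-1 * t).
    by apply/funext => u; rewrite /cutoff (negbTE ji) mulrBl [12^-1 * u]mulrC.
  have h1 := @is_deriveZ _ _ _ (fun t : R => t) (12^-1 : R) t 1 1 (is_derive_id _ _).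
  have := @is_deriveB _ _ _ (cst (16 / 12 : R)) _ t 1 0 _ (is_derive_cst _ _ _) h1.
  move/is_derive_eq; apply; rewrite -[_ *: _]/(_ * _); lra.
have := is_derive1_comp (is_derive_pos2 (cutoff i j t)) h.
by move/is_derive_eq; apply; rewrite -?[_ *: _]/(_ * _); lra.
Qed.

Let cutoff_cont i j : continuous (fun t => pos (cutoff i j t) * cutoffD i j).
Proof.
move=> t; have cc : cutoff i j u @[u --> t] --> cutoff i j t.
  rewrite /cutoff; case: ifP => _; first exact: (cvgB cvg_id (cvg_cst (1 : R))).
  exact: (cvgM (cvgB (cvg_cst (16 : R)) cvg_id) (cvg_cst (12^-1 : R))).
have cp : pos (cutoff i j u) @[u --> t] --> pos (cutoff i j t).
  exact: (cvg_comp _ _ cc (@pos_continuous R _)).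
exact: (cvgM cp (cvg_cst (cutoffD i j))).
Qed.

Lemma annulus_C1 i : C1M (annulus i).
Proof.
apply: C1M_sum => j; exact: C1M_comp (@cutoff_cont i j) (@cutoff_derive i j) (@zfun_C1 j).
Qed.

Let outer_derive t : is_derive t (1 : R) (fun t => pos2 (1 - t)) (- 2 * pos (1 - t)).
Proof.
have h : is_derive t (1 : R) (fun u : R => 1 - u) (0 - 1).
  exact: (@is_deriveB _ _ _ (cst (1 : R)) (fun t : R => t) t 1 0 1 (is_derive_cst _ _ _) (is_derive_id _ _)).
have := @is_derive1_comp _ (@pos2 R) (fun u : R => 1 - u) t _ _ (is_derive_pos2 (1 - t)) h.
by move/is_derive_eq; apply; rewrite -?[_ *: _]/(_ * _); lra.
Qed.

Let outer_cont : continuous (fun t : R => - 2 * pos (1 - t)).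
Proof.
move=> t; have cc : (1 - u : R) @[u --> t] --> 1 - t by exact: (cvgB (cvg_cst (1 : R)) cvg_id).
have cp : pos (1 - u) @[u --> t] --> pos (1 - t) by exact: (cvg_comp _ _ cc (@pos_continuous R _)).
exact: (cvgM (cvg_cst (- 2 : R)) cp).
Qed.

Lemma test_fun_C1 i : C1M (test_fun i).
Proof. exact: C1M_comp outer_cont outer_derive (@annulus_C1 i). Qed.

Definition test_coef i p l : R := (- 2 * pos (1 - annulus i p)) *
  \sum_(j < i.+1) (pos (cutoff i j (zfun j p)) * cutoffD i j) * (2 * (phi l p - y j l) / s j ^+ 2).

Lemma pd_test_fun c p i : atlas c -> chart_dom c p ->
  pd c (test_fun i) p = \sum_l test_coef i p l *: pd c (phi l) p.
Proof.
move=> Ac cp.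
rewrite (pd_comp1 (h := fun t => pos2 (1 - t)) cp outer_cont outer_derive (@annulus_C1 i c Ac p cp)).
have Cj (j : 'I_i.+1) : C1_at c (fun q => pos2 (cutoff i j (zfun j q))) p.
  by apply: (C1_at_comp1 (@cutoff_cont i j) (@cutoff_derive i j)); exact: zfun_C1.
rewrite pd_sum//.
under eq_bigr => j _.
  rewrite (pd_comp1 (h := fun t => pos2 (cutoff i j t)) cp (@cutoff_cont i j) (@cutoff_derive i j) (@zfun_C1 j c Ac p cp)).
  rewrite pd_zfun// scaler_sumr; over.
rewrite exchange_big /= scaler_sumr; apply: eq_bigr => l _.
rewrite /test_coef -[RHS]scalerA; congr (_ *: _); rewrite scaler_suml.
by apply: eq_bigr => j _; rewrite scalerA.
Qed.

Lemma test_coef0 i p l : 1 <= annulus i p -> test_coef i p l = 0.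
Proof. by move=> h; rewrite /test_coef pos_le0 ?mulr0 ?mul0r// subr_le0. Qed.

Lemma test_fun0 i p : 1 <= annulus i p -> test_fun i p = 0.
Proof. by move=> h; rewrite /test_fun /pos2 pos_le0 ?expr0n// subr_le0. Qed.

Lemma annulus_term i (j : 'I_i.+1) p : annulus i p < 1 -> cutoff i j (zfun j p) < 1.
Proof.
move=> h; apply: pos2_lt1; apply: le_lt_trans h.
by rewrite /annulus (bigD1 j)//= lerDl sumr_ge0// => k _; exact: pos2_ge0.
Qed.

Lemma annulus_lt2 i p : annulus i p < 1 -> zfun i p < 2.
Proof. by move=> /(annulus_term ord_max); rewrite /cutoff /= eqxx; lra. Qed.

Lemma annulus_gt4 i j p : (j < i)%N -> annulus i p < 1 -> 4 < zfun j p.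
Proof.
move=> ji; have ji' : (j < i.+1)%N by exact: ltnW.
by move=> /(annulus_term (Ordinal ji')); rewrite /cutoff /= ltn_eqF//; lra.
Qed.

(** For i < i', the set of i lies where z_i < 2 and the set of i' where z_i > 4. *)
Lemma annulus_disjoint i i' p : annulus i p < 1 -> annulus i' p < 1 -> i = i'.
Proof.
move=> h h'; have [ii|ii|//] := ltngtP i i'.
  have := lt_trans (annulus_gt4 ii h') (annulus_lt2 h); rewrite ltr_nat; by [].
have := lt_trans (annulus_gt4 ii h) (annulus_lt2 h'); rewrite ltr_nat; by [].
Qed.

Lemma test_fun1 i p : zfun i p < 1 -> (forall j, (j < i)%N -> 16 <= zfun j p) -> test_fun i p = 1.
Proof.
move=> zi zj; rewrite /test_fun (_ : annulus i p = 0) ?subr0 /pos2 ?pos_id ?expr1n//.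
rewrite /annulus big1// => j _; rewrite /pos2 pos_le0 ?expr0n// /cutoff.
case: ifP => [/eqP ->|/negbT ji]; first by rewrite subr_le0 ltW.
have : 16 <= zfun j p by apply: zj; rewrite ltn_neqAle ji -ltnS ltn_ord.
lra.
Qed.

(** The outer derivative contributes (2 pos)^2 <= 4; Cauchy-Schwarz with the weights [al] turns the
    square of the sum over j into a sum of squares, where only the j with al_j > 0 count. *)
Lemma test_coef_bound i p : annulus i p < 1 ->
  \sum_l test_coef i p l ^+ 2 <= 128 * \sum_(j < i.+1) ((zfun j p < 16)%R : bool)%:R / s j ^+ 2.
Proof.
move=> h; pose al (j : 'I_i.+1) := pos (cutoff i j (zfun j p)).
have al1 : \sum_j al j ^+ 2 <= 1 by exact: ltW.
pose X l (j : 'I_i.+1) : R := if 0 < al j then cutoffD i j * (2 * (phi l p - y j l) / s j ^+ 2) else 0.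
have coefE l : test_coef i p l = (- 2 * pos (1 - annulus i p)) * \sum_j al j * X l j.
  rewrite /test_coef; congr (_ * _); apply: eq_bigr => j _; rewrite /X -/(al j).
  have [aj|] := boolP (0 < al j); first by rewrite -mulrA.
  rewrite -leNgt => aj; have -> : al j = 0 by apply/le_anti; rewrite aj pos_ge0.
  by rewrite !mul0r.
have p1 : pos (1 - annulus i p) ^+ 2 <= 1.
  have an0 : 0 <= annulus i p by apply: sumr_ge0 => j _; exact: pos2_ge0.
  rewrite exprn_ile1// ?pos_ge0// /pos ge_max ler01 andbT; lra.
apply: (@le_trans _ _ (\sum_l 4 * \sum_j X l j ^+ 2)).
  apply: ler_sum => l _; rewrite coefE.
  have -> (P S : R) : (- 2 * P * S) ^+ 2 = 4 * (P ^+ 2 * S ^+ 2) by ring.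
  rewrite ler_pM2l//; apply: le_trans (cauchy_schwarz1 _ al1).
  by rewrite ler_piMl ?sqr_ge0.
rewrite -mulr_sumr exchange_big /= mulr_sumr [leRHS]mulr_sumr; apply: ler_sum => j _.
have [aj|aj] := ltP 0 (al j); last first.
  rewrite big1 ?mulr0; last by move=> l _; rewrite /X ltNge aj /= expr0n.
  by rewrite mulr_ge0// divr_ge0// sqr_ge0.
have sj := s_gt0 j; have sj2 : 0 < s j ^+ 2 by rewrite exprn_gt0.
have -> : \sum_l X l j ^+ 2 = cutoffD i j ^+ 2 * (4 * zfun j p / s j ^+ 2).
  have -> : cutoffD i j ^+ 2 * (4 * zfun j p / s j ^+ 2) =
      (cutoffD i j ^+ 2 * 4 / s j ^+ 4) * \sum_l (phi l p - y j l) ^+ 2.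
    by rewrite /zfun; field; rewrite gt_eqF.
  by rewrite mulr_sumr; apply: eq_bigr => l _; rewrite /X aj; field; rewrite gt_eqF.
have cut0 : 0 < cutoff i j (zfun j p).
  by rewrite ltNge; apply/negP => cN; move: aj; rewrite /al pos_le0// ltxx.
have z0 := zfun_ge0 j p.
(* For j = i the slope squared is 4 and z < 2, giving 32; for j < i it is 1/36 and z < 16, giving
   less than 2. Together with the outer factor 4 this makes 128. *)
have zbound : cutoffD i j ^+ 2 * (4 * zfun j p) <= 32 /\ zfun j p < 16.
  have := annulus_term j h; move: cut0; rewrite /cutoff /cutoffD; case: ifP => _ c0 c1; lra.
have [zb z16] := zbound; rewrite z16 mul1r.
rewrite mulrA mulrA ler_pM2r ?invr_gt0// -mulrA; lra.
Qed.

End TestFunctions.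

(** * An upper bound for the extremal eigenvalues *)

Section GridCover.
Variables (R : realType) (I : finType).

Local Notation grid := {ffun I -> 'I_(8 * #|I|.+1)}.
Definition grid_size : nat := #|{: grid}|.

Lemma grid_size_gt0 : (0 < grid_size)%N.
Proof. by rewrite /grid_size card_ffun card_ord expn_gt0 muln_gt0. Qed.

(** On each axis the interval of length 8 s around y is divided into 8 (#|I| + 1) cells of
    half-length de. The point of a cell is within #|I| de^2 < (s / 2)^2 of its centre in squared
    distance. *)
Lemma grid_cover (y : I -> R) (s : R) : 0 < s -> exists c : 'I_grid_size -> I -> R,
  forall x : I -> R, \sum_l (x l - y l) ^+ 2 < 16 * s ^+ 2 ->
    exists i, \sum_l (x l - c i l) ^+ 2 < (s / 2) ^+ 2.
Proof.
move=> s0; pose D : R := #|I|.+1%:R; have D0 : 0 < D by rewrite ltr0n.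
pose de := s / (2 * D); have de0 : 0 < de by rewrite divr_gt0// mulr_gt0.
have deD : 2 * D * de = s by rewrite /de mulrC divfK// gt_eqF// mulr_gt0.
exists (fun i l => y l - 4 * s + (2 * ((enum_val i : grid) l : nat)%:R + 1) * de) => x Hx.
pose t l := (x l - y l + 4 * s) / (2 * de).
have tE l : t l * (2 * de) = x l - y l + 4 * s by rewrite divfK// gt_eqF// mulr_gt0.
have small l : - (4 * s) < x l - y l < 4 * s.
  have h : (x l - y l) ^+ 2 < 16 * s ^+ 2.
    by apply: le_lt_trans Hx; rewrite (bigD1 l)//= lerDl sumr_ge0// => j _; exact: sqr_ge0.
  rewrite -ltr_norml -(@ltr_pXn2r _ 2)// ?nnegrE ?normr_ge0 ?mulr_ge0 ?ltW//.
  by rewrite real_normK ?num_real// exprMn -natrX; apply: lt_le_trans h _.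
have t0 l : 0 <= t l.
  have /andP[h _] := small l; have h' : 0 <= x l - y l + 4 * s by lra.
  by rewrite divr_ge0// mulr_ge0// ltW.
have tD l : (Num.truncn (t l) < 8 * #|I|.+1)%N.
  have h : t l < 8 * D.
    have de2 : 0 < 2 * de by rewrite mulr_gt0.
    rewrite ltr_pdivrMr//; have -> : 8 * D * (2 * de) = 8 * s by rewrite -deD; ring.
    by have /andP[_ h] := small l; lra.
  by rewrite truncn_lt_nat// natrM.
exists (enum_rank ([ffun l => Ordinal (tD l)] : grid)).
apply: (@le_lt_trans _ _ (\sum_(l : I) de ^+ 2)).
  apply: ler_sum => l _; rewrite enum_rankK ffunE /=.
  have /andP[k1 k2] := truncn_itv (t0 l); rewrite -natr1 in k2.
  have -> : x l - (y l - 4 * s + (2 * (Num.truncn (t l))%:R + 1) * de) =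
      (2 * (t l - (Num.truncn (t l))%:R) - 1) * de.
    transitivity (x l - y l + 4 * s - (2 * (Num.truncn (t l))%:R + 1) * de); first by ring.
    by rewrite -tE; ring.
  rewrite exprMn ler_piMl ?sqr_ge0// -real_normK ?num_real// exprn_ile1// ler_norml; lra.
have cD : #|(xpredT : pred I)|%:R = D - 1 by rewrite /D -natr1 addrK.
rewrite sumr_const -[X in X < _]mulr_natl cD /de; have -> : (D - 1) * (s / (2 * D)) ^+ 2 = (s / 2) ^+ 2 * ((D - 1) / D ^+ 2).
  by field; rewrite gt_eqF.
rewrite gtr_pMr ?exprn_gt0 ?divr_gt0// ltr_pdivrMr ?exprn_gt0// mul1r.
have : 1 <= D by rewrite ler1n.
by move=> D1; have := sqr_ge0 (D - 1); rewrite sqrrB; lra.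
Qed.

End GridCover.

Lemma sum_sqr_disjoint (R : realType) (J : finType) (x : J -> R) :
  (forall i j, x i != 0 -> x j != 0 -> i = j) -> (\sum_i x i) ^+ 2 = \sum_i x i ^+ 2.
Proof.
move=> H; have [[i xi]|N] := pselect (exists i, x i != 0).
  rewrite (bigD1 i)//= [RHS](bigD1 i)//= !big1 ?addr0//.
    by move=> j ji; apply/eqP; rewrite sqrf_eq0; apply: contraNT ji => xj; rewrite (H j i xj xi).
  by move=> j ji; apply/eqP; apply: contraNT ji => xj; rewrite (H j i xj xi).
have x0 i : x i = 0 by apply/eqP/negP => /negP xi; apply: N; exists i.
by rewrite !big1// => [|i _]; rewrite ?x0 expr0n.
Qed.

Section UpperBound.
Variables (R : realType) (n : nat) (M : manifold R n) (g : metric M).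
Hypotheses (M_compact : compact [set: M]) (n_gt0 : (0 < n)%N).
Variables (I : finType) (phi : I -> M -> R).
Hypothesis phi_C1 : forall l, C1M (phi l).
Hypothesis gform_combination : forall c p (u : M -> R) (a : I -> R), atlas c -> chart_dom c p ->
  pd c u p = \sum_l a l *: pd c (phi l) p -> gform g c u u p <= \sum_l a l ^+ 2.
Variable E : R.
Hypothesis E_gt0 : 0 < E.
Hypothesis volume_ball : forall (y : I -> R) s, 0 < s ->
  (volume g [set p | (\sum_l (phi l p - y l) ^+ 2 < s ^+ 2)%R] <= (E * s ^+ 2)%:E)%E.
Hypothesis volume1 : volume g [set: borel M] = 1%E.

Lemma measurable_ltC (f : M -> R) (t : R) : continuous f ->
  measurable ([set p | f p < t] : set (borel M)).
Proof.
move=> cf; apply: sub_sigma_algebra; change (open (f @^-1` [set x : R | x < t])).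
by apply: open_comp; [move=> p _; exact: cf|exact: open_lt].
Qed.

Let measurable_leC (f : M -> R) (t : R) : continuous f ->
  measurable ([set p | t <= f p] : set (borel M)).
Proof.
move=> cf; rewrite (_ : [set _ | _] = ~` [set p | f p < t]).
  by apply: measurableC; exact: measurable_ltC.
by apply/seteqP; split=> p /=; rewrite leNgt => /negP.
Qed.

Section Fixed.
Variables (y : nat -> I -> R) (s : nat -> R).
Hypothesis s_gt0 : forall j, 0 < s j.
Local Notation z j := (zfun phi y s j).
Local Notation test i := (test_fun phi y s i).

(** An explicit majorant of the squared gradient of cut-off i. The first indicator keeps the
    majorants disjointly supported, the others are indicators of balls of radius 4 s_j. *)
Definition energy i : M -> R := fun p => \1_[set q | annulus phi y s i q < 1] p *
  (128 * \sum_(j < i.+1) \1_[set q | z j q < 16] p / s j ^+ 2).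

Definition core i : set (borel M) := [set p | z i p < 1 /\ forall j, (j < i)%N -> 16 <= z j p].

Let cz j : continuous (z j). Proof. by apply: C1M_continuous; exact: zfun_C1. Qed.
Let can j : continuous (annulus phi y s j). Proof. by apply: C1M_continuous; exact: annulus_C1. Qed.

Lemma measurable_core i : measurable (core i).
Proof.
rewrite (_ : core i = [set p | z i p < 1] `&` \bigcap_(j in [set j | (j < i)%N]) [set p | 16 <= z j p]).
  apply: measurableI; first exact: measurable_ltC.
  by apply: bigcap_measurableType => j _; exact: measurable_leC.
by apply/seteqP; split.
Qed.

Lemma measurable_energy i : measurable_fun [set: borel M] (energy i).
Proof.
apply: measurable_funM; first by apply: measurable_indic; exact: measurable_ltC.
apply: measurable_funM; first exact: measurable_cst.
apply: measurable_sum => j; apply: measurable_funM; last exact: measurable_cst.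
by apply: measurable_indic; exact: measurable_ltC.
Qed.

Lemma energy_ge0 i p : 0 <= energy i p.
Proof.
rewrite !mulr_ge0 ?indicE ?ler0n// sumr_ge0// => j _.
by rewrite mulr_ge0 ?indicE ?ler0n// invr_ge0 sqr_ge0.
Qed.

Let indicb (b : M -> bool) p : \1_[set q | b q] p = (b p)%:R :> R.
Proof. by rewrite indicE; congr (_%:R); congr nat_of_bool; apply/idP/idP; rewrite in_setE. Qed.

Lemma test_coef_energy i p : \sum_l test_coef phi y s i p l ^+ 2 <= energy i p.
Proof.
have [h|h] := ltP (annulus phi y s i p) 1; last first.
  by rewrite big1 ?energy_ge0// => l _; rewrite test_coef0// expr0n.
rewrite /energy indicb h mul1r; apply: le_trans (test_coef_bound s_gt0 h) _.
by under [X in _ <= _ * X]eq_bigr do rewrite indicb.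
Qed.

(** At most one i contributes at a given point, so the double sum is bounded by a single sum over j.
    Its term j is the volume of a ball of radius 4 s_j over s_j^2, at most 16 E; and 2048 = 128 *
    16. *)
Lemma sum_energy K : (\sum_(i < K) \int[volume g]_p (energy i p)%:E <= (2048 * E * K%:R)%:E)%E.
Proof.
rewrite -ge0_integral_sum//; last 2 first.
- by move=> i; apply/measurable_EFinP; exact: measurable_energy.
- by move=> i p _; rewrite lee_fin energy_ge0.
pose F p : R := 128 * \sum_(j < K) \1_[set q | z j q < 16] p / s j ^+ 2.
have mterm j : measurable_fun [set: borel M] (fun p => \1_[set q | z j q < 16] p / s j ^+ 2 : R).
  apply: measurable_funM; last exact: measurable_cst.
  by apply: measurable_indic; exact: measurable_ltC.
have term0 j p : 0 <= \1_[set q | z j q < 16] p / s j ^+ 2 :> R.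
  by rewrite mulr_ge0 ?indicE ?ler0n// invr_ge0 sqr_ge0.
have F0 p : 0 <= F p by rewrite mulr_ge0// sumr_ge0.
apply: (@le_trans _ _ (\int[volume g]_p (F p)%:E)%E).
  apply: ge0_le_integral => //.
  - by move=> p _; rewrite sume_ge0// => i _; rewrite lee_fin energy_ge0.
  - by apply: emeasurable_sum => i; apply/measurable_EFinP; exact: measurable_energy.
  - by apply/measurable_EFinP; apply: measurable_funM; [exact: measurable_cst|exact: measurable_sum].
  move=> p _; rewrite sumEFin lee_fin.
  (* For the only active index i, the sum over j <= i is completed to a sum over all j < K. *)
  have [[i ip]|N] := pselect (exists i : 'I_K, annulus phi y s i p < 1); last first.
    rewrite big1 ?F0// => i _; rewrite /energy indicb ltNge.
    by case: leP => [_|h]; [rewrite mul0r|exfalso; apply: N; exists i].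
  rewrite (bigD1 i)//= big1 ?addr0 => [|j ji]; last first.
    rewrite /energy indicb ltNge; case: leP => [_|h]; first by rewrite mul0r.
    by move: ji; rewrite -(inj_eq val_inj) /= (annulus_disjoint h ip) eqxx.
  rewrite /energy indicb ip mul1r ler_pM2l//.
  rewrite -(big_mkord xpredT (fun j => \1_[set q | z j q < 16] p / s j ^+ 2 : R)).
  rewrite -[leRHS](big_mkord xpredT (fun j => \1_[set q | z j q < 16] p / s j ^+ 2 : R)).
  by rewrite [leRHS](@big_cat_nat _ _ _ i.+1)//= lerDl sumr_ge0.
rewrite /F; under eq_integral do rewrite EFinM -sumEFin.
rewrite ge0_integralZl_EFin//; last 2 first.
- by move=> p _; rewrite sume_ge0// => j _; rewrite lee_fin.
- by apply: emeasurable_sum => j; apply/measurable_EFinP.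
rewrite ge0_integral_sum//; last 2 first.
- by move=> j; apply/measurable_EFinP.
- by move=> j p _; rewrite lee_fin.
apply: (@le_trans _ _ (128%:E * \sum_(j < K) (16 * E)%:E)%E); last first.
  by rewrite sumEFin sumr_const card_ord -EFinM lee_fin -mulr_natr; lra.
apply: lee_wpmul2l; first by rewrite lee_fin.
apply: lee_sum => j _; have sj := s_gt0 j; have sj2 : 0 < s j ^+ 2 by rewrite exprn_gt0.
under eq_integral do rewrite mulrC EFinM.
rewrite ge0_integralZl_EFin//; last 2 first.
- by apply/measurable_EFinP; apply: measurable_indic; exact: measurable_ltC.
- by rewrite invr_ge0 ltW.
rewrite integral_indic ?setIT//; last exact: measurable_ltC.
apply: (@le_trans _ _ ((s j ^- 2)%:E * (E * (4 * s j) ^+ 2)%:E)%E); last first.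
  by rewrite -EFinM lee_fin le_eqVlt; apply/orP; left; apply/eqP; field; rewrite gt_eqF.
apply: lee_wpmul2l; first by rewrite lee_fin invr_ge0 ltW.
have s4 : 0 < 4 * s j by rewrite mulr_gt0.
apply: le_trans (volume_ball (y j) s4); rewrite le_eqVlt; apply/orP; left; apply/eqP.
congr (volume g _); apply/seteqP; split => p /=.
  by rewrite /zfun ltr_pdivrMr// exprMn -natrX.
by rewrite /zfun ltr_pdivrMr// exprMn -natrX.
Qed.

Variables (rho : M -> R) (rho_dens : density rho).

Let crho : continuous rho. Proof. by case: rho_dens. Qed.
Let rho0 p : 0 < rho p. Proof. by case: rho_dens. Qed.
Let mrho : measurable_fun [set: borel M] rho. Proof. exact: continuous_measurable. Qed.

Section Span.
Variables (m : nat) (f : 'I_m -> nat) (B b : R).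
Hypotheses (f_inj : injective f) (B_ge0 : 0 <= B) (b_gt0 : 0 < b).
Hypothesis energyB : forall i, (\int[volume g]_p (energy (f i) p)%:E <= B%:E)%E.
Hypothesis coreb : forall i, (b%:E <= \int[volume g]_p (rho p * \1_(core (f i)) p)%:E)%E.
Variable a : 'I_m -> R.
Let u p := \sum_i a i * test (f i) p.
Let A := \sum_i a i ^+ 2.
Let A_ge0 : 0 <= A. Proof. by apply: sumr_ge0 => i _; exact: sqr_ge0. Qed.

Lemma span_C1 : C1M u.
Proof.
apply: C1M_sum => i c Ac p cp; apply: C1_atM; first exact: C1_at_cst.
exact: (test_fun_C1 phi_C1 y s (f i)).
Qed.

(** The coefficients of du on the d phi_l are sums over i with at most one nonzero term at each
    point, so no cross terms appear. *)
Lemma span_gip p : gip g u u p <= \sum_i a i ^+ 2 * energy (f i) p.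
Proof.
have [c Ac cp] := atlas_cover p; rewrite (gipE g Ac cp span_C1 span_C1).
have Ct i : C1_at c (test (f i)) p by exact: (test_fun_C1 phi_C1 y s (f i) Ac cp).
have pdu : pd c u p = \sum_l (\sum_i a i * test_coef phi y s (f i) p l) *: pd c (phi l) p.
  rewrite /u pd_sum//; last by move=> i; apply: C1_atM; [exact: C1_at_cst|exact: Ct].
  under [RHS]eq_bigr do rewrite scaler_suml.
  rewrite exchange_big /=; apply: eq_bigr => i _.
  rewrite pdZ// (pd_test_fun phi_C1 y s (f i) Ac cp) scaler_sumr.
  by apply: eq_bigr => l _; rewrite scalerA.
apply: le_trans (gform_combination Ac cp pdu) _.
have -> : \sum_l (\sum_i a i * test_coef phi y s (f i) p l) ^+ 2 =
    \sum_l \sum_i a i ^+ 2 * test_coef phi y s (f i) p l ^+ 2.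
  apply: eq_bigr => l _; rewrite sum_sqr_disjoint.
    by apply: eq_bigr => i _; rewrite exprMn.
  have N i : a i * test_coef phi y s (f i) p l != 0 -> annulus phi y s (f i) p < 1.
    by move=> h; rewrite ltNge; apply: contra h => h; rewrite test_coef0// mulr0.
  by move=> i j /N hi /N hj; apply: f_inj; exact: annulus_disjoint hi hj.
rewrite exchange_big /=; apply: ler_sum => i _; rewrite -mulr_sumr.
by apply: ler_wpM2l (test_coef_energy _ _); exact: sqr_ge0.
Qed.

(** Disjoint supports remove the cross terms, and each cut-off equals 1 on its core. *)
Lemma span_sqr p : \sum_i a i ^+ 2 * (rho p * \1_(core (f i)) p) <= u p ^+ 2 * rho p.
Proof.
rewrite /u sum_sqr_disjoint; last first.
  have N i : a i * test (f i) p != 0 -> annulus phi y s (f i) p < 1.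
    by move=> h; rewrite ltNge; apply: contra h => h; rewrite test_fun0// mulr0.
  by move=> i j /N hi /N hj; apply: f_inj; exact: annulus_disjoint hi hj.
rewrite mulr_suml; apply: ler_sum => i _; rewrite exprMn -[leRHS]mulrA.
apply: ler_wpM2l; first exact: sqr_ge0.
rewrite mulrC; apply: ler_wpM2r; first exact: ltW.
rewrite indicE; case: (boolP (p \in _)) => [|_]; last exact: sqr_ge0.
by rewrite in_setE => -[z1 z16]; rewrite test_fun1// expr1n.
Qed.

Lemma span_energy : (\int[volume g]_p (gip g u u p)%:E <= (B * A)%:E)%E.
Proof.
have mterm i : measurable_fun [set: borel M] (fun p => a i ^+ 2 * energy (f i) p).
  by apply: measurable_funM; [exact: measurable_cst|exact: measurable_energy].
have term0 i p : 0 <= a i ^+ 2 * energy (f i) p by rewrite mulr_ge0 ?sqr_ge0 ?energy_ge0.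
apply: (@le_trans _ _ (\int[volume g]_p (\sum_i (a i ^+ 2 * energy (f i) p)%:E))%E).
  apply: ge0_le_integral => //.
  - by move=> p _; rewrite lee_fin gip_ge0//; exact: span_C1.
  - apply/measurable_EFinP; apply: continuous_measurable; apply: gip_continuous; exact: span_C1.
  - by apply: emeasurable_sum => i; apply/measurable_EFinP.
  by move=> p _; rewrite sumEFin lee_fin span_gip.
rewrite ge0_integral_sum//; last 2 first.
- by move=> i; apply/measurable_EFinP.
- by move=> i p _; rewrite lee_fin.
rewrite /A mulr_sumr -sumEFin; apply: lee_sum => i _.
under eq_integral do rewrite EFinM.
rewrite ge0_integralZl_EFin ?sqr_ge0//; last 2 first.
- by move=> p _; rewrite lee_fin energy_ge0.
- by apply/measurable_EFinP; exact: measurable_energy.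
by rewrite [B * _]mulrC [(_ * B)%:E]EFinM; apply: lee_wpmul2l; rewrite ?lee_fin ?sqr_ge0.
Qed.

Lemma span_mass : ((b * A)%:E <= \int[volume g]_p (u p ^+ 2 * rho p)%:E)%E.
Proof.
have cu : continuous u by exact: C1M_continuous span_C1.
have mcore i : measurable_fun [set: borel M] (fun p => rho p * \1_(core (f i)) p).
  by apply: measurable_funM => //; apply: measurable_indic; exact: measurable_core.
have core0 i p : 0 <= rho p * \1_(core (f i)) p by rewrite mulr_ge0 ?indicE ?ler0n// ltW.
have mterm i : measurable_fun [set: borel M] (fun p => a i ^+ 2 * (rho p * \1_(core (f i)) p)).
  by apply: measurable_funM => //; exact: measurable_cst.
have term0 i p : 0 <= a i ^+ 2 * (rho p * \1_(core (f i)) p) by rewrite mulr_ge0 ?sqr_ge0.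
apply: (@le_trans _ _ (\int[volume g]_p (\sum_i (a i ^+ 2 * (rho p * \1_(core (f i)) p))%:E))%E); last first.
  apply: ge0_le_integral => //.
  - by move=> p _; rewrite sume_ge0// => i _; rewrite lee_fin.
  - by apply: emeasurable_sum => i; apply/measurable_EFinP.
  - apply/measurable_EFinP; apply: measurable_funM => //; apply: measurable_funX.
    exact: continuous_measurable.
  by move=> p _; rewrite sumEFin lee_fin span_sqr.
rewrite ge0_integral_sum//; last 2 first.
- by move=> i; apply/measurable_EFinP.
- by move=> i p _; rewrite lee_fin.
rewrite /A mulr_sumr -sumEFin; apply: lee_sum => i _.
under eq_integral do rewrite EFinM.
rewrite ge0_integralZl_EFin ?sqr_ge0//; last 2 first.
- by move=> p _; rewrite lee_fin.
- by apply/measurable_EFinP.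
by rewrite [b * _]mulrC [(_ * b)%:E]EFinM; apply: lee_wpmul2l; rewrite ?lee_fin ?sqr_ge0.
Qed.

(** If u vanishes almost everywhere, the lower bound b A for its weighted mass forces the sum A of
    squared coefficients to vanish. *)
Lemma span_ae0 : ae0 g u -> forall i, a i = 0.
Proof.
move=> [N [mN N0 HN]]; have cu : continuous u by exact: C1M_continuous span_C1.
have mu2 : measurable_fun [set: borel M] (fun p => (u p ^+ 2 * rho p)%:E).
  apply/measurable_EFinP; apply: measurable_funM => //; apply: measurable_funX.
  exact: continuous_measurable.
have I0 : (\int[volume g]_p (u p ^+ 2 * rho p)%:E = 0)%E.
  rewrite (@ae_eq_integral _ _ _ _ _ (cst 0%E))// ?integral0//.
  exists N; split => // p Np; apply: HN => up; apply: Np => _.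
  by rewrite up expr0n mul0r.
have := span_mass; rewrite I0 lee_fin pmulr_rle0// => A0 i.
apply/eqP; rewrite -sqrf_eq0; apply/eqP/le_anti; rewrite sqr_ge0 andbT.
by apply: le_trans A0; rewrite /A (bigD1 i)//= lerDl sumr_ge0// => j _; exact: sqr_ge0.
Qed.

Lemma span_rayleigh : ~ ae0 g u -> (rayleigh g rho (fun=> 1%R) u <= (B / b)%:E)%E.
Proof.
move=> u0; have cu : continuous u by exact: C1M_continuous span_C1.
have A0 : 0 < A.
  rewrite lt_def A_ge0 andbT; apply: contra_notN u0 => /eqP A0; exists set0; split => //.
  move=> p; apply; rewrite /= /u big1// => i _.
  have ai : a i ^+ 2 <= 0.
    by rewrite -A0 /A (bigD1 i)//= lerDl sumr_ge0// => j _; exact: sqr_ge0.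
  have /eqP : a i ^+ 2 = 0 by apply/le_anti; rewrite ai sqr_ge0.
  by rewrite sqrf_eq0 => /eqP ->; rewrite mul0r.
rewrite /rayleigh integral_grad_sq//; last exact: span_C1.
have cu2 : continuous (fun p => u p ^+ 2 * rho p).
  move=> p; apply: cvgM; last exact: crho.
  under [X in X @ _ --> _]eq_fun do rewrite expr2; rewrite expr2; exact: (cvgM (cu p) (cu p)).
have fin := integrable_fin_num measurableT (continuous_integrable g M_compact cu2).
have := span_mass; rewrite -(fineK fin) lee_fin; set d := fine _ => bd.
have d0 : 0 < d by apply: lt_le_trans bd; rewrite mulr_gt0.
rewrite inver gt_eqF//.
apply: (@le_trans _ _ ((B * A)%:E * (d^-1)%:E)%E).
  by apply: lee_wpmul2r; [rewrite lee_fin invr_ge0 ltW|exact: span_energy].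
rewrite -EFinM lee_fin ler_pdivrMr// mulrAC ler_pdivlMr//.
by rewrite -!mulrA; apply: ler_wpM2l => //; rewrite mulrC.
Qed.

End Span.

Lemma mu_le_span m (f : 'I_m.+1 -> nat) (B b : R) : injective f -> 0 <= B -> 0 < b ->
  (forall i, (\int[volume g]_p (energy (f i) p)%:E <= B%:E)%E) ->
  (forall i, (b%:E <= \int[volume g]_p (rho p * \1_(core (f i)) p)%:E)%E) ->
  (mu g m rho (fun=> 1%R) <= (B / b)%:E)%E.
Proof.
move=> f_inj B0 b0 HB Hb.
pose V := [set u | exists a : 'I_m.+1 -> R, u = (fun p => \sum_(i < m.+1) a i * test (f i) p)].
apply: (@le_trans _ _ (ereal_sup [set rayleigh g rho (fun=> 1%R) u | u in V `\` ae0 g])).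
  apply: ereal_inf_lbound; exists V => //; exists (fun i => test (f i)); split => //.
    by move=> i; apply: C1M_H1 => //; exact: test_fun_C1.
  by move=> a; exact: span_ae0 b0 Hb _.
apply: ge_ereal_sup => _ [_ [[a ->] a0] <-].
exact: (span_rayleigh f_inj B0 b0 HB Hb a0).
Qed.

End Fixed.

(** The greedy choice for the measure with density [rho], with balls centred at arbitrary points of
    the ambient space and radii halved from one level to the next. The balls [big] have radius four
    times larger, which matches the definition of [core]. *)
Lemma select_balls (rho : M -> R) (K : nat) : density rho -> (0 < K)%N ->
  (\int[volume g]_p (rho p)%:E = 1)%E ->
  exists (y : nat -> I -> R) (s : nat -> R), (forall j, 0 < s j) /\
    forall i, (i < K)%N -> (((2 * (grid_size I)%:R * K%:R)^-1)%:E <=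
      \int[volume g]_p (rho p * \1_(core y s i) p)%:E)%E.
Proof.
move=> [crho rho0] K0 rho1; set N := grid_size I.
have mrho : measurable_fun [set: borel M] rho by exact: continuous_measurable.
have [v [vE _]] := density_measure (volume g) mrho (fun p => ltW (rho0 p)).
pose z (y : I -> R) (s : R) : M -> R := zfun phi (fun=> y) (fun=> s) 0%N.
have cz y s : continuous (z y s) by apply: C1M_continuous; exact: zfun_C1.
have [A A0 HA] := continuous_bounded M_compact (cz (fun=> 0) 1).
have [B B0 HB] := continuous_bounded M_compact crho.
(* A bounds the squared norm of the embedding, so the ball of radius A + 1 around the origin has all
   of M as preimage. *)
pose rad l : R := (A + 1) / 2 ^+ l; have rad0 l : 0 < rad l by rewrite divr_gt0 ?exprn_gt0//; lra.
have zlt (y : I -> R) s t p : 0 < s -> (z y s p < t) = (\sum_l (phi l p - y l) ^+ 2 < t * s ^+ 2).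
  by move=> s0; rewrite /z /zfun ltr_pdivrMr// exprn_gt0.
pose ball y l : set (borel M) := [set p | z y (rad l) p < 1].
pose big y l : set (borel M) := [set p | z y (rad l) p < 16].
have beta0 : 0 < (2 * N%:R * K%:R)^-1 :> R.
  by rewrite invr_gt0 !mulr_gt0 ?ltr0n// grid_size_gt0.
have [||||||yl Hyl] := @greedy _ _ _ v _ ball big N K _ (grid_size_gt0 I) K0.
- by rewrite vE.
- by move=> y l; exact: measurable_ltC.
- by move=> y l; exact: measurable_ltC.
- exists (fun=> 0); apply/seteqP; split => // p _; rewrite /ball /= zlt// mul1r /rad expr0 divr1.
  have := HA p; rewrite /z /zfun expr1n divr1 => h; have {h} := le_trans (ler_norm _) h => h.
  by apply: (le_lt_trans h); nra.
- move=> y l; have [c Hc] := grid_cover y (rad0 l); exists c => p; rewrite /big /= zlt// => /Hc[i Hi].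
  have radS : rad l.+1 = rad l / 2 by rewrite /rad exprSr invfM mulrA.
  by exists i => //; rewrite /ball /= zlt// mul1r radS.
(* A ball of level l has mass at most B E (A + 1)^2 / 4^l, where B bounds [rho]; this is below beta
   as soon as 2^l exceeds the displayed number. *)
- exists (Num.truncn (B * E * (A + 1) ^+ 2 * (2 * N%:R * K%:R))) => y l Ll.
  apply: (@le_lt_trans _ _ (B%:E * volume g (ball y l))%E).
    rewrite vE -integral_cst; last exact: measurable_ltC.
    apply: ge0_le_integral => //.
    + exact: measurable_ltC.
    + by move=> p _; rewrite lee_fin ltW.
    + by apply/measurable_EFinP; apply: measurable_funTS.
    by move=> p _; rewrite lee_fin; exact: le_trans (ler_norm _) (HB p).
  apply: (@le_lt_trans _ _ (B%:E * (E * rad l ^+ 2)%:E)%E).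
    apply: lee_wpmul2l; first by rewrite lee_fin.
    apply: le_trans (volume_ball y (rad0 l)); rewrite le_eqVlt; apply/orP; left; apply/eqP.
    by congr (volume g _); apply/seteqP; split => p; rewrite /ball /= zlt// mul1r.
  rewrite -EFinM lte_fin; set X := B * E * (A + 1) ^+ 2 * (2 * N%:R * K%:R) in Ll *.
  have c0 : 0 < 2 * N%:R * K%:R :> R by rewrite -invr_gt0.
  have X0 : 0 <= X := mulr_ge0 (mulr_ge0 (mulr_ge0 B0 (ltW E_gt0)) (sqr_ge0 _)) (ltW c0).
  have Xl : X < 2 ^+ l.
    have /andP[_ h] := truncn_itv X0; apply: (lt_le_trans h); rewrite -natrX ler_nat.
    by apply: leq_ltn_trans Ll _; exact: ltn_expl.
  have p1 : 1 <= 2 ^+ l :> R by rewrite exprn_ege1// ler1n.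
  rewrite -[ltRHS]div1r ltr_pdivlMr//.
  have -> : B * (E * rad l ^+ 2) * (2 * N%:R * K%:R) = X / (2 ^+ l) ^+ 2.
    by rewrite /X /rad; field; rewrite gt_eqF// (lt_le_trans _ p1).
  have p0 : 0 < 2 ^+ l :> R by exact: lt_le_trans p1.
  rewrite ltr_pdivrMr ?exprn_gt0// mul1r; apply: (lt_le_trans Xl).
  by rewrite expr2 ler_peMr// ltW.
exists (fun j => (yl j).1), (fun j => rad (yl j).2); split => // i iK.
have := Hyl i iK; rewrite vE integral_mkcond; move/le_trans; apply.
rewrite le_eqVlt; apply/orP; left; apply/eqP; apply: eq_integral => p _.
rewrite epatch_indic -EFinM; congr ((_ * \1_ _ _)%:E); apply/seteqP; split => q.
  by move=> [/= q1 q2]; split => // j ji; rewrite leNgt; apply/negP => q3; apply: q2; exists j.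
move=> [q1 q2]; split => //= -[j /= ji q3].
by have := lt_le_trans q3 (q2 j ji); rewrite ltxx.
Qed.

(** For index k + 1 a space of dimension k + 2 is required. Twice as many annuli are selected, and
    those with too much energy are discarded. *)
Lemma mu_star_le k : (mu_star g k <= (8 * 4096 * (grid_size I)%:R * E * k%:R)%:E)%E.
Proof.
apply: ge_ereal_sup => _ [rho [dens mass] <-].
have rho1 : (\int[volume g]_p (rho p)%:E = 1)%E by move: mass; rewrite volume1 inver oner_eq0 invr1 mul1e.
case: k => [|k].
  (* At index 0 the bound is 0, reached by the line of constant functions. *)
  rewrite mulr0; pose V := [set u : M -> R | exists a : 'I_1 -> R, u = (fun p => \sum_(i < 1) a i * 1)].
  have Cc (a : R) : @C1M _ _ M (fun=> a) by move=> c Ac p cp; exact: C1_at_cst.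
  apply: (@le_trans _ _ (ereal_sup [set rayleigh g rho (fun=> 1%R) u | u in V `\` ae0 g])).
    apply: ereal_inf_lbound; exists V => //; exists (fun _ _ => 1); split => //.
      by move=> i; exact: C1M_H1.
    move=> a [N [mN N0 HN]] i; rewrite (ord1 i); apply: contrapT => a0.
    have NT : N = setT.
      by apply/seteqP; split => // p _; apply: HN; rewrite /= big_ord1 mulr1.
    by move: N0; rewrite NT volume1 => /eqP; rewrite eqe oner_eq0.
  apply: ge_ereal_sup => _ [_ [[a ->] _] <-].
  rewrite /rayleigh integral_grad_sq//.
  have -> : (\int[volume g]_p (gip g (fun=> \sum_(i < 1) a i * 1) (fun=> \sum_(i < 1) a i * 1) p)%:E = 0)%E.
    apply: integral0_eq => p _; have [Ac cp] := some_chartP p.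
    by rewrite /gip /gform pd_cst// !mul0mx mxE.
  by rewrite mul0e.
have K0 : (0 < 2 * k.+2)%N by [].
have [y [s [s0 Hs]]] := select_balls dens K0 rho1.
pose e (i : 'I_(2 * k.+2)) := (\int[volume g]_p (energy y s i p)%:E)%E.
have e0 i : (0 <= e i)%E by apply: integral_ge0 => p _; rewrite lee_fin energy_ge0.
(* Markov: the threshold is twice the average 2048 E, so at least half of the 2 (k + 2) indices stay
   below it. *)
pose S : {set 'I_(2 * k.+2)} := [set i | (e i <= (4096 * E)%:E)%E]%SET.
have cS : (k.+2 <= #|S|)%N.
  rewrite leqNgt; apply/negP => cS.
  have := sum_energy y s0 (2 * k.+2); rewrite leNgt => /negP; apply.
  apply: (@lt_le_trans _ _ (\sum_(i in ~: S) (4096 * E)%:E)%E); last first.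
    apply: (@le_trans _ _ (\sum_(i in ~: S) e i)%E).
      by apply: lee_sum => i; rewrite !inE -ltNge => /ltW.
    rewrite [leRHS](bigID (mem S)) /= [leLHS](eq_bigl (fun i => i \notin S)); last by move=> i; rewrite !inE.
    by apply: leeDr; apply: sume_ge0 => i _; exact: e0.
  rewrite sumEFin lte_fin sumr_const cardsCs finset.setCK card_ord -[ltRHS]mulr_natr.
  have -> : 2048 * E * (2 * k.+2)%:R = 4096 * E * k.+2%:R by rewrite natrM; ring.
  have aux m : (m < k.+2)%N -> (k.+2 < 2 * k.+2 - m)%N.
    by move=> mk; rewrite ltn_subRL mul2n -addnn ltn_add2r.
  have E4 : 0 < 4096 * E by apply: mulr_gt0; rewrite ?ltr0n.
  by rewrite (ltr_pM2l E4) ltr_nat; exact: aux.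
pose f (i : 'I_k.+2) : nat := enum_val (widen_ord cS i).
have f_inj : injective f.
  by move=> i j /val_inj/enum_val_inj /(congr1 val) /= ij; exact: val_inj.
have := @mu_le_span y s s0 rho dens k.+1 f (4096 * E) _ f_inj _ _ _ _.
move=> /(_ (2 * (grid_size I)%:R * (2 * k.+2)%:R)^-1) h.
apply: le_trans (h _ _ _ _) _.
- exact: mulr_ge0 (ler0n _ _) (ltW E_gt0).
- by rewrite invr_gt0 !mulr_gt0 ?ltr0n// grid_size_gt0.
- by move=> i; have := enum_valP (widen_ord cS i); rewrite inE.
- by move=> i; apply: Hs; exact: ltn_ord.
rewrite lee_fin invrK natrM.
(* The quotient of energy by mass is 4 * 4096 * N * E * (k + 2); replacing k + 2 by 2 (k + 1)
   accounts for the constant 8 * 4096. *)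
have : k.+2%:R <= 2 * k.+1%:R :> R by rewrite -natrM ler_nat mul2n doubleS ltnS ltnS -addnn leq_addr.
have : 0 <= E * (grid_size I)%:R by rewrite mulr_ge0 ?ler0n ?ltW.
move: (k.+2%:R : R) (k.+1%:R : R) (grid_size I)%:R => x x' N N0 xx; nra.
Qed.

End UpperBound.

(** * Slicing estimates *)

Section UnimodalSlice.
Variable R : realType.
Local Notation MR := (measurableTypeR R).
Local Notation leb := (@lebesgue_measure R).

Lemma is_derive_ge0 (f : R -> R) (t d : R) : is_derive t (1 : R) f d ->
  (forall u, u < t -> f u <= f t) -> 0 <= d.
Proof.
move=> [df <-] Hf.
have L0 : (fun h : R => h^-1 *: (f (h *: (1 : R) + t) - f t)) @ 0^' --> 'D_1 f t by exact: df.
have L := cvg_dnbhs_at_left L0.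
apply: (cvgr_to_ge L); near=> h.
have h0 : h < 0 by near: h; exact: nbhs_left_lt.
rewrite -[_ *: (_ - _)]/(_ * _) mulr_le0// ?invr_le0 ?(ltW h0)// subr_le0.
by apply: Hf; rewrite -[h *: 1]/(h * 1) mulr1 gtrDr.
Unshelve. all: by end_near. Qed.

Lemma is_derive_le0 (f : R -> R) (t d : R) : is_derive t (1 : R) f d ->
  (forall u, t < u -> f u <= f t) -> d <= 0.
Proof.
move=> [df <-] Hf.
have L0 : (fun h : R => h^-1 *: (f (h *: (1 : R) + t) - f t)) @ 0^' --> 'D_1 f t by exact: df.
have L := cvg_dnbhs_at_right L0.
apply: (cvgr_to_le L); near=> h.
have h0 : 0 < h by near: h; exact: nbhs_right_gt.
rewrite -[_ *: (_ - _)]/(_ * _) mulr_ge0_le0// ?invr_ge0 ?(ltW h0)// subr_le0.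
by apply: Hf; rewrite -[h *: 1]/(h * 1) mulr1 ltrDr.
Unshelve. all: by end_near. Qed.

Variables (f f' : R -> R) (y s : R).
Hypotheses (s_gt0 : 0 < s) (cf' : continuous f').
Hypothesis (df : forall t, is_derive t (1 : R) f (f' t)).

(* [w |-> 2 s atan ((w - y) / s)] has derivative [>= 1] where [|w - y| <= s] and total variation [2 pi s]. *)
Let psi w : R := 2 / (1 + ((w - y) / s) ^+ 2).
Let Psi w : R := 2 * s * atan ((w - y) / s).

Let cf : continuous f.
Proof. by move=> x; apply/differentiable_continuous/derivable1_diffP; have [] := df x. Qed.

Let den0 w : 0 < 1 + ((w - y) / s) ^+ 2 :> R.
Proof. by apply: ltr_pwDl => //; exact: sqr_ge0. Qed.

Let psi_ge1 w : `|w - y| <= s -> 1 <= psi w.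
Proof.
move=> h; rewrite ler_pdivlMr// mul1r.
have : ((w - y) / s) ^+ 2 <= 1.
  by rewrite -real_normK ?num_real// exprn_ile1// normrM normfV (gtr0_norm s_gt0) ler_pdivrMr// mul1r.
lra.
Qed.

Let psi_ge0 w : 0 <= psi w. Proof. by rewrite divr_ge0// ltW. Qed.

Let dPsi w : is_derive w (1 : R) Psi (psi w).
Proof.
have h : is_derive w (1 : R) (fun w : R => (w - y) / s) (s^-1).
  have -> : (fun w : R => (w - y) / s) = (fun w : R => s^-1 * w - y / s).
    by apply/funext => u; rewrite mulrBl mulrC.
  have h1 := @is_deriveZ _ _ _ (fun t : R => t) (s^-1 : R) w 1 1 (is_derive_id _ _).
  have := @is_deriveB _ _ _ _ (cst (y / s : R)) w 1 _ 0 h1 (is_derive_cst _ _ _).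
  by move/is_derive_eq; apply; rewrite -[_ *: _]/(_ * _) mulr1 subr0.
have h2 := is_derive_comp1 h (is_derive1_atan _).
have := @is_deriveZ _ _ _ _ (2 * s : R) w 1 _ h2.
move/is_derive_eq; apply; rewrite -[_ *: _]/(_ * _) /psi; field.
by rewrite gt_eqF//= gt_eqF// ltr_pwDl ?exprn_gt0 ?sqr_ge0.
Qed.

Let Psi_bound a b : Psi b - Psi a <= 8 * s.
Proof.
(* Two values of atan differ by less than pi, which is below 4. *)
rewrite /Psi -mulrBr; have h1 := atan_ltpi2 ((b - y) / s); have h2 := atan_gtNpi2 ((a - y) / s).
have [h3 _] := pihalf_02_cos_pihalf R; have /andP[_ h4] := h3.
have : atan ((b - y) / s) - atan ((a - y) / s) <= 4 by lra.
by move=> h; rewrite (_ : 8 * s = 2 * s * 4); [rewrite ler_pM2l// mulr_gt0|ring].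
Qed.

Let cpsi : continuous psi.
Proof.
move=> w; apply: (cvgM (cvg_cst (2 : R))); apply: cvgV; first by rewrite gt_eqF.
have h : (u - y) / s @[u --> w] --> (w - y) / s.
  exact: (cvgM (cvgB cvg_id (cvg_cst y)) (cvg_cst (s^-1 : R))).
by rewrite expr2; apply: cvgD; [exact: cvg_cst|under eq_fun do rewrite expr2; exact: (cvgM h h)].
Qed.

Let cw : continuous (fun t => f' t * psi (f t)).
Proof. by move=> t; exact: (cvgM (cf' (x := t)) (cvg_comp _ _ (cf (x := t)) (@cpsi _))). Qed.

Let half a b : a < b ->
  (\int[leb]_(t in `[a, b]) (f' t * psi (f t))%:E = (Psi (f b) - Psi (f a))%:E)%E.
Proof.
move=> ab; have dP t : is_derive t (1 : R) (Psi \o f) (f' t * psi (f t)).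
  exact: is_derive_comp1 (df t) (dPsi _).
have cP : continuous (Psi \o f).
  by move=> x; apply/differentiable_continuous/derivable1_diffP; have [] := dP x.
rewrite EFinB; apply: (continuous_FTC2 (F := Psi \o f)) => //.
- exact: continuous_subspaceT.
- split; first by move=> x _; have [] := dP x.
  + by apply: cvg_at_right_filter; exact: cP.
  + by apply: cvg_at_left_filter; exact: cP.
- by move=> x _; rewrite derive1E; have [_ ->] := dP x.
Qed.

(** Where f is within s of y, [psi] is at least 1, so |f'| is at most |f'| psi(f). On each side of a
    the sign of f' is constant and this integrates to an increment of [Psi], at most 8 s. *)
Lemma unimodal_integral (a L : R) : 0 < L -> (forall t, t <= a -> 0 <= f' t) ->
  (forall t, a <= t -> f' t <= 0) -> (forall t, L <= `|t - a| -> f' t = 0) ->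
  (\int[leb]_t (`|f' t| * \1_[set u : R | (`|f u - y| <= s)%R] t)%:E <= (16 * s)%:E)%E.
Proof.
move=> L0 fpos fneg f0.
pose w t := f' t * psi (f t).
have mw : measurable_fun [set: MR] w by exact: continuous_measurable_fun cw.
pose A : set MR := `[a - L, a]%classic; pose B : set MR := `[a, a + L]%classic.
have mA : measurable A by exact: measurable_itv.
have mB : measurable B by exact: measurable_itv.
have mS : measurable ([set u : R | (`|f u - y| <= s)%R] : set MR).
  have mg : measurable_fun [set: MR] (fun u : R => `|f u - y|).
    apply: continuous_measurable_fun => u; apply: cvg_norm; exact: (cvgB (cf (x := u)) (cvg_cst y)).
  rewrite (_ : [set _ | _] = (fun u : R => `|f u - y|) @^-1` `]-oo, s]%classic).
    by rewrite -[X in measurable X]setTI; apply: mg => //; exact: measurable_itv.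
  by apply/seteqP; split => u /=; rewrite in_itv.
have wA0 t : 0 <= w t * \1_A t.
  rewrite indicE; case: (boolP (t \in A)) => [|_]; last by rewrite mulr0.
  rewrite in_setE /A /= in_itv /= mulr1 => /andP[_ ta].
  by apply: mulr_ge0 => //; exact: fpos.
have wB0 t : 0 <= - w t * \1_B t.
  rewrite indicE; case: (boolP (t \in B)) => [|_]; last by rewrite mulr0.
  rewrite in_setE /B /= in_itv /= mulr1 => /andP[ta _].
  by rewrite -mulNr; apply: mulr_ge0 => //; rewrite oppr_ge0; exact: fneg.
have mwA : measurable_fun [set: MR] (fun t => (w t * \1_A t)%:E).
  by apply/measurable_EFinP; apply: measurable_funM => //; exact: measurable_indic.
have mwB : measurable_fun [set: MR] (fun t => (- w t * \1_B t)%:E).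
  apply/measurable_EFinP; apply: measurable_funM; first exact: measurable_funN.
  exact: measurable_indic.
apply: (@le_trans _ _ (\int[leb]_t ((w t * \1_A t)%:E + (- w t * \1_B t)%:E))%E).
  apply: ge0_le_integral => //.
  - apply/measurable_EFinP; apply: measurable_funM; last exact: measurable_indic.
    by apply: measurableT_comp => //; exact: continuous_measurable_fun cf'.
  - exact: emeasurable_funD.
  move=> t _; rewrite -EFinD lee_fin.
  rewrite indicE; case: (boolP (t \in _)) => [|_]; last by rewrite mulr0 addr_ge0.
  rewrite in_setE /= mulr1 => fy.
  have [tL|tL] := leP L `|t - a|; first by rewrite f0// normr0 addr_ge0.
  move: tL; rewrite ltr_norml => /andP[t1 t2].
  have psi1 := psi_ge1 fy.
  have [ta|ta] := leP t a.
    have tA : t \in A by rewrite in_setE /A /= in_itv /=; apply/andP; split => //; lra.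
    rewrite ger0_norm ?fpos// indicE tA mulr1 -[leLHS]addr0; apply: lerD => //.
    by rewrite /w ler_peMr// fpos.
  have tB : t \in B by rewrite in_setE /B /= in_itv /=; apply/andP; split; [exact: ltW|lra].
  have n0 : f' t <= 0 by exact: fneg (ltW ta).
  rewrite (ler0_norm n0) [\1_B t]indicE tB mulr1 -[leLHS]add0r; apply: lerD => //.
  by rewrite /w -mulNr ler_peMr// oppr_ge0.
rewrite ge0_integralD//; last 2 first.
- by move=> t _; rewrite lee_fin.
- by move=> t _; rewrite lee_fin.
have -> : (\int[leb]_t (w t * \1_A t)%:E = \int[leb]_(t in A) (w t)%:E)%E.
  by rewrite [RHS]integral_mkcond; apply: eq_integral => t _; rewrite epatch_indic -EFinM.
have -> : (\int[leb]_t (- w t * \1_B t)%:E = - \int[leb]_(t in B) (w t)%:E)%E.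
  have wB t : B t -> (0 <= (- w t)%:E)%E.
    by move=> Bt; have := wB0 t; rewrite indicE mem_set// mulr1 lee_fin.
  have := @integral_ge0N _ _ _ leb B (fun t => (- w t)%:E) wB; under eq_integral do rewrite -EFinN opprK.
  move=> ->; rewrite oppeK.
  by rewrite [RHS]integral_mkcond; apply: eq_integral => t _; rewrite epatch_indic -EFinM.
rewrite half; last by lra.
rewrite half; last by lra.
rewrite -EFinN -EFinD lee_fin; have h1 := Psi_bound (f (a - L)) (f a).
have h2 := Psi_bound (f (a + L)) (f a); lra.
Qed.

End UnimodalSlice.

(** * Integration over slabs, one axis at a time *)

Section SliceBound.
Variable R : realType.
Local Notation Rn n := (borel 'rV[R]_n).
Local Notation MR := (measurableTypeR R).
Local Notation leb := (@lebesgue_measure R).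

Lemma measurable_coord_le n (k : 'I_n) (a s : R) :
  measurable [set x : Rn n | `|x 0 k - a| <= s].
Proof.
rewrite (_ : [set _ | _] = (fun x : Rn n => x 0 k) @^-1` `[a - s, a + s]%classic).
  by rewrite -[X in measurable X]setTI; apply: measurable_coord => //; exact: measurable_itv.
by apply/seteqP; split => x /=; rewrite in_itv /= ler_distl.
Qed.

Definition slab n (k : 'I_n) (a s : R) (x0 : 'rV[R]_n) (r : R) : set (Rn n) :=
  [set x | `|x 0 k - a| <= s /\ forall i, `|x 0 i - x0 0 i| <= r].

Lemma measurable_slab n k a s x0 r : measurable (@slab n k a s x0 r).
Proof.
rewrite (_ : slab k a s x0 r = [set x : Rn n | `|x 0 k - a| <= s] `&`
    \bigcap_(i : 'I_n) [set x : Rn n | `|x 0 i - x0 0 i| <= r]).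
  apply: measurableI; first exact: measurable_coord_le.
  by apply: fin_bigcap_measurable => // i _; exact: measurable_coord_le.
by apply/seteqP; split => x [xk xr]; split => // i; have := xr i; exact.
Qed.

Lemma leb_interval (a s : R) : 0 <= s -> leb `[a - s, a + s]%classic = (2 * s)%:E.
Proof.
move=> s0; rewrite lebesgue_measure_itv /= lte_fin; case: ltP => h.
  by rewrite -EFinB; congr (_%:E); lra.
by congr (_%:E); lra.
Qed.

(** The axis j is integrated first and gives K. The remaining coordinates range over a box with one
    side 2 s, that of axis k, and all others 2 r. The transposition moves axis j to the front, where
    Tonelli applies, and has determinant of absolute value 1. *)
Lemma slice_bound n (j k : 'I_n) (x0 : 'rV[R]_n) (r : R) : j != k -> 0 <= r ->
  exists2 C, 0 <= C & forall (h : Rn n -> \bar R) (a s K : R),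
    measurable_fun setT h -> (forall x, 0 <= h x)%E -> 0 <= s -> 0 <= K ->
    (forall x : 'rV[R]_n, \int[leb]_t h (\row_i if i == j then t else x 0 i)%R <= K%:E)%E ->
    (\int[lebn R n]_x (h x * (\1_(slab k a s x0 r) x)%:E) <= (K * s * C)%:E)%E.
Proof.
case: n j k x0 => [[//]|m] j k x0 jk r0.
pose sg l := tperm j ord0 (lift ord0 l : 'I_m.+1).
have sgj l : sg l != j.
  by rewrite /sg -[X in _ != X](tpermR j ord0) (inj_eq perm_inj).
have [l0 kl0] : exists l0, sg l0 = k.
  have : tperm j ord0 k != ord0 by rewrite -[X in _ != X](tpermL j ord0) (inj_eq perm_inj) eq_sym.
  rewrite eq_sym => /unlift_some[l kl _]; exists l; rewrite /sg -kl.
  by rewrite tpermK.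
pose C := 2 * \prod_(l < m | l != l0) (2 * r).
have C0 : 0 <= C by rewrite mulr_ge0// prodr_ge0// => l _; rewrite mulr_ge0.
exists C => // h a s K mh h0 s0 K0 HK.
set S := slab k a s x0 r; have mS : measurable S by exact: measurable_slab.
pose F x := (h x * (\1_S x)%:E)%E.
have mF : measurable_fun setT F.
  by apply: emeasurable_funM => //; apply/measurable_EFinP; exact: measurable_indic.
have F0 x : (0 <= F x)%E by rewrite mule_ge0// lee_fin indicE ler0n.
pose P : 'M[R]_m.+1 := tperm_mx j ord0.
have PE (x : 'rV[R]_m.+1) i : (x *m P) 0 i = x 0 (tperm j ord0 i).
  by rewrite -xcolE mxE.
have uP : P \in unitmx by exact: unitmx_perm.
rewrite (integral_linear uP mF F0).
have -> : `|\det P| = 1 by rewrite /P /tperm_mx det_perm normrX normrN1 expr1n.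
have mhP : measurable_fun setT (fun x : Rn m.+1 => h (x *m P)).
  by apply: measurableT_comp mh _; exact: measurable_mulmx.
have mFP : measurable_fun setT (fun x : Rn m.+1 => F (x *m P)).
  by apply: measurableT_comp mF _; exact: measurable_mulmx.
rewrite mul1e lebnS2; last 2 first.
- exact: mFP.
- by move=> x; exact: F0.
pose T l : set R := if l == l0 then `[a - s, a + s]%classic else `[x0 0 (sg l) - r, x0 0 (sg l) + r]%classic.
pose len l : R := if l == l0 then 2 * s else 2 * r.
have [||mbox boxE] := @lebn_box R m T len.
- by move=> l; rewrite /T; case: ifP => _; exact: measurable_itv.
- by move=> l; rewrite /T /len; case: ifP => _; exact: leb_interval.
have cat (x : Rn m) : (\int[leb]_t F (rcons0 t x *m P)%R <= K%:E * (\1_[set x : Rn m | forall i, T i (x 0 i)] x)%:E)%E.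
  pose Y : 'rV[R]_m.+1 := rcons0 0 x *m P.
  have XE t : rcons0 t x *m P = \row_i if i == j then t else Y 0 i.
    apply/rowP => i; rewrite [RHS]mxE /Y !PE; case: eqVneq => [->|ij]; first by rewrite tpermL rcons0E0.
    have : tperm j ord0 i != ord0 by rewrite -[X in _ != X](tpermL j ord0) (inj_eq perm_inj).
    by rewrite eq_sym => /unlift_some[l -> _]; rewrite !rcons0ES.
  have Xsg t l : (rcons0 t x *m P) 0 (sg l) = x 0 l by rewrite PE /sg tpermK rcons0ES.
  have [xT|xT] := pselect (forall i, T i (x 0 i)).
    rewrite indicE mem_set// mule1; apply: le_trans (HK Y); apply: ge0_le_integral => //.
    - exact: (measurable_section_l x mFP).
    - under eq_fun do rewrite -XE; exact: (measurable_section_l x mhP).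
    move=> t _; rewrite XE -[leRHS]mule1; apply: lee_wpmul2l; first exact: h0.
    by rewrite lee_fin indicE lern1 leq_b1.
  rewrite indicE memNset// mule0 integral0_eq// => t _; rewrite /F indicE memNset ?mule0//.
  move=> [Xk Xr]; apply: xT => l; rewrite /T; case: eqVneq => [->|_]; rewrite /= in_itv /= -ler_distl.
    by have := Xk; rewrite -kl0 Xsg.
  by have := Xr (sg l); rewrite Xsg.
apply: (@le_trans _ _ (\int[lebn R m]_x (K%:E * (\1_[set x : Rn m | forall i, T i (x 0 i)] x)%:E))%E).
  apply: ge0_le_integral => //.
  - by move=> x _; apply: integral_ge0.
  - by apply: (measurable_lebnS2 mFP) => x; exact: F0.
  - by apply/measurable_EFinP; apply: measurable_funM => //; exact: measurable_indic.
rewrite ge0_integralZl_EFin//; last first.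
  by apply/measurable_EFinP; exact: measurable_indic.
rewrite lebn_indic// boxE -EFinM lee_fin /len (bigD1 l0)//= eqxx.
rewrite (eq_bigr (fun=> 2 * r)); last by move=> l /negbTE ->.
by rewrite /C; rewrite le_eqVlt; apply/orP; left; apply/eqP; ring.
Qed.

End SliceBound.

(** * Stretched pullback metrics *)

(** Two eliminations of the block matrix with rows (1, -v) and (v^T, A), starting from either
    diagonal block. *)
Lemma det_rank_one (F : fieldType) n (A : 'M[F]_n) (v : 'rV[F]_n) : A \in unitmx ->
  \det (A + v^T *m v) = \det A * (1 + (v *m invmx A *m v^T) 0 0).
Proof.
move=> uA; pose B : 'M[F]_(1 + n) := block_mx 1%:M (- v) v^T A.
have E1 : B = block_mx 1%:M 0 v^T 1%:M *m block_mx 1%:M (- v) 0 (A + v^T *m v).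
  rewrite mulmx_block !mul1mx !mulmx1 !mulmx0 !mul0mx !addr0.
  by rewrite mulmxN addrCA addNr addr0.
have E2 : B *m block_mx 1%:M 0 (- (invmx A *m v^T)) 1%:M =
    block_mx (1%:M + v *m invmx A *m v^T) (- v) 0 A.
  rewrite mulmx_block !mulmx1 !mulmx0 !add0r mulNmx mulmxN opprK mulmxA.
  by rewrite mulmxN mulmxA mulmxV// mul1mx subrr.
have D1 : \det B = \det (A + v^T *m v).
  by rewrite E1 det_mulmx det_lblock det_ublock !det1 !mul1r.
have D2 : \det B = (1 + (v *m invmx A *m v^T) 0 0) * \det A.
  have := congr1 determinant E2; rewrite det_mulmx det_lblock det_ublock !det1 !mulr1 => ->.
  by congr (_ * _); rewrite {1}[X in \det X]mx11_scalar det_scalar1 mxE mxE eqxx.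
by rewrite -D1 D2 mulrC.
Qed.

Section PullbackProjection.
Variables (R : realType) (n : nat) (M : manifold R n) (I : finType) (phi : I -> M -> R).
Hypotheses (phi_smooth : forall l, smoothM (phi l)) (phi_imm : immersion phi).

(* With [v] the gradient, [|grad u|^2 = <v, du>] and [|v|^2 = \sum_l <v, d phi_l>^2]. *)
Lemma gform_pullback_le c p (u : M -> R) (a : I -> R) : atlas c -> chart_dom c p ->
  pd c u p = \sum_l a l *: pd c (phi l) p ->
  gform (pullback_metric phi_smooth phi_imm) c u u p <= \sum_l a l ^+ 2.
Proof.
move=> Ac cp du; rewrite /gform /=; set G := pull_gram phi c p.
set w := pd c u p in du *.
have uG : G \in unitmx := gram_unit (pullback_metric phi_smooth phi_imm) Ac cp.
pose v := w *m invmx G; pose x l := (v *m (pd c (phi l) p)^T) 0 0.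
have E1 : (w *m invmx G *m w^T) 0 0 = \sum_l a l * x l.
  rewrite {2}du raddf_sum /= mulmx_sumr summxE; apply: eq_bigr => l _.
  by rewrite linearZ /= -scalemxAr mxE.
have E2 : (w *m invmx G *m w^T) 0 0 = \sum_l x l ^+ 2.
  rewrite -(pull_gram_form phi c p v) -/G /v mulmxKV// trmx_mul trmx_inv pull_gram_sym.
  by rewrite mulmxA.
have : 2 * \sum_l a l * x l <= \sum_l a l ^+ 2 + \sum_l x l ^+ 2.
  rewrite mulr_sumr -big_split /=; apply: ler_sum => l _.
  have := sqr_ge0 (a l - x l); rewrite sqrrB; lra.
rewrite -E2 -E1; lra.
Qed.

End PullbackProjection.

Section Stretch.
Variables (R : realType) (n : nat) (M : manifold R n).
Hypotheses (M_compact : compact [set: M]) (n_gt0 : (0 < n)%N).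
Local Notation Rn := (borel 'rV[R]_n).
Variables (J : finType) (phi : J -> M -> R) (tau : M -> R).
Hypotheses (phi_smooth : forall l, smoothM (phi l)) (phi_imm : immersion phi).
Hypothesis tau_smooth : smoothM tau.
Let g0 := pullback_metric phi_smooth phi_imm.

Section Scale.
Variables (lam sig : R).
Hypothesis sig_gt0 : 0 < sig.

Definition stretch (o : J + 'I_1) (p : M) : R :=
  sig * (if o is inl l then phi l p else lam * tau p).

Let smoothMZ (k : R) (f : M -> R) : smoothM f -> smoothM (fun p => k * f p).
Proof. by move=> Hf c Ac; apply: smooth_onM; [exact: smooth_on_cst|exact: Hf]. Qed.

Lemma stretch_smooth o : smoothM (stretch o).
Proof.
case: o => [l|i] /=; apply: smoothMZ; first exact: phi_smooth.
exact: smoothMZ.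
Qed.

Lemma pd_stretch c p o : atlas c -> chart_dom c p -> pd c (stretch o) p =
  sig *: (if o is inl l then pd c (phi l) p else lam *: pd c tau p).
Proof.
move=> Ac cp; have Ct : C1_at c tau p by exact: smoothM_C1M.
case: o => [l|i]; rewrite /stretch.
  by rewrite pdZ//; exact: smoothM_C1M.
by rewrite pdZ ?pdZ//; apply: C1_atM => //; exact: C1_at_cst.
Qed.

Lemma stretch_imm : immersion stretch.
Proof.
move=> c Ac p cp v /(phi_imm Ac cp)[l vl]; exists (inl l).
by rewrite pd_stretch// linearZ /= -scalemxAr mxE mulf_neq0// gt_eqF.
Qed.

Definition stretch_metric : metric M := pullback_metric stretch_smooth stretch_imm.

Lemma pull_gram_stretch c p : atlas c -> chart_dom c p -> pull_gram stretch c p =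
  sig ^+ 2 *: (pull_gram phi c p + (lam *: pd c tau p)^T *m (lam *: pd c tau p)).
Proof.
have sqZ (k : R) (w : 'rV[R]_n) : (k *: w)^T *m (k *: w) = k ^+ 2 *: (w^T *m w).
  by rewrite -scalemxAr [(k *: w)^T]linearZ /= -scalemxAl scalerA expr2.
move=> Ac cp; rewrite /pull_gram big_sumType /= big_ord1 scalerDr scaler_sumr; congr (_ + _).
  by apply: eq_bigr => l _; rewrite pd_stretch// sqZ.
by rewrite pd_stretch// sqZ.
Qed.

(** The ratio of the volume densities of the stretched metric and of [g0]: the metric is sig^2 times
    a rank-one perturbation of [g0], and [det_rank_one] evaluates its determinant. *)
Definition stretch_weight (p : M) : R := sig ^+ n * Num.sqrt (1 + lam ^+ 2 * gip g0 tau tau p).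

Lemma sqrt_det_stretch c p : atlas c -> chart_dom c p ->
  Num.sqrt (\det (gram stretch_metric c p)) = Num.sqrt (\det (gram g0 c p)) * stretch_weight p.
Proof.
move=> Ac cp; rewrite /= pull_gram_stretch// detZ det_rank_one; last exact: (gram_unit g0 Ac cp).
have Ct : C1M tau by exact: smoothM_C1M.
have -> : (lam *: pd c tau p *m invmx (pull_gram phi c p) *m (lam *: pd c tau p)^T) 0 0 =
    lam ^+ 2 * gip g0 tau tau p.
  rewrite (gipE g0 Ac cp Ct Ct) /gform /= linearZ /= -!scalemxAl -scalemxAr scalerA mxE.
  by rewrite -expr2.
rewrite -exprM mulnC exprM sqrtrM ?sqr_ge0// sqrtr_sqr ger0_norm ?exprn_ge0 ?ltW//.
rewrite sqrtrM; last by apply: ltW; apply: det_posdef; exact: (gram_posdef g0 Ac cp).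
by rewrite /stretch_weight mulrCA.
Qed.

Lemma stretch_weight_continuous : continuous stretch_weight.
Proof.
have Ct : C1M tau by exact: smoothM_C1M.
move=> p; apply: (cvgM (cvg_cst (sig ^+ n : R))).
have h : 1 + lam ^+ 2 * gip g0 tau tau q @[q --> p] --> 1 + lam ^+ 2 * gip g0 tau tau p.
  exact: (cvgD (cvg_cst (1 : R)) (cvgM (cvg_cst (lam ^+ 2 : R)) (@gip_continuous _ _ _ g0 _ _ Ct Ct p))).
exact: (cvg_comp _ _ h (@sqrt_continuous R _)).
Qed.

Lemma stretch_weight_ge0 p : 0 <= stretch_weight p.
Proof. by rewrite mulr_ge0 ?sqrtr_ge0// exprn_ge0// ltW. Qed.

(** The weighted volume has the right density in every chart, so it is the volume by uniqueness. *)
Lemma volume_stretch (B : set (borel M)) : measurable B ->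
  volume stretch_metric B = (\int[volume g0]_(p in B) (stretch_weight p)%:E)%E.
Proof.
move=> mB; have mw : measurable_fun [set: borel M] stretch_weight.
  by apply: continuous_measurable; exact: stretch_weight_continuous.
have [v [vE _]] := density_measure (volume g0) mw stretch_weight_ge0.
rewrite -vE -(@volume_unique _ _ _ M_compact stretch_metric v)//.
move=> c Ac S mS Sc; rewrite vE.
have -> : (\int[volume g0]_(p in S) (stretch_weight p)%:E =
    \int[volume g0]_(p in chart_dom c) ((stretch_weight p)%:E * (\1_S p)%:E))%E.
  rewrite integral_mkcond [RHS]integral_mkcond; apply: eq_integral => p _.
  rewrite epatch_indic !/patch; case: ifPn => //; rewrite notin_setE => cp.
  by rewrite /= indicE memNset ?mule0//; move=> /Sc.
rewrite (volume_chart_integral M_compact g0 Ac); last 2 first.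
- by apply: emeasurable_funM; apply/measurable_EFinP => //; exact: measurable_indic.
- by move=> p; rewrite mule_ge0// lee_fin ?stretch_weight_ge0// indicE ler0n.
rewrite (chart_volumeE stretch_metric Ac mS Sc); apply: eq_integral => x _.
rewrite -!EFinM; congr (_%:E); rewrite mulrA; congr (_ * _).
have [cx|cx] := pselect (chart_img c x); last by rewrite !cdens0N// mul0r.
by rewrite !cdens0E// cinvE// /cdens sqrt_det_stretch//; exact: chart_invP.
Qed.

Lemma gform_stretch_le c p (u : M -> R) (a : J + 'I_1 -> R) : atlas c -> chart_dom c p ->
  pd c u p = \sum_l a l *: pd c (stretch l) p -> gform stretch_metric c u u p <= \sum_l a l ^+ 2.
Proof. exact: gform_pullback_le. Qed.

End Scale.
End Stretch.

(** * The hump along lines parallel to the axes *)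

Section CubeBumpSlice.
Variables (R : realType) (n : nat) (z : 'rV[R]_n) (r : R).
Hypothesis r_gt0 : 0 < r.
Local Notation leb := (@lebesgue_measure R).
Local Notation ee i := (delta_mx 0 i : 'rV[R]_n).
Local Notation T := (cube_bump z r).

Lemma bump_derive_sign : exists db : R -> R, [/\ continuous db,
  forall t, is_derive t (1 : R) (@bump R) (db t), forall t, t <= 0 -> 0 <= db t,
  forall t, 0 <= t -> db t <= 0 & forall t, 2 <= `|t| -> db t = 0].
Proof.
have [db cdb dbE] := bump_derive R; exists db.
have pos t : t <= 0 -> 0 <= db t.
  by move=> t0; apply: (is_derive_ge0 (dbE t)) => u /ltW ut; exact: bump_nondecr.
have neg t : 0 <= t -> db t <= 0.
  by move=> t0; apply: (is_derive_le0 (dbE t)) => u /ltW ut; exact: bump_nonincr.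
(* Beyond distance 2 the bump attains its minimum 0, so the one-sided test applies to its opposite
   as well and the derivative vanishes. *)
split => // t t2; have bt : bump t = 0 by exact: bump0.
have dN : is_derive t (1 : R) (fun u : R => - bump u) (- db t) by exact: is_deriveN (dbE t).
have [t0|t0] := leP t 0.
  apply/le_anti; rewrite pos// andbT.
  rewrite -oppr_ge0; apply: (is_derive_ge0 dN) => u _.
  by rewrite bt oppr0 oppr_le0 bump_ge0.
apply/le_anti; rewrite neg ?(ltW t0)//=.
rewrite -oppr_le0; apply: (is_derive_le0 dN) => u _.
by rewrite bt oppr0 oppr_le0 bump_ge0.
Qed.

Let row_at (j : 'I_n) (t : R) (x : 'rV[R]_n) : 'rV[R]_n := \row_i if i == j then t else x 0 i.
Let factor (j : 'I_n) (x : 'rV[R]_n) : R := \prod_(i | i != j) bump ((x 0 i - z 0 i) / r).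

Let factor_ge0 j x : 0 <= factor j x. Proof. by apply: prodr_ge0 => i _; exact: bump_ge0. Qed.

Let cube_bump_row j t x : T (row_at j t x) = factor j x * bump ((t - z 0 j) / r).
Proof.
rewrite /cube_bump (bigD1 j)//= mulrC mxE eqxx; congr (_ * _).
by apply: eq_bigr => i /negbTE ij; rewrite mxE ij.
Qed.

Let line_derive (db : R -> R) (k a t : R) : (forall t, is_derive t (1 : R) (@bump R) (db t)) ->
  is_derive t (1 : R) (fun t => k * bump ((t - a) / r)) (k * (db ((t - a) / r) / r)).
Proof.
move=> dbE.
have h : is_derive t (1 : R) (fun t : R => (t - a) / r) (r^-1).
  have -> : (fun t : R => (t - a) / r) = (fun t : R => r^-1 * t - a / r).
    by apply/funext => u; rewrite mulrBl mulrC.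
  have h1 := @is_deriveZ _ _ _ (fun t : R => t) (r^-1 : R) t 1 1 (is_derive_id _ _).
  have := @is_deriveB _ _ _ _ (cst (a / r : R)) t 1 _ 0 h1 (is_derive_cst _ _ _).
  by move/is_derive_eq; apply; rewrite -[_ *: _]/(_ * _) mulr1 subr0.
have := @is_deriveZ _ _ _ _ (k : R) t 1 _ (is_derive_comp1 h (dbE _)).
by move/is_derive_eq; apply; rewrite -[_ *: _]/(_ * _) [r^-1 * _]mulrC.
Qed.

Let derive_row (db : R -> R) j t x : (forall t, is_derive t (1 : R) (@bump R) (db t)) ->
  'D_(ee j) T (row_at j t x) = factor j x * (db ((t - z 0 j) / r) / r).
Proof.
move=> dbE; rewrite derive_line.
have -> : (fun h : R => T (h *: ee j + row_at j t x)) =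
    (fun h => factor j x * bump ((h - (z 0 j - t)) / r)).
  apply/funext => h; have -> : h *: ee j + row_at j t x = row_at j (h + t) x.
    apply/rowP => i; rewrite !mxE eqxx /=; case: (i == j); first by rewrite mulr1.
    by rewrite mulr0 add0r.
  by rewrite cube_bump_row; congr (_ * bump (_ / _)); ring.
have [_ ->] := @line_derive db (factor j x) (z 0 j - t) 0 dbE.
by congr (_ * (db (_ / _) / _)); ring.
Qed.

(** On the line, lam T is a nonnegative multiple of a rescaled [bump] centred at z_j. The bound of
    [unimodal_integral] does not see the multiple, hence neither lam nor the other coordinates. *)
Lemma cube_bump_slice j (lam y s : R) (x : 'rV[R]_n) : 0 <= lam -> 0 < s ->
  (\int[leb]_t (lam * `|'D_(ee j) T (\row_i if i == j then t else x 0 i)| *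
     \1_[set u | (`|lam * T u - y| <= s)%R] (\row_i if i == j then t else x 0%R i)%R)%:E
   <= (16 * s)%:E)%E.
Proof.
move=> lam0 s0; have [db [cdb dbE pos neg db0]] := bump_derive_sign.
pose k := lam * factor j x; have k0 : 0 <= k by rewrite mulr_ge0.
pose a := z 0 j; pose f' (t : R) := k * (db ((t - a) / r) / r).
have cf' : continuous f'.
  move=> t; have h : (u - a) / r @[u --> t] --> (t - a) / r.
    exact: (cvgM (cvgB cvg_id (cvg_cst (a : R))) (cvg_cst (r^-1 : R))).
  exact: (cvgM (cvg_cst (k : R)) (cvgM (cvg_comp _ _ h (cdb _)) (cvg_cst (r^-1 : R)))).
have := @unimodal_integral R (fun t => k * bump ((t - a) / r)) f' y s s0 cf'
  (fun t => line_derive k a t dbE) a (2 * r).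
move=> H; rewrite (@eq_integral _ _ _ leb setT (fun t : R => (`|f' t| * \1_[set u : R | (`|k * bump ((u - a) / r) - y| <= s)%R] t)%:E)).
  apply: H.
  - by rewrite mulr_gt0.
  - move=> t ta; rewrite mulr_ge0// divr_ge0 ?(ltW r_gt0)// pos//.
    by rewrite pmulr_lle0 ?invr_gt0// subr_le0.
  - move=> t ta; rewrite mulr_ge0_le0// pmulr_lle0 ?invr_gt0// neg//.
    by rewrite divr_ge0 ?subr_ge0// ltW.
  - move=> t ta; rewrite /f' db0 ?mul0r ?mulr0// normrM normfV (gtr0_norm r_gt0).
    by rewrite ler_pdivlMr.
move=> t _; congr (_%:E); rewrite -/(row_at j t x); congr (_ * _).
  have -> : f' t = lam * (factor j x * (db ((t - a) / r) / r)) by rewrite /f' /k -mulrA.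
  by rewrite (derive_row _ _ _ dbE) [RHS]normrM (ger0_norm lam0).
by rewrite !indicE; congr ((_ : bool)%:R); apply/idP/idP; rewrite !in_setE /= cube_bump_row /k mulrA.
Qed.

(** [bump] falls from 1 at 0 to 0 at 2, so its derivative is nonzero somewhere in between; the other
    factors are 1 when the remaining coordinates are those of z. *)
Lemma cube_bump_steep j : exists2 x, `|x - z| <= 2 * r & 'D_(ee j) T x != 0.
Proof.
have [db [cdb dbE pos neg db0]] := bump_derive_sign.
have cb : continuous (@bump R).
  by move=> t; apply/differentiable_continuous/derivable1_diffP; have [] := dbE t.
have [|c|c] := @MVT R (@bump R) db 0 2 _ (fun t _ => dbE t).
- by [].
- exact: continuous_subspaceT.
rewrite in_itv /= => /andP[c0 c2]; rewrite (@bump0 R 2) ?(@bump1 R 0) ?normr0//; last by rewrite ger0_norm.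
move=> H; have dbc : db c != 0.
  by apply/eqP => d0; move: H; rewrite d0 mul0r; lra.
exists (row_at j (z 0 j + r * c) z).
  have r2 : 0 <= 2 * r by rewrite mulr_ge0// ltW.
  apply: rV_norm_le => // i; rewrite !mxE; case: eqVneq => [->|_]; last by rewrite subrr normr0.
  rewrite addrAC subrr add0r ger0_norm; last by rewrite mulr_ge0// ltW.
  by rewrite mulrC ler_pM2r// ltW.
rewrite (derive_row _ _ _ dbE) addrAC subrr add0r mulrAC divff ?(gt_eqF r_gt0)// mul1r.
rewrite /factor big1 ?mul1r; last by move=> i _; rewrite subrr mul0r bump1// normr0.
by rewrite mulf_neq0// invr_eq0 (gt_eqF r_gt0).
Qed.

End CubeBumpSlice.

Section ChartSlab.
Variables (R : realType) (n : nat) (M : manifold R n) (g : metric M).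
Hypothesis M_compact : compact [set: M].
Local Notation Rn := (borel 'rV[R]_n).
Local Notation H := (@half_space R n).

Lemma closed_cube_compact (x0 : 'rV[R]_n) (r : R) : 0 <= r -> compact [set y : 'rV[R]_n | `|y - x0| <= r].
Proof.
move=> r0; rewrite (_ : [set _ | _] = [set x : 'rV[R]_n | forall j, `[x0 0 j - r, x0 0 j + r]%classic (x ord0 j)]).
  by apply: (@rV_compact R n (fun j => `[x0 0 j - r, x0 0 j + r]%classic)) => j; exact: segment_compact.
apply/seteqP; split => y /= Hy.
  move=> j; rewrite in_itv /= -ler_distl; apply: le_trans Hy.
  by have := rV_normE (y - x0) j; rewrite !mxE.
by apply: rV_norm_le => // j; have := Hy j; rewrite in_itv /= -ler_distl !mxE.
Qed.

Variables (c : chart R n M) (x0 : 'rV[R]_n) (r : R).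
Hypotheses (Ac : atlas c) (r_gt0 : 0 < r).
Hypothesis cube_img : forall y : 'rV[R]_n, `|y - x0| <= r -> H y -> chart_img c y.

Lemma cdens_bounded : exists2 D, 0 <= D & forall y, `|y - x0| <= r -> chart_img c y -> cdens g c y <= D.
Proof.
set K := [set y : 'rV[R]_n | `|y - x0| <= r].
have cK : compact (K `&` H).
  by apply: compact_closedI; [exact: closed_cube_compact (ltW r_gt0)|exact: half_space_closed].
have cim : compact (cdens g c @` (K `&` H)).
  have sub : K `&` H `<=` chart_img c by move=> y [Ky Hy]; exact: cube_img.
  apply: continuous_compact cK; exact: continuous_subspaceW sub (@cdens_continuous _ _ _ g c Ac).
have [D [_ HD]] := compact_bounded cim.
exists (Num.max 0 (D + 1)); first by rewrite le_max lexx.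
move=> y yr cy; rewrite le_max; apply/orP; right; apply: le_trans (ler_norm _) _.
apply: HD; first by rewrite ltrDl.
by exists y => //; split => //; exact: chart_img_half cy.
Qed.

(** The density of the metric in the chart is bounded on the compact cube, which passes integrals
    over M to Lebesgue integrals over slabs. *)
Lemma chart_slab_bound : exists2 D, 0 <= D & forall (k : 'I_n) (a s : R) (h : Rn -> \bar R)
    (S : set (borel M)), measurable_fun setT h -> (forall x, 0 <= h x)%E -> measurable S ->
    (forall p, S p -> chart_dom c p /\ slab k a s x0 r (chart_map c p)) ->
  (\int[volume g]_(p in S) h (cmap c p) <= D%:E * \int[lebn R n]_x (h x * (\1_(slab k a s x0 r) x)%:E))%E.
Proof.
have [D D0 HD] := cdens_bounded; exists D => // k a s h S mh h0 mS HS.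
have mhc : measurable_fun [set: borel M] (fun p => h (cmap c p)).
  exact: measurableT_comp mh (measurable_cmap c).
have mhS : measurable_fun [set: borel M] (fun p => h (cmap c p) * (\1_S p)%:E)%E.
  by apply: emeasurable_funM => //; apply/measurable_EFinP; exact: measurable_indic.
have hS0 p : (0 <= h (cmap c p) * (\1_S p)%:E)%E.
  by rewrite mule_ge0// lee_fin indicE ler0n.
have -> : (\int[volume g]_(p in S) h (cmap c p) =
    \int[volume g]_(p in chart_dom c) (h (cmap c p) * (\1_S p)%:E))%E.
  rewrite integral_mkcond [RHS]integral_mkcond; apply: eq_integral => p _.
  rewrite epatch_indic [RHS]/patch; case: ifPn => //; rewrite notin_setE => cp.
  by rewrite /= indicE memNset ?mule0//; move=> /HS[].
rewrite (volume_chart_integral M_compact g Ac)//.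
have mslab : measurable (slab k a s x0 r) by exact: measurable_slab.
have mhs : measurable_fun setT (fun x => h x * (\1_(slab k a s x0 r) x)%:E)%E.
  by apply: emeasurable_funM => //; apply/measurable_EFinP; exact: measurable_indic.
have hs0 x : (0 <= h x * (\1_(slab k a s x0 r) x)%:E)%E.
  by rewrite mule_ge0// lee_fin indicE ler0n.
rewrite -ge0_integralZl_EFin//; apply: ge0_le_integral => //.
- by move=> x _; rewrite mule_ge0// lee_fin cdens0_ge0.
- apply: emeasurable_funM; first by apply/measurable_EFinP; exact: measurable_cdens0.
  exact: measurableT_comp mhS (measurable_cinv c).
- by apply: emeasurable_funM => //; exact: measurable_cst.
move=> x _; have [cx|cx] := pselect (chart_img c x); last by rewrite cdens0N// mul0e mule_ge0.
rewrite cinvE// [\1_S _]indicE; case: (boolP (_ \in S)) => [|_]; last by rewrite mule0 mule0 mule_ge0.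
rewrite in_setE => /HS[cp]; rewrite cmapE// chart_invK// => xs.
rewrite [\1_(slab _ _ _ _ _) _]indicE mem_set// mule1; apply: lee_wpmul2r; first exact: h0.
rewrite lee_fin cdens0E//; apply: HD => //; apply: rV_norm_le; first exact: ltW.
by move=> i; rewrite !mxE; case: xs => _; exact.
Qed.

End ChartSlab.

(** * The stretched metrics of the theorem *)

Section Geometry.
Variables (R : realType) (n : nat) (M : manifold R n).
Hypotheses (n_ge3 : (3 <= n)%N) (M_compact : compact [set: M]).
Local Notation Rn := (borel 'rV[R]_n).
Local Notation H := (@half_space R n).
Local Notation ee i := (delta_mx 0 i : 'rV[R]_n).
Local Notation leb := (@lebesgue_measure R).
Variables (N : nat) (c : 'I_N -> chart R n M) (x : 'I_N -> 'rV[R]_n) (r : 'I_N -> R).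
Hypotheses (Ac : forall i, atlas (c i)) (r_gt0 : forall i, 0 < r i).
Hypothesis cube_img : forall i y, `|y - x i| <= 4 * r i -> H y -> chart_img (c i) y.
Let U i : set M := [set p | chart_dom (c i) p /\ `|chart_map (c i) p - x i| < r i].
Hypothesis cover : forall p, exists i, U i p.
Variable i0 : 'I_N.
Hypothesis center_img : chart_img (c i0) (x i0).

Let n_gt0 : (0 < n)%N. Proof. exact: leq_trans n_ge3. Qed.
Let n_gt1 : (1 < n)%N. Proof. exact: leq_trans n_ge3. Qed.
Let j0 : 'I_n := Ordinal n_gt0.
(** A second axis, available since n >= 2: it supplies the second factor s. *)
Let other (j : 'I_n) : 'I_n := if j == j0 then Ordinal n_gt1 else j0.
Let otherP j : j != other j.
Proof. by rewrite /other; case: (eqVneq j j0) => [->|//]. Qed.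

Definition coordinates (l : 'I_N * 'I_n) : M -> R :=
  extM (c l.1) (fun y => cube_bump (x l.1) (r l.1) y * y 0 l.2).
(** Shifting the centre by r / 2 in every coordinate keeps the support, of radius 2 r' = r / 4, away
    from the hyperplane x_0 = 0 even if [x i0] lies on it, and inside the cube where the cut-off
    coordinates are the true ones. *)
Let z : 'rV[R]_n := x i0 + const_mx (r i0 / 2).
Let r' : R := r i0 / 8.
Let T := cube_bump z r'.
Definition hump : M -> R := extM (c i0) T.

Let r'_gt0 : 0 < r'. Proof. by rewrite divr_gt0. Qed.

Lemma coordinates_smooth l : smoothM (coordinates l).
Proof.
have r2 : 0 <= 2 * r l.1 by rewrite mulr_ge0// ltW.
apply: (smoothM_extM (K := [set y | `|y - x l.1| <= 2 * r l.1])) => //.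
- move=> k; apply: C_kM; [exact: openT|apply: C_k_cube_bump; exact: openT|].
  by apply: C_k_coord; exact: openT.
- exact: closed_cube_compact.
- move=> y [/= yr Hy]; apply: cube_img => //; apply: le_trans yr _.
  by rewrite ler_pM2r// ler_nat.
- by move=> y /= /negP; rewrite -ltNge => /ltW yr; rewrite cube_bump0// mul0r.
Qed.

Let U_near i p : U i p -> \forall q \near p, U i q.
Proof.
move=> [cp pr]; have n1 : \forall q \near p, chart_dom (c i) q.
  by apply: open_nbhs_nbhs; split => //; exact: chart_dom_open.
have h : `|chart_map (c i) q - x i| @[q --> p] --> `|chart_map (c i) p - x i|.
  by apply: cvg_norm; apply: (cvgB (chart_map_cvg cp) (cvg_cst _)).
have n2 : \forall q \near p, `|chart_map (c i) q - x i| < r i by exact: cvgr_lt h _ pr.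
by near=> q; split; [near: q|near: q].
Unshelve. all: by end_near. Qed.

Let coordinates_near i j p : U i p ->
  \forall q \near p, coordinates (i, j) q = chart_map (c i) q 0 j.
Proof.
move=> /U_near; apply: filterS => q [cq qr].
by rewrite /coordinates extME//= cube_bump1 ?mul1r// ltW.
Qed.

Lemma coordinates_imm : immersion coordinates.
Proof.
apply: coordinates_immersion => p; have [i Up] := cover p.
exists (c i), (fun j => (i, j)); split => //; first by case: Up.
by move=> j; exact: coordinates_near.
Qed.

Let KT : set 'rV[R]_n := [set y | `|y - z| <= 2 * r'].

Let KT_near y : KT y -> `|y - x i0| < r i0 /\ forall i, x i0 0 i < y 0 i.
Proof.
move=> Ky; have ri := r_gt0 i0.
have Hy i : `|y 0 i - (x i0 0 i + r i0 / 2)| <= r i0 / 4.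
  have := le_trans (rV_normE (y - z) i) Ky; rewrite !mxE /r'.
  by move/le_trans; apply; lra.
split; last by move=> i; have := Hy i; rewrite ler_distl => /andP[h _]; lra.
by apply: rV_norm_lt => // i; rewrite !mxE ltr_norml; have := Hy i; rewrite ler_distl => /andP[h1 h2]; apply/andP; split; lra.
Qed.

Let KT_half y : KT y -> forall i, 0 < y 0 i \/ val i <> 0%N.
Proof.
move=> /KT_near[_ h] i; have [i0'|i0'] := eqVneq (val i) 0%N; last by right; apply/eqP.
by left; apply: le_lt_trans (h i); apply: (chart_img_half center_img).
Qed.

Let KT_img y : KT y -> chart_img (c i0) y.
Proof.
move=> Ky; have [h1 h2] := KT_near Ky; apply: cube_img.
  by apply: (le_trans (ltW h1)); have := r_gt0 i0; lra.
by move=> i i0'; case: (KT_half Ky i) => [/ltW|].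
Qed.

Let KT_compact : compact KT.
Proof. by apply: closed_cube_compact; rewrite mulr_ge0// ltW. Qed.

Let CT : C_infty setT T.
Proof. by move=> k; apply: C_k_cube_bump; exact: openT. Qed.

Let T0 y : ~ KT y -> T y = 0.
Proof. by move=> /negP; rewrite -ltNge => /ltW; exact: cube_bump0. Qed.

Lemma hump_smooth : smoothM hump.
Proof. by apply: smoothM_extM KT_compact _ T0 => // y [/KT_img]. Qed.

Let S : set (borel M) := chart_inv (c i0) @` (KT `&` H).

Let closedS : closed (S : set M).
Proof. by apply: compact_chart_closed KT_compact _ => y [/KT_img]. Qed.

Let measurableS : measurable S.
Proof. by apply: borel_closed; exact: closedS. Qed.

Let SP p : S p -> chart_dom (c i0) p /\ KT (chart_map (c i0) p).
Proof.
move=> [y [Ky Hy] <-]; rewrite chart_invK; last exact: KT_img.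
by split => //; apply: chart_invP; exact: KT_img.
Qed.

Let SU p : S p -> U i0 p.
Proof. by move=> /SP[cp /KT_near[]]. Qed.

Local Notation g0 := (pullback_metric coordinates_smooth coordinates_imm).
Local Notation D j y := ('D_(ee j) T y).

Let pd_hump p : chart_dom (c i0) p -> pd (c i0) hump p = \row_j D j (chart_map (c i0) p).
Proof.
move=> cp; apply: (pd_ext cp (@openT _) (CT 1)) => // y _ cy.
by rewrite /hump extME ?chart_invK//; exact: chart_invP.
Qed.

Let C1_hump : C1M hump. Proof. exact: smoothM_C1M hump_smooth. Qed.

Let gip_hump0 p : ~ S p -> gip g0 hump hump p = 0.
Proof.
move=> Sp; have [a Aa ap] := atlas_cover p; rewrite (gipE g0 Aa ap C1_hump C1_hump) /gform.
suff -> : pd a hump p = 0 by rewrite !mul0mx mxE.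
rewrite -(pd_cst 0 ap); apply: pd_near => //; first exact: C1_at_cst.
have : \forall q \near p, (~` (S : set M)) q.
  by apply: open_nbhs_nbhs; split => //; exact: closed_openC.
apply: filterS => q Sq; rewrite /hump /extM; case: asboolP => // cq.
apply: T0 => Kq; apply: Sq; exists (chart_map (c i0) q); last by rewrite chart_mapK.
by split => //; exact: chart_img_half (chart_imgP cq).
Qed.

(** On S the hump is a function of the coordinates of the chart [c i0], which are components of the
    embedding there; [gform_pullback_le] applies with its partial derivatives as coefficients. *)
Let gip_hump_le p : S p -> gip g0 hump hump p <= (\sum_j `|D j (chart_map (c i0) p)|) ^+ 2.
Proof.
move=> Sp; have Up := SU Sp; have [cp _] := Up.
rewrite (gipE g0 (Ac i0) cp C1_hump C1_hump).
pose a (l : 'I_N * 'I_n) : R := if l.1 == i0 then D l.2 (chart_map (c i0) p) else 0.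
have dh : pd (c i0) hump p = \sum_l a l *: pd (c i0) (coordinates l) p.
  have -> : \sum_l a l *: pd (c i0) (coordinates l) p =
      \sum_i \sum_j a (i, j) *: pd (c i0) (coordinates (i, j)) p.
    by rewrite pair_bigA /=; apply: eq_bigr => -[].
  rewrite (bigD1 i0)//= [X in _ + X]big1 ?addr0; last first.
    by move=> i /negbTE ii; rewrite big1// => j _; rewrite /a /= ii scale0r.
  rewrite pd_hump//; apply/rowP => k; rewrite mxE summxE (bigD1 k)//= big1 ?addr0 => [|j jk].
    rewrite /a /= eqxx mxE (pd_near cp _ (coordinates_near k Up)) ?pd_coord_self//.
      by rewrite mxE !eqxx mulr1.
    exact: C1_at_coord.
  rewrite mxE (pd_near cp _ (coordinates_near j Up)) ?pd_coord_self//; last exact: C1_at_coord.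
  by rewrite mxE eq_sym (negbTE jk) andbF mulr0.
apply: le_trans (gform_pullback_le coordinates_smooth coordinates_imm (Ac i0) cp dh) _.
have -> : \sum_l a l ^+ 2 = \sum_i \sum_j a (i, j) ^+ 2.
  by rewrite pair_bigA /=; apply: eq_bigr => -[].
rewrite (bigD1 i0)//= [X in _ + X]big1 ?addr0; last first.
  by move=> i /negbTE ii; rewrite big1// => j _; rewrite /a /= ii expr0n.
rewrite expr2 mulr_suml; apply: ler_sum => j _; rewrite /a eqxx -real_normK ?num_real// expr2.
by apply: ler_wpM2l => //; rewrite (bigD1 j)//= lerDl sumr_ge0.
Qed.

Local Notation weight lam := (stretch_weight hump coordinates_smooth coordinates_imm lam 1).

(** From sqrt (1 + X^2) <= 1 + X. Bounding the gradient by the sum of the |D_j T| lets each term be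
    integrated along its own axis. *)
Let weight_le lam p : 0 <= lam ->
  weight lam p <= 1 + \sum_j lam * `|D j (cmap (c i0) p)| * \1_S p.
Proof.
move=> lam0; rewrite /stretch_weight expr1n mul1r.
have gp : 0 <= gip g0 hump hump p by exact: gip_ge0 C1_hump.
have [Sp|Sp] := pselect (S p); last first.
  by rewrite gip_hump0// mulr0 addr0 sqrtr1 lerDl sumr_ge0// => j _; rewrite !mulr_ge0// indicE ler0n.
have [cp _] := SU Sp; rewrite (cmapE cp).
have -> : \sum_j lam * `|D j (chart_map (c i0) p)| * \1_S p = lam * \sum_j `|D j (chart_map (c i0) p)|.
  by rewrite mulr_sumr; apply: eq_bigr => j _; rewrite indicE mem_set// mulr1.
have := gip_hump_le Sp; set X := \sum_j _ => XX.
have X0 : 0 <= X by rewrite sumr_ge0.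
have lX : 0 <= lam * X by rewrite mulr_ge0.
rewrite -[leRHS]ger0_norm; last by rewrite addr_ge0.
rewrite -sqrtr_sqr; apply: ler_wsqrtr.
apply: (@le_trans _ _ (1 + (lam * X) ^+ 2)).
  by rewrite lerD2l exprMn; apply: ler_wpM2l => //; exact: sqr_ge0.
rewrite sqrrD; lra.
Qed.

Let ballset lam (y : 'I_N * 'I_n + 'I_1 -> R) s : set (borel M) :=
  [set p | \sum_l (stretch coordinates hump lam 1 l p - y l) ^+ 2 < s ^+ 2].

Let measurable_ballset lam y s : measurable (ballset lam y s).
Proof.
apply: measurable_ltC.
have Cs l : C1M (stretch coordinates hump lam 1 l).
  by apply: smoothM_C1M; apply: stretch_smooth hump_smooth _ _ _; exact: coordinates_smooth.
have := C1M_continuous (zfun_C1 Cs (fun=> y) (fun=> 1) 0%N).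
by rewrite /zfun; under eq_fun do rewrite expr1n divr1.
Qed.

Let ballset_le lam y s l p : 0 < s -> ballset lam y s p ->
  `|stretch coordinates hump lam 1 l p - y l| <= s.
Proof.
move=> s0; rewrite /ballset /= => h.
have : (stretch coordinates hump lam 1 l p - y l) ^+ 2 < s ^+ 2.
  by apply: le_lt_trans h; rewrite (bigD1 l)//= lerDl sumr_ge0// => k _; exact: sqr_ge0.
move=> h2; apply: ltW; rewrite -(@ltr_pXn2r _ 2)// ?nnegrE ?normr_ge0 ?(ltW s0)//.
by rewrite real_normK ?num_real.
Qed.

Let ballset_coord lam y s i j p : 0 < s -> U i p -> ballset lam y s p ->
  `|chart_map (c i) p 0 j - y (inl (i, j))| <= s.
Proof.
move=> s0 Up /(ballset_le (inl (i, j)) s0); rewrite /stretch mul1r.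
by rewrite (nbhs_singleton (coordinates_near j Up)).
Qed.

Let slab_U i k a s p : U i p -> `|chart_map (c i) p 0 k - a| <= s ->
  chart_dom (c i) p /\ slab k a s (x i) (r i) (chart_map (c i) p).
Proof.
move=> [cp pr] h; split => //; split => // j; apply: le_trans (ltW pr).
by have := rV_normE (chart_map (c i) p - x i) j; rewrite !mxE.
Qed.

Let measurableU i : measurable (U i : set (borel M)).
Proof.
apply: borel_open; rewrite openE => p /U_near Up; exact: Up.
Qed.

Let cube_img1 i y : `|y - x i| <= r i -> H y -> chart_img (c i) y.
Proof.
by move=> yr; apply: cube_img; apply: (le_trans yr); have := r_gt0 i; lra.
Qed.

(** In the unstretched volume, two coordinates of the chart are confined to intervals of length 2 s
    by the ball. *)
Let piece1 i : exists2 C, 0 <= C & forall lam y s, 0 < s ->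
  (volume g0 (ballset lam y s `&` U i) <= (C * s ^+ 2)%:E)%E.
Proof.
have [D D0 HD] := chart_slab_bound g0 M_compact (Ac i) (r_gt0 i) (@cube_img1 i).
have [C C0 HC] := slice_bound (x i) (otherP j0) (ltW (r_gt0 i)).
exists (D * (2 * C)); first by rewrite !mulr_ge0.
move=> lam y s s0; set A := _ `&` _.
have mA : measurable A by apply: measurableI; [exact: measurable_ballset|exact: measurableU].
pose b := y (inl (i, j0)); pose a := y (inl (i, other j0)).
pose B : set Rn := [set u | `|u 0 j0 - b| <= s].
have mB : measurable B by exact: measurable_coord_le.
pose h (u : Rn) : \bar R := (\1_B u)%:E.
have mh : measurable_fun setT h by apply/measurable_EFinP; exact: measurable_indic.
have h0 u : (0 <= h u)%E by rewrite lee_fin indicE ler0n.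
have AB p : A p -> B (cmap (c i) p).
  by move=> [pA pU]; have [cp _] := pU; rewrite /B /= (cmapE cp); exact: ballset_coord pA.
have -> : volume g0 A = (\int[volume g0]_(p in A) h (cmap (c i) p))%E.
  rewrite -[LHS]mul1e -integral_cst//; apply: eq_integral => p /set_mem Ap.
  by rewrite /h indicE mem_set//; exact: AB.
apply: le_trans (HD (other j0) a s h A mh h0 mA _) _.
  by move=> p [pA pU]; apply: slab_U => //; exact: ballset_coord pA.
have -> : D * (2 * C) * s ^+ 2 = D * ((2 * s) * s * C) by rewrite expr2; ring.
rewrite EFinM; apply: lee_wpmul2l; first by rewrite lee_fin.
apply: HC => //; first exact: ltW.
  by rewrite mulr_ge0// ltW.
move=> u; rewrite -(@leb_interval _ b s (ltW s0)).
have hE (t : R) : h (\row_k if k == j0 then t else u 0 k) =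
    (\1_(`[b - s, b + s]%classic : set (measurableTypeR R)) t : R)%:E.
  rewrite /h !indicE; congr ((_ : bool)%:R%:E).
  by apply/idP/idP; rewrite !in_setE /B /= in_itv /= mxE eqxx ler_distl.
under eq_integral do rewrite hE.
by rewrite integral_indic ?setIT//; exact: measurable_itv.
Qed.

Let mD j : measurable_fun setT (fun u : Rn => D j u).
Proof.
apply: continuous_measurable => u; have [_ /(_ j)[_ [h _]]] := CT 1.
by apply: h.
Qed.

Let mT : measurable_fun setT (T : Rn -> R).
Proof. by apply: continuous_measurable => u; have [h _] := CT 0; exact: h. Qed.

(** The component lam T of the embedding is within s of its centre on the ball, which bounds the
    integral along axis j by 16 s; the coordinate [other j] gives the second factor s. *)
Let piece2 j : exists2 C, 0 <= C & forall lam y s, 0 <= lam -> 0 < s ->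
  (\int[volume g0]_(p in ballset lam y s) (lam * `|D j (cmap (c i0) p)| * \1_S p)%:E <= (C * s ^+ 2)%:E)%E.
Proof.
have [D' D0 HD] := chart_slab_bound g0 M_compact (Ac i0) (r_gt0 i0) (@cube_img1 i0).
have [C C0 HC] := slice_bound (x i0) (otherP j) (ltW (r_gt0 i0)).
exists (D' * (16 * C)); first by rewrite !mulr_ge0.
move=> lam y s lam0 s0; set A := ballset lam y s.
have mA : measurable A by exact: measurable_ballset.
have mAS : measurable (A `&` S) by exact: measurableI.
pose b := y (inr ord0); pose k := other j; pose a := y (inl (i0, k)).
pose B : set Rn := [set u | `|lam * T u - b| <= s].
have mB : measurable B.
  have mg : measurable_fun setT (fun u : Rn => `|lam * T u - b|).
    apply: measurableT_comp => //; apply: measurable_funB; last exact: measurable_cst.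
    by apply: measurable_funM => //; exact: measurable_cst.
  rewrite (_ : B = (fun u : Rn => `|lam * T u - b|) @^-1` `]-oo, s]%classic).
    by rewrite -[X in measurable X]setTI; apply: mg => //; exact: measurable_itv.
  by apply/seteqP; split => u; rewrite /B /= in_itv.
pose h (u : Rn) : \bar R := (lam * `|D j u| * \1_B u)%:E.
have mh : measurable_fun setT h.
  apply/measurable_EFinP; apply: measurable_funM; last exact: measurable_indic.
  by apply: measurable_funM; [exact: measurable_cst|exact: measurableT_comp].
have h0 u : (0 <= h u)%E by rewrite lee_fin !mulr_ge0// indicE ler0n.
have -> : (\int[volume g0]_(p in A) (lam * `|D j (cmap (c i0) p)| * \1_S p)%:E =
    \int[volume g0]_(p in A `&` S) h (cmap (c i0) p))%E.
  rewrite integral_mkcond [RHS]integral_mkcond; apply: eq_integral => p _.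
  rewrite !epatch_indic /h -!EFinM indicI; congr (_%:E).
  have [[Ap Sp]|N'] := pselect (A p /\ S p); last first.
    have AS0 : \1_A p * \1_S p = 0 :> R.
      rewrite !indicE; case: (boolP (p \in A)) => pA; case: (boolP (p \in S)) => pS; rewrite ?mulr0 ?mul0r//.
      by exfalso; apply: N'; split; exact/set_mem.
    have SA0 : \1_S p * \1_A p = 0 :> R by rewrite mulrC.
    by rewrite -[LHS]mulrA SA0 mulr0 /= AS0 mulr0.
  have [cp _] := SP Sp; rewrite [\1_B _]indicE (mem_set (_ : B _)) ?mulr1; last first.
    rewrite /B /= (cmapE cp); have := ballset_le (inr ord0) s0 Ap.
    by rewrite /stretch mul1r /hump extME.
  by rewrite -[LHS]mulrA; congr (_ * _); rewrite mulrC.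
apply: le_trans (HD k a s h (A `&` S) mh h0 mAS _) _.
  by move=> p [pA /SU pU]; apply: slab_U => //; exact: ballset_coord pA.
have -> : D' * (16 * C) * s ^+ 2 = D' * ((16 * s) * s * C) by rewrite expr2; ring.
rewrite EFinM; apply: lee_wpmul2l; first by rewrite lee_fin.
apply: HC => //; first exact: ltW.
  by rewrite mulr_ge0// ltW.
by move=> u; exact: cube_bump_slice.
Qed.

(** [piece1] is summed over the finite cover and [piece2] over the axes; none of these constants
    involves lam. *)
Lemma weight_ball_le : exists2 E, 0 < E & forall lam y s, 0 <= lam -> 0 < s ->
  (\int[volume g0]_(p in [set p | (\sum_l (stretch coordinates hump lam 1 l p - y l) ^+ 2 < s ^+ 2)%R])
     (weight lam p)%:E <= (E * s ^+ 2)%:E)%E.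
Proof.
have [C1 HC1] := choice (fun i => let: ex_intro2 C h1 h2 := piece1 i in ex_intro
  (fun C => 0 <= C /\ forall lam y s, 0 < s -> (volume g0 (ballset lam y s `&` U i) <= (C * s ^+ 2)%:E)%E) C (conj h1 h2)).
have [C2 HC2] := choice (fun j => let: ex_intro2 C h1 h2 := piece2 j in ex_intro
  (fun C => 0 <= C /\ forall lam y s, 0 <= lam -> 0 < s ->
  (\int[volume g0]_(p in ballset lam y s) (lam * `|D j (cmap (c i0) p)| * \1_S p)%:E <= (C * s ^+ 2)%:E)%E) C (conj h1 h2)).
(* The summand 1 makes E positive. *)
exists (1 + (\sum_i C1 i + \sum_j C2 j)).
  by rewrite ltr_pwDl// addr_ge0// sumr_ge0// => i _; [case: (HC1 i)|case: (HC2 i)].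
move=> lam y s lam0 s0; rewrite -/(ballset lam y s); set A := ballset lam y s.
have mA : measurable A by exact: measurable_ballset.
have mw : measurable_fun [set: borel M] (weight lam).
  by apply: continuous_measurable; exact: (@stretch_weight_continuous _ _ _ _ _ _ _ _ hump_smooth lam 1).
pose F j (p : borel M) : R := lam * `|D j (cmap (c i0) p)| * \1_S p.
have mF j : measurable_fun [set: borel M] (F j).
  apply: measurable_funM; last exact: measurable_indic.
  apply: measurable_funM; first exact: measurable_cst.
  apply: measurableT_comp => //; exact: measurableT_comp (mD j) (measurable_cmap (c i0)).
have F0 j p : 0 <= F j p by rewrite !mulr_ge0// indicE ler0n.
apply: (@le_trans _ _ (\int[volume g0]_(p in A) (1 + \sum_j (F j p)%:E))%E).
  apply: ge0_le_integral => //.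
  - by move=> p _; rewrite lee_fin stretch_weight_ge0.
  - by apply/measurable_EFinP; exact: measurable_funTS.
  - apply: emeasurable_funD; first exact: measurable_cst.
    by apply: emeasurable_sum => j; apply/measurable_EFinP; exact: measurable_funTS.
  - by move=> p _; rewrite sumEFin -EFinD lee_fin; exact: weight_le.
rewrite ge0_integralD//; last 2 first.
- by move=> p _; rewrite sume_ge0// => j _; rewrite lee_fin.
- by apply: emeasurable_sum => j; apply/measurable_EFinP; exact: measurable_funTS.
rewrite integral_cst// mul1e ge0_integral_sum//; last 2 first.
- by move=> j; apply/measurable_EFinP; exact: measurable_funTS.
- by move=> j p _; rewrite lee_fin.
apply: (@le_trans _ _ ((\sum_i C1 i * s ^+ 2)%:E + (\sum_j C2 j * s ^+ 2)%:E)%E); last first.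
  rewrite -EFinD lee_fin -!mulr_suml -mulrDl; apply: ler_wpM2r; first exact: sqr_ge0.
  by rewrite lerDr.
apply: leeD; last by rewrite -sumEFin; apply: lee_sum => j _; case: (HC2 j) => _; apply.
pose V k : set (borel M) := if insub k is Some i then A `&` U i else set0.
have mV k : measurable (V k).
  by rewrite /V; case: insub => [i|]; [exact: measurableI|exact: measurable0].
apply: (@le_trans _ _ (\sum_(k < N) volume g0 (V k))%E).
  apply: (@content_subadditive _ _ _ (volume g0)) => //.
  move=> p Ap; have [i Ui] := cover p; rewrite -bigcup_mkord; exists (val i) => /=; first exact: ltn_ord.
  by rewrite /V insubT//= => ?; rewrite (_ : Sub _ _ = i)//; exact: val_inj.
rewrite -sumEFin; apply: lee_sum => i _; rewrite /V insubT//= => ?.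
by rewrite (_ : Sub _ _ = i); [case: (HC1 i) => _; apply|exact: val_inj].
Qed.

(** The weight is at least lam |grad hump|, so this integral bounds the total volume below by a
    multiple of lam. The integrand read in the chart is continuous and positive at a point where the
    hump is steep, hence bounded below on a small cube. *)
Lemma hump_gradient : exists2 e, 0 < e &
  (e%:E <= \int[volume g0]_p (Num.sqrt (gip g0 hump hump p))%:E)%E.
Proof.
have [u Ku Du] := @cube_bump_steep R n z r' r'_gt0 j0.
have cu : chart_img (c i0) u by exact: KT_img.
have Iu : interior (chart_img (c i0)) u.
  apply: (interior_chart_img (n_gt0 := n_gt0)) => //.
  by rewrite gt_eqF//; case: (KT_half Ku j0).
pose q v := cdens g0 (c i0) v * Num.sqrt (gform g0 (c i0) hump hump (chart_inv (c i0) v)).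
have qc : {within chart_img (c i0), continuous q}.
  apply: within_continuousM; first exact: cdens_continuous.
  have h := @gform_continuous _ _ _ g0 _ _ _ (Ac i0) C1_hump C1_hump.
  apply/subspace_continuousP => v cv; move/subspace_continuousP : h => /(_ v cv) h.
  suff h' : Num.sqrt (gform g0 (c i0) hump hump (chart_inv (c i0) w)) @[w --> within (chart_img (c i0)) (nbhs v)]
      --> Num.sqrt (gform g0 (c i0) hump hump (chart_inv (c i0) v)) by exact: h'.
  exact: (cvg_comp _ _ h (@sqrt_continuous R _)).
have q0 v : 0 <= q v by rewrite mulr_ge0// sqrtr_ge0.
have qu : 0 < q u.
  rewrite mulr_gt0 ?cdens_gt0// sqrtr_gt0; have cp := chart_invP cu.
  set p := chart_inv (c i0) u in cp *.
  have pd0 : pd (c i0) hump p != 0.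
    apply/eqP => /rowP/(_ j0); rewrite pd_hump// !mxE /p chart_invK// => h.
    by move/eqP: Du; apply.
  rewrite /gform; set w := pd _ _ _ in pd0 *; set G := gram g0 _ _.
  have uG : G \in unitmx := gram_unit g0 (Ac i0) cp.
  have symG : G^T = G := gram_sym g0 (Ac i0) cp.
  have -> : w *m invmx G *m w^T = (w *m invmx G) *m G *m (w *m invmx G)^T.
    by rewrite mulmxKV// trmx_mul trmx_inv symG mulmxA.
  apply: (gram_posdef g0 (Ac i0) cp); apply: contra pd0 => /eqP h.
  by rewrite -(mulmxKV uG w) h mul0mx.
have : \forall v \near u, chart_img (c i0) v /\ q u / 2 < q v.
  have n1 : \forall v \near u, chart_img (c i0) v by exact: Iu.
  have /subspace_continuousP/(_ u cu) qc' := qc.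
  have qc'' : q v @[v --> within (chart_img (c i0)) (nbhs u)] --> q u := qc'.
  have qq : q u / 2 < q u by lra.
  move/cvgr_gt : qc'' => /(_ _ qq); rewrite near_withinE => n2.
  by near=> v; split; [near: v|apply: (near n2 v) => //; near: v].
move=> /nbhs_ballP[e /= e0 He].
pose w : 'rV[R]_n := u - const_mx (e / 2).
have [mQ lQ] := lebn_cubeE w (ltW e0).
exists (q u / 2 * e ^+ n); first by rewrite mulr_gt0 ?divr_gt0 ?exprn_gt0.
pose G : borel M -> \bar R := fun p => (Num.sqrt (gip g0 hump hump p))%:E.
have mG : measurable_fun [set: borel M] G.
  apply/measurable_EFinP; apply: continuous_measurable => p.
  exact: (cvg_comp _ _ (@gip_continuous _ _ _ g0 _ _ C1_hump C1_hump p) (@sqrt_continuous R _)).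
have G0 p : (0 <= G p)%E by rewrite lee_fin sqrtr_ge0.
apply: (@le_trans _ _ (\int[volume g0]_(p in chart_dom (c i0)) G p)%E); last first.
  by apply: ge0_subset_integral => //; exact: chart_dom_measurable.
rewrite (volume_chart_integral M_compact g0 (Ac i0))//.
rewrite EFinM -lQ -lebn_indic// -ge0_integralZl_EFin//; last 2 first.
- by apply/measurable_EFinP; exact: measurable_indic.
- by rewrite divr_ge0.
apply: ge0_le_integral; first exact: measurableT.
- by move=> v _; rewrite mule_ge0// ?lee_fin ?divr_ge0// indicE ler0n.
- by apply: emeasurable_funM; [exact: measurable_cst|apply/measurable_EFinP; exact: measurable_indic].
- apply: emeasurable_funM; first by apply/measurable_EFinP; exact: measurable_cdens0.
  exact: measurableT_comp mG (measurable_cinv _).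
move=> v _; rewrite indicE; case: (boolP (v \in _)) => [|_]; last first.
  by rewrite mule0 mule_ge0// lee_fin cdens0_ge0.
rewrite in_setE mule1 => Qv.
have [cv /ltW qv] : chart_img (c i0) v /\ q u / 2 < q v.
  apply: He; apply/rV_ballE => // i; have := Qv i; rewrite !mxE => /andP[h1 h2].
  rewrite ltr_distl; apply/andP; split; lra.
rewrite (cdens0E g0 cv) (cinvE cv).
have -> : G (chart_inv (c i0) v) = (Num.sqrt (gform g0 (c i0) hump hump (chart_inv (c i0) v)))%:E.
  by rewrite /G (gipE g0 (Ac i0) (chart_invP cv) C1_hump C1_hump).
by rewrite -EFinM lee_fin; exact: qv.
Unshelve. all: by end_near. Qed.

End Geometry.

(** * Choice of the parameters and conclusion *)

Section SmallEigenvalues.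
Variables (R : realType) (n : nat) (M : manifold R n).
Hypotheses (n_ge3 : (3 <= n)%N) (M_compact : compact [set: M]).
Local Notation H := (@half_space R n).

Lemma cube_cover : exists (N : nat) (c : 'I_N -> chart R n M) (x : 'I_N -> 'rV[R]_n) (r : 'I_N -> R),
  [/\ forall i, atlas (c i), forall i, 0 < r i, forall i, chart_img (c i) (x i),
      forall i y, `|y - x i| <= 4 * r i -> H y -> chart_img (c i) y &
      forall p, exists i, chart_dom (c i) p /\ `|chart_map (c i) p - x i| < r i].
Proof.
pose P c (U : set M) := exists xr : 'rV[R]_n * R, [/\ atlas c, 0 < xr.2, chart_img c xr.1,
  forall y, `|y - xr.1| <= 4 * xr.2 -> H y -> chart_img c y &
  U = [set p | chart_dom c p /\ `|chart_map c p - xr.1| < xr.2]].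
have [p|N [c [U [HU cU]]]] := @finite_cover _ _ _ M_compact P.
  have [c Ac cp] := atlas_cover p; set x := chart_map c p.
  have /nbhs_ballP[e /= e0 He] := chart_img_near (chart_imgP cp).
  (* The closed cube of radius 4 (e / 5) has to fit in the ball of radius e. *)
  have r0 : 0 < e / 5 by rewrite divr_gt0.
  exists c, [set q | chart_dom c q /\ `|chart_map c q - x| < e / 5]; split.
  - exists (x, e / 5); split => //=; first exact: chart_imgP.
    move=> y yx; apply: He; rewrite -ball_normE /ball_ /= -normrN opprB; apply: (le_lt_trans yx); lra.
  - rewrite openE => q [cq qx].
    have n1 : \forall q' \near q, chart_dom c q'.
      by apply: open_nbhs_nbhs; split => //; exact: chart_dom_open.
    have h : `|chart_map c q' - x| @[q' --> q] --> `|chart_map c q - x|.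
      by apply: cvg_norm; apply: (cvgB (chart_map_cvg cq) (cvg_cst _)).
    have n2 : \forall q' \near q, `|chart_map c q' - x| < e / 5 by exact: cvgr_lt h _ qx.
    by near=> q'; split; [near: q'|near: q'].
  - by split => //; rewrite subrr normr0.
have [xr Hxr] := choice HU.
exists N, c, (fun i => (xr i).1), (fun i => (xr i).2); split.
- by move=> i; case: (Hxr i).
- by move=> i; case: (Hxr i).
- by move=> i; case: (Hxr i).
- by move=> i; case: (Hxr i).
- by move=> p; have [i Ui] := cU p; exists i; case: (Hxr i) => _ _ _ _ UE; rewrite UE in Ui.
Unshelve. all: by end_near. Qed.

Lemma small_mu_star (del : R) : 0 < del -> exists g : metric M,
  volume g [set: borel M] = 1%E /\ forall k, (mu_star g k <= (del * k%:R)%:E)%E.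
Proof.
move=> del0; have n_gt0 : (0 < n)%N by exact: leq_trans n_ge3.
have [N [c [x [r [Ac r0 xc cube cov]]]]] := cube_cover.
have [i0 _] := cov point.
pose cs := coordinates_smooth Ac r0 cube; pose ci := coordinates_imm Ac r0 cov.
pose hs := hump_smooth Ac r0 cube (xc i0).
have [E E0 HE] := weight_ball_le n_ge3 M_compact Ac r0 cube cov (xc i0).
have [e e0 He] := hump_gradient n_ge3 M_compact Ac r0 cube cov (xc i0).
rewrite -/cs -/ci in HE He; move: cs ci hs HE He.
set phi := coordinates c x r; set tau := hump c x r i0 => cs ci hs HE He.
pose C : R := 8 * 4096 * (grid_size (('I_N * 'I_n) + 'I_1)%type)%:R * E.
have C0 : 0 <= C by apply: mulr_ge0; [rewrite -!natrM ler0n|exact: ltW].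
(* The target for sig: eta <= 1 makes the powers of sig at most sig, and C eta <= del gives the
   bound. *)
pose eta : R := Num.min 1 (del / (C + 1)).
have eta0 : 0 < eta by rewrite lt_min ltr01 divr_gt0// ltr_pwDr.
have eta1 : eta <= 1 by rewrite ge_min lexx.
have etaC : C * eta <= del.
  apply: (@le_trans _ _ (C * (del / (C + 1)))).
    by apply: ler_wpM2l => //; rewrite ge_min lexx orbT.
  rewrite mulrCA -[leRHS]mulr1; apply: ler_wpM2l; first exact: ltW.
  by rewrite ler_pdivrMr ?mul1r ?lerDl// ltr_pwDr.
(* With this stretching the volume V is at least lam e = eta^-n, so that sig = V^(-1/n) is at most
   eta. *)
pose lam : R := (eta ^+ n)^-1 / e.
have lam0 : 0 <= lam by rewrite divr_ge0 ?ltW// invr_gt0 exprn_gt0.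
pose w := stretch_weight tau cs ci lam 1.
have w0 p : 0 <= w p by exact: stretch_weight_ge0.
have mw : measurable_fun [set: borel M] w.
  by apply: continuous_measurable; exact: (@stretch_weight_continuous _ _ _ _ _ _ _ _ hs lam 1).
have Vfin : (\int[volume (pullback_metric cs ci)]_p (w p)%:E)%E \is a fin_num.
  by rewrite -(volume_stretch M_compact cs ci hs lam ltr01 measurableT) volume_fin_num.
set V := fine (\int[volume (pullback_metric cs ci)]_p (w p)%:E)%E.
have VE : (\int[volume (pullback_metric cs ci)]_p (w p)%:E = V%:E)%E by rewrite fineK.
have Vlow : (eta ^+ n)^-1 <= V.
  rewrite -lee_fin -VE.
  apply: (@le_trans _ _ (lam%:E * \int[volume (pullback_metric cs ci)]_p (Num.sqrt (gip (pullback_metric cs ci) tau tau p))%:E)%E).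
    have -> : ((eta ^+ n)^-1)%:E = (lam%:E * e%:E)%E by rewrite -EFinM /lam divfK// gt_eqF.
    by apply: lee_wpmul2l; rewrite ?lee_fin.
  have Ct : C1M tau by exact: smoothM_C1M.
  have mG : measurable_fun [set: borel M] (fun p => Num.sqrt (gip (pullback_metric cs ci) tau tau p)).
    apply: continuous_measurable => p.
    exact: (cvg_comp _ _ (@gip_continuous _ _ _ (pullback_metric cs ci) _ _ Ct Ct p) (@sqrt_continuous R _)).
  rewrite -ge0_integralZl_EFin//; last exact/measurable_EFinP.
  apply: ge0_le_integral => //.
  - by move=> p _; rewrite mule_ge0// lee_fin ?sqrtr_ge0.
  - by apply: emeasurable_funM; [exact: measurable_cst|exact/measurable_EFinP].
  - exact/measurable_EFinP.
  move=> p _; rewrite -EFinM lee_fin /w /stretch_weight expr1n mul1r.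
  rewrite -{1}(ger0_norm lam0) -sqrtr_sqr -sqrtrM ?sqr_ge0//.
  by apply: ler_wsqrtr; rewrite lerDr.
have V0 : 0 < V by apply: lt_le_trans Vlow; rewrite invr_gt0 exprn_gt0.
pose sig := V^-1 `^ (n%:R^-1).
have sig0 : 0 < sig by rewrite powR_gt0// invr_gt0.
have sigV : sig ^+ n = V^-1.
  by rewrite -powR_mulrn ?ltW// -powRrM mulVf ?pnatr_eq0 -?lt0n// powRr1// invr_ge0 ltW.
have sig_eta : sig <= eta.
  rewrite -(@ler_pXn2r _ n)// ?nnegrE ?(ltW sig0) ?(ltW eta0)// sigV.
  by rewrite -[leRHS]invrK lef_pV2// posrE// invr_gt0 exprn_gt0.
have wE p : stretch_weight tau cs ci lam sig p = sig ^+ n * w p.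
  by rewrite /w /stretch_weight expr1n mul1r.
pose g := stretch_metric cs ci hs lam sig0.
have volA (A : set (borel M)) : measurable A -> (volume g A =
    (sig ^+ n)%:E * \int[volume (pullback_metric cs ci)]_(p in A) (w p)%:E)%E.
  move=> mA; rewrite (volume_stretch M_compact cs ci hs lam sig0 mA).
  under eq_integral do rewrite wE EFinM.
  rewrite ge0_integralZl_EFin//; last 3 first.
  - by move=> p _; rewrite lee_fin.
  - by apply/measurable_EFinP; exact: measurable_funTS.
  - by rewrite exprn_ge0// ltW.
have vol1 : volume g [set: borel M] = 1%E.
  by rewrite volA// VE -EFinM sigV mulVf// gt_eqF.
exists g; split => // k.
(* A ball of radius s in the rescaled embedding is one of radius s / sig before rescaling, and
   volumes gain sig^n: together sig^n E (s / sig)^2 = E' s^2. *)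
pose E' := E * sig ^+ (n - 2); have E'0 : 0 < E' by rewrite mulr_gt0// exprn_gt0.
have Cs l : C1M (stretch phi tau lam sig l).
  by apply: smoothM_C1M; exact: (stretch_smooth cs hs).
have ball_le y s : 0 < s ->
    (volume g [set p | (\sum_l (stretch phi tau lam sig l p - y l) ^+ 2 < s ^+ 2)%R] <= (E' * s ^+ 2)%:E)%E.
  move=> s0; have -> : [set p | (\sum_l (stretch phi tau lam sig l p - y l) ^+ 2 < s ^+ 2)%R] =
      [set p | (\sum_l (stretch phi tau lam 1 l p - y l / sig) ^+ 2 < (s / sig) ^+ 2)%R].
    apply/funext => p; apply/propext => /=.
    have -> : \sum_l (stretch phi tau lam sig l p - y l) ^+ 2 =
        sig ^+ 2 * \sum_l (stretch phi tau lam 1 l p - y l / sig) ^+ 2.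
      by rewrite mulr_sumr; apply: eq_bigr => l _; rewrite /stretch mul1r; field; rewrite gt_eqF.
    by rewrite expr_div_n ltr_pdivlMr ?exprn_gt0// mulrC.
  rewrite volA.
    apply: (@le_trans _ _ ((sig ^+ n)%:E * (E * (s / sig) ^+ 2)%:E)%E).
      apply: lee_wpmul2l; first by rewrite lee_fin exprn_ge0// ltW.
      by apply: HE => //; rewrite divr_gt0.
    rewrite -EFinM lee_fin le_eqVlt; apply/orP; left; apply/eqP.
    have -> : sig ^+ n = sig ^+ (n - 2) * sig ^+ 2 by rewrite -exprD subnK// ltnW.
    by rewrite /E'; field; rewrite gt_eqF.
  apply: measurable_ltC.
  have Cs1 l : C1M (stretch phi tau lam 1 l).
    by apply: smoothM_C1M; exact: (stretch_smooth cs hs).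
  have := C1M_continuous (zfun_C1 Cs1 (fun _ l => y l / sig) (fun=> 1) 0%N).
  by rewrite /zfun; under eq_fun do rewrite expr1n divr1.
apply: le_trans (mu_star_le M_compact n_gt0 Cs (gform_stretch_le cs ci hs sig0 (lam := lam)) E'0 ball_le vol1 k) _.
rewrite lee_fin; apply: ler_wpM2r; first exact: ler0n.
apply: le_trans etaC; rewrite /E' mulrA -/C; apply: ler_wpM2l => //.
have sig1 : sig <= 1 by exact: le_trans sig_eta eta1.
apply: le_trans sig_eta.
(* This is where dimension at least 3 enters: the exponent is positive, so sig^(n-2) <= sig <=
   eta. *)
have : (0 < n - 2)%N by rewrite subn_gt0.
case: (n - 2)%N => // m _; rewrite exprS; apply: ler_piMr; [exact: ltW|by apply: exprn_ile1 => //; exact: ltW].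
Qed.

End SmallEigenvalues.

Theorem theorem5p1 (R : realType) (n : nat) (n_ge3 : (3 <= n)%N)
    (M : manifold R n) (M_compact : compact [set: M]) :
  exists (g : R -> metric M) (C : R),
    forall eps : R, 0 < eps ->
      volume (g eps) [set: borel M] = 1%E /\
      forall k : nat,
        (mu_star (g eps) k <=
           (C * k%:R * eps `^ ((n%:R - 2) / n%:R))%:E)%E.
Proof.
(* [small_mu_star] is used with del equal to the required power of eps, which leaves C = 1. For eps
   <= 0 any metric completes the family. *)
have ex (eps : R) : exists g : metric M, 0 < eps -> volume g [set: borel M] = 1%E /\
    forall k : nat, (mu_star g k <= (eps `^ ((n%:R - 2) / n%:R) * k%:R)%:E)%E.
  have [eps0|eps0] := ltP 0 eps.
    have [g Hg] := small_mu_star n_ge3 M_compact (powR_gt0 ((n%:R - 2) / n%:R) eps0).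
    by exists g.
  have [g _] := small_mu_star n_ge3 M_compact (@ltr01 R).
  by exists g.
have [g Hg] := choice ex.
exists g, 1 => eps /Hg[v1 Hmu]; split => // k.
by rewrite mul1r mulrC.
Qed.
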